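(* Let $a\in\mathbb{R}$, let $n\geq 1$ be an integer, $1<q<\infty$, $1\leq r<\infty$, $\beta>0$, and let $\gamma$ satisfy $$0<\gamma<\min\bigl(2,\,n,\,n-(n-2)(\beta+1)\bigr).$$ Let $\kappa>q$ be such that $$\frac1\kappa>\max\Bigl(\frac{n-\gamma}{n(\beta+1)}+\frac1q-1,\ \frac{n-\gamma}{n(\beta+1)}+\frac1q+\frac{\gamma-2}{n\beta},\ \frac{1}{q(\beta+1)},\ \frac1q-\frac{2}{n(\beta+1)}\Bigr)$$ and $$\frac1\kappa<\min\Bigl(\frac{n-\gamma}{n(\beta+1)}+\frac1q,\ \frac1\beta-\frac{n-\gamma}{n\beta(\beta+1)}\Bigr).$$ Then the integral equation $$u(t)=e^{t\Delta}u_0+a\int_0^t e^{(t-\tau)\Delta}\bigl(|\cdot|^{-\gamma}|u(\tau)|^{\beta}u(\tau)\bigr)\,d\tau \qquad (\ast)$$ is locally well-posed in $\dot K_q^{\frac{n-\gamma}{\beta+1}-\frac n\kappa,1}$ in the following sense: for every $u_0\in\dot K_q^{\frac{n-\gamma}{\beta+1}-\frac n\kappa,1}$ there exist $T>0$ and a solution $u\in C\bigl([0,T],\dot K_q^{\frac{n-\gamma}{\beta+1}-\frac n\kappa,1}\bigr)$ of $(\ast)$, which is unique in the class of continuous functions $u$ for which $$t^{\frac{n}{2q}-\frac{n}{2\kappa}}\|u(t)\|_{\dot K_\kappa^{\frac{n-\gamma}{\beta+1}-\frac n\kappa,1}}$$ is bounded on $(0,T]$. Moreover, the solution extends to a maximal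 interval of existence $[0,T_{\max})$ such that either $T_{\max}=\infty$, or $T_{\max}<\infty$ and $$\lim_{t\to T_{\max}}\|u(t)\|_{\dot K_q^{\frac{n-\gamma}{\beta+1}-\frac n\kappa,1}}=\infty.$$ Furthermore, the minimal existence time $T$ depends only on $\|u_0\|_{\dot K_q^{\frac{n-\gamma}{\beta+1}-\frac n\kappa,1}}$.
   Context: For $k\in\mathbb{Z}$ let $B_k=B(0,2^k)\subset\mathbb{R}^n$, $R_k=B_k\setminus B_{k-1}$, and let $\chi_k$ be the characteristic function of $R_k$. For $\alpha\in\mathbb{R}$ and $1\leq p,q\leq\infty$, the homogeneous Herz space $\dot K_p^{\alpha,q}$ is the set of all $f\in L^p_{\mathrm{loc}}(\mathbb{R}^n\setminus\{0\})$ with $$\|f\|_{\dot K_p^{\alpha,q}}=\Bigl(\sum_{k=-\infty}^{\infty}2^{k\alpha q}\|f\chi_k\|_{L^p(\mathbb{R}^n)}^q\Bigr)^{1/q}<\infty,$$ with the usual modifications when $p=\infty$ and/or $q=\infty$. Here $e^{t\Delta}$ denotes the heat semigroup on $\mathbb{R}^n$ (convolution with the Gaussian heat kernel). Equation $(\ast)$ is the mild formulation of the Hardy--Hénon equation $\partial_t u=\Delta u+a|x|^{-\gamma}|u|^{\beta}u$, $u(0)=u_0$; a solution is a function $u$ satisfying $(\ast)$ on the relevant time interval. *)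

(* Defs.v *)
From HB Require Import structures.
From mathcomp Require Import all_boot all_order all_algebra.
From mathcomp Require Import all_classical all_reals all_analysis.

Set Implicit Arguments.
Unset Strict Implicit.
Unset Printing Implicit Defensive.
Import Order.TTheory GRing.Theory Num.Theory.
Import numFieldNormedType.Exports.

Local Open Scope classical_set_scope.
Local Open Scope ring_scope.

(* R^n, as a measurable space: n-tuples carry the product sigma-algebra of the
   Borel sets of R. *)
Notation Rspace R n := (n.-tuple (measurableTypeR R)).

Section lebesgue_space.
Context {R : realType}.

Definition cons_space n (p : measurableTypeR R * Rspace R n) : Rspace R n.+1 :=
  [tuple of p.1 :: p.2].

Lemma measurable_cons_space n :
  measurable_fun [set: measurableTypeR R * Rspace R n] (@cons_space n).
Proof. exact: (measurable_cons measurable_fst measurable_snd). Qed.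

Lemma measurable_preimage_cons n (A : set (Rspace R n.+1)) :
  measurable A -> measurable (@cons_space n @^-1` A).
Proof.
by move=> mA; rewrite -[X in measurable X]setTI; exact: measurable_cons_space.
Qed.

Section succ.
Variables (n : nat) (nu : {sigma_finite_measure set (Rspace R n) -> \bar R}).

Definition lebesgue_succ : set (Rspace R n.+1) -> \bar R :=
  pushforward (lebesgue_measure \x nu)%E (@cons_space n).

Let lebesgue_succ0 : lebesgue_succ set0 = 0%E.
Proof. by rewrite /lebesgue_succ /pushforward preimage_set0 measure0. Qed.

Let lebesgue_succ_ge0 A : (0 <= lebesgue_succ A)%E.
Proof. by rewrite /lebesgue_succ /pushforward measure_ge0. Qed.

Let lebesgue_succ_sigma_additive : semi_sigma_additive lebesgue_succ.
Proof.
move=> F mF tF mUF; rewrite /lebesgue_succ /pushforward preimage_bigcup.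
apply: measure_semi_sigma_additive.
- by move=> k; exact: measurable_preimage_cons.
- apply/trivIsetP => /= i j _ _ ij; rewrite -preimage_setI.
  by move/trivIsetP : tF => /(_ _ _ _ _ ij) ->//; rewrite preimage_set0.
- by rewrite -preimage_bigcup; exact: measurable_preimage_cons.
Qed.

HB.instance Definition _ := isMeasure.Build _ _ _ lebesgue_succ
  lebesgue_succ0 lebesgue_succ_ge0 lebesgue_succ_sigma_additive.

Let split_space (x : Rspace R n.+1) : measurableTypeR R * Rspace R n :=
  (thead x, [tuple of behead x]).

Let split_cons : cancel (@cons_space n) split_space.
Proof.
move=> [x y]; rewrite /split_space /cons_space /=; congr pair.
by apply/val_inj.
Qed.

Let measurable_split : measurable_fun setT split_space.
Proof.
apply/measurable_fun_pairP; split; first exact: measurable_tnth.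
exact: measurable_behead.
Qed.

Let sigma_finite_lebesgue_succ : sigma_finite setT lebesgue_succ.
Proof.
have /sigma_finiteP[F [TF ndF Foo]] :=
  sigma_finiteT (@lebesgue_measure R : {sigma_finite_measure set _ -> \bar R}).
have /sigma_finiteP[G [TG ndG Goo]] := sigma_finiteT nu.
exists (fun k => split_space @^-1` (F k `*` G k)).
  rewrite predeqE => x; split=> // _.
  have : setT (split_space x).1 by [].
  rewrite TF => -[i _ Fi].
  have : setT (split_space x).2 by [].
  rewrite TG => -[j _ Gj].
  exists (maxn i j) => //; split.
  - by move: Fi; exact/subsetPset/ndF/leq_maxl.
  - by move: Gj; exact/subsetPset/ndG/leq_maxr.
move=> k; have [mF Fk] := Foo k; have [mG Gk] := Goo k; split.
  rewrite -[X in measurable X]setTI; apply: measurable_split => //.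
  exact: measurableX.
rewrite /lebesgue_succ /pushforward -comp_preimage.
rewrite (_ : split_space \o _ = id); last first.
  by apply/funext => x; exact: split_cons.
by rewrite preimage_id product_measure1E// lte_mul_pinfty// ge0_fin_numE.
Qed.

HB.instance Definition _ := Measure_isSigmaFinite.Build _ _ _ lebesgue_succ
  sigma_finite_lebesgue_succ.

End succ.

(* Lebesgue measure on R^n, by recursion on n through R^(n+1) ~ R x R^n. *)
Fixpoint lebesgue_space n : {sigma_finite_measure set (Rspace R n) -> \bar R} :=
  if n is m.+1 then lebesgue_succ (lebesgue_space m) else \d_([tuple]).

Lemma lebesgue_space_box n (A : 'I_n -> set (measurableTypeR R)) :
  (forall i, measurable (A i)) ->
  lebesgue_space n [set x | forall i, A i (tnth x i)] =
  (\prod_(i < n) lebesgue_measure (A i))%E.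
Proof.
elim: n A => [|n IHn] A mA /=.
  by rewrite big_ord0 diracE mem_set// => -[].
rewrite big_ord_recl -IHn// -product_measure1E//.
- rewrite /lebesgue_succ /pushforward; congr (product_measure1 _ _ _).
  apply/seteqP; split => -[x y] /=.
    move=> xyA; split; first by have := xyA ord0.
    by move=> i; have := xyA (lift ord0 i); rewrite tnthS.
  by move=> [Ax Ay] i; case: (unliftP ord0 i) => [j|] ->//; rewrite tnthS.
- rewrite (_ : [set _ | _] = \bigcap_(i in [set: 'I_n])
      ((fun x : Rspace R n => tnth x i) @^-1` A (lift ord0 i))).
    apply: fin_bigcap_measurable => // i _; rewrite -[X in measurable X]setTI.
    exact: measurable_tnth.
  by apply/seteqP; split => x /= xA i; [move=> _|]; exact: xA.
Qed.

End lebesgue_space.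

Section euclidean.
Context {R : realType} {n : nat}.
Implicit Types (x y : Rspace R n) (f : Rspace R n -> R).

Definition enorm x : R := Num.sqrt (\sum_(i < n) (tnth x i : R) ^+ 2).

Definition subs x y : Rspace R n :=
  [tuple (tnth x i : R) - (tnth y i : R) | i < n].

(* The topology of R^n is that of the row vectors 'rV[R]_n. *)
Definition compact_space (K : set (Rspace R n)) : Prop :=
  compact [set v : 'rV[R]_n | K [tuple v ord0 i | i < n]].

Definition Lp_norm (p : \bar R) f : \bar R :=
  'N[lebesgue_space n]_p[EFin \o f]%E.

Definition Lp_loc_punctured (p : \bar R) f : Prop :=
  forall K : set (Rspace R n), compact_space K -> ~ K [tuple 0 | _ < n] ->
    (Lp_norm p (fun x => f x * \1_K x)%R < +oo)%E.

End euclidean.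

Section herz.
Context {R : realType} {n : nat}.
Implicit Types (alpha : R) (p q : \bar R) (f : Rspace R n -> R).

Definition dyadic_ball (k : int) : set (Rspace R n) :=
  [set x | enorm x < 2 ^ k].

Definition dyadic_annulus (k : int) : set (Rspace R n) :=
  dyadic_ball k `\` dyadic_ball (k - 1).

Definition herz_norm alpha p q f : \bar R :=
  let N k := Lp_norm p (fun x => f x * \1_(dyadic_annulus k) x) in
  match q with
  | q'%:E => ((\esum_(k in [set: int])
               ((2 `^ (k%:~R * alpha * q'))%R%:E * N k `^ q')) `^ (q'^-1)%R)%E
  | +oo%E => ereal_sup (range (fun k : int => (2 `^ (k%:~R * alpha))%R%:E * N k)%E)
  | -oo%E => 0%E
  end.

Definition herz alpha p q : set (Rspace R n -> R) :=
  [set f | [/\ measurable_fun setT f, Lp_loc_punctured p f &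
               (herz_norm alpha p q f < +oo)%E]].

(* C(I, herz alpha p q) *)
Definition continuous_herz alpha p q (I : set R) (u : R -> Rspace R n -> R) :=
  (forall t, I t -> herz alpha p q (u t)) /\
  (forall t, I t -> herz_norm alpha p q (u s \- u t) @[s --> within I (nbhs t)]
                      --> 0%E).

End herz.

Section hardy_henon.
Context {R : realType} {n : nat}.
Local Notation mu := (lebesgue_space n).
Implicit Types (t : R) (f : Rspace R n -> R) (u : R -> Rspace R n -> R).

Definition heat_kernel t (x : Rspace R n) : R :=
  (4 * pi * t) `^ (- (n%:R / 2)) * expR (- (enorm x ^+ 2 / (4 * t))).

(* e^(t Delta) f, with e^(0 Delta) = id *)
Definition heat t f (x : Rspace R n) : R :=
  if 0 < t then (\int[mu]_y (heat_kernel t (subs x y) * f y))%R else f x.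

Definition nonlinearity (gamma beta : R) f (y : Rspace R n) : R :=
  enorm y `^ (- gamma) * `|f y| `^ beta * f y.

(* u satisfies the integral equation for all t in I: for each such t the
   Duhamel integral converges absolutely and the equation holds at almost
   every point. *)
Definition mild_solution (a gamma beta : R) (I : set R)
    (u0 : Rspace R n -> R) u : Prop :=
  forall t, I t -> \forall x \ae mu,
    (\int[lebesgue_measure]_(tau in `[0%R, t]) \int[mu]_y
        `|heat_kernel (t - tau) (subs x y) *
          nonlinearity gamma beta (u tau) y|%R%:E < +oo)%E /\
    u t x = heat t u0 x +
      a * (\int[lebesgue_measure]_(tau in `[0, t])
             heat (t - tau) (nonlinearity gamma beta (u tau)) x)%R.

Definition wp_class (alpha q kappa T : R) u : Prop :=
  continuous_herz alpha q%:E 1%E `[0, T] u /\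
  exists M : R, forall t, 0 < t <= T ->
    ((t `^ (n%:R / (2 * q) - n%:R / (2 * kappa)))%R%:E *
       herz_norm alpha kappa%:E 1%E (u t) <= M%:E)%E.

End hardy_henon.

(* Main.v *)
Require Import Defs.
From HB Require Import structures.
From mathcomp Require Import all_boot all_order all_algebra.
From mathcomp Require Import all_classical all_reals all_analysis.
From mathcomp Require Import measurable_realfun ring lra zify.

Set Implicit Arguments.
Unset Strict Implicit.
Unset Printing Implicit Defensive.
Import Order.TTheory GRing.Theory Num.Theory.
Import numFieldNormedType.Exports.

Local Open Scope classical_set_scope.
Local Open Scope ring_scope.

(* Write P_t for the heat semigroup and G for its kernel. The identity
     G(t2, x - z) G(t1, z - y) = G(t1 + t2, x - y) G(t1 t2 / (t1 + t2), z - m),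
   with m on the segment from x to y, shows that for V = |.|^-gamma f^beta
     P_t2 (V P_t1 g) <= C (t1 t2 / (t1 + t2))^-theta ||f||^beta P_(t1 + t2) g
   pointwise, where ||f|| is the norm of f in K_kappa^(s,1). As the norm of
   P_t |u0| is O(t^-sigma) with theta + beta sigma < 1, Picard iteration converges
   pointwise on a time interval depending only on the norm of u0, to a solution
   with |u(t)| <= 2 P_t |u0|; heat semigroup bounds and strong continuity in
   Herz spaces place it in the required class. For two solutions v1, v2 of that
   class, t |-> P_(T - t) |F(v1 t) - F(v2 t)| (x) satisfies a Gronwall inequality
   with an integrable singular kernel, so it vanishes for almost every x.
   Solutions can be glued, and the existence time depends on the norm only,
   hence the norm blows up at the end of a finite maximal interval. *)

(** * The heat kernel *)

Section heat_kernel_basics.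
Context {R : realType}.
Notation T1 := (measurableTypeR R).

(** A fixed point in a space of Herz-valued curves would need vector-valued integrals of curves
    whose measurability in time is not known. The argument stays pointwise in x instead, with
    nonnegative extended-valued functions, for which Tonelli's theorem requires no integrability;
    finiteness is recovered almost everywhere from finite Herz norms. What makes this possible is
    that the scalar factor in the kernel estimate sees the potential only through its K_kappa norm.
    For existence the potential comes from the free evolution, so multiples of P_t |u0| form an
    invariant class. For uniqueness it comes from the two given solutions, about which nothing
    pointwise is known, and the weighted K_kappa bound of the class is enough. In both cases the
    time kernel is singular of order lambda = theta + beta sigma at its two ends. The exponent
    conditions enter through the convergence of sums over dyadic annuli and through lambda < 1.
    Constants are not optimised; even the triangle inequality for Herz norms is used with a factor
    4. *)

Definition hker {n} (t : R) (x y : Rspace R n) : R := heat_kernel t (subs x y).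

Lemma enorm_sqr n (x : Rspace R n) :
  enorm x ^+ 2 = \sum_(i < n) (tnth x i : R) ^+ 2.
Proof. by rewrite sqr_sqrtr// sumr_ge0// => i _; exact: sqr_ge0. Qed.

Lemma enorm_ge0 n (x : Rspace R n) : 0 <= enorm x.
Proof. exact: sqrtr_ge0. Qed.

Lemma enorm_sqrB n (x y : Rspace R n) :
  enorm (subs x y) ^+ 2 = \sum_(i < n) ((tnth x i : R) - tnth y i) ^+ 2.
Proof. by rewrite enorm_sqr; apply: eq_bigr => i _; rewrite tnth_mktuple. Qed.

(** Since [4 * t] is twice the variance [2 * t], the kernel is a product of one-dimensional normal
    densities, and its total mass reduces to the known integral on the line. *)
Lemma hkerE n (t : R) (x y : Rspace R n) : 0 < t ->
  hker t x y = \prod_(i < n) normal_pdf (tnth x i : R) (Num.sqrt (2 * t)) (tnth y i).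
Proof.
move=> t0; rewrite /hker /heat_kernel enorm_sqrB.
have s0 : Num.sqrt (2 * t) != 0 by rewrite gt_eqF// sqrtr_gt0 mulr_gt0.
have s2 : Num.sqrt (2 * t) ^+ 2 = 2 * t by rewrite sqr_sqrtr// mulr_ge0// ltW.
under [in RHS]eq_bigr do rewrite normal_pdfE//.
rewrite big_split/= prodr_const card_ord; congr (_ * _).
  rewrite /normal_peak s2 -powR12_sqrt; last first.
    by rewrite mulrn_wge0// !mulr_ge0 ?pi_ge0// ltW.
  have -> : 4 * pi * t = 2 * t * pi *+ 2 :> R by rewrite -mulr_natr; ring.
  by rewrite powRN [n%:R / 2]mulrC powRrM powR_mulrn ?powR_ge0// exprVn.
rewrite /normal_fun -expR_sum; congr expR; rewrite mulr_suml -sumrN.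
apply: eq_bigr => i _; rewrite s2 mulNr; congr (- (_ / _)); last first.
  by rewrite -mulr_natr; ring.
by rewrite -sqrrN opprB.
Qed.

(** Lebesgue measure in dimension [n.+1] is by construction a pushforward of a product measure, so a
    change of variables followed by Tonelli suffices. *)
Lemma integral_succ n (f : Rspace R n.+1 -> \bar R) :
  measurable_fun [set: Rspace R n.+1] f ->
  (forall x, 0 <= f x)%E ->
  (\int[lebesgue_space n.+1]_x f x =
   \int[lebesgue_measure]_(a in [set: T1]) \int[lebesgue_space n]_x f (cons_space (a, x)))%E.
Proof.
move=> mf f0.
rewrite -(@fubini_tonelli1 _ _ _ _ _ lebesgue_measure (lebesgue_space n)
  (f \o @cons_space R n)); last 2 first.
- by apply: measurableT_comp => //; exact: measurable_cons_space.
- by move=> x /=.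
have mc := @measurable_cons_space R n.
(* Bundled as a measurable function, [cons_space] has a pushforward that carries a measure
   structure, which [eq_measure_integral] can compare with [lebesgue_space n.+1]. *)
pose c : {mfun _ >-> _} := HB.pack (@cons_space R n) (isMeasurableFun.Build _ _ _ _ _ mc).
transitivity (\int[pushforward (lebesgue_measure \x lebesgue_space n)%E c]_x f x)%E.
  exact: eq_measure_integral.
by rewrite (ge0_integral_pushforward mc).
Qed.

Lemma integral_prod_tnth n (f : 'I_n -> T1 -> \bar R) :
  (forall i, measurable_fun [set: T1] (f i)) -> (forall i a, 0 <= f i a)%E ->
  (\int[lebesgue_space n]_x (\prod_(i < n) f i (tnth x i)) =
   \prod_(i < n) \int[lebesgue_measure]_a f i a)%E.
Proof.
elim: n f => [|n IHn] f mf f0.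
  rewrite big_ord0.
  under eq_integral do rewrite big_ord0.
  by rewrite integral_cst//= mul1e diracT.
have mprod m (g : 'I_m -> T1 -> \bar R) : (forall i, measurable_fun [set: T1] (g i)) ->
   measurable_fun [set: Rspace R m] (fun x => \prod_(i < m) g i (tnth x i))%E.
  move=> mg; elim: m g mg => [|m IHm] g mg.
    under eq_fun do rewrite big_ord0; exact: measurable_cst.
  under eq_fun do rewrite big_ord_recl.
  apply: emeasurable_funM.
    by apply: (measurableT_comp (mg ord0)); exact: measurable_tnth.
  rewrite (_ : (fun x => _) = (fun x : Rspace R m => \prod_(i < m) g (lift ord0 i) (tnth x i))%E
    \o (fun x : Rspace R m.+1 => [tuple of behead x])).
    apply: (@measurableT_comp _ _ _ _ _ _ (fun x : Rspace R m => \prod_(i < m) g (lift ord0 i) (tnth x i))%E).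
      by apply: (IHm (fun i => g (lift ord0 i))) => i; apply: mg.
    exact: measurable_behead.
  apply/funext => x/=; apply: eq_bigr => i _; congr g.
  by rewrite [in LHS](tuple_eta x) tnthS.
rewrite integral_succ//; [|exact: mprod|by move=> x; apply: prode_ge0].
rewrite big_ord_recl -IHn//.
rewrite -ge0_integralZr//; last by apply: integral_ge0 => x _; apply: prode_ge0.
apply: eq_integral => a _; rewrite -ge0_integralZl//.
- by apply: eq_integral => x _; rewrite big_ord_recl; congr (_ * _)%E; apply: eq_bigr => i _; rewrite tnthS.
- by apply: (mprod _ (fun i => f (lift ord0 i))) => i; apply: mf.
- by move=> x _; apply: prode_ge0.
Qed.

Lemma hker_ge0 n (t : R) (x y : Rspace R n) : 0 <= hker t x y.
Proof. by rewrite mulr_ge0 ?powR_ge0 ?expR_ge0. Qed.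

Lemma hker_gt0 n (t : R) (x y : Rspace R n) : 0 < t -> 0 < hker t x y.
Proof. by move=> t0; rewrite mulr_gt0 ?powR_gt0 ?expR_gt0// !mulr_gt0// pi_gt0. Qed.

Lemma hkerC n (t : R) (x y : Rspace R n) : hker t x y = hker t y x.
Proof.
rewrite /hker /heat_kernel !enorm_sqrB; do 4 f_equal.
by apply: eq_bigr => i _; rewrite -sqrrN opprB.
Qed.

Lemma hker_le n (t : R) (x y : Rspace R n) : 0 < t ->
  hker t x y <= (4 * pi * t) `^ (- (n%:R / 2)).
Proof.
move=> t0; rewrite ler_piMr ?powR_ge0// -expR0 ler_expR oppr_le0.
by rewrite divr_ge0 ?sqr_ge0// mulr_ge0// ltW.
Qed.

(** Mean at time [t1] of the Brownian bridge running from [y] to [x] in time [t1 + t2]; the bridge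
    has a heat kernel of time parameter [t1 * t2 / (t1 + t2)] as density. *)
Definition bridge_mean n (t1 t2 : R) (x y : Rspace R n) : Rspace R n :=
  [tuple (t1 * (tnth x i : R) + t2 * tnth y i) / (t1 + t2) | i < n].

(** Completing the square in each coordinate matches the exponents; the prefactors agree because the
    product of the two times on either side is [t1 * t2]. *)
Lemma hker_bridge n (t1 t2 : R) (x y z : Rspace R n) : 0 < t1 -> 0 < t2 ->
  hker t2 x z * hker t1 z y =
  hker (t1 + t2) x y * hker (t1 * t2 / (t1 + t2)) z (bridge_mean t1 t2 x y).
Proof.
move=> t10 t20; rewrite /hker /heat_kernel !enorm_sqrB.
rewrite mulrACA [RHS]mulrACA; congr (_ * _).
  have p0 := pi_ge0 R; have t1' := ltW t10; have t2' := ltW t20.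
  have t3 : 0 <= t1 + t2 by rewrite addr_ge0.
  have t4 : 0 <= t1 * t2 / (t1 + t2) by rewrite divr_ge0// mulr_ge0.
  have q0 x' : 0 <= x' -> 0 <= 4 * pi * x' :> R by move=> x0; apply: mulr_ge0 => //; apply: mulr_ge0.
  rewrite -!powRM ?q0//.
  by congr (_ `^ _); field; rewrite gt_eqF// addr_gt0.
rewrite -!expRD; congr expR; rewrite -!opprD !mulr_suml -!big_split/=.
congr (- _); apply: eq_bigr => i _; rewrite tnth_mktuple; field.
by rewrite !gt_eqF// addr_gt0.
Qed.

Lemma measurable_enorm n : measurable_fun [set: Rspace R n] (@enorm R n).
Proof.
rewrite (_ : enorm = fun x : Rspace R n => (\sum_(i < n) (tnth x i : R) ^+ 2) `^ 2^-1); last first.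
  by apply/funext => x; rewrite powR12_sqrt// sumr_ge0// => i _; exact: sqr_ge0.
apply: (measurableT_comp (measurable_powR _)) => //.
apply: measurable_sum => i; apply: measurable_funX; exact: measurable_tnth.
Qed.

Lemma measurable_inv d (T : measurableType d) (f : T -> T1) :
  measurable_fun [set: T] f -> measurable_fun [set: T] (fun x => (f x : R)^-1).
Proof.
(* The power [-1] computes the inverse only on a nonnegative base, hence the square; at 0 both sides
   vanish by the convention on [0^-1]. *)
move=> mf; rewrite (_ : (fun x => _) = fun x => (f x : R) * ((f x : R) ^+ 2) `^ (-1)).
  apply: measurable_funM => //.
  by apply: (measurableT_comp (measurable_powR _)) => //; exact: measurable_funX.
apply/funext => x; rewrite powR_inv1 ?sqr_ge0//.
by have [->|fx0] := eqVneq (f x : R) 0; [rewrite invr0 mul0r|field].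
Qed.

Lemma measurable_hker n d (T : measurableType d) (f : T -> T1) (g h : T -> Rspace R n) :
  measurable_fun [set: T] f -> measurable_fun [set: T] g -> measurable_fun [set: T] h ->
  measurable_fun [set: T] (fun z => hker (f z) (g z) (h z)).
Proof.
move=> mf mg mh; rewrite /hker /heat_kernel; apply: measurable_funM => /=.
  apply: (measurableT_comp (measurable_powR _)) => //.
  exact: measurable_funM.
apply: (measurableT_comp (@measurable_expR R)) => //.
apply: (measurableT_comp (@oppr_measurable R setT)) => //.
apply: measurable_funM => /=; last first.
  by apply: measurable_inv; exact: measurable_funM.
under eq_fun do rewrite enorm_sqrB.
apply: measurable_sum => i; apply: measurable_funX; apply: measurable_funB.
- by apply: (measurableT_comp (@measurable_tnth _ _ _ _)).
- by apply: (measurableT_comp (@measurable_tnth _ _ _ _)).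
Qed.

Lemma integral_hker n (t : R) (x : Rspace R n) : 0 < t ->
  (\int[lebesgue_space n]_y (hker t x y)%:E = 1)%E.
Proof.
move=> t0; under eq_integral do rewrite hkerE// -prodEFin.
rewrite (integral_prod_tnth (f := fun i a => (normal_pdf (tnth x i : R) (Num.sqrt (2 * t)) a)%:E)).
- by rewrite big1// => i _; exact: integral_normal_pdf.
- by move=> i; apply/measurable_EFinP; exact: measurable_normal_pdf.
- by move=> i a; rewrite lee_fin normal_pdf_ge0.
Qed.

End heat_kernel_basics.

(** * The heat semigroup on nonnegative functions *)

Section ereal_hoelder.
Context d {T : measurableType d} {R : realType}.
Variable mu : {measure set T -> \bar R}.
Local Open Scope ereal_scope.

Lemma measurable_funpow (D : set T) (f : T -> \bar R) (p : R) :
  measurable_fun D f -> measurable_fun D (fun x => f x `^ p).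
Proof. by move=> mf; apply: (measurableT_comp (measurable_poweR _)). Qed.

Lemma ae_eq0_pow (f : T -> \bar R) (p : R) : measurable_fun [set: T] f -> (0 < p)%R ->
  (forall x, 0 <= f x) -> \int[mu]_x (f x `^ p) = 0 -> ae_eq mu setT f (cst 0).
Proof.
move=> mf p0 f0 I0.
have : ae_eq mu setT (fun x => f x `^ p) (cst 0).
  apply/ae_eq_integral_abs => //; first exact: measurable_funpow.
  by rewrite -[RHS]I0; apply: eq_integral => x _; rewrite gee0_abs ?poweR_ge0.
apply: filterS => x /(_ Logic.I) fp0 _; exact: (poweR_eq0_eq0 _ fp0).
Qed.

Lemma ae_fin_pow (f : T -> \bar R) (p : R) : measurable_fun [set: T] f -> (0 < p)%R ->
  (forall x, 0 <= f x) -> \int[mu]_x (f x `^ p) < +oo -> {ae mu, forall x, f x \is a fin_num}.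
Proof.
move=> mf p0 f0 Ioo.
have : mu.-integrable setT (fun x => f x `^ p).
  apply/integrableP; split; first exact: measurable_funpow.
  by under eq_integral do rewrite gee0_abs ?poweR_ge0//.
move=> /(integrable_ae measurableT); apply: filterS => x /(_ Logic.I) fp.
rewrite ge0_fin_numE//; apply: (@lty_poweRy _ _ p); first by rewrite gt_eqF.
by rewrite -ge0_fin_numE// poweR_ge0.
Qed.

(** The real inequality applied to [fine \o f] and [fine \o g]. These agree almost everywhere with
    [f] and [g] once both integrals of powers are finite; zero and infinite integrals are treated
    apart. *)
Lemma ehoelder (f g : T -> \bar R) (p q : R) :
  measurable_fun [set: T] f -> measurable_fun [set: T] g ->
  (forall x, 0 <= f x) -> (forall x, 0 <= g x) ->
  (0 < p)%R -> (0 < q)%R -> (p^-1 + q^-1 = 1)%R ->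
  \int[mu]_x (f x * g x) <=
  (\int[mu]_x (f x `^ p)) `^ p^-1 * (\int[mu]_x (g x `^ q)) `^ q^-1.
Proof.
move=> mf mg f0 g0 p0 q0 pq.
set A := \int[mu]_x (f x `^ p); set B := \int[mu]_x (g x `^ q).
have A0 : 0 <= A by apply: integral_ge0 => x _; exact: poweR_ge0.
have B0 : 0 <= B by apply: integral_ge0 => x _; exact: poweR_ge0.
have mfg : measurable_fun [set: T] (fun x => f x * g x) by exact: emeasurable_funM.
have LHS0 : ae_eq mu setT (fun x => f x * g x) (cst 0) ->
    \int[mu]_x (f x * g x) <= A `^ p^-1 * B `^ q^-1.
  move=> fg0; rewrite (_ : \int[mu]_x (f x * g x) = 0) ?mule_ge0 ?poweR_ge0//.
  rewrite -[RHS](integral0 mu setT); apply: ge0_ae_eq_integral => //.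
  by move=> x _; rewrite mule_ge0.
(* By convention 0 times infinity is 0, so a vanishing factor kills the right-hand side whatever the
   other factor is; the integrand then vanishes almost everywhere as well. *)
have [AE|AN] := eqVneq A 0.
  apply: LHS0; have := ae_eq0_pow mf p0 f0 AE.
  by apply: filterS => x /(_ Logic.I)/= -> _; rewrite mul0e.
have [BE|BN] := eqVneq B 0.
  apply: LHS0; have := ae_eq0_pow mg q0 g0 BE.
  by apply: filterS => x /(_ Logic.I)/= -> _; rewrite mule0.
have Ap : 0 < A `^ p^-1 by rewrite poweR_gt0// lt0e AN.
have Bp : 0 < B `^ q^-1 by rewrite poweR_gt0// lt0e BN.
have [Aoo|Afin] := eqVneq A +oo.
  by rewrite Aoo poweRyr ?gt_eqF ?invr_gt0// gt0_mulye// leey.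
have [Boo|Bfin] := eqVneq B +oo.
  by rewrite Boo poweRyr ?gt_eqF ?invr_gt0// gt0_muley// leey.
have ff : {ae mu, forall x, f x \is a fin_num}.
  by apply: (@ae_fin_pow f p) => //; rewrite ltey.
have gf : {ae mu, forall x, g x \is a fin_num}.
  by apply: (@ae_fin_pow g q) => //; rewrite ltey.
have mff : measurable_fun [set: T] (fine \o f) by exact: measurableT_comp.
have mfg' : measurable_fun [set: T] (fine \o g) by exact: measurableT_comp.
have := hoelder mu mff mfg' p0 q0 pq.
rewrite Lnorm1 [X in X <= _ -> _](_ : _ = \int[mu]_x (f x * g x)); last first.
  apply: ge0_ae_eq_integral => //.
  - by apply: measurableT_comp => //; apply/measurable_EFinP; exact: measurable_funM.
  - by move=> x _; rewrite mule_ge0.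
  apply: filterS2 ff gf => x fx gx _ /=.
  by rewrite ger0_norm ?EFinM ?fineK// mulr_ge0// fine_ge0.
have LE (h : T -> \bar R) r : measurable_fun [set: T] h -> (forall x, 0 <= h x) ->
    {ae mu, forall x, h x \is a fin_num} ->
    'N[mu]_r%:E[EFin \o (fine \o h)] = (\int[mu]_x (h x `^ r)) `^ r^-1.
  move=> mh h0 hf; rewrite unlock; congr (_ `^ _).
  apply: ge0_ae_eq_integral => //.
  - apply: measurable_funpow; apply: measurableT_comp => //.
    by apply/measurable_EFinP; exact: measurableT_comp.
  - exact: measurable_funpow.
  - by move=> x _; exact: poweR_ge0.
  - by move=> x _; exact: poweR_ge0.
  by apply: filterS hf => x hx _ /=; rewrite ger0_norm ?fine_ge0// -poweR_EFin fineK.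
by rewrite !LE.
Qed.

Lemma ehoelder_in (D : set T) (f g : T -> \bar R) (p q : R) : measurable D ->
  measurable_fun [set: T] f -> measurable_fun [set: T] g ->
  (forall x, 0 <= f x) -> (forall x, 0 <= g x) ->
  (0 < p)%R -> (0 < q)%R -> (p^-1 + q^-1 = 1)%R ->
  \int[mu]_(x in D) (f x * g x) <=
  (\int[mu]_(x in D) (f x `^ p)) `^ p^-1 * (\int[mu]_(x in D) (g x `^ q)) `^ q^-1.
Proof.
move=> mD mf mg f0 g0 p0 q0 pq.
have mr (h : T -> \bar R) : measurable_fun [set: T] h -> measurable_fun [set: T] (h \_ D).
  by move=> mh; apply/(measurable_restrictT _ _).1 => //; exact: measurable_funTS.
have r0 (h : T -> \bar R) : (forall x, 0 <= h x) -> forall x, 0 <= (h \_ D) x.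
  by move=> h0 x; rewrite patchE; case: ifP.
have := ehoelder (mr _ mf) (mr _ mg) (r0 _ f0) (r0 _ g0) p0 q0 pq.
congr (_ <= _ `^ _ * _ `^ _); rewrite [RHS]integral_mkcond; apply: eq_integral => x _.
- by rewrite !patchE; case: ifP => //; rewrite mule0.
- by rewrite !patchE; case: ifP => // _; rewrite poweR0r// gt_eqF.
- by rewrite !patchE; case: ifP => // _; rewrite poweR0r// gt_eqF.
Qed.

End ereal_hoelder.

(** * Bridge formula, semigroup law and L^p-L^r smoothing *)

Section eheat.
Context {R : realType} {n : nat}.
Local Notation E := (Rspace R n).
Local Notation mu := (@lebesgue_space R n).
Implicit Types (t : R) (g : E -> \bar R) (x : E).
Local Open Scope ereal_scope.

(** Extended-valued counterpart of [heat]: for nonnegative data every integral makes sense, and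
    integrability becomes a finiteness statement to be checked only where it is used. *)
Definition eheat t g x : \bar R :=
  if (0 < t)%R then \int[mu]_y ((hker t x y)%:E * g y) else g x.

Lemma eheatE t g x : (0 < t)%R -> eheat t g x = \int[mu]_y ((hker t x y)%:E * g y).
Proof. by rewrite /eheat => ->. Qed.

Lemma eheat0 g : eheat 0 g = g.
Proof. by apply/funext => x; rewrite /eheat ltxx. Qed.

Lemma eheat_ge0 t g x : (forall y, 0 <= g y) -> 0 <= eheat t g x.
Proof.
move=> g0; rewrite /eheat; case: ifP => // _.
by apply: integral_ge0 => y _; rewrite mule_ge0// lee_fin hker_ge0.
Qed.

Lemma measurable_hkerl t x : measurable_fun [set: E] (fun y => (hker t x y)%:E).
Proof. by apply/measurable_EFinP; apply: measurable_hker. Qed.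

Lemma measurable_hkerg t x g : measurable_fun [set: E] g ->
  measurable_fun [set: E] (fun y => (hker t x y)%:E * g y).
Proof. by move=> mg; apply: emeasurable_funM => //; exact: measurable_hkerl. Qed.

Lemma measurable_eheat t g : measurable_fun [set: E] g -> (forall y, 0 <= g y) ->
  measurable_fun [set: E] (eheat t g).
Proof.
move=> mg g0; rewrite /eheat; case: (0 < t)%R => //.
apply: (@measurable_fun_fubini_tonelli_F _ _ _ _ _ mu
   (fun z : E * E => (hker t z.1 z.2)%:E * g z.2)).
  apply: emeasurable_funM; first by apply/measurable_EFinP; exact: measurable_hker.
  exact: measurableT_comp.
by move=> z; rewrite mule_ge0// lee_fin hker_ge0.
Qed.

Lemma le_eheat t g1 g2 x : measurable_fun [set: E] g1 -> measurable_fun [set: E] g2 ->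
  (forall y, 0 <= g1 y) -> (forall y, g1 y <= g2 y) -> eheat t g1 x <= eheat t g2 x.
Proof.
move=> m1 m2 g10 g12; rewrite /eheat; case: ifP => // _.
apply: ge0_le_integral => //.
- by move=> y _; rewrite mule_ge0// lee_fin hker_ge0.
- exact: measurable_hkerg.
- exact: measurable_hkerg.
by move=> y _; rewrite lee_wpmul2l// lee_fin hker_ge0.
Qed.

Lemma eheatD t g1 g2 x : measurable_fun [set: E] g1 -> measurable_fun [set: E] g2 ->
  (forall y, 0 <= g1 y) -> (forall y, 0 <= g2 y) ->
  eheat t (fun y => g1 y + g2 y) x = eheat t g1 x + eheat t g2 x.
Proof.
move=> m1 m2 g10 g20; rewrite /eheat; case: ifP => // _.
rewrite -ge0_integralD//.
- by apply: eq_integral => y _; rewrite ge0_muleDr.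
- by move=> y _; rewrite mule_ge0// lee_fin hker_ge0.
- exact: measurable_hkerg.
- by move=> y _; rewrite mule_ge0// lee_fin hker_ge0.
- exact: measurable_hkerg.
Qed.

Lemma eheatZ t g c x : measurable_fun [set: E] g ->
  (forall y, 0 <= g y) -> 0 <= c ->
  eheat t (fun y => c * g y) x = c * eheat t g x.
Proof.
move=> mg g0 c0; rewrite /eheat; case: ifP => // _.
rewrite -ge0_integralZl//.
- by apply: eq_integral => y _; rewrite muleCA.
- exact: measurable_hkerg.
- by move=> y _; rewrite mule_ge0// lee_fin hker_ge0.
Qed.

(* Between its two endpoints the heat kernel splits as a heat kernel times a Brownian bridge kernel. *)
Lemma eheat_potential (t1 t2 : R) (V g : E -> \bar R) x :
  (0 < t1)%R -> (0 < t2)%R -> measurable_fun [set: E] V -> measurable_fun [set: E] g ->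
  (forall y, 0 <= V y) -> (forall y, 0 <= g y) ->
  eheat t2 (fun z => V z * eheat t1 g z) x =
  \int[mu]_y ((hker (t1 + t2) x y)%:E * g y *
    \int[mu]_z (V z * (hker (t1 * t2 / (t1 + t2)) z (bridge_mean t1 t2 x y))%:E)).
Proof.
move=> t10 t20 mV mg V0 g0; rewrite eheatE//.
pose h := fun z : E * E => (hker t2 x z.1)%:E * (V z.1 * ((hker t1 z.1 z.2)%:E * g z.2)).
have h0 z : 0 <= h z.
  by rewrite mule_ge0 ?lee_fin ?hker_ge0// mule_ge0// mule_ge0// lee_fin hker_ge0.
have mh : measurable_fun [set: E * E] h.
  apply: emeasurable_funM; first by apply/measurable_EFinP; exact: measurable_hker.
  apply: emeasurable_funM; first exact: measurableT_comp.
  apply: emeasurable_funM; first by apply/measurable_EFinP; exact: measurable_hker.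
  exact: measurableT_comp.
transitivity (\int[mu]_z \int[mu]_y h (z, y)).
  apply: eq_integral => z _; rewrite eheatE// -!ge0_integralZl//.
  - by apply: measurable_funeM; exact: measurable_hkerg.
  - by move=> y _; rewrite !mule_ge0// lee_fin hker_ge0.
  - by rewrite lee_fin hker_ge0.
  - exact: measurable_hkerg.
  - by move=> y _; rewrite mule_ge0// lee_fin hker_ge0.
rewrite (@fubini_tonelli _ _ _ _ _ mu mu h)//; apply: eq_integral => y _.
rewrite -ge0_integralZl//.
- apply: eq_integral => z _; rewrite /h/=.
  transitivity (V z * g y * (hker t2 x z * hker t1 z y)%:E).
    by rewrite EFinM muleCA -[RHS]muleA; congr (_ * _); rewrite muleA muleC.
  by rewrite hker_bridge// EFinM muleACA [X in X * _]muleC muleACA.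
- apply: emeasurable_funM => //; apply/measurable_EFinP; exact: measurable_hker.
- by move=> z _; rewrite mule_ge0// lee_fin hker_ge0.
- by rewrite mule_ge0// lee_fin hker_ge0.
Qed.

Lemma measurable_bridge_mean (t1 t2 : R) x :
  measurable_fun [set: E] (bridge_mean t1 t2 x).
Proof.
apply/measurable_fun_tnthP => i.
rewrite (_ : _ \o _ = fun y : E => ((t1 * (tnth x i : R) + t2 * tnth y i) / (t1 + t2))%R); last first.
  by apply/funext => y /=; rewrite tnth_mktuple.
apply: measurable_funM => //; apply: measurable_funD => //.
by apply: measurable_funM => //; exact: measurable_tnth.
Qed.

(** In the bridge formula the potential is tested against a single Gaussian whose centre depends on
    [x] and [y]. A bound uniform in the centre therefore factors out and leaves the free flow over
    the total time. *)
Lemma eheat_potential_le (t1 t2 : R) (V g : E -> \bar R) x (B : \bar R) :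
  (0 < t1)%R -> (0 < t2)%R -> measurable_fun [set: E] V -> measurable_fun [set: E] g ->
  (forall y, 0 <= V y) -> (forall y, 0 <= g y) ->
  (forall m, \int[mu]_z (V z * (hker (t1 * t2 / (t1 + t2)) z m)%:E) <= B) ->
  eheat t2 (fun z => V z * eheat t1 g z) x <= B * eheat (t1 + t2) g x.
Proof.
move=> t10 t20 mV mg V0 g0 VB; rewrite eheat_potential// eheatE ?addr_gt0//.
have B0 : 0 <= B.
  by apply: le_trans (VB x); apply: integral_ge0 => z _; rewrite mule_ge0// lee_fin hker_ge0.
rewrite -ge0_integralZl//; last 2 first.
- exact: measurable_hkerg.
- by move=> y _; rewrite mule_ge0// lee_fin hker_ge0.
have i0 y : 0 <= \int[mu]_z (V z * (hker (t1 * t2 / (t1 + t2)) z (bridge_mean t1 t2 x y))%:E).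
  by apply: integral_ge0 => z _; rewrite mule_ge0// lee_fin hker_ge0.
apply: ge0_le_integral => //.
- by move=> y _; rewrite !mule_ge0// lee_fin hker_ge0.
- apply: emeasurable_funM; first exact: measurable_hkerg.
  apply: (@measurable_fun_fubini_tonelli_F _ _ _ _ _ mu
    (fun w : E * E => V w.2 * (hker (t1 * t2 / (t1 + t2)) w.2 (bridge_mean t1 t2 x w.1))%:E)).
    apply: emeasurable_funM; first exact: measurableT_comp.
    apply/measurable_EFinP; apply: measurable_hker => //.
    by apply: (measurableT_comp (@measurable_bridge_mean _ _ _)).
  by move=> w; rewrite mule_ge0// lee_fin hker_ge0.
- by apply: measurable_funeM; exact: measurable_hkerg.
by move=> y _; rewrite muleC lee_wpmul2r// mule_ge0// lee_fin hker_ge0.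
Qed.

(** The bridge formula with constant potential 1, the bridge kernel having mass 1. *)
Lemma eheat_semigroup (t1 t2 : R) g x : (0 < t1)%R -> (0 < t2)%R ->
  measurable_fun [set: E] g -> (forall y, 0 <= g y) ->
  eheat t2 (eheat t1 g) x = eheat (t1 + t2) g x.
Proof.
move=> t10 t20 mg g0.
rewrite (_ : eheat t1 g = fun z => cst 1 z * eheat t1 g z); last first.
  by apply/funext => z; rewrite mul1e.
rewrite eheat_potential// eheatE ?addr_gt0//; apply: eq_integral => y _.
rewrite -[RHS]mule1; congr (_ * _).
under eq_integral do rewrite mul1e hkerC.
by apply: integral_hker; rewrite divr_gt0 ?mulr_gt0 ?addr_gt0.
Qed.

Lemma eheat_cst t (c : \bar R) x : 0 <= c -> eheat t (cst c) x = c.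
Proof.
move=> c0; rewrite /eheat; case: ifP => // t0.
rewrite ge0_integralZr//; last 2 first.
- exact: measurable_hkerl.
- by move=> y _; rewrite lee_fin hker_ge0.
by rewrite integral_hker// mul1e.
Qed.

Lemma integral_eheat t g : (0 < t)%R -> measurable_fun [set: E] g -> (forall y, 0 <= g y) ->
  forall h, measurable_fun [set: E] h -> (forall y, 0 <= h y) ->
  \int[mu]_x (h x * eheat t g x) = \int[mu]_y (g y * eheat t h y).
Proof.
move=> t0 mg g0 h mh h0.
pose k := fun z : E * E => h z.1 * ((hker t z.1 z.2)%:E * g z.2).
have k0 z : 0 <= k z by rewrite mule_ge0// mule_ge0// lee_fin hker_ge0.
have mk : measurable_fun [set: E * E] k.
  apply: emeasurable_funM; first exact: measurableT_comp.
  apply: emeasurable_funM; first by apply/measurable_EFinP; exact: measurable_hker.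
  exact: measurableT_comp.
transitivity (\int[mu]_x \int[mu]_y k (x, y)).
  apply: eq_integral => x _; rewrite eheatE// -ge0_integralZl//.
  - exact: measurable_hkerg.
  - by move=> y _; rewrite mule_ge0// lee_fin hker_ge0.
rewrite (@fubini_tonelli _ _ _ _ _ mu mu k)//; apply: eq_integral => y _.
rewrite eheatE// -ge0_integralZl//.
- by apply: eq_integral => x _; rewrite /k/= hkerC muleC -muleA muleCA.
- exact: measurable_hkerg.
- by move=> x _; rewrite mule_ge0// lee_fin hker_ge0.
Qed.

(** Jensen's inequality for the probability density [hker t x], by Hölder after splitting the kernel
    k as k^(1/p) k^(1/q). *)
Lemma eheat_pow t g (p : R) x : (0 < t)%R -> (1 <= p)%R ->
  measurable_fun [set: E] g -> (forall y, 0 <= g y) ->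
  eheat t g x `^ p <= eheat t (fun y => g y `^ p) x.
Proof.
move=> t0; rewrite le_eqVlt => /predU1P[<-|p1] mg g0.
  rewrite poweRe1 ?eheat_ge0// le_eqVlt; apply/orP; left; apply/eqP.
  by rewrite !eheatE//; apply: eq_integral => y _; rewrite poweRe1.
have p0 : (0 < p)%R by rewrite (lt_trans _ p1).
pose q := (p / (p - 1))%R.
have p10 : (0 < p - 1)%R by rewrite subr_gt0.
have q0 : (0 < q)%R by rewrite divr_gt0.
have pq : (p^-1 + q^-1 = 1)%R by rewrite /q; field; rewrite !gt_eqF.
have k0 y : 0 <= (hker t x y)%:E by rewrite lee_fin hker_ge0.
pose f y := (hker t x y)%:E `^ p^-1 * g y.
pose h y := (hker t x y)%:E `^ q^-1.
have mk r : measurable_fun [set: E] (fun y => (hker t x y)%:E `^ r).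
  by apply: measurable_funpow; exact: measurable_hkerl.
have mf : measurable_fun [set: E] f by apply: emeasurable_funM.
have f0 y : 0 <= f y by rewrite mule_ge0// poweR_ge0.
have := ehoelder mu mf (mk q^-1%R) f0 (fun y => poweR_ge0 _ _) p0 q0 pq.
rewrite [X in X <= _ -> _](_ : _ = eheat t g x); last first.
  rewrite eheatE//; apply: eq_integral => y _; rewrite /f muleAC; congr (_ * _).
  by rewrite -poweRD ?pq ?poweRe1// poweRD_defE pq oner_eq0.
rewrite [X in _ <= _ * X -> _](_ : _ = 1); last first.
  under eq_integral do rewrite -poweRrM mulVf ?gt_eqF// poweRe1//.
  by rewrite integral_hker// poweR1r.
rewrite mule1 => /(gt0_ler_poweR (ltW p0)).
rewrite !in_itv/= !leey !andbT eheat_ge0//= poweR_ge0 => /(_ erefl erefl).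
rewrite -poweRrM mulVf ?gt_eqF// poweRe1; last first.
  by apply: integral_ge0 => y _; rewrite poweR_ge0.
move=> /le_trans; apply; rewrite eheatE// le_eqVlt; apply/orP; left; apply/eqP.
apply: eq_integral => y _; rewrite poweRM ?poweR_ge0//.
by rewrite -poweRrM mulVf ?gt_eqF// poweRe1.
Qed.

Lemma eheat_le_integral t g x : (0 < t)%R ->
  measurable_fun [set: E] g -> (forall y, 0 <= g y) ->
  eheat t g x <= ((4 * pi * t) `^ (- (n%:R / 2)))%:E * \int[mu]_y g y.
Proof.
move=> t0 mg g0; rewrite eheatE// -ge0_integralZl//; last by rewrite lee_fin powR_ge0.
apply: ge0_le_integral => //.
- by move=> y _; rewrite mule_ge0// lee_fin hker_ge0.
- exact: measurable_hkerg.
- exact: measurable_funeM.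
by move=> y _; rewrite lee_wpmul2r// lee_fin hker_le.
Qed.

(** Interpolation between conservation of mass and the sup bound: after Jensen's inequality, all but
    one of the [r / p] powers of the flow of g^p are bounded by [K], and the remaining one is
    integrated. *)
Lemma integral_eheat_pow t g (p r : R) : (0 < t)%R -> (1 <= p)%R -> (p <= r)%R ->
  measurable_fun [set: E] g -> (forall y, 0 <= g y) ->
  (\int[mu]_x (eheat t g x `^ r)) `^ r^-1 <=
  ((4 * pi * t) `^ (- (n%:R / 2) * (p^-1 - r^-1)))%:E * (\int[mu]_y (g y `^ p)) `^ p^-1.
Proof.
move=> t0 p1 pr mg g0.
have p0 : (0 < p)%R by rewrite (lt_le_trans _ p1).
have r0 : (0 < r)%R by rewrite (lt_le_trans p0).
set c := (4 * pi * t)%R; set I := \int[mu]_y (g y `^ p).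
have c0 : (0 < c)%R by rewrite !mulr_gt0// pi_gt0.
have mgp : measurable_fun [set: E] (fun y => g y `^ p) by exact: measurable_funpow.
have gp0 y : 0 <= g y `^ p by rewrite poweR_ge0.
have I0 : 0 <= I by apply: integral_ge0.
set K := (c `^ (- (n%:R / 2)))%:E * I.
have K0 : 0 <= K by rewrite mule_ge0// lee_fin powR_ge0.
have e1 x : eheat t g x `^ r <= K `^ (r / p - 1) * eheat t (fun y => g y `^ p) x.
  have -> : (r = p * (r / p))%R by field; rewrite gt_eqF.
  rewrite poweRrM; set a := eheat t g x `^ p; set b := eheat _ (fun y => g y `^ p) x.
  have -> : (p * (r / p) = r)%R by field; rewrite gt_eqF.
  have ab : a <= b by exact: eheat_pow.
  have bK : b <= K by exact: eheat_le_integral.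
  have a0 : 0 <= a by rewrite poweR_ge0.
  have b0 : 0 <= b by apply: eheat_ge0.
  have rp : (0 <= r / p - 1)%R by rewrite subr_ge0 ler_pdivlMr// mul1r.
  apply: (@le_trans _ _ (a `^ (r / p - 1) * a)); last first.
    apply: lee_pmul => //; rewrite ?poweR_ge0//.
    apply: gt0_ler_poweR => //; rewrite ?in_itv/= ?leey ?andbT//.
    exact: le_trans bK.
  rewrite -{3}[a]poweRe1// -poweRD ?subrK// poweRD_defE subrK.
  by rewrite mulf_eq0 invr_eq0 (gt_eqF r0) (gt_eqF p0).
have : \int[mu]_x (eheat t g x `^ r) <= K `^ (r / p - 1) * I.
  apply: (@le_trans _ _ (\int[mu]_x (K `^ (r / p - 1) * eheat t (fun y => g y `^ p) x))).
    apply: ge0_le_integral => //.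
    - by move=> x _; exact: poweR_ge0.
    - by apply: measurable_funpow; exact: measurable_eheat.
    - by apply: measurable_funeM; exact: measurable_eheat.
  rewrite ge0_integralZl ?poweR_ge0//; [|exact: measurable_eheat|by move=> x _; exact: eheat_ge0].
  apply: lee_wpmul2l; first exact: poweR_ge0.
  have := integral_eheat t0 mgp gp0 (h := cst 1) (@measurable_cst _ _ _ _ _ _) (fun=> lee01).
  rewrite [X in X = _ -> _](eq_integral (eheat t (fun y => g y `^ p))); last first.
    by move=> x _; rewrite mul1e.
  by move=> ->; under eq_integral do rewrite eheat_cst ?mule1//.
move=> /(gt0_ler_poweR (r := r^-1)) => /(_ (ltW _)); rewrite invr_gt0 => /(_ r0).
rewrite !in_itv/= !leey !andbT integral_ge0 => [|x _]; last exact: poweR_ge0.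
rewrite mule_ge0 ?poweR_ge0// => /(_ erefl erefl) /le_trans; apply.
have C0 : 0 <= (c `^ (- (n%:R / 2)))%:E by rewrite lee_fin powR_ge0.
rewrite {1}/K (poweRM _ C0 I0).
rewrite -muleA -{2}(poweRe1 I0) -poweRD; last first.
  by rewrite poweRD_defE subrK mulf_eq0 invr_eq0 (gt_eqF r0) (gt_eqF p0).
rewrite subrK poweRM ?poweR_ge0// -poweRrM.
rewrite poweR_EFin -!poweRrM -powRrM.
rewrite le_eqVlt; apply/orP; left; apply/eqP; congr ((_ `^ _)%:E * _ `^ _).
  by field; rewrite !gt_eqF.
by field; rewrite !gt_eqF.
Qed.

End eheat.

(** * Dyadic annuli and Herz norms *)

Section annuli.
Context {R : realType} {n : nat}.
Local Notation E := (Rspace R n).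
Local Notation mu := (@lebesgue_space R n).
Implicit Types (k : int) (x : E).

Lemma dyadic_annulusP k x : dyadic_annulus k x <->
  2 `^ (k%:~R - 1) <= enorm x < 2 `^ k%:~R.
Proof.
rewrite /dyadic_annulus /dyadic_ball /= -!powR_intmul// intrB.
split=> [[xk /negP]|/andP[kx xk]]; first by rewrite -leNgt => ->; rewrite xk.
by split=> //; apply/negP; rewrite -leNgt.
Qed.

Lemma measurable_dyadic_annulus k : measurable (@dyadic_annulus R n k).
Proof.
have mb j : measurable (@dyadic_ball R n j).
  rewrite /dyadic_ball (_ : [set _ | _] = enorm @^-1` `]-oo, (2 ^ j)[%classic); last first.
    by apply/seteqP; split => x /=; rewrite in_itv.
  by rewrite -[X in measurable X]setTI; apply: measurable_enorm.
exact: measurableD.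
Qed.

Lemma dyadic_annulus_disj j k x : dyadic_annulus j x -> dyadic_annulus k x -> j = k.
Proof.
move=> /dyadic_annulusP/andP[jx xj] /dyadic_annulusP/andP[kx xk].
have lt2 (a b : R) : 2 `^ a < 2 `^ b -> a < b.
  by rewrite !ltNge; apply: contra; apply: ler_powR; rewrite ler1n.
have h1 : (j%:~R - 1 < k%:~R :> R) by apply: lt2; exact: le_lt_trans xk.
have h2 : (k%:~R - 1 < j%:~R :> R) by apply: lt2; exact: le_lt_trans xj.
move: h1 h2; rewrite -[1]/(1%:~R) -!intrB !ltr_int; lia.
Qed.

Lemma dyadic_annulus_cover x : 0 < enorm x -> exists k, dyadic_annulus k x.
Proof.
move=> x0; have l2 : 0 < ln 2 :> R by rewrite ln_gt0// ltr1n.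
have [L e] : exists L, enorm x = 2 `^ L.
  by exists (ln (enorm x) / ln 2); rewrite /powR pnatr_eq0/= mulfVK ?gt_eqF// lnK.
have /andP[f1 f2] := floor_itv L.
(* The shift by one reflects that annulus [k] has inner radius [2^(k-1)], included, and outer radius
   [2^k], excluded. *)
exists (Num.floor L + 1); apply/dyadic_annulusP; rewrite e; apply/andP; split.
  by apply: ler_powR; rewrite ?ler1n// intrD addrK.
by rewrite /powR pnatr_eq0/= ltr_expR ltr_pM2r.
Qed.

Lemma le_tnth_enorm x i : `|tnth x i : R| <= enorm x.
Proof.
rewrite -(@ler_pXn2r _ 2) ?nnegrE ?enorm_ge0// enorm_sqr real_normK ?num_real//.
by rewrite (bigD1 i)//= lerDl sumr_ge0// => j _; exact: sqr_ge0.
Qed.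

(** Comparison with the enclosing cube of side [2 * 2^k]; later arguments use only the growth in
    [k]. *)
Lemma lebesgue_space_annulus_le k :
  (mu (dyadic_annulus k) <= (2 `^ n%:R * 2 `^ (k%:~R * n%:R))%:E)%E.
Proof.
pose r : R := 2 `^ k%:~R.
have r0 : 0 < r by rewrite powR_gt0.
pose B := [set x : E | forall i, (`]- r, r[%classic : set (measurableTypeR R)) (tnth x i)].
have mB : measurable B.
  rewrite (_ : B = \bigcap_(i in [set: 'I_n])
      ((fun x : E => tnth x i) @^-1` (`]- r, r[%classic : set (measurableTypeR R)))).
    apply: fin_bigcap_measurable => // i _; rewrite -[X in measurable X]setTI.
    by apply: measurable_tnth => //; exact: measurable_itv.
  by apply/seteqP; split => x /= xA i; [move=> _|]; exact: xA.
apply: (@le_trans _ _ (mu B)).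
  apply: le_measure; rewrite ?inE//; first exact: measurable_dyadic_annulus.
  move=> x /dyadic_annulusP/andP[_ xk] i /=; rewrite in_itv/= -ltr_norml.
  exact: le_lt_trans (le_tnth_enorm _ _) xk.
rewrite (lebesgue_space_box (A := fun=> `]- r, r[%classic))//.
under eq_bigr do rewrite lebesgue_measure_itv/= lte_fin gtrN// -EFinB opprK.
rewrite prodEFin prodr_const card_ord lee_fin.
have -> : r + r = 2 * r by ring.
rewrite exprMn.
by rewrite powR_mulrn// powRrM powR_mulrn ?powR_ge0.
Qed.

(** In dimension 0 the measure is a Dirac mass at the origin, hence the hypothesis on [n], which
    reappears wherever space is decomposed into annuli. *)
Lemma lebesgue_space_origin : (0 < n)%N -> mu [set x : E | enorm x = 0] = 0%E.
Proof.
move=> n0; pose B := [set x : E | forall i, ([set 0] : set (measurableTypeR R)) (tnth x i)].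
have -> : [set x : E | enorm x = 0] = B.
  apply/seteqP; split => x /= x0.
    by move=> i; apply/eqP; rewrite -normr_le0 -x0 le_tnth_enorm.
  apply/eqP; rewrite sqrtr_eq0 big1// => i _; by rewrite x0 expr0n.
rewrite (lebesgue_space_box (A := fun=> [set 0]))//.
by case: n n0 B => // m _ _; rewrite big_ord_recl lebesgue_measure_set1 mul0e.
Qed.

End annuli.

(** * Geometric sums over the integers *)

Section int_sums.
Context {R : realType}.
Local Open Scope ereal_scope.

Lemma powRDp (x a b : R) : (0 < x -> x `^ (a + b) = x `^ a * x `^ b)%R.
Proof. by move=> x0; rewrite powRD// (gt_eqF x0) implybT. Qed.

(** Enumerates the integers as 0, -1, 1, -2, and so on, to turn unordered sums into series and into
    integrals for the counting measure on [nat]. *)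
Definition int_of_nat (m : nat) : int := if odd m then Negz m./2 else Posz m./2.

Lemma int_of_nat_bij : set_bij [set: nat] [set: int] int_of_nat.
Proof.
split=> //.
- move=> i j _ _; rewrite /int_of_nat => ij.
  rewrite -(odd_double_half i) -(odd_double_half j).
  by move: ij; case: (odd i); case: (odd j) => // -[->].
- move=> [k|k] _.
  + by exists k.*2 => //; rewrite /int_of_nat odd_double doubleK.
  + by exists k.*2.+1 => //; rewrite /int_of_nat/= odd_double/= uphalf_double.
Qed.

Lemma esum_int (a : int -> \bar R) : (forall k, 0 <= a k) ->
  \esum_(k in [set: int]) a k = \sum_(m <oo) a (int_of_nat m).
Proof.
by move=> a0; rewrite (reindex_esum _ _ _ _ int_of_nat_bij) -nneseries_esumT.
Qed.

Lemma esum_intZ (a : int -> \bar R) (c : R) : (0 <= c)%R -> (forall k, 0 <= a k) ->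
  \esum_(k in [set: int]) (c%:E * a k) = c%:E * \esum_(k in [set: int]) a k.
Proof.
move=> c0 a0; rewrite !esum_int//; last by move=> k; rewrite mule_ge0// lee_fin.
exact: nneseriesZl.
Qed.

Lemma esum_int_shift (a : int -> \bar R) (j : int) :
  \esum_(k in [set: int]) a (k + j)%R = \esum_(k in [set: int]) a k.
Proof.
rewrite [RHS](@reindex_esum _ _ _ [set: int] _ (fun k => (k + j)%R))//.
split=> //; first by move=> x y _ _ /addIr.
by move=> k _; exists (k - j)%R => //; rewrite subrK.
Qed.

Lemma esum_term (a : int -> \bar R) j : (forall k, 0 <= a k) ->
  a j <= \esum_(k in [set: int]) a k.
Proof.
move=> a0; apply: esum_ge; exists [set j]; first by split.
by rewrite fsbig_set1.
Qed.

Lemma geometric_int_sum (d : R) : (0 < d)%R ->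
  exists2 C : R, (0 <= C)%R &
    \esum_(k in [set: int]) (2 `^ (- d * `|k|%:~R))%:E <= C%:E.
Proof.
(* The [m]-th integer of the enumeration has absolute value at least [m / 2], which halves the
   rate. *)
move=> d0; pose z : R := (2 `^ (- d / 2))%R.
have z0 : (0 < z)%R by rewrite powR_gt0.
have z1 : (z < 1)%R.
  rewrite /z /powR pnatr_eq0/= -[ltRHS]expR0 ltr_expR mulNr mulNr oppr_lt0.
  by rewrite !mulr_gt0 ?ln_gt0 ?ltr1n.
exists (2 `^ d / (1 - z))%R; first by rewrite divr_ge0 ?powR_ge0// subr_ge0 ltW.
rewrite esum_int//.
apply: (@le_trans _ _ (\sum_(m <oo) (geometric (2 `^ d) z m)%:E)).
  apply: lee_nneseries => [m _ _|m _]; first by rewrite lee_fin powR_ge0.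
  rewrite lee_fin /geometric/= -powR_mulrn ?powR_ge0// -powRrM -powRD; last first.
    by rewrite pnatr_eq0 implybT.
  apply: ler_powR; first by rewrite ler1n.
  rewrite /int_of_nat; have := odd_double_half m.
  case: (odd m) => /= mE; rewrite -[in leRHS]mE natrD -muln2 natrM.
    rewrite NegzE normrN -pmulrn/= -[X in (_ * X <= _)%R]natr1.
    move: (m./2%:R : R) => h; have -> : (d + - d / 2 * (1 + h * 2) = d / 2 - d * h)%R by field.
    lra.
  rewrite -pmulrn add0r; move: (m./2%:R : R) => h.
  have -> : (d + - d / 2 * (h * 2) = d - d * h)%R by field.
  lra.
apply: lime_le.
  by apply: is_cvg_nneseries => m _ _; rewrite lee_fin mulr_ge0 ?powR_ge0// exprn_ge0// ltW.
apply: nearW => m; rewrite sumEFin lee_fin; apply: geometric_le_lim => //.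
by rewrite gtr0_norm.
Qed.

(** The terms peak where [2^k] is close to [1 / r] and decay geometrically on both sides; recentring
    the sum there makes the constant independent of [r]. With [r = t^(-1/2)] this uniformity lets
    sums over annuli produce exact powers of time. *)
Lemma two_sided_geometric_sum (x y : R) : (0 < x)%R -> (0 < y)%R ->
  exists2 C : R, (0 <= C)%R & forall r : R, (0 < r)%R ->
    \esum_(k in [set: int])
      (Num.min ((2 `^ k%:~R * r) `^ x) ((2 `^ k%:~R * r) `^ (- y)))%:E <= C%:E.
Proof.
move=> x0 y0; pose d := Num.min x y.
have d0 : (0 < d)%R by rewrite lt_min x0.
have [C C0 HC] := geometric_int_sum d0.
exists (2 `^ y * C)%R; first by rewrite mulr_ge0 ?powR_ge0.
move=> r r0; have l2 : (0 < ln 2 :> R)%R by rewrite ln_gt0// ltr1n.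
have [L rE] : exists L, r = (2 `^ (- L))%R.
  by exists (- (ln r / ln 2))%R; rewrite opprK /powR pnatr_eq0/= mulfVK ?gt_eqF// lnK.
(* [2^k0] is [1 / r] rounded down to a power of two; the rounding costs the factor [2^y] in the
   constant. *)
have /andP[f1 f2] := floor_itv L; set k0 := Num.floor L in f1 f2.
rewrite -(esum_int_shift _ k0).
apply: (@le_trans _ _ (\esum_(k in [set: int]) ((2 `^ y)%:E * (2 `^ (- d * `|k|%:~R))%:E))).
  apply: le_esum => j _; rewrite -EFinM lee_fin rE.
  have y0' := ltW y0; have d0' := ltW d0.
  have p2 (a b : R) : (2 `^ a * 2 `^ b = 2 `^ (a + b))%R by rewrite powRD// pnatr_eq0 implybT.
  rewrite !p2 -!powRrM ge_min intrD; apply/orP.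
  have [j0|j0] := leP j 0%R; [left|right]; apply: ler_powR; rewrite ?ler1n//.
    rewrite ler0_norm// mulrNz; have : (j%:~R <= 0 :> R)%R by rewrite lerz0.
    have : (d <= x)%R by rewrite ge_min lexx.
    nra.
  rewrite gtr0_norm//; have : (0 < j%:~R :> R)%R by rewrite ltr0z.
  have : (d <= y)%R by rewrite ge_min lexx orbT.
  move: f2; rewrite intrD; nra.
rewrite esum_intZ ?powR_ge0//.
by rewrite EFinM lee_wpmul2l// lee_fin powR_ge0.
Qed.

End int_sums.

(** * Annulus blocks and the Herz norm with summation exponent 1 *)

Section herz_ereal.
Context {R : realType} {n : nat}.
Hypothesis n0 : (0 < n)%N.
Local Notation E := (Rspace R n).
Local Notation mu := (@lebesgue_space R n).
Local Notation ann := (@dyadic_annulus R n).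
Implicit Types (alpha p : R) (g : E -> \bar R).
Local Open Scope ereal_scope.

Definition block p g (k : int) : \bar R := (\int[mu]_(x in ann k) (g x `^ p)) `^ p^-1.

(** Taken on extended-valued functions so that it applies to heat flows before they are known to be
    finite; [herz_normE] links it to [herz_norm]. *)
Definition hnorm alpha p g : \bar R :=
  \esum_(k in [set: int]) ((2 `^ (k%:~R * alpha))%:E * block p g k).

Lemma block_ge0 p g k : 0 <= block p g k.
Proof. exact: poweR_ge0. Qed.

Lemma hnorm_ge0 alpha p g : 0 <= hnorm alpha p g.
Proof.
by apply: esum_ge0 => k _; rewrite mule_ge0 ?block_ge0// lee_fin powR_ge0.
Qed.

Lemma Lp_norm_block p (f : E -> R) k : (0 < p)%R ->
  Lp_norm p%:E (fun x => f x * \1_(ann k) x)%R = block p (fun x => `|f x|%:E) k.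
Proof.
move=> p0; rewrite /Lp_norm unlock; congr (_ `^ _).
rewrite [RHS]integral_mkcond; apply: eq_integral => x _.
rewrite patchE /= indicE; by case: ifPn => xk; rewrite ?mulr1// mulr0 normr0 powR0// gt_eqF.
Qed.

Lemma herz_normE alpha p (f : E -> R) : (0 < p)%R ->
  herz_norm alpha p%:E 1%E f = hnorm alpha p (fun x => `|f x|%:E).
Proof.
move=> p0; rewrite /herz_norm invr1 poweRe1; last first.
  by apply: esum_ge0 => k _; rewrite mule_ge0 ?poweR_ge0// lee_fin powR_ge0.
apply: eq_esum => k _; rewrite mulr1 poweRe1; last exact: Lnorm_ge0.
by rewrite Lp_norm_block.
Qed.

Lemma le_block p g1 g2 k : (0 < p)%R -> measurable_fun [set: E] g1 -> measurable_fun [set: E] g2 ->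
  (forall x, 0 <= g1 x) -> (forall x, 0 <= g2 x) ->
  {ae mu, forall x, ann k x -> g1 x <= g2 x} -> block p g1 k <= block p g2 k.
Proof.
move=> p0 m1 m2 g10 g20 g12.
apply: gt0_ler_poweR; rewrite ?invr_ge0 ?(ltW p0)//.
- by rewrite in_itv/= leey andbT integral_ge0// => x _; exact: poweR_ge0.
- by rewrite in_itv/= leey andbT integral_ge0// => x _; exact: poweR_ge0.
apply: ae_ge0_le_integral => //.
- exact: measurable_dyadic_annulus.
- by move=> x _; exact: poweR_ge0.
- by apply: measurable_funpow; exact: measurable_funTS.
- by move=> x _; exact: poweR_ge0.
- by apply: measurable_funpow; exact: measurable_funTS.
apply: filterS g12 => x /[apply] g12; apply: gt0_ler_poweR; rewrite ?(ltW p0)//.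
- by rewrite in_itv/= leey andbT.
- by rewrite in_itv/= leey andbT.
Qed.

Lemma le_hnorm alpha p g1 g2 : (0 < p)%R -> measurable_fun [set: E] g1 -> measurable_fun [set: E] g2 ->
  (forall x, 0 <= g1 x) -> (forall x, 0 <= g2 x) ->
  {ae mu, forall x, g1 x <= g2 x} -> hnorm alpha p g1 <= hnorm alpha p g2.
Proof.
move=> p0 m1 m2 g10 g20 g12; apply: le_esum => k _.
apply: lee_wpmul2l; [by rewrite lee_fin powR_ge0|apply: le_block => //].
by apply: filterS g12 => x.
Qed.

Lemma eq_hnorm alpha p g1 g2 : (0 < p)%R -> measurable_fun [set: E] g1 -> measurable_fun [set: E] g2 ->
  (forall x, 0 <= g1 x) -> (forall x, 0 <= g2 x) ->
  {ae mu, forall x, g1 x = g2 x} -> hnorm alpha p g1 = hnorm alpha p g2.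
Proof.
move=> p0 m1 m2 g10 g20 g12; apply/eqP; rewrite eq_le !le_hnorm//.
  by apply: filterS g12 => x ->.
by apply: filterS g12 => x ->.
Qed.

Lemma blockZ p g (c : R) k : (0 < p)%R -> (0 <= c)%R -> measurable_fun [set: E] g ->
  (forall x, 0 <= g x) -> block p (fun x => c%:E * g x) k = c%:E * block p g k.
Proof.
move=> p0 c0 mg g0; rewrite /block.
under eq_integral do rewrite poweRM ?lee_fin//.
rewrite ge0_integralZl//; last 4 first.
- exact: measurable_dyadic_annulus.
- by apply: measurable_funpow; exact: measurable_funTS.
- by move=> x _; exact: poweR_ge0.
- exact: poweR_ge0.
rewrite poweRM ?poweR_ge0//; last by apply: integral_ge0 => x _; exact: poweR_ge0.
by rewrite -poweRrM mulfV ?gt_eqF// poweRe1 ?lee_fin.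
Qed.

Lemma hnormZ alpha p g (c : R) : (0 < p)%R -> (0 <= c)%R -> measurable_fun [set: E] g ->
  (forall x, 0 <= g x) -> hnorm alpha p (fun x => c%:E * g x) = c%:E * hnorm alpha p g.
Proof.
move=> p0 c0 mg g0; rewrite /hnorm -esum_intZ//.
  by apply: eq_esum => k _; rewrite blockZ// muleCA.
by move=> k; rewrite mule_ge0 ?block_ge0// lee_fin powR_ge0.
Qed.

Lemma poweRD_le (a b : \bar R) (r : R) : 0 <= a -> 0 <= b -> (0 < r)%R ->
  (a + b) `^ r <= (2 `^ r)%:E * (a `^ r + b `^ r).
Proof.
move=> a0 b0 r0; wlog ab : a b a0 b0 / a <= b.
  move=> H; have [|/ltW] := leP a b; first exact: H.
  by rewrite addeC [X in _ * X]addeC; exact: H.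
apply: (@le_trans _ _ ((2%:E * b) `^ r)).
  apply: gt0_ler_poweR; rewrite ?(ltW r0)// ?in_itv/= ?leey ?andbT ?adde_ge0 ?mule_ge0//.
  by rewrite mule_natl mule2n leeD2r.
rewrite poweRM// poweR_EFin lee_wpmul2l ?lee_fin ?powR_ge0//.
by rewrite leeDr// poweR_ge0.
Qed.

(** A crude form of Minkowski's inequality: [poweRD_le] is used once for the exponent [p] and once
    for [p^-1], each time at the cost of a factor at most 2. *)
Lemma blockD p g1 g2 k : (1 <= p)%R -> measurable_fun [set: E] g1 -> measurable_fun [set: E] g2 ->
  (forall x, 0 <= g1 x) -> (forall x, 0 <= g2 x) ->
  block p (fun x => g1 x + g2 x) k <= 4%:E * (block p g1 k + block p g2 k).
Proof.
move=> p1 m1 m2 g10 g20; have p0 : (0 < p)%R by rewrite (lt_le_trans _ p1).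
have mA := @measurable_dyadic_annulus R n k.
have mp g : measurable_fun [set: E] g -> measurable_fun (ann k) (fun x => g x `^ p).
  by move=> mg; apply: measurable_funpow; exact: measurable_funTS.
set A := \int[mu]_(x in ann k) (g1 x `^ p); set B := \int[mu]_(x in ann k) (g2 x `^ p).
have A0 : 0 <= A by apply: integral_ge0 => x _; exact: poweR_ge0.
have B0 : 0 <= B by apply: integral_ge0 => x _; exact: poweR_ge0.
have H : \int[mu]_(x in ann k) ((g1 x + g2 x) `^ p) <= (2 `^ p)%:E * (A + B).
  rewrite -ge0_integralD//; [|by move=> x _; exact: poweR_ge0|exact: mp|by move=> x _; exact: poweR_ge0|exact: mp].
  rewrite -ge0_integralZl//; last 2 first.
  - by apply: emeasurable_funD; exact: mp.
  - by move=> x _; rewrite adde_ge0// poweR_ge0.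
  apply: ge0_le_integral => //.
  - by move=> x _; exact: poweR_ge0.
  - by apply: mp; exact: emeasurable_funD.
  - by apply: measurable_funeM; apply: emeasurable_funD; exact: mp.
  - by move=> x _; exact: poweRD_le.
have ip0 : (0 < p^-1)%R by rewrite invr_gt0.
rewrite {1}/block; apply: (@le_trans _ _ (((2 `^ p)%:E * (A + B)) `^ p^-1)).
  apply: gt0_ler_poweR; rewrite ?(ltW ip0)// in_itv/= leey andbT.
    by apply: integral_ge0 => x _; exact: poweR_ge0.
  by rewrite mule_ge0//= adde_ge0.
have C0 : 0 <= (2 `^ p)%:E by rewrite lee_fin powR_ge0.
rewrite (poweRM _ C0 (adde_ge0 A0 B0)) poweR_EFin -powRrM mulfV ?gt_eqF// powRr1//.
apply: (@le_trans _ _ (2%:E * ((2 `^ p^-1)%:E * (A `^ p^-1 + B `^ p^-1)))).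
  by apply: lee_wpmul2l => //; exact: poweRD_le.
rewrite muleA -EFinM; apply: lee_wpmul2r; first by rewrite adde_ge0 ?poweR_ge0.
rewrite lee_fin (_ : 4 = 2 * 2)%R; last by rewrite -natrM.
rewrite ler_pM2l// -[leRHS](powRr1 (ler0n R 2)); apply: ler_powR; first by rewrite ler1n.
by rewrite invf_le1.
Qed.

Lemma hnormD alpha p g1 g2 : (1 <= p)%R -> measurable_fun [set: E] g1 -> measurable_fun [set: E] g2 ->
  (forall x, 0 <= g1 x) -> (forall x, 0 <= g2 x) ->
  hnorm alpha p (fun x => g1 x + g2 x) <= 4%:E * (hnorm alpha p g1 + hnorm alpha p g2).
Proof.
move=> p1 m1 m2 g10 g20; rewrite /hnorm.
have t0 g k : 0 <= (2 `^ (k%:~R * alpha))%:E * block p g k.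
  by rewrite mule_ge0 ?block_ge0// lee_fin powR_ge0.
rewrite -esumD// -esum_intZ//; last by move=> k; rewrite adde_ge0.
apply: le_esum => k _; rewrite -ge0_muleDr ?block_ge0// muleCA.
by apply: lee_wpmul2l; [rewrite lee_fin powR_ge0|exact: blockD].
Qed.

Lemma block_le_hnorm alpha p g k :
  block p g k <= (2 `^ (- (k%:~R * alpha)))%:E * hnorm alpha p g.
Proof.
rewrite powRN -lee_pdivrMl ?invr_gt0 ?powR_gt0// invrK.
apply: (@esum_term R (fun k => (2 `^ (k%:~R * alpha))%:E * block p g k)) => j.
by rewrite mule_ge0 ?block_ge0// lee_fin powR_ge0.
Qed.

Lemma ae_annulus : {ae mu, forall x : E, exists k, ann k x}.
Proof.
exists [set x : E | enorm x = 0%R]; split.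
- rewrite (_ : [set x | _] = enorm @^-1` [set 0%R]) //.
  by rewrite -[X in measurable X]setTI; apply: measurable_enorm.
- exact: lebesgue_space_origin.
- move=> x /= nx; apply/eqP; rewrite eq_le enorm_ge0 andbT leNgt; apply/negP => x0.
  by apply: nx; exact: dyadic_annulus_cover.
Qed.

Lemma integral_annuli g : measurable_fun [set: E] g -> (forall x, 0 <= g x) ->
  \int[mu]_x g x = \esum_(k in [set: int]) \int[mu]_(x in ann k) g x.
Proof.
move=> mg g0; have mA k := @measurable_dyadic_annulus R n k.
rewrite esum_int; last by move=> k; exact: integral_ge0.
pose F m := ann (int_of_nat m).
transitivity (\int[mu]_(x in \bigcup_m F m) g x).
  have mU : measurable (\bigcup_m F m) by apply: bigcupT_measurable => m; exact: mA.
  rewrite [RHS]integral_mkcond; apply: ge0_ae_eq_integral => //.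
  - by apply/(measurable_restrictT _ _).1 => //; exact: measurable_funTS.
  - by move=> x _; rewrite patchE; case: ifP.
  apply: filterS ae_annulus => x [k xk] _; rewrite patchE ifT// inE.
  have [_ _ /(_ k Logic.I)[m _ mk]] := int_of_nat_bij.
  by exists m => //; rewrite /F mk.
rewrite ge0_integral_bigcup//.
- by move=> m; exact: mA.
- exact: measurable_funTS.
- move=> i j _ _ [x [xi xj]].
  have [_ inj _] := int_of_nat_bij; apply: inj; rewrite ?inE//.
  exact: dyadic_annulus_disj xi xj.
Qed.

Lemma hnorm_lty_fin alpha p g : (0 < p)%R -> measurable_fun [set: E] g -> (forall x, 0 <= g x) ->
  hnorm alpha p g < +oo -> {ae mu, forall x, g x \is a fin_num}.
Proof.
move=> p0 mg g0 Hoo.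
have H k : {ae mu, forall x, ann k x -> g x \is a fin_num}.
  have Ik : \int[mu]_(x in ann k) (g x `^ p) < +oo.
    apply: (@lty_poweRy _ _ p^-1); first by rewrite gt_eqF// invr_gt0.
    apply: (le_lt_trans (block_le_hnorm alpha p g k)).
    by rewrite lte_mul_pinfty// lee_fin powR_ge0.
  have : mu.-integrable (ann k) (fun x => g x `^ p).
    apply/integrableP; split; first by apply: measurable_funpow; exact: measurable_funTS.
    by under eq_integral do rewrite gee0_abs ?poweR_ge0//.
  move=> /(integrable_ae (@measurable_dyadic_annulus R n k)); apply: filterS => x /[apply] fp.
  rewrite ge0_fin_numE//; apply: (@lty_poweRy _ _ p); first by rewrite gt_eqF.
  by rewrite -ge0_fin_numE// poweR_ge0.
have HA : {ae mu, forall x, forall m, ann (int_of_nat m) x -> g x \is a fin_num}.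
  by apply: ae_foralln => m; exact: H.
apply: filterS2 HA ae_annulus => x Hx [k xk].
have [_ _ /(_ k Logic.I)[m _ mk]] := int_of_nat_bij.
by apply: (Hx m); rewrite mk.
Qed.

End herz_ereal.

(** * Potentials and heat flow in Herz spaces *)

Section potential.
Context {R : realType} {n : nat}.
Hypothesis n0 : (0 < n)%N.
Local Notation E := (Rspace R n).
Local Notation mu := (@lebesgue_space R n).
Local Notation ann := (@dyadic_annulus R n).
Local Open Scope ereal_scope.

Lemma fourpi_ge1 : (1 <= 4 * pi :> R)%R.
Proof. by have := @pi_ge2 R; lra. Qed.

Lemma powR_fourpi (t a : R) : (0 < t)%R -> (0 <= a)%R ->
  ((4 * pi * t) `^ (- a) <= t `^ (- a))%R.
Proof.
move=> t0 a0; rewrite !powRN lef_pV2 ?posrE ?powR_gt0 ?mulr_gt0 ?pi_gt0//.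
apply: ge0_ler_powR; rewrite ?nnegrE// ?(ltW t0)// ?mulr_ge0 ?pi_ge0 ?(ltW t0)//.
by rewrite ler_peMl ?(ltW t0)// fourpi_ge1.
Qed.

Lemma block_hker_aux (p rho c : R) (k : int) : (1 < p)%R -> (0 < rho)%R -> (0 < c)%R ->
  (c <= rho `^ (- (n%:R / 2)))%R ->
  ((c `^ p * (2 `^ n%:R * 2 `^ (k%:~R * n%:R))) `^ p^-1 <=
   2 `^ n%:R * rho `^ (- (n%:R / 2) * (1 - p^-1)) *
   (2 `^ k%:~R * rho `^ (- 2^-1)) `^ (n%:R / p))%R.
Proof.
move=> p1 r0 c0 cr; have p0 : (0 < p)%R by rewrite (lt_trans _ p1).
rewrite (powRM p^-1 (powR_ge0 c p) (mulr_ge0 (powR_ge0 2 n%:R) (powR_ge0 2 (k%:~R * n%:R)))).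
rewrite (powRM _ (powR_ge0 2 n%:R) (powR_ge0 _ _)).
rewrite (powRM (n%:R / p) (powR_ge0 2 k%:~R) (powR_ge0 _ _)).
have pp : (p * p^-1 = 1)%R by rewrite mulfV// gt_eqF.
rewrite -(powRrM c p p^-1) pp (powRr1 (ltW c0)) -!powRrM.
have -> : (2 `^ n%:R * rho `^ (- (n%:R / 2) * (1 - p^-1)) * (2 `^ (k%:~R * (n%:R / p)) * rho `^ (- 2^-1 * (n%:R / p))) = 2 `^ n%:R * rho `^ (- (n%:R / 2)) * 2 `^ (k%:~R * (n%:R / p)) :> R)%R.
  rewrite mulrACA -(powRDp _ _ r0) mulrAC; congr (_ * _ `^ _ * _)%R.
  by field; rewrite gt_eqF.
rewrite mulrA [X in (X * _ <= _)%R]mulrC mulrA ler_pM ?mulr_ge0 ?powR_ge0//.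
  exact: ltW.
rewrite ler_pM ?powR_ge0 ?(ltW c0)//; apply: ler_powR; first by rewrite ler1n.
by rewrite ler_piMr// invf_le1// ltW.
Qed.

(** Two estimates of the same block: the sup bound with the measure of the annulus, better for small
    annuli, and the sup bound to the power [p - 1] with total mass 1, better for large ones. They
    cross where [2^k] is of order [rho^(1/2)]. *)
Lemma block_hker_le (p rho : R) (m : E) k : (1 < p)%R -> (0 < rho)%R ->
  block p (fun z => (hker rho z m)%:E) k <=
  ((2 `^ n%:R * rho `^ (- (n%:R / 2) * (1 - p^-1)) *
    Num.min ((2 `^ k%:~R * rho `^ (- 2^-1)) `^ (n%:R / p)) 1)%R)%:E.
Proof.
move=> p1 r0; have p0 : (0 < p)%R by rewrite (lt_trans _ p1).
have mA := @measurable_dyadic_annulus R n k.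
set c := ((4 * pi * rho) `^ (- (n%:R / 2)))%R.
have c0 : (0 < c)%R by rewrite powR_gt0// !mulr_gt0// pi_gt0.
have n2 : (0 <= n%:R / 2 :> R)%R by rewrite divr_ge0.
have cr : (c <= rho `^ (- (n%:R / 2)))%R by exact: powR_fourpi.
have mk : measurable_fun [set: E] (fun z => (hker rho z m)%:E).
  by apply/measurable_EFinP; exact: measurable_hker.
have ip : (0 <= p^-1)%R by rewrite invr_ge0 ltW.
have I0 : 0 <= \int[mu]_(z in ann k) ((hker rho z m)%:E `^ p).
  by apply: integral_ge0 => z _; exact: poweR_ge0.
rewrite minr_pMr ?mulr_ge0 ?powR_ge0// EFin_min le_min; apply/andP; split.
  apply: (@le_trans _ _ (((c `^ p)%:E * (2 `^ n%:R * 2 `^ (k%:~R * n%:R))%:E) `^ p^-1)).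
    apply: gt0_ler_poweR => //; rewrite ?in_itv/= ?leey ?andbT// ?lee_fin ?mulr_ge0 ?powR_ge0//.
    apply: (@le_trans _ _ (\int[mu]_(z in ann k) (cst (c `^ p)%:E z))).
      apply: ge0_le_integral => //.
      + by move=> z _; rewrite lee_fin powR_ge0.
      + by apply: (@measurable_funpow _ _ R _ (fun z => (hker rho z m)%:E)); exact: measurable_funTS.
      + move=> z _ /=; rewrite lee_fin; apply: ge0_ler_powR; rewrite ?nnegrE ?(ltW p0) ?(ltW c0) ?hker_ge0//.
        exact: hker_le.
    rewrite integral_cst// lee_wpmul2l ?lee_fin ?powR_ge0//.
    exact: lebesgue_space_annulus_le.
  by rewrite -EFinM poweR_EFin lee_fin; exact: block_hker_aux.
rewrite mulr1; apply: (@le_trans _ _ ((c `^ (p - 1))%:E `^ p^-1)).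
  apply: gt0_ler_poweR => //; rewrite ?in_itv/= ?leey ?andbT// ?lee_fin ?powR_ge0//.
  apply: (@le_trans _ _ (\int[mu]_z ((c `^ (p - 1))%:E * (hker rho z m)%:E))).
    rewrite [leLHS]integral_mkcond; apply: ge0_le_integral => //.
    + by move=> z _; rewrite patchE; case: ifP => // _; rewrite lee_fin powR_ge0.
    + apply/(measurable_restrictT _ _).1 => //.
      by apply: (@measurable_funpow _ _ R _ (fun z => (hker rho z m)%:E)); exact: measurable_funTS.
    + exact: measurable_funeM.
    + move=> z _; rewrite patchE; case: ifP => _; last by rewrite mule_ge0 ?lee_fin ?powR_ge0 ?hker_ge0.
      rewrite -EFinM lee_fin -(@mulr_powRB1 _ _ p) ?hker_ge0// mulrC.
      rewrite ler_pM2r ?hker_gt0//; apply: ge0_ler_powR; rewrite ?nnegrE ?subr_ge0 ?(ltW p1) ?(ltW c0) ?hker_ge0//.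
      exact: hker_le.
  have cp : 0 <= (c `^ (p - 1))%:E by rewrite lee_fin powR_ge0.
  rewrite ge0_integralZl//; last by move=> z _; rewrite lee_fin hker_ge0.
  under eq_integral do rewrite hkerC.
  by rewrite integral_hker// mule1.
rewrite poweR_EFin lee_fin -powRrM -powRrM.
have -> : (- (n%:R / 2) * ((p - 1) / p) = - (n%:R / 2 * (1 - p^-1)))%R by field; rewrite gt_eqF.
have p10 : (0 <= 1 - p^-1)%R by rewrite subr_ge0 invf_le1// ltW.
rewrite mulNr; apply: (@le_trans _ _ (rho `^ (- (n%:R / 2 * (1 - p^-1))))%R).
  by apply: powR_fourpi => //; rewrite mulr_ge0.
rewrite ler_peMl ?powR_ge0// -[leLHS](powRr0 2); apply: ler_powR => //; by rewrite ler1n.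
Qed.

(* The bound is uniform in the centre [m], where the Brownian bridge of [eheat_potential] sits. *)
Lemma herz_potential (s kappa beta gamma : R) :
  (0 < beta)%R -> (beta < kappa)%R -> (0 < gamma)%R ->
  (0 < gamma + s * beta)%R -> (gamma + s * beta < n%:R * (1 - beta / kappa))%R ->
  exists2 C : R, (0 <= C)%R & forall (rho : R) (g : E -> \bar R) (m : E), (0 < rho)%R ->
    measurable_fun [set: E] g -> (forall x, 0 <= g x) ->
    \int[mu]_z ((enorm z `^ (- gamma))%:E * g z `^ beta * (hker rho z m)%:E) <=
    (C * rho `^ (- (n%:R * beta / (2 * kappa) + (gamma + s * beta) / 2)))%:E *
      (hnorm s kappa g) `^ beta.
Proof.
move=> b0 bk ga0 eta0 eta1.
have k0 : (0 < kappa)%R by rewrite (lt_trans b0).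
set eta := (gamma + s * beta)%R in eta0 eta1 *.
pose nu : R := (n%:R * (1 - beta / kappa))%R.
(* In terms of [A = 2^k rho^(-1/2)], annulus [k] contributes [A^(-eta)] from the two weights and the
   minimum of [A^nu] and 1 from the Gaussian; the sum converges because [0 < eta < nu]. *)
have [|C C0 HC] := @two_sided_geometric_sum R (nu - eta) eta _ eta0.
  by rewrite subr_gt0.
(* [C + 1] makes the constant positive, so that an infinite norm gives an infinite right-hand
   side. *)
exists (2 `^ gamma * 2 `^ n%:R * (C + 1))%R; first by rewrite !mulr_ge0 ?powR_ge0// addr_ge0.
move=> rho g m r0 mg g0; set H := hnorm s kappa g.
have H0 : 0 <= H by exact: hnorm_ge0.
(* Conjugate exponent of [kappa / beta]: on each annulus [g^beta] is measured in L^(kappa/beta). *)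
pose p' : R := (kappa / (kappa - beta))%R.
have kb : (0 < kappa - beta)%R by rewrite subr_gt0.
have p'1 : (1 < p')%R by rewrite ltr_pdivlMr// mul1r ltrBlDr ltrDl.
have p'0 : (0 < p')%R by rewrite (lt_trans _ p'1).
have mk : measurable_fun [set: E] (fun z => (hker rho z m)%:E).
  by apply/measurable_EFinP; exact: measurable_hker.
have me : measurable_fun [set: E] (fun z => (enorm z `^ (- gamma))%:E).
  apply/measurable_EFinP; apply: (measurableT_comp (measurable_powR _)).
  exact: measurable_enorm.
have mgb : measurable_fun [set: E] (fun z => g z `^ beta) by exact: measurable_funpow.
have k_ge0 z : 0 <= (hker rho z m)%:E by rewrite lee_fin hker_ge0.
have gb0 z : 0 <= g z `^ beta by exact: poweR_ge0.
have e0 z : 0 <= (enorm z `^ (- gamma))%:E by rewrite lee_fin powR_ge0.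
rewrite integral_annuli//; last 2 first.
- by apply: emeasurable_funM => //; exact: emeasurable_funM.
- by move=> z; rewrite !mule_ge0.
pose r := (rho `^ (- 2^-1))%R.
pose D := ((2 `^ gamma * 2 `^ n%:R) * rho `^ (- (n%:R * beta / (2 * kappa) + eta / 2)))%R.
have D0 : (0 < D)%R by rewrite !mulr_gt0 ?powR_gt0.
pose M (k : int) : R := (Num.min ((2 `^ k%:~R * r) `^ (nu - eta)) ((2 `^ k%:~R * r) `^ (- eta)))%R.
have M0 k : (0 <= M k)%R by rewrite le_min !powR_ge0.
have CE : (2 `^ gamma * 2 `^ n%:R * (C + 1) * rho `^ (- (n%:R * beta / (2 * kappa) + eta / 2)) = D * (C + 1))%R.
  by rewrite /D mulrAC.
rewrite CE.
have [->|Hfin] := eqVneq (H `^ beta) +oo.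
  by rewrite gt0_muley ?leey// lte_fin mulr_gt0// ltr_wpDl.
have Hb : H `^ beta \is a fin_num by rewrite ge0_fin_numE ?poweR_ge0// ltey.
have bound k : \int[mu]_(z in ann k) ((enorm z `^ (- gamma))%:E * g z `^ beta * (hker rho z m)%:E) <=
    (D * fine (H `^ beta))%:E * (M k)%:E.
  have mA := @measurable_dyadic_annulus R n k.
  pose d := (2 `^ gamma * 2 `^ (- (k%:~R * gamma)))%R.
  have d0 : (0 <= d)%R by rewrite mulr_ge0 ?powR_ge0.
  apply: (@le_trans _ _ (\int[mu]_(z in ann k) (d%:E * (g z `^ beta * (hker rho z m)%:E)))).
    apply: ge0_le_integral => //.
    - by move=> z _; rewrite !mule_ge0.
    - by apply: measurable_funTS; apply: emeasurable_funM => //; exact: emeasurable_funM.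
    - by apply: measurable_funTS; apply: measurable_funeM; exact: emeasurable_funM.
    move=> z /dyadic_annulusP/andP[kz _]; rewrite -muleA; apply: lee_wpmul2r; first by rewrite mule_ge0.
    rewrite lee_fin /d -powRDp//.
    have -> : (gamma + - (k%:~R * gamma) = (k%:~R - 1) * - gamma)%R by ring.
    rewrite powRrM !powRN lef_pV2 ?posrE ?powR_gt0//; last by rewrite (lt_le_trans _ kz)// powR_gt0.
    apply: ge0_ler_powR; rewrite ?nnegrE ?(ltW ga0) ?powR_ge0 ?enorm_ge0//.
  rewrite ge0_integralZl//; last 2 first.
  - by apply: measurable_funTS; exact: emeasurable_funM.
  - by move=> z _; rewrite mule_ge0.
  have qq : ((kappa / beta)^-1 + p'^-1 = 1)%R by rewrite /p'; field; rewrite !gt_eqF.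
  have q0 : (0 < kappa / beta)%R by rewrite divr_gt0.
  have := @ehoelder_in _ _ R mu (ann k) (fun z => g z `^ beta) (fun z => (hker rho z m)%:E) _ _ mA mgb mk gb0 k_ge0 q0 p'0 qq.
  have -> : (\int[mu]_(x in ann k) ((g x `^ beta) `^ (kappa / beta))) `^ (kappa / beta)^-1 = block kappa g k `^ beta.
    rewrite /block -poweRrM; congr (_ `^ _); last by rewrite invf_div mulrC.
    by apply: eq_integral => z _; rewrite -poweRrM; congr (_ `^ _); field; rewrite gt_eqF.
  rewrite -/(block p' (fun z => (hker rho z m)%:E) k) => hh.
  have hb : block kappa g k `^ beta <= (2 `^ (- (k%:~R * s * beta)))%:E * H `^ beta.
    have C1 : 0 <= (2 `^ (- (k%:~R * s)))%:E by rewrite lee_fin powR_ge0.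
    have := block_le_hnorm s kappa g k; rewrite -/H => hbl.
    have -> : (- (k%:~R * s * beta) = - (k%:~R * s) * beta)%R by ring.
    rewrite powRrM -poweR_EFin -(poweRM _ C1 H0).
    apply: gt0_ler_poweR => //; rewrite ?(ltW b0)// in_itv/= leey andbT ?block_ge0//.
    by rewrite mule_ge0.
  have {}hh := le_trans hh (lee_pmul (poweR_ge0 _ _) (block_ge0 _ _ _) hb (@block_hker_le p' rho m k p'1 r0)).
  apply: (le_trans (lee_wpmul2l _ hh)) => //.
  rewrite -(fineK Hb) -!EFinM lee_fin [fine _%:E]/=; move: (fine (H `^ beta)) (fine_ge0 (poweR_ge0 H beta)) => h h0.
  have e1 : (1 - p'^-1 = beta / kappa)%R by rewrite /p'; field; rewrite !gt_eqF.
  have e2 : (n%:R / p' = nu)%R by rewrite /p' /nu; field; rewrite !gt_eqF.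
  rewrite e1 e2 -/r /d /D.
  set A := (2 `^ k%:~R * r)%R; have A0 : (0 < A)%R by rewrite mulr_gt0 ?powR_gt0.
  have ME : M k = (A `^ (- eta) * Num.min (A `^ nu) 1)%R.
    rewrite minr_pMr ?powR_ge0// mulr1 -powRDp//.
    by rewrite /M -/A [(- eta + nu)%R]addrC.
  have AE : (A `^ (- eta) = 2 `^ (- (k%:~R * gamma)) * 2 `^ (- (k%:~R * s * beta)) * rho `^ (eta / 2))%R.
    rewrite powRM ?powR_ge0// -powRrM -powRDp//.
    by rewrite /r -powRrM; congr (_ `^ _ * _ `^ _)%R; rewrite /eta; field.
  have RE : (rho `^ (- (n%:R * beta / (2 * kappa) + eta / 2)) * rho `^ (eta / 2) = rho `^ (- (n%:R / 2) * (beta / kappa)))%R.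
    rewrite -powRDp//.
    by congr (_ `^ _)%R; field; rewrite gt_eqF.
  rewrite ME AE -RE; set mm := Num.min _ _.
  rewrite le_eqVlt; apply/orP; left; apply/eqP.
  ring.
apply: (@le_trans _ _ (\esum_(k in [set: int]) ((D * fine (H `^ beta))%:E * (M k)%:E))).
  by apply: le_esum => k _; exact: bound.
rewrite esum_intZ//; last by rewrite mulr_ge0 ?(ltW D0)// fine_ge0 ?poweR_ge0.
have -> : (D * (C + 1))%:E * H `^ beta = (D * fine (H `^ beta))%:E * (C + 1)%:E.
  by rewrite -{1}(fineK Hb) -!EFinM; congr EFin; ring.
apply: lee_wpmul2l; first by rewrite lee_fin mulr_ge0 ?(ltW D0)// fine_ge0 ?poweR_ge0.
apply: (le_trans (HC r _)); first exact: powR_gt0.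
by rewrite lee_fin lerDl.
Qed.

End potential.

(** * Gaussian decay between distant annuli *)

Section heat_herz.
Context {R : realType} {n : nat}.
Hypothesis n0 : (0 < n)%N.
Local Notation E := (Rspace R n).

(** Raise [y <= expR y] at [y = X / M] to the power [M]: Gaussian decay is traded for decay of any
    polynomial order. *)
Lemma expRN_le_powR (X M : R) : 0 < X -> 0 < M -> expR (- X) <= (M / X) `^ M.
Proof.
move=> X0 M0.
have h : X / M <= expR (X / M) by apply: le_trans (expR_ge1Dx _); rewrite lerDr.
have : (X / M) `^ M <= expR (X / M) `^ M.
  have XM : 0 <= X / M by rewrite divr_ge0// ltW.
  by apply: ge0_ler_powR; rewrite ?nnegrE ?expR_ge0 ?(ltW M0).
have -> : expR (X / M) `^ M = expR X.
  by rewrite /powR gt_eqF ?expR_gt0// expRK mulrC mulfVK// gt_eqF.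
move=> h2; have -> : (M / X) `^ M = ((X / M) `^ M)^-1.
  by rewrite -invf_div -[(X / M)^-1]powR_inv1 ?divr_ge0 ?(ltW X0) ?(ltW M0)// -powRrM mulN1r powRN.
rewrite expRN.
by rewrite lef_pV2 ?posrE ?expR_gt0 ?powR_gt0 ?divr_gt0.
Qed.

(** Uses |z|^2 / 2 - |y|^2 <= |z - y|^2, a coordinatewise inequality, with |z| >= 2 c and |y| <= c
    for [c = 2^(j-2)]. *)
Lemma enorm_sub_far (j k : int) (z y : E) : dyadic_annulus j z -> dyadic_annulus k y ->
  k + 2 <= j -> 2 `^ (2 * (j%:~R - 2)) <= enorm (subs z y) ^+ 2.
Proof.
move=> /dyadic_annulusP/andP[jz _] /dyadic_annulusP/andP[_ ky] kj.
have p2 (a : R) : 0 < 2 `^ a by rewrite powR_gt0.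
have h : enorm z ^+ 2 / 2 - enorm y ^+ 2 <= enorm (subs z y) ^+ 2.
  rewrite enorm_sqrB !enorm_sqr mulr_suml -sumrB; apply: ler_sum => i _.
  have := sqr_ge0 ((tnth z i : R) - 2 * tnth y i); rewrite !expr2; lra.
apply: le_trans h.
have ky2 : enorm y <= 2 `^ (j%:~R - 2).
  apply: (le_trans (ltW ky)); apply: ler_powR; first by rewrite ler1n.
  by rewrite lerBrDr -[2]/(2%:~R) -intrD ler_int.
have e2 : 2 `^ (j%:~R - 1) = 2 * 2 `^ (j%:~R - 2) :> R.
  rewrite -[2 in X in _ = X * _](powRr1 (ler0n R 2)) -powRDp//; congr (_ `^ _); ring.
rewrite e2 in jz; rewrite mulrC powRrM powR_mulrn ?powR_ge0//.
have := p2 (j%:~R - 2); have := enorm_ge0 y; move: jz ky2.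
move: (2 `^ _) (enorm z) (enorm y) => a b c; rewrite !expr2; nra.
Qed.

End heat_herz.

(** * Heat flow estimates between Herz spaces *)

Section heat_herz_bound.
Context {R : realType} {n : nat}.
Hypothesis n0 : (0 < n)%N.
Local Notation E := (Rspace R n).
Local Notation mu := (@lebesgue_space R n).
Local Notation ann := (@dyadic_annulus R n).
Local Open Scope ereal_scope.

Lemma hker_far (N : R) : (0 < N)%R -> exists2 C : R, (0 < C)%R &
  forall (t : R) (j k : int) (z y : E), (0 < t)%R -> ann j z -> ann k y -> (k + 2 <= j)%R ->
  (hker t z y <= C * t `^ (- (n%:R / 2)) * Num.min 1 ((2 `^ j%:~R * t `^ (- 2^-1)) `^ (- N)))%R.
Proof.
move=> N0; pose M : R := (N / 2)%R; have M0 : (0 < M)%R by rewrite divr_gt0.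
(* 64 is the product of the 4 in the Gaussian exponent and the 16 coming from [enorm_sub_far]. *)
pose K : R := ((64 * M) `^ M)%R.
exists (Num.max 1 K)%R; first by rewrite lt_max ltr01.
move=> t j k z y t0 jz ky kj.
have n2 : (0 <= n%:R / 2 :> R)%R by rewrite divr_ge0.
have c1 : (0 <= t `^ (- (n%:R / 2)))%R by exact: powR_ge0.
apply: (@le_trans _ _ (t `^ (- (n%:R / 2)) * expR (- (enorm (subs z y) ^+ 2 / (4 * t))))%R).
  by rewrite /hker /heat_kernel ler_wpM2r ?expR_ge0// powR_fourpi.
rewrite -mulrA [leRHS]mulrCA ler_wpM2l//.
rewrite minr_pMr ?le_max ?ler01// mulr1 le_min; apply/andP; split.
  rewrite (@le_trans _ _ 1%R) ?le_max ?lexx// -[leRHS]expR0 ler_expR oppr_le0.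
  by rewrite divr_ge0 ?sqr_ge0// mulr_ge0// ltW.
set A := (2 `^ j%:~R * t `^ (- 2^-1))%R.
have A0 : (0 < A)%R by rewrite mulr_gt0 ?powR_gt0.
have A2 : (A ^+ 2 / 64 <= enorm (subs z y) ^+ 2 / (4 * t))%R.
  have := enorm_sub_far jz ky kj; move: (enorm _ ^+ 2)%R => e.
  have -> : (2 `^ (2 * (j%:~R - 2)) = (2 `^ j%:~R) ^+ 2 / 16 :> R)%R.
    rewrite mulrC powRrM powR_mulrn ?powR_ge0// powRDp// exprMn; congr (_ * _)%R.
    rewrite powRN powR_mulrn// exprVn -exprM; congr (_^-1)%R; by rewrite -natrX.
  have tE : ((t `^ (- 2^-1)) ^+ 2 = t^-1)%R.
    rewrite -powR_mulrn ?powR_ge0// -powRrM (_ : - 2^-1 * 2%:R = -1)%R; last by field.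
    by rewrite powR_inv1// ltW.
  rewrite /A exprMn tE => h.
  rewrite mulrAC ler_pdivrMr//.
  have -> : (e / (4 * t) * t = e / 4)%R by field; rewrite gt_eqF.
  lra.
apply: (@le_trans _ _ (expR (- (A ^+ 2 / 64)))); first by rewrite ler_expR lerN2.
have X0 : (0 < A ^+ 2 / 64)%R by rewrite divr_gt0// exprn_gt0.
apply: (le_trans (expRN_le_powR X0 M0)).
have -> : (M / (A ^+ 2 / 64) = (64 * M) * A `^ (- 2))%R.
  rewrite powRN -[2%R]/(2%:R) powR_mulrn ?(ltW A0)//; field; rewrite gt_eqF//.
rewrite (powRM M (mulr_ge0 (ler0n R 64) (ltW M0)) (powR_ge0 A (- 2))) -(powRrM A).
have -> : (- 2 * M = - N)%R by rewrite /M; field.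
by rewrite ler_wpM2r ?powR_ge0// le_max lexx orbT.
Qed.

Lemma powR1x (a : R) : (1 `^ a = 1)%R.
Proof. by rewrite powR1. Qed.

(** The growth [a^y] of a source annulus is absorbed by the decay at the larger scale [B], which is
    why the order of decay asked from [hker_far] is [y + N] when [N] is wanted. *)
Lemma decay_bound (a A B y N : R) : (0 < a)%R -> (0 < A)%R -> (a <= B)%R -> (A <= B)%R ->
  (0 <= y)%R -> (0 <= N)%R ->
  (a `^ y * Num.min 1 (B `^ (- (y + N))) <= Num.min 1 (A `^ (- N)))%R.
Proof.
move=> a0 A0 aB AB y0 N0; have B0 : (0 < B)%R by exact: lt_le_trans AB.
have h1 : (a `^ y * Num.min 1 (B `^ (- (y + N))) <= B `^ y * Num.min 1 (B `^ (- (y + N))))%R.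
  rewrite ler_wpM2r ?le_min ?ler01 ?powR_ge0//.
  by apply: ge0_ler_powR; rewrite ?nnegrE ?(ltW a0) ?(ltW B0).
apply: (le_trans h1); rewrite minr_pMr ?powR_ge0// mulr1 -powRDp// opprD addrA subrr sub0r.
rewrite ge_min le_min; have [B1|B1] := leP B 1%R.
  apply/orP; left; apply/andP; split.
    rewrite -[leRHS](powR1x y); apply: ge0_ler_powR; rewrite ?nnegrE ?(ltW B0)//.
  apply: (@le_trans _ _ 1%R).
    rewrite -[leRHS](powR1x y); apply: ge0_ler_powR; rewrite ?nnegrE ?(ltW B0)//.
  rewrite powRN -[leLHS]invr1 lef_pV2 ?posrE ?powR_gt0//.
  rewrite -[leRHS](powR1x N); apply: ge0_ler_powR; rewrite ?nnegrE ?(ltW A0)//.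
  exact: le_trans B1.
apply/orP; right; rewrite le_min; apply/andP; split.
  rewrite powRN -[leRHS]invr1 lef_pV2 ?posrE ?powR_gt0// -[leLHS](powR1x N).
  by apply: ge0_ler_powR; rewrite ?nnegrE ?(ltW B0) ?(ltW B1).
rewrite !powRN lef_pV2 ?posrE ?powR_gt0//.
by apply: ge0_ler_powR; rewrite ?nnegrE ?(ltW B0) ?(ltW A0).
Qed.

Definition near_ann (j : int) : set E := ann (j - 1)%R `|` ann j `|` ann (j + 1)%R.

Lemma measurable_near_ann j : measurable (near_ann j).
Proof. by apply: measurableU; [apply: measurableU|]; exact: measurable_dyadic_annulus. Qed.

Lemma near_annN j k y : ann k y -> ~ near_ann j y -> (k + 2 <= j)%R \/ (j + 2 <= k)%R.
Proof.
move=> ky nj.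
have : k != (j - 1)%R by apply/eqP => kE; apply: nj; left; left; rewrite -kE.
have : k != j by apply/eqP => kE; apply: nj; left; right; rewrite -kE.
have : k != (j + 1)%R by apply/eqP => kE; apply: nj; right; rewrite -kE.
by lia.
Qed.

Lemma measurable_restr (A : set E) g : measurable A -> measurable_fun [set: E] g ->
  measurable_fun [set: E] (g \_ A : E -> \bar R).
Proof.
by move=> mA mg; apply/(measurable_restrictT _ _).1 => //; exact: measurable_funTS.
Qed.

Lemma restr_ge0 (A : set E) g : (forall x, 0 <= g x) -> forall x, 0 <= (g \_ A : E -> \bar R) x.
Proof. by move=> g0 x; rewrite patchE; case: ifP. Qed.

Lemma integral_block_le (p : R) g k : (1 < p)%R -> measurable_fun [set: E] g -> (forall x, 0 <= g x) ->
  \int[mu]_(y in ann k) g y <= (2 `^ n%:R * 2 `^ (k%:~R * (n%:R * (1 - p^-1))))%:E * block p g k.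
Proof.
move=> p1 mg g0; have p0 : (0 < p)%R by rewrite (lt_trans _ p1).
pose q := (p / (p - 1))%R.
have p10 : (0 < p - 1)%R by rewrite subr_gt0.
have q0 : (0 < q)%R by rewrite divr_gt0.
have qE : (q^-1 = 1 - p^-1)%R by rewrite /q; field; rewrite !gt_eqF.
have pq : (p^-1 + q^-1 = 1)%R by rewrite qE addrC subrK.
have mA := @measurable_dyadic_annulus R n k.
have := @ehoelder_in _ _ R mu (ann k) g (cst 1) _ _ mA mg (@measurable_cst _ _ _ _ _ _) g0 (fun=> lee01) p0 q0 pq.
under eq_integral do rewrite mule1.
move=> /le_trans; apply; rewrite -/(block p g k) muleC; apply: lee_wpmul2r; first exact: block_ge0.
rewrite (eq_integral (cst 1)) => [|x _]; last by rewrite /= powR1.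
rewrite integral_cst// mul1e -qE.
apply: (@le_trans _ _ ((2 `^ n%:R * 2 `^ (k%:~R * n%:R))%:E `^ q^-1)).
  apply: gt0_ler_poweR; rewrite ?in_itv/= ?leey ?andbT ?invr_ge0 ?(ltW q0)//.
  exact: lebesgue_space_annulus_le.
rewrite poweR_EFin lee_fin powRM ?powR_ge0// -!powRrM mulrA ler_wpM2r ?powR_ge0//.
apply: ler_powR; first by rewrite ler1n.
by rewrite ler_piMr// qE gerBl invr_ge0 ltW.
Qed.

Lemma pow_near_le (p : R) g j : (1 <= p)%R -> measurable_fun [set: E] g -> (forall x, 0 <= g x) ->
  (\int[mu]_x ((g \_ (near_ann j)) x `^ p)) `^ p^-1 <=
  4%:E * (block p g (j - 1)%R + block p g j + block p g (j + 1)%R).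
Proof.
move=> p1 mg g0; have p0 : (0 < p)%R by rewrite (lt_le_trans _ p1).
have mA k := @measurable_dyadic_annulus R n k.
have ip : (0 < p^-1)%R by rewrite invr_gt0.
have mp D : measurable_fun D (fun x => g x `^ p) by apply: measurable_funpow; exact: measurable_funTS.
have disj (i k : int) : i != k -> [disjoint ann i & ann k].
  move=> /eqP ik; apply/disj_setPS => x [xi xk]; apply: ik; exact: dyadic_annulus_disj xi xk.
set a := \int[mu]_(x in ann (j - 1)%R) (g x `^ p).
set b := \int[mu]_(x in ann j) (g x `^ p).
set c := \int[mu]_(x in ann (j + 1)%R) (g x `^ p).
have i0 D : 0 <= \int[mu]_(x in D) (g x `^ p) by apply: integral_ge0 => x _; exact: poweR_ge0.
have -> : \int[mu]_x ((g \_ (near_ann j)) x `^ p) = a + b + c.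
  transitivity (\int[mu]_(x in near_ann j) (g x `^ p)).
    rewrite [RHS]integral_mkcond; apply: eq_integral => x _; rewrite !patchE.
    by case: ifP => // _; rewrite poweR0r// gt_eqF.
  rewrite /near_ann ge0_integral_setU//.
  - rewrite ge0_integral_setU//.
    + by move=> x _; exact: poweR_ge0.
    + by apply: disj; lia.
  - exact: measurableU.
  - by move=> x _; exact: poweR_ge0.
  - apply/disj_setPS => x [[xi|xi] xk].
      by have := dyadic_annulus_disj xi xk; lia.
    by have := dyadic_annulus_disj xi xk; lia.
have step u v : 0 <= u -> 0 <= v -> (u + v) `^ p^-1 <= 2%:E * (u `^ p^-1 + v `^ p^-1).
  move=> u0 v0; apply: (le_trans (poweRD_le u0 v0 ip)); apply: lee_wpmul2r.
    by rewrite adde_ge0 ?poweR_ge0.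
  rewrite lee_fin -[leRHS](powRr1 (ler0n R 2)); apply: ler_powR; first by rewrite ler1n.
  by rewrite invf_le1.
apply: (le_trans (step _ _ (adde_ge0 (i0 _) (i0 _)) (i0 _))).
have -> : 4%:E = 2%:E * 2%:E :> \bar R by rewrite -EFinM -natrM.
rewrite -muleA; apply: lee_wpmul2l => //.
rewrite [leRHS]ge0_muleDr ?adde_ge0 ?block_ge0//; apply: leeD; first exact: step.
by rewrite -[leLHS]mul1e; apply: lee_wpmul2r; rewrite ?poweR_ge0// lee_fin ler1n.
Qed.

(** Source annuli at least two steps away are seen through Gaussian decay at the larger of the two
    scales; [decay_bound] absorbs their growth, and this is where [alpha < n (1 - 1/p)] enters. The
    neighbouring annuli, across which the kernel has no decay, are left to L^p estimates. *)
Lemma eheat_pointwise (alpha p N : R) : (1 < p)%R -> (alpha < n%:R * (1 - p^-1))%R -> (0 < N)%R ->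
  exists2 C : R, (0 < C)%R & forall (t : R) g j z, (0 < t)%R -> measurable_fun [set: E] g ->
    (forall x, 0 <= g x) -> ann j z ->
    eheat t g z <= eheat t (g \_ (near_ann j)) z +
      (C * t `^ ((n%:R * (1 - p^-1) - alpha - n%:R) / 2) *
        Num.min 1 ((2 `^ j%:~R * t `^ (- 2^-1)) `^ (- N)))%:E * hnorm alpha p g.
Proof.
move=> p1 al N0; have p0 : (0 < p)%R by rewrite (lt_trans _ p1).
pose y : R := (n%:R * (1 - p^-1) - alpha)%R.
have y0 : (0 < y)%R by rewrite subr_gt0.
have [C C0 HC] := @hker_far (y + N) (addr_gt0 y0 N0).
exists (C * 2 `^ n%:R)%R; first by rewrite mulr_gt0 ?powR_gt0.
move=> t g j z t0 mg g0 zj.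
have mA k := @measurable_dyadic_annulus R n k.
have mgn := measurable_restr (measurable_near_ann j) mg.
have gn0 := restr_ge0 (near_ann j) g0.
pose r := (t `^ (- 2^-1))%R; have r0 : (0 < r)%R by exact: powR_gt0.
pose A (i : int) := (2 `^ i%:~R * r)%R.
have A0 i : (0 < A i)%R by rewrite mulr_gt0 ?powR_gt0.
have leA (i k : int) : (i <= k)%R -> (A i <= A k)%R.
  by move=> ik; rewrite ler_wpM2r ?(ltW r0)//; apply: ler_powR; rewrite ?ler1n ?ler_int.
set D := (C * 2 `^ n%:R * t `^ ((n%:R * (1 - p^-1) - alpha - n%:R) / 2) * Num.min 1 (A j `^ (- N)))%R.
have D0 : (0 <= D)%R by rewrite !mulr_ge0 ?powR_ge0 ?(ltW C0)// le_min ler01 powR_ge0.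
pose B (k : int) := Num.max (A j) (A k).
have kf (k : int) (w : E) : ann k w -> ~ near_ann j w ->
    (hker t z w <= C * t `^ (- (n%:R / 2)) * Num.min 1 (B k `^ (- (y + N))))%R.
  move=> wk nw; have [kj|jk] := near_annN wk nw.
    rewrite /B max_l; first exact: HC zj wk kj.
    by apply: leA; move: kj; lia.
  rewrite hkerC /B max_r; first exact: HC wk zj jk.
  by apply: leA; move: jk; lia.
have bound (k : int) : \int[mu]_(w in ann k) ((hker t z w)%:E * g w) <=
    \int[mu]_(w in ann k) ((hker t z w)%:E * (g \_ (near_ann j)) w) +
    D%:E * ((2 `^ (k%:~R * alpha))%:E * block p g k).
  set c := (C * t `^ (- (n%:R / 2)) * Num.min 1 (B k `^ (- (y + N))))%R.
  have c0 : (0 <= c)%R by rewrite !mulr_ge0 ?powR_ge0 ?(ltW C0)// le_min ler01 powR_ge0.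
  apply: (@le_trans _ _ (\int[mu]_(w in ann k) ((hker t z w)%:E * (g \_ (near_ann j)) w + c%:E * g w))).
    apply: ge0_le_integral => //.
    - by move=> w _; rewrite mule_ge0// lee_fin hker_ge0.
    - by apply: measurable_funTS; exact: measurable_hkerg.
    - by apply: measurable_funTS; apply: emeasurable_funD; [exact: measurable_hkerg|exact: measurable_funeM].
    move=> w wk; rewrite patchE; case: ifPn => wn.
      by rewrite leeDl// mule_ge0.
    rewrite mule0 add0e; apply: lee_wpmul2r => //; rewrite lee_fin; apply: kf => //.
    by move/negP: wn; rewrite inE.
  rewrite ge0_integralD//; last 4 first.
  - by move=> w _; rewrite mule_ge0// lee_fin hker_ge0.
  - by apply: measurable_funTS; exact: measurable_hkerg.
  - by move=> w _; rewrite mule_ge0.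
  - by apply: measurable_funTS; exact: measurable_funeM.
  apply: leeD => //; rewrite ge0_integralZl//; last exact: measurable_funTS.
  apply: (@le_trans _ _ (c%:E * ((2 `^ n%:R * 2 `^ (k%:~R * (n%:R * (1 - p^-1))))%:E * block p g k))).
    by apply: lee_wpmul2l => //; exact: integral_block_le.
  rewrite muleA muleA -!EFinM; apply: lee_wpmul2r; first exact: block_ge0.
  rewrite lee_fin.
  have -> : (n%:R * (1 - p^-1) = y + alpha)%R by rewrite /y subrK.
  rewrite mulrDr powRDp// !mulrA ler_wpM2r ?powR_ge0//.
  have yE : (2 `^ (k%:~R * y) = A k `^ y * t `^ (y / 2))%R.
    rewrite /A powRM ?powR_ge0// -powRrM -mulrA /r -powRrM -powRDp//.
    by rewrite (_ : - 2^-1 * y + y / 2 = 0)%R ?powRr0 ?mulr1//; field.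
  have tE : (t `^ ((n%:R * (1 - p^-1) - alpha - n%:R) / 2) = t `^ (- (n%:R / 2)) * t `^ (y / 2))%R.
    by rewrite -powRDp// /y; congr (_ `^ _)%R; field; rewrite (gt_eqF p0).
  rewrite /D tE yE /c.
  have := @decay_bound (A k) (A j) (B k) y N (A0 k) (A0 j).
  rewrite /B !le_max !lexx orbT => /(_ erefl erefl (ltW y0) (ltW N0)) h.
  have q1 : (0 <= C * 2 `^ n%:R * (t `^ (- (n%:R / 2)) * t `^ (y / 2)))%R.
    by rewrite !mulr_ge0 ?powR_ge0 ?(ltW C0).
  apply: le_trans (ler_wpM2l q1 h).
  rewrite le_eqVlt; apply/orP; left; apply/eqP.
  move: (Num.min _ _) => mm; ring.
rewrite !eheatE// integral_annuli//; last 2 first.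
- exact: measurable_hkerg.
- by move=> w; rewrite mule_ge0// lee_fin hker_ge0.
rewrite [X in _ <= X + _]integral_annuli//; last 2 first.
- exact: measurable_hkerg.
- by move=> w; rewrite mule_ge0// lee_fin hker_ge0.
have t1 k : 0 <= (2 `^ (k%:~R * alpha))%:E * block p g k.
  by rewrite mule_ge0 ?block_ge0// lee_fin powR_ge0.
rewrite /hnorm -esum_intZ// -esumD.
- by apply: le_esum => k _; exact: bound.
- by move=> k _; apply: integral_ge0 => w _; rewrite mule_ge0// lee_fin hker_ge0.
- by move=> k _; rewrite mule_ge0.
Qed.

(** The near part is handled by L^p-L^r smoothing on each annulus. The far part is a constant on
    annulus [j]; its weighted L^r norms sum over small annuli because [0 < alpha + n / r], and over
    large ones by the freely chosen order of decay. *)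
Lemma heat_herz (alpha p r : R) : (1 < p)%R -> (p <= r)%R ->
  (0 < alpha + n%:R / r)%R -> (alpha < n%:R * (1 - p^-1))%R ->
  exists2 C : R, (0 < C)%R & forall (t : R) g, (0 < t)%R -> measurable_fun [set: E] g ->
    (forall x, 0 <= g x) ->
    hnorm alpha r (eheat t g) <= (C * t `^ (- (n%:R / 2) * (p^-1 - r^-1)))%:E * hnorm alpha p g.
Proof.
move=> p1 pr x0 al; have p0 : (0 < p)%R by rewrite (lt_trans _ p1).
have r0 : (0 < r)%R by rewrite (lt_le_trans p0).
have r1 : (1 <= r)%R by rewrite (le_trans (ltW p1)).
set x := (alpha + n%:R / r)%R in x0.
(* With [A = 2^j t^(-1/2)], the weight and the volume of annulus [j] give [A^x]; decay of order
   [2 x] turns this into the minimum of [A^x] and [A^(-x)]. *)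
have N0 : (0 < x + x)%R by rewrite addr_gt0.
have [C1 C10 HC1] := eheat_pointwise p1 al N0.
have [C2 C20 HC2] := @two_sided_geometric_sum R x x x0 x0.
(* The three terms are the ratios of weights when the sum is shifted from annuli [j - 1], [j] and
   [j + 1] back to [j]. *)
pose S : R := (2 `^ alpha + 1 + 2 `^ (- alpha))%R.
have S0 : (0 < S)%R by rewrite !addr_gt0 ?powR_gt0.
exists (16 * S + 4 * (2 `^ n%:R * C1 * C2))%R.
  by rewrite ltr_pwDl ?mulr_gt0// !mulr_ge0 ?powR_ge0 ?(ltW C10).
move=> t g t0 mg g0; set H := hnorm alpha p g.
have H0 : 0 <= H by exact: hnorm_ge0.
set K := (t `^ (- (n%:R / 2) * (p^-1 - r^-1)))%R.
have K0 : (0 < K)%R by exact: powR_gt0.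
have [->|Hfin] := eqVneq H +oo.
  rewrite gt0_muley ?leey// lte_fin mulr_gt0// ltr_pwDl ?mulr_gt0// !mulr_ge0 ?powR_ge0 ?(ltW C10)//.
have Hf : H \is a fin_num by rewrite ge0_fin_numE// ltey.
pose c (j : int) : R := (C1 * t `^ ((n%:R * (1 - p^-1) - alpha - n%:R) / 2) *
        Num.min 1 ((2 `^ j%:~R * t `^ (- 2^-1)) `^ (- (x + x))))%R.
have c0 j : (0 <= c j)%R by rewrite !mulr_ge0 ?powR_ge0 ?(ltW C10)// le_min ler01 powR_ge0.
have mgn j := measurable_restr (measurable_near_ann j) mg.
have gn0 j := restr_ge0 (near_ann j) g0.
have mA k := @measurable_dyadic_annulus R n k.
pose B k := block p g k.
have B0 k : 0 <= B k by exact: block_ge0.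
pose M (j : int) : R := (Num.min ((2 `^ j%:~R * t `^ (- 2^-1)) `^ x) ((2 `^ j%:~R * t `^ (- 2^-1)) `^ (- x)))%R.
have M0 j : (0 <= M j)%R by rewrite le_min !powR_ge0.
have near_bd j : block r (eheat t (g \_ (near_ann j))) j <= (K * 4)%:E * (B (j - 1)%R + B j + B (j + 1)%R).
  apply: (@le_trans _ _ ((\int[mu]_z (eheat t (g \_ (near_ann j)) z `^ r)) `^ r^-1)).
    apply: gt0_ler_poweR; rewrite ?in_itv/= ?leey ?andbT ?invr_ge0 ?(ltW r0)//.
    - by apply: integral_ge0 => z _; exact: poweR_ge0.
    - by apply: integral_ge0 => z _; exact: poweR_ge0.
    - apply: ge0_subset_integral => //.
      + by apply: measurable_funpow; exact: measurable_eheat.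
      + by move=> z _; exact: poweR_ge0.
  apply: (le_trans (integral_eheat_pow t0 (ltW p1) pr (mgn j) (gn0 j))).
  rewrite EFinM -muleA; apply: lee_pmul.
  - by rewrite lee_fin powR_ge0.
  - exact: poweR_ge0.
  - rewrite lee_fin /K !mulNr; apply: powR_fourpi => //.
    by rewrite mulr_ge0 ?divr_ge0// subr_ge0 lef_pV2 ?posrE.
  - exact: (pow_near_le _ (ltW p1) mg g0).
have far_bd j : block r (cst ((c j)%:E * H) : E -> \bar R) j <= (c j * (2 `^ n%:R * 2 `^ (j%:~R * (n%:R / r))))%:E * H.
  have cH : 0 <= (c j)%:E * H by rewrite mule_ge0// lee_fin.
  have rr : (r * r^-1 = 1)%R by rewrite mulfV// gt_eqF.
  rewrite /block (eq_integral (cst (((c j)%:E * H) `^ r)))// integral_cst//.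
  rewrite (poweRM _ (poweR_ge0 _ _) (measure_ge0 _ _)) -poweRrM rr (poweRe1 cH).
  rewrite (EFinM (c j)) -[leRHS]muleA -[leLHS]muleA; apply: lee_wpmul2l; first by rewrite lee_fin.
  rewrite muleC; apply: lee_wpmul2r => //.
  apply: (@le_trans _ _ ((2 `^ n%:R * 2 `^ (j%:~R * n%:R))%:E `^ r^-1)).
    apply: gt0_ler_poweR; rewrite ?in_itv/= ?leey ?andbT ?invr_ge0 ?(ltW r0)//.
    exact: lebesgue_space_annulus_le.
  rewrite poweR_EFin lee_fin (powRM _ (powR_ge0 2 n%:R) (powR_ge0 _ _)) -!powRrM mulrA ler_wpM2r ?powR_ge0//.
  apply: ler_powR; first by rewrite ler1n.
  by rewrite ler_piMr// invf_le1.
have w0 (j : int) : (0 <= 2 `^ (j%:~R * alpha) :> R)%R by exact: powR_ge0.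
have blk j : (2 `^ (j%:~R * alpha))%:E * block r (eheat t g) j <=
   (4 * (K * 4))%:E * ((2 `^ (j%:~R * alpha))%:E * (B (j - 1)%R + B j + B (j + 1)%R)) +
   (4 * (2 `^ n%:R * C1 * K) * fine H)%:E * (M j)%:E.
  have h1 : block r (eheat t g) j <= block r (fun z => eheat t (g \_ (near_ann j)) z + cst ((c j)%:E * H) z) j.
    apply: le_block => //.
    - exact: measurable_eheat.
    - by apply: emeasurable_funD => //; exact: measurable_eheat.
    - by move=> z; exact: eheat_ge0.
    - by move=> z; rewrite adde_ge0 ?eheat_ge0// mule_ge0 ?lee_fin.
    - by apply: nearW => z zj; exact: HC1.
  have h2 := le_trans h1 (blockD j r1 (measurable_eheat t (mgn j) (gn0 j))
     (@measurable_cst _ _ _ _ _ _) (fun z => eheat_ge0 t z (gn0 j)) (fun z => mule_ge0 (c0 j : 0 <= (c j)%:E) H0)).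
  have h3 := le_trans h2 (lee_wpmul2l (ler0n R 4 : 0 <= 4%:E) (leeD (near_bd j) (far_bd j))).
  have w0' : 0 <= (2 `^ (j%:~R * alpha))%:E by rewrite lee_fin.
  apply: (le_trans (lee_wpmul2l w0' h3)).
  have S1 : 0 <= B (j - 1)%R + B j + B (j + 1)%R by rewrite !adde_ge0.
  have Y0 : 0 <= (c j * (2 `^ n%:R * 2 `^ (j%:~R * (n%:R / r))))%:E * H.
    by rewrite mule_ge0// lee_fin mulr_ge0// mulr_ge0 ?powR_ge0.
  have Z0 : 0 <= (K * 4)%:E * (B (j - 1)%R + B j + B (j + 1)%R).
    by rewrite mule_ge0// lee_fin mulr_ge0// ltW.
  rewrite (ge0_muleDr _ Z0 Y0) (ge0_muleDr _ (mule_ge0 (ler0n R 4 : 0 <= 4%:E) Z0) (mule_ge0 (ler0n R 4 : 0 <= 4%:E) Y0)).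
  apply: leeD; first by rewrite [X in _ * X <= _]muleA -EFinM muleCA.
  rewrite -(fineK Hf) -!EFinM lee_fin [fine _%:E]/=; move: (fine H) => h.
  set A := (2 `^ j%:~R * t `^ (- 2^-1))%R; have A0 : (0 < A)%R by rewrite mulr_gt0 ?powR_gt0.
  have ME : (M j = A `^ x * Num.min 1 (A `^ (- (x + x))))%R.
    by rewrite minr_pMr ?powR_ge0// mulr1 -powRDp// opprD addrA subrr sub0r.
  have AE : (2 `^ (j%:~R * alpha) * 2 `^ (j%:~R * (n%:R / r)) = A `^ x * t `^ (x / 2))%R.
    rewrite -powRDp// /A powRM ?powR_ge0// -!powRrM -mulrA -powRDp//.
    rewrite (_ : - 2^-1 * x + x / 2 = 0)%R ?powRr0 ?mulr1; last by field.
    by congr (_ `^ _)%R; rewrite /x; ring.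
  have KE : (K = t `^ ((n%:R * (1 - p^-1) - alpha - n%:R) / 2) * t `^ (x / 2))%R.
    by rewrite -powRDp// /K; congr (_ `^ _)%R; rewrite /x; field; rewrite (gt_eqF p0) (gt_eqF r0).
  rewrite ME KE /c -/A le_eqVlt; apply/orP; left; apply/eqP.
  transitivity (4 * 2 `^ n%:R * C1 * h * Num.min 1 (A `^ (- (x + x))) * t `^ ((n%:R * (1 - p^-1) - alpha - n%:R) / 2) *
    (2 `^ (j%:~R * alpha) * 2 `^ (j%:~R * (n%:R / r))))%R; first by ring.
  by rewrite AE; ring.
have sB i : \esum_(j in [set: int]) ((2 `^ (j%:~R * alpha))%:E * B (j + i)%R) = (2 `^ (- (i%:~R * alpha)))%:E * H.
  rewrite /H /hnorm -(esum_int_shift (fun j => (2 `^ (j%:~R * alpha))%:E * block p g j) i) -esum_intZ ?powR_ge0//; last first.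
    by move=> k; rewrite mule_ge0 ?block_ge0.
  apply: eq_esum => j _; rewrite muleA -EFinM -powRDp//; congr ((_ `^ _)%:E * _).
  by rewrite intrD; ring.
rewrite /hnorm.
apply: (@le_trans _ _ ((4 * (K * 4))%:E * (S%:E * H) + (4 * (2 `^ n%:R * C1 * K) * fine H)%:E * C2%:E)); last first.
  rewrite -(fineK Hf) -!EFinM -EFinD lee_fin [fine _%:E]/=.
  by rewrite le_eqVlt; apply/orP; left; apply/eqP; ring.
apply: (@le_trans _ _ (\esum_(j in [set: int]) ((4 * (K * 4))%:E * ((2 `^ (j%:~R * alpha))%:E * (B (j - 1)%R + B j + B (j + 1)%R)) +
   (4 * (2 `^ n%:R * C1 * K) * fine H)%:E * (M j)%:E))).
  by apply: le_esum => j _; exact: blk.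
have k4 : (0 <= 4 * (K * 4))%R by rewrite !mulr_ge0// ltW.
have kf : (0 <= 4 * (2 `^ n%:R * C1 * K) * fine H)%R.
  by rewrite !mulr_ge0 ?powR_ge0 ?(ltW C10) ?(ltW K0) ?fine_ge0.
have wS j : 0 <= (2 `^ (j%:~R * alpha))%:E * (B (j - 1)%R + B j + B (j + 1)%R).
  by rewrite mule_ge0 ?lee_fin// !adde_ge0.
rewrite esumD; last 2 first.
- by move=> j _; rewrite mule_ge0.
- by move=> j _; rewrite mule_ge0 ?lee_fin.
rewrite !esum_intZ//; apply: leeD; apply: lee_wpmul2l => //; last first.
  by apply: HC2; exact: powR_gt0.
rewrite (eq_esum (b := fun j : int => ((2 `^ (j%:~R * alpha))%:E * B (j + (-1))%R + (2 `^ (j%:~R * alpha))%:E * B (j + 0)%R) + (2 `^ (j%:~R * alpha))%:E * B (j + 1)%R)); last first.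
  by move=> j _; rewrite addr0 !ge0_muleDr ?adde_ge0.
have wB i j : 0 <= (2 `^ (j%:~R * alpha))%:E * B (j + i)%R by rewrite mule_ge0.
rewrite !esumD//; try by move=> j _; rewrite ?adde_ge0.
rewrite !sB -!ge0_muleDl ?lee_fin ?addr_ge0//.
rewrite mulN1r opprK mul0r oppr0 powRr0 !mul1r -!EFinD.
by [].
Qed.

End heat_herz_bound.

(** * Singular integrals in time *)

Section time_integrals.
Context {R : realType}.
Local Notation leb := (@lebesgue_measure R).

(** The fundamental theorem of calculus on closed subintervals that exhaust the open one, then
    monotone convergence; this admits integrands singular at either end. *)
Lemma integral_oo_le (f F : R -> R) (a b B : R) : a < b ->
  measurable_fun [set: R] f ->
  (forall x, a < x < b -> 0 <= f x) ->
  (forall x, a < x < b -> {for x, continuous f}) ->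
  (forall x, a < x < b -> is_derive x 1 F (f x)) ->
  (forall x y, a < x -> x < y -> y < b -> F y - F x <= B) ->
  (\int[leb]_(x in `]a, b[) (f x)%:E <= B%:E)%E.
Proof.
move=> ab mf f0 cf dF FB.
pose d := (b - a) / 2; have d0 : 0 < d by rewrite divr_gt0// subr_gt0.
pose u (m : nat) := a + d / m.+2%:R; pose v (m : nat) := b - d / m.+2%:R.
have dm m : 0 < d / m.+2%:R by rewrite divr_gt0.
have dm2 m : d / m.+2%:R < d.
  by rewrite ltr_pdivrMr// ltr_pMr// ltr1n.
have uv m : u m < v m.
  have := dm2 m; rewrite /u /v; have -> : b = a + 2 * d by rewrite /d; field.
  move: (d / m.+2%:R) => e; lra.
have au m : a < u m by rewrite ltrDl.
have vb m : v m < b by rewrite ltrBlDr ltrDl.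
pose I m := `[u m, v m]%classic.
have UI : `]a, b[%classic = \bigcup_m I m.
  apply/seteqP; split => [x|x [m _]]; rewrite /I/= !in_itv/=; last first.
    by move=> /andP[ux xv]; rewrite (lt_le_trans (au m) ux) (le_lt_trans xv (vb m)).
  move=> /andP[ax xb].
  pose e := Num.min (x - a) (b - x).
  have e0 : 0 < e by rewrite lt_min !subr_gt0 ax xb.
  have [N HN] : exists N : nat, d / e < N%:R.
    by exists (Num.truncn (d / e)).+1; exact: truncnS_gt.
  exists N => //; rewrite /I/= in_itv/=.
  have h : d / N.+2%:R < e.
    rewrite ltr_pdivrMr// mulrC -ltr_pdivrMr//; apply: (lt_trans HN).
    by rewrite ltr_nat.
  have e1 : e <= x - a by rewrite ge_min lexx.
  have e2 : e <= b - x by rewrite ge_min lexx orbT.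
  rewrite /u /v; move: (d / N.+2%:R) h => w h; apply/andP; split; lra.
rewrite UI.
have ndI : nondecreasing_seq I.
  apply/nondecreasing_seqP => m; apply/subsetPset => x; rewrite /I/= !in_itv/= => /andP[ux xv].
  have h : d / m.+3%:R <= d / m.+2%:R.
    by rewrite ler_pM2l// lef_pV2 ?posrE ?ltr0n// ler_nat.
  rewrite /u /v in ux xv *; move: (d / m.+3%:R) (d / m.+2%:R) h ux xv => w w' h ux xv.
  apply/andP; split; lra.
have := @ge0_nondecreasing_set_cvg_integral _ (measurableTypeR R) R I (EFin \o f) leb ndI.
have sub m x : I m x -> a < x < b.
  by rewrite /I/= in_itv/= => /andP[ux xv]; rewrite (lt_le_trans (au m) ux) (le_lt_trans xv (vb m)).
move=> /(_ (fun m => measurable_itv _) (fun m => measurable_funTS ((measurable_EFinP _ _).2 mf))).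
move=> /(_ (fun m x Ix => f0 x (sub m x Ix))) H.
rewrite -(cvg_lim _ H)//; apply: lime_le; first by apply/cvg_ex; eexists; exact: H.
apply: nearW => m; rewrite /I (@continuous_FTC2 _ f F) ?lee_fin//.
- exact: FB.
- apply: continuous_in_subspaceT => x; rewrite inE => Ix.
  exact: cf (sub m x Ix).
- have cF x : a < x < b -> {for x, continuous F}.
    move=> xab; apply: differentiable_continuous; apply/derivable1_diffP.
    by have := dF x xab => -[].
  split.
  + move=> x; rewrite in_itv/= => /andP[ux xv].
    have xab : a < x < b by rewrite (lt_trans (au m) ux) (lt_trans xv (vb m)).
    by have := dF x xab => -[].
  + apply: cvg_at_right_filter; apply: cF.
    by rewrite au (lt_trans (uv m) (vb m)).
  + apply: cvg_at_left_filter; apply: cF.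
    by rewrite vb (lt_trans (au m) (uv m)).
- move=> x; rewrite in_itv/= => /andP[ux xv].
  have xab : a < x < b by rewrite (lt_trans (au m) ux) (lt_trans xv (vb m)).
  by rewrite derive1E; have := dF x xab => -[].
Qed.

Lemma integral_powR_left (a b l : R) : a < b -> 0 <= l -> l < 1 ->
  (\int[leb]_(x in `]a, b[) ((x - a) `^ (- l))%:E <= ((b - a) `^ (1 - l) / (1 - l))%:E)%E.
Proof.
move=> ab l0 l1; have l10 : 0 < 1 - l by rewrite subr_gt0.
have dG (c x : R) : a < x -> is_derive x 1 (fun x => (x - a) `^ c) (c * (x - a) `^ (c - 1)).
  move=> ax; have xa : 0 < x - a by rewrite subr_gt0.
  have := @is_derive1_comp R (fun y => y `^ c) (fun x => x - a) x (c * (x - a) `^ (c - 1)) 1.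
  by rewrite mulr1; apply; [exact: is_derive1_powR|apply: is_derive_eq; rewrite subr0].
apply: (@integral_oo_le _ (fun x => (1 - l)^-1 * (x - a) `^ (1 - l))) => //.
- by apply: (measurableT_comp (measurable_powR _)) => //; exact: measurable_funB.
- by move=> x _; exact: powR_ge0.
- move=> x /andP[ax _]; apply: differentiable_continuous; apply/derivable1_diffP.
  by have [] := dG (- l) x ax.
- move=> x /andP[ax _]; have := dG (1 - l) x ax => dGx.
  have -> : (x - a) `^ (- l) = (1 - l)^-1 *: ((1 - l) * (x - a) `^ (1 - l - 1)).
    by rewrite /GRing.scale/= mulKf ?gt_eqF//; congr (_ `^ _); ring.
  exact: is_deriveZ.
- move=> x y ax xy yb; rewrite -mulrBr mulrC ler_pM2r ?invr_gt0//.
  rewrite lerBlDr ler_wpDr ?powR_ge0//; apply: ge0_ler_powR; rewrite ?nnegrE ?subr_ge0 ?ltW//.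
  + exact: lt_trans xy.
  + by rewrite ltrD2r.
Qed.

Lemma integral_powR_right (a b l : R) : a < b -> 0 <= l -> l < 1 ->
  (\int[leb]_(x in `]a, b[) ((b - x) `^ (- l))%:E <= ((b - a) `^ (1 - l) / (1 - l))%:E)%E.
Proof.
move=> ab l0 l1; have l10 : 0 < 1 - l by rewrite subr_gt0.
have dG (c x : R) : x < b -> is_derive x 1 (fun x => (b - x) `^ c) (- (c * (b - x) `^ (c - 1))).
  move=> ax; have xa : 0 < b - x by rewrite subr_gt0.
  have := @is_derive1_comp R (fun y => y `^ c) (fun x => b - x) x (c * (b - x) `^ (c - 1)) (-1).
  have dB : is_derive x 1 (fun x : R => b - x) (-1).
    by rewrite -[-1]sub0r; exact: is_deriveB.
  by rewrite mulrN1; apply => //; exact: is_derive1_powR.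
apply: (@integral_oo_le _ (fun x => - (1 - l)^-1 * (b - x) `^ (1 - l))) => //.
- by apply: (measurableT_comp (measurable_powR _)) => //; exact: measurable_funB.
- by move=> x _; exact: powR_ge0.
- move=> x /andP[_ ax]; apply: differentiable_continuous; apply/derivable1_diffP.
  by have [] := dG (- l) x ax.
- move=> x /andP[_ ax]; have := dG (1 - l) x ax => dGx.
  have -> : (b - x) `^ (- l) = (- (1 - l)^-1) *: (- ((1 - l) * (b - x) `^ (1 - l - 1))).
    by rewrite /GRing.scale/= mulrNN mulKf ?gt_eqF//; congr (_ `^ _); ring.
  exact: is_deriveZ.
- move=> x y ax xy yb; rewrite !mulNr opprK addrC -mulrBr mulrC ler_pM2r ?invr_gt0//.
  rewrite lerBlDr ler_wpDr ?powR_ge0//; apply: ge0_ler_powR; rewrite ?nnegrE ?subr_ge0 ?ltW//.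
  + exact: lt_trans yb.
  + by rewrite ltrD2l ltrN2.
Qed.

(** The coefficient 2 is the one that the Duhamel estimate produces: the left singularity occurs
    once in the term singular only there, and once more when a mixed product is split by
    [powRN_mul_le]. *)
Definition tker (a b l x : R) : R := 2 * (x - a) `^ (- l) + (b - x) `^ (- l).

Lemma tker_ge0 a b l x : 0 <= tker a b l x.
Proof. by rewrite addr_ge0 ?mulr_ge0 ?powR_ge0. Qed.

Lemma measurable_tker d (T : measurableType d) (f g h : T -> R) l :
  measurable_fun [set: T] f -> measurable_fun [set: T] g -> measurable_fun [set: T] h ->
  measurable_fun [set: T] (fun x => tker (f x) (g x) l (h x)).
Proof.
move=> mf mg mh; apply: measurable_funD.
  apply: measurable_funM => //; apply: (measurableT_comp (measurable_powR _)) => //.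
  exact: measurable_funB.
by apply: (measurableT_comp (measurable_powR _)) => //; exact: measurable_funB.
Qed.

Lemma integral_tker (a b l : R) : a < b -> 0 <= l -> l < 1 ->
  (\int[leb]_(x in `]a, b[) (tker a b l x)%:E <= (3 * (b - a) `^ (1 - l) / (1 - l))%:E)%E.
Proof.
move=> ab l0 l1; rewrite /tker.
have mp (g : R -> R) : measurable_fun [set: R] g ->
    measurable_fun (`]a, b[ : set R) (fun x => (g x `^ (- l))%:E).
  move=> mg; apply: measurable_funTS; apply/measurable_EFinP.
  exact: (measurableT_comp (measurable_powR _)).
under eq_integral do rewrite EFinD EFinM.
rewrite ge0_integralD//; last 4 first.
- by move=> x _; rewrite mule_ge0// lee_fin powR_ge0.
- by apply: measurable_funeM; apply: mp; exact: measurable_funB.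
- by move=> x _; rewrite lee_fin powR_ge0.
- by apply: mp; exact: measurable_funB.
rewrite ge0_integralZl//; last 2 first.
- by apply: mp; exact: measurable_funB.
- by move=> x _; rewrite lee_fin powR_ge0.
apply: (@le_trans _ _ (2%:E * ((b - a) `^ (1 - l) / (1 - l))%:E + ((b - a) `^ (1 - l) / (1 - l))%:E)%E).
  apply: leeD; last exact: integral_powR_right.
  by apply: lee_wpmul2l => //; exact: integral_powR_left.
by rewrite -EFinM -EFinD lee_fin le_eqVlt; apply/orP; left; apply/eqP; ring.
Qed.

(** Both bases are replaced by the smaller one. This decouples the two endpoint singularities, so
    that no Beta integral has to be computed. *)
Lemma powRN_mul_le (x y p q : R) : 0 < x -> 0 < y -> 0 <= p -> 0 <= q ->
  x `^ (- p) * y `^ (- q) <= x `^ (- (p + q)) + y `^ (- (p + q)).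
Proof.
move=> x0 y0 p0 q0; have le (u v c : R) : 0 < u -> u <= v -> 0 <= c -> v `^ (- c) <= u `^ (- c).
  move=> u0 uv c0; have v0 : 0 < v by exact: lt_le_trans uv.
  rewrite !powRN lef_pV2 ?posrE ?powR_gt0//.
  by apply: ge0_ler_powR; rewrite ?nnegrE ?(ltW u0) ?(ltW v0).
rewrite !opprD !powRDp//; have [xy|/ltW yx] := leP x y.
  rewrite ler_wpDr ?mulr_ge0 ?powR_ge0// ler_wpM2l ?powR_ge0//; exact: le.
rewrite ler_wpDl ?mulr_ge0 ?powR_ge0// ler_wpM2r ?powR_ge0//; exact: le.
Qed.

(** [x * y / (x + y)] is at least half of the smaller of [x] and [y]; this is applied to the time
    parameter of the bridge. *)
Lemma powRN_harmonic_le (x y p : R) : 0 < x -> 0 < y -> 0 <= p ->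
  (x * y / (x + y)) `^ (- p) <= 2 `^ p * (x `^ (- p) + y `^ (- p)).
Proof.
move=> x0 y0 p0; wlog xy : x y x0 y0 / x <= y.
  move=> H; have [|/ltW yx] := leP x y; first exact: H.
  by rewrite [x * y]mulrC [x + y]addrC [_ `^ _ + _]addrC; exact: H.
apply: (@le_trans _ _ ((x / 2) `^ (- p))).
  have xy0 : 0 < x + y by rewrite addr_gt0.
  have h : x / 2 <= x * y / (x + y).
    rewrite ler_pdivlMr// -mulrA ler_pM2l// mulrC ler_pdivrMr//; lra.
  have xy1 : 0 < x * y / (x + y) by rewrite divr_gt0// mulr_gt0.
  have x2 : 0 < x / 2 by rewrite divr_gt0.
  rewrite !powRN lef_pV2 ?posrE ?powR_gt0//.
  by apply: ge0_ler_powR; rewrite ?nnegrE ?(ltW xy1) ?(ltW x2).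
rewrite (powRM _ (ltW x0)) ?invr_ge0// mulrC.
have -> : (2^-1 `^ (- p) = 2 `^ p :> R) by rewrite -powR_inv1// -powRrM mulN1r opprK.
by rewrite ler_wpM2l ?powR_ge0// lerDl powR_ge0.
Qed.

End time_integrals.

(** * The heat semigroup on real functions *)

Section integral_parameter.
Context {R : realType}.
Local Open Scope ereal_scope.

(** Tonelli on the positive and the negative part; the difference is measurable whatever its value
    where both integrals are infinite. *)
Lemma measurable_int_param d (T : measurableType d) d' (T' : measurableType d')
    (m : {sigma_finite_measure set T' -> \bar R}) (k : T * T' -> \bar R) :
  measurable_fun [set: T * T'] k -> measurable_fun [set: T] (fun x => \int[m]_y k (x, y)).
Proof.
move=> mk; pose F (h : T * T' -> \bar R) x := \int[m]_y h (x, y).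
have -> : (fun x => \int[m]_y k (x, y)) = (fun x => F k^\+ x - F k^\- x).
  apply/funext => x; rewrite integralE /F; congr (_ - _); apply: eq_integral => y _.
    by rewrite !funeposE.
  by rewrite !funenegE.
apply: emeasurable_funB.
- exact: (@measurable_fun_fubini_tonelli_F _ _ _ _ _ m k^\+
    (measurable_funepos mk) (funepos_ge0 k)).
- exact: (@measurable_fun_fubini_tonelli_F _ _ _ _ _ m k^\-
    (measurable_funeneg mk) (funeneg_ge0 k)).
Qed.

Lemma abs_fine_le (a : \bar R) : `|fine a|%:E <= `|a|.
Proof. by case: a => [r| |]//=; rewrite normr0 leey. Qed.

End integral_parameter.

Section real_heat.
Context {R : realType} {n : nat}.
Local Notation E := (Rspace R n).
Local Notation mu := (@lebesgue_space R n).
Local Open Scope ereal_scope.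

Definition absE (f : E -> R) : E -> \bar R := fun x => `|f x|%:E.

Lemma absE_ge0 f x : 0 <= absE f x. Proof. by rewrite lee_fin. Qed.

Lemma measurable_absE f : measurable_fun [set: E] f -> measurable_fun [set: E] (absE f).
Proof. by move=> mf; apply/measurable_EFinP; exact: measurableT_comp. Qed.

Lemma measurable_hkerf t x (f : E -> R) : measurable_fun [set: E] f ->
  measurable_fun [set: E] (fun y => hker t x y * f y)%R.
Proof. by move=> mf; apply: measurable_funM => //; exact: measurable_hker. Qed.

Lemma abs_hkerf t x (f : E -> R) y : `|(hker t x y * f y)%R|%:E = (hker t x y)%:E * absE f y.
Proof. by rewrite normrM ger0_norm ?hker_ge0// EFinM. Qed.

Lemma heatE t (f : E -> R) x : (0 < t)%R ->
  heat t f x = fine (\int[mu]_y (hker t x y * f y)%:E).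
Proof. by rewrite /heat => ->. Qed.

Lemma heat0 (f : E -> R) : heat 0 f = f.
Proof. by apply/funext => x; rewrite /heat ltxx. Qed.

Lemma abs_heat_le t (f : E -> R) x : measurable_fun [set: E] f ->
  `|heat t f x|%:E <= eheat t (absE f) x.
Proof.
move=> mf; rewrite /heat /eheat; case: ifP => // t0.
apply: (le_trans (abs_fine_le _)).
apply: (le_trans (le_abse_integral _ _ _)) => //.
  by apply/measurable_EFinP; exact: measurable_hkerf.
by under eq_integral do rewrite /= abs_hkerf.
Qed.

Lemma integrable_heat t (f : E -> R) x : (0 < t)%R -> measurable_fun [set: E] f ->
  eheat t (absE f) x < +oo -> mu.-integrable setT (fun y => (hker t x y * f y)%:E).
Proof.
move=> t0 mf; rewrite eheatE// => foo; apply/integrableP; split.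
  by apply/measurable_EFinP; exact: measurable_hkerf.
by under eq_integral do rewrite /= abs_hkerf.
Qed.

Lemma heatB t (f g : E -> R) x : measurable_fun [set: E] f -> measurable_fun [set: E] g ->
  eheat t (absE f) x < +oo -> eheat t (absE g) x < +oo ->
  heat t (fun y => f y - g y)%R x = (heat t f x - heat t g x)%R.
Proof.
move=> mf mg fo go; rewrite /heat; case: ifPn => // t0.
rewrite -RintegralB//; [|exact: integrable_heat|exact: integrable_heat].
by apply: eq_Rintegral => y _; rewrite mulrBr.
Qed.

Lemma heatD t (f g : E -> R) x : measurable_fun [set: E] f -> measurable_fun [set: E] g ->
  eheat t (absE f) x < +oo -> eheat t (absE g) x < +oo ->
  heat t (fun y => f y + g y)%R x = (heat t f x + heat t g x)%R.
Proof.
move=> mf mg fo go; rewrite /heat; case: ifPn => // t0.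
rewrite -RintegralD//; [|exact: integrable_heat|exact: integrable_heat].
by apply: eq_Rintegral => y _; rewrite mulrDr.
Qed.

Lemma heatZ t c (f : E -> R) x : measurable_fun [set: E] f ->
  eheat t (absE f) x < +oo ->
  heat t (fun y => c * f y)%R x = (c * heat t f x)%R.
Proof.
move=> mf fo; rewrite /heat; case: ifPn => // t0.
rewrite -RintegralZl//; last exact: integrable_heat.
by apply: eq_Rintegral => y _; rewrite mulrCA.
Qed.

Lemma heat_cst t (c : R) (x : E) : heat t (cst c) x = c.
Proof.
rewrite /heat; case: ifPn => // t0.
rewrite /Rintegral; under eq_integral => y _ do rewrite /= mulrC EFinM.
rewrite integralZl//; last first.
  apply/integrableP; split; first exact: measurable_hkerl.
  under eq_integral => y _ do rewrite /= ger0_norm ?hker_ge0//.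
  by rewrite integral_hker// ltry.
by rewrite integral_hker// mule1.
Qed.

Lemma measurable_heat_param d (T : measurableType d) (t : T -> R) (x : T -> E) (f : T -> E -> R) :
  measurable_fun [set: T] t -> measurable_fun [set: T] x ->
  measurable_fun [set: T * E] (fun z => f z.1 z.2) ->
  measurable_fun [set: T] (fun z => heat (t z) (f z) (x z)).
Proof.
move=> mt mx mf.
have -> : (fun z => heat (t z) (f z) (x z)) = (fun z => if (0 < t z)%R
    then fine (\int[mu]_y (hker (t z) (x z) y * f z y)%:E) else f z (x z)) by [].
apply: measurable_fun_if => //.
- exact: measurable_fun_ltr.
- apply: measurable_funTS; apply: measurableT_comp => //.
  apply: (@measurable_int_param _ _ _ _ _ mu (fun z : T * E => (hker (t z.1) (x z.1) z.2 * f z.1 z.2)%:E)).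
  apply/measurable_EFinP; apply: measurable_funM => //.
  by apply: measurable_hker => //; exact: measurableT_comp.
- apply: measurable_funTS.
  apply: (measurableT_comp (f := fun z : T * E => f z.1 z.2) (g := fun z => (z, x z))) => //.
  exact: measurable_fun_pair.
Qed.

Lemma measurable_heat t (f : E -> R) : measurable_fun [set: E] f -> measurable_fun [set: E] (heat t f).
Proof.
move=> mf; apply: (@measurable_heat_param _ E (cst t) id (fun _ => f)) => //.
exact: measurableT_comp.
Qed.

(** The kernel is positive everywhere, so a single finite value of the flow cannot coexist with
    infinite data on a set of positive measure. *)
Lemma eheat_lty_ae t (g : E -> \bar R) x : (0 < t)%R -> measurable_fun [set: E] g ->
  (forall y, 0 <= g y) -> eheat t g x < +oo -> {ae mu, forall y, g y < +oo}.
Proof.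
move=> t0 mg g0; rewrite eheatE// => goo.
have : mu.-integrable setT (fun y => (hker t x y)%:E * g y).
  apply/integrableP; split; first exact: measurable_hkerg.
  by under eq_integral => y _ do rewrite gee0_abs ?mule_ge0 ?lee_fin ?hker_ge0//.
move=> /(integrable_ae measurableT); apply: filterS => y /(_ I).
rewrite ltey; apply: contraTneq => ->.
by rewrite mulry gtr0_sg ?hker_gt0// mul1e.
Qed.

(** Finiteness of the absolute flow at the point [x] is exactly the integrability that Fubini's
    theorem requires; the bridge identity then evaluates the inner integral. *)
Lemma heat_semigroup (t1 t2 : R) (f : E -> R) x : (0 < t1)%R -> (0 < t2)%R ->
  measurable_fun [set: E] f -> eheat (t1 + t2) (absE f) x < +oo ->
  heat t2 (heat t1 f) x = heat (t1 + t2) f x.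
Proof.
move=> t10 t20 mf foo; rewrite !heatE ?addr_gt0//; congr fine.
have foo2 : eheat t2 (eheat t1 (absE f)) x < +oo.
  by rewrite eheat_semigroup//; [exact: measurable_absE|exact: absE_ge0].
have mef : measurable_fun [set: E] (eheat t1 (absE f)).
  by apply: measurable_eheat; [exact: measurable_absE|exact: absE_ge0].
have faeoo : {ae mu, forall y, eheat t1 (absE f) y < +oo}.
  by apply: (eheat_lty_ae t20 mef _ foo2) => y; apply: eheat_ge0; exact: absE_ge0.
pose k := fun z : E * E => (hker t2 x z.1 * (hker t1 z.1 z.2 * f z.2))%:E.
have mk : measurable_fun [set: E * E] k.
  apply/measurable_EFinP; apply: measurable_funM; first exact: measurable_hker.
  by apply: measurable_funM; [exact: measurable_hker|exact: measurableT_comp].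
have ik : (mu \x mu).-integrable setT k.
  apply/(integrable12ltyP mu mu) => //.
  rewrite eheatE// in foo2; apply: le_lt_trans foo2.
  apply: ge0_le_integral => //.
  - by move=> y _; exact: integral_ge0.
  - apply: (@measurable_int_param _ _ _ _ _ mu (fun z => `|k z|)).
    exact: measurableT_comp.
  - exact: measurable_hkerg.
  move=> y _; rewrite eheatE// -ge0_integralZl//; last 3 first.
  - by apply: measurable_hkerg; exact: measurable_absE.
  - by move=> w _; rewrite mule_ge0 ?absE_ge0// lee_fin hker_ge0.
  - by rewrite lee_fin hker_ge0.
  rewrite le_eqVlt; apply/orP; left; apply/eqP; apply: eq_integral => w _.
  by rewrite /k/= normrM ger0_norm ?hker_ge0// EFinM abs_hkerf.
(* [heat t1 f] passes through [fine], so it agrees with the inner integral only where the absolute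
   flow is finite, which is almost everywhere. *)
transitivity (\int[mu]_y \int[mu]_w k (y, w)).
  apply: ae_eq_integral => //.
  - by apply/measurable_EFinP; apply: measurable_hkerf; exact: measurable_heat.
  - exact: (@measurable_int_param _ _ _ _ _ mu k).
  apply: filterS faeoo => y yoo _.
  have iy := integrable_heat t10 mf yoo.
  rewrite heatE// EFinM fineK; last exact: integrable_fin_num.
  by rewrite -integralZl//.
rewrite (Fubini ik); apply: eq_integral => w _.
transitivity (\int[mu]_y ((hker (t1 + t2) x w * f w)%:E *
   (hker (t1 * t2 / (t1 + t2)) (bridge_mean t1 t2 x w) y)%:E)).
  apply: eq_integral => y _; rewrite /k/= mulrA hker_bridge// [hker _ y _]hkerC -EFinM; congr (_%:E); ring.
have rho0 : (0 < t1 * t2 / (t1 + t2))%R by rewrite divr_gt0 ?mulr_gt0 ?addr_gt0.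
rewrite integralZl//; last first.
  apply/integrableP; split; first exact: measurable_hkerl.
  under eq_integral => y _ do rewrite /= ger0_norm ?hker_ge0//.
  by rewrite integral_hker// ltry.
by rewrite integral_hker// mule1.
Qed.

End real_heat.

(** * Strong continuity of the heat semigroup *)

Section small_limits.
Context {R : realType}.
Local Open Scope ereal_scope.

Lemma seq0_le (a : nat -> \bar R) (e : R) : a i @[i --> \oo] --> 0 -> (0 < e)%R ->
  exists N, forall i, (N <= i)%N -> a i <= e%:E.
Proof.
move=> a0 e0; have [N _ HN] := a0 [set y | y < e%:E] (nbhs_open_ereal_lt e0).
by exists N => i Ni; exact/ltW/(HN i).
Qed.

Lemma seq0_intro (a : nat -> \bar R) : (forall i, 0 <= a i) ->
  (forall e : R, (0 < e)%R -> exists N, forall i, (N <= i)%N -> a i <= e%:E) ->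
  a i @[i --> \oo] --> 0.
Proof.
move=> a0 H; apply/fine_cvgP; split.
  have [N HN] := H 1%R ltr01; exists N => // i Ni.
  by rewrite ge0_fin_numE// (le_lt_trans (HN i Ni))// ltry.
apply/cvgr0Pnorm_le => e e0; have [N HN] := H e e0; exists N => // i Ni.
have := HN i Ni; have := a0 i; rewrite /=; case: (a i) => [r| |]//= r0 re.
by rewrite ger0_norm.
Qed.

Definition tends0 (phi : R -> \bar R) :=
  forall e : R, (0 < e)%R -> exists2 d : R, (0 < d)%R &
    forall t : R, (0 < t < d)%R -> phi t <= e%:E.

(** Dominated convergence speaks of sequences; this brings its conclusion back to a continuous
    time. *)
Lemma tends0_of_seq (phi : R -> \bar R) :
  (forall ts : nat -> R, (forall i, 0 < ts i <= i.+1%:R^-1)%R ->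
     phi (ts i) @[i --> \oo] --> 0) -> tends0 phi.
Proof.
move=> H e e0; apply: contrapT => nd.
have ex (i : nat) : exists t : R, ((0 < t < i.+1%:R^-1)%R /\ e%:E < phi t)%E.
  apply: contrapT => nt; apply: nd; exists (i.+1%:R^-1)%R => [|t ti].
    by rewrite invr_gt0.
  by rewrite leNgt; apply/negP => lt; apply: nt; exists t.
have [ts Hts] := choice ex.
have {}H : phi (ts i) @[i --> \oo] --> 0.
  by apply: H => i; have [/andP[-> /ltW ->]] := Hts i.
have [N HN] := seq0_le H e0; have [_] := Hts N.
by rewrite ltNge HN.
Qed.

Lemma tends0_seq (phi : R -> \bar R) (ts : nat -> R) : (forall t, 0 <= phi t) -> tends0 phi ->
  (forall i, 0 < ts i <= i.+1%:R^-1)%R -> phi (ts i) @[i --> \oo] --> 0.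
Proof.
move=> p0 H ts0; apply: seq0_intro => // e e0; have [d d0 Hd] := H e e0.
have [N _ HN] := near_infty_natSinv_lt (PosNum d0); exists N => i Ni; apply: Hd.
by have /andP[-> ti] := ts0 i; exact: (le_lt_trans ti (HN i Ni)).
Qed.

Lemma tends0_le (phi psi : R -> \bar R) (d0 : R) : (0 < d0)%R ->
  (forall t, 0 < t < d0 -> (phi t <= psi t)%E)%R -> tends0 psi -> tends0 phi.
Proof.
move=> d00 le H e e0; have [d dgt Hd] := H e e0; exists (Num.min d d0).
  by rewrite lt_min dgt.
move=> t /andP[t0]; rewrite lt_min => /andP[td td0].
by rewrite (le_trans (le t _) (Hd t _))// t0.
Qed.

Lemma tends0D (phi psi : R -> \bar R) : tends0 phi -> tends0 psi -> tends0 (fun t => phi t + psi t).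
Proof.
move=> H1 H2 e e0; have e2 : (0 < e / 2)%R by rewrite divr_gt0.
have [d1 d10 h1] := H1 _ e2; have [d2 d20 h2] := H2 _ e2; exists (Num.min d1 d2).
  by rewrite lt_min d10.
move=> t /andP[t0]; rewrite lt_min => /andP[td1 td2].
by rewrite [e]splitr EFinD leeD// ?h1 ?h2// t0.
Qed.

Lemma tends0Z (c : R) (phi : R -> \bar R) : (0 <= c)%R -> tends0 phi -> tends0 (fun t => c%:E * phi t).
Proof.
rewrite le_eqVlt => /predU1P[<-|c0] H e e0.
  by exists 1%R => // t _; rewrite mul0e lee_fin ltW.
have [d d0 Hd] := H _ (divr_gt0 e0 c0); exists d => // t /Hd; rewrite EFinM => le.
have -> : e = (c * (e / c))%R by field; rewrite gt_eqF.
by rewrite EFinM lee_wpmul2l// lee_fin ltW.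
Qed.

Lemma tends0_lim (phi : R -> \bar R) (psi : nat -> R -> \bar R) (b : nat -> \bar R) (d0 : R) :
  (0 < d0)%R -> b i @[i --> \oo] --> 0 -> (forall i, tends0 (psi i)) ->
  (forall i t, 0 < t < d0 -> (phi t <= psi i t + b i)%E)%R -> tends0 phi.
Proof.
move=> d00 b0 H le e e0; have e2 : (0 < e / 2)%R by rewrite divr_gt0.
have [N HN] := seq0_le b0 e2.
have [d dgt Hd] := H N _ e2; exists (Num.min d d0).
  by rewrite lt_min dgt.
move=> t /andP[t0]; rewrite lt_min => /andP[td td0].
rewrite (le_trans (le N t _))// ?t0// [e]splitr EFinD leeD// ?HN//.
by rewrite Hd// t0.
Qed.

(** Dominated convergence for the counting measure, after enumerating the integers. *)
Lemma esum_cvg0 (a : nat -> int -> \bar R) (b : int -> \bar R) :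
  (forall i k, 0 <= a i k) -> (forall i k, a i k <= b k) ->
  \esum_(k in [set: int]) b k < +oo ->
  (forall k, a i k @[i --> \oo] --> 0) ->
  (\esum_(k in [set: int]) a i k) @[i --> \oo] --> 0.
Proof.
move=> a0 ab boo ak.
have b0 k : 0 <= b k by exact: le_trans (a0 0%N k) (ab 0%N k).
have bfin k : b k \is a fin_num.
  by rewrite ge0_fin_numE//; exact: le_lt_trans (esum_term k b0) boo.
have E i : \esum_(k in [set: int]) a i k = \int[counting]_m a i (int_of_nat m).
  by rewrite esum_int// ge0_integral_count.
under eq_fun do rewrite E.
rewrite -[0%E](integral0 (@counting nat R) [set: nat]).
apply: (@dominated_cvg _ _ _ _ _ measurableT _ _ (b \o int_of_nat)) => //.
- by move=> m _; exact: ak.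
- by move=> m _; exact: bfin.
- apply/integrableP; split => //.
  under eq_integral do rewrite /= gee0_abs//.
  by rewrite ge0_integral_count// -esum_int.
- by move=> i m _; rewrite gee0_abs.
Qed.

End small_limits.

(** * Strong continuity in L^1 with a Gaussian weight *)

Section heat_weight.
Context {R : realType} {n : nat}.
Local Notation E := (Rspace R n).
Local Notation mu := (@lebesgue_space R n).
Local Open Scope ereal_scope.

Lemma hker_le_time (t1 t2 : R) (x y : E) : (0 < t1)%R -> (t1 <= t2)%R ->
  (hker t1 x y <= (t2 / t1) `^ (n%:R / 2) * hker t2 x y)%R.
Proof.
move=> t10 t12; have t20 : (0 < t2)%R by exact: lt_le_trans t12.
have p0 : (0 < 4 * pi :> R)%R by rewrite mulr_gt0// pi_gt0.
rewrite /hker /heat_kernel mulrA; apply: ler_pM; rewrite ?powR_ge0 ?expR_ge0//.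
  have -> : (4 * pi * t2 = (t2 / t1) * (4 * pi * t1))%R by field; rewrite gt_eqF.
  have q1 : (0 < t2 / t1)%R by rewrite divr_gt0.
  have q2 : (0 <= 4 * pi * t1)%R by rewrite mulr_ge0// ltW.
  by rewrite (powRM _ (ltW q1) q2) mulrA -powRDp// subrr powRr0 mul1r.
rewrite ler_expR lerN2; apply: ler_wpM2l; first exact: sqr_ge0.
by rewrite lef_pV2 ?posrE ?mulr_gt0// ler_pM2l.
Qed.

(** Half of the Gaussian exponent becomes an explicit decay factor, the other half a kernel of mass
    1 at the doubled time. *)
Lemma hker_gauss (t : R) (x y : E) : (0 < t)%R ->
  (hker t x y = 2 `^ (n%:R / 2) * expR (- (enorm (subs x y) ^+ 2 / (8 * t))) * hker (2 * t) x y)%R.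
Proof.
move=> t0; have p0 : (0 < 4 * pi :> R)%R by rewrite mulr_gt0// pi_gt0.
rewrite /hker /heat_kernel.
have -> : (4 * pi * (2 * t) = 2 * (4 * pi * t) :> R)%R by ring.
rewrite [in RHS]powRM ?mulr_ge0 ?pi_ge0 ?ltW//.
have h : (2 `^ (n%:R / 2) * 2 `^ (- (n%:R / 2)) = 1 :> R)%R.
  by rewrite powRN mulfV// gt_eqF// powR_gt0.
set z := enorm _.
have -> : (z ^+ 2 / (4 * t) = z ^+ 2 / (8 * t) + z ^+ 2 / (4 * (2 * t)))%R by field; rewrite gt_eqF.
rewrite opprD expRD.
move: h; set u := (2 `^ _)%R; set v := (2 `^ _)%R => h; rewrite -[LHS]mul1r -h; ring.
Qed.

Lemma eheat_le_time (t1 t2 : R) (g : E -> \bar R) x : (0 < t1)%R -> (t1 <= t2)%R ->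
  measurable_fun [set: E] g -> (forall y, 0 <= g y) ->
  eheat t1 g x <= ((t2 / t1) `^ (n%:R / 2))%:E * eheat t2 g x.
Proof.
move=> t10 t12 mg g0; have t20 : (0 < t2)%R by exact: lt_le_trans t12.
rewrite !eheatE// -ge0_integralZl//; last 3 first.
- exact: measurable_hkerg.
- by move=> y _; rewrite mule_ge0 ?lee_fin ?hker_ge0.
- by rewrite lee_fin powR_ge0.
apply: ge0_le_integral => //.
- by move=> y _; rewrite mule_ge0 ?lee_fin ?hker_ge0.
- exact: measurable_hkerg.
- by apply: measurable_funeM; exact: measurable_hkerg.
- by move=> y _; rewrite muleA lee_wpmul2r// -EFinM lee_fin; exact: hker_le_time.
Qed.

Lemma le_eheat_ae t (g1 g2 : E -> \bar R) x : (0 < t)%R ->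
  measurable_fun [set: E] g1 -> measurable_fun [set: E] g2 ->
  (forall y, 0 <= g1 y) -> (forall y, 0 <= g2 y) -> {ae mu, forall y, g1 y <= g2 y} ->
  eheat t g1 x <= eheat t g2 x.
Proof.
move=> t0 m1 m2 g10 g20 le; rewrite !eheatE//; apply: ae_ge0_le_integral => //.
- by move=> y _; rewrite mule_ge0 ?lee_fin ?hker_ge0.
- exact: measurable_hkerg.
- by move=> y _; rewrite mule_ge0 ?lee_fin ?hker_ge0.
- exact: measurable_hkerg.
- by apply: filterS le => y le _; rewrite lee_wpmul2l// lee_fin hker_ge0.
Qed.

Definition herr (f : E -> R) (t : R) (x : E) : \bar R := `|heat t f x - f x|%:E.

Lemma herr_ge0 f t x : 0 <= herr f t x. Proof. by rewrite lee_fin. Qed.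

Lemma measurable_herr f t : measurable_fun [set: E] f -> measurable_fun [set: E] (herr f t).
Proof.
move=> mf; apply/measurable_EFinP; apply: measurableT_comp => //.
by apply: measurable_funB => //; exact: measurable_heat.
Qed.

Lemma herr_le f t x : measurable_fun [set: E] f -> herr f t x <= eheat t (absE f) x + absE f x.
Proof.
move=> mf; apply: (@le_trans _ _ (`|heat t f x|%:E + absE f x)).
  by rewrite -EFinD lee_fin; exact: ler_normB.
by rewrite leeD2r//; exact: abs_heat_le.
Qed.

Variable o : E.

(** Source of the two weights: testing a flow of duration [t <= 1] against the Gaussian of time 1
    means testing its datum against the Gaussian of time [1 + t], which is comparable from above
    with that of time 2. *)
Lemma eheat_one_le t (g : E -> \bar R) : (0 < t <= 1)%R ->
  measurable_fun [set: E] g -> (forall y, 0 <= g y) ->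
  eheat 1 (eheat t g) o <= (2 `^ (n%:R / 2))%:E * eheat 2 g o.
Proof.
move=> /andP[t0 t1] mg g0; rewrite eheat_semigroup//.
have h : (0 < t + 1)%R by rewrite addr_gt0.
apply: (le_trans (eheat_le_time o h _ mg g0)).
  by have := t1; rewrite -(lerD2r 1%R) => /le_trans; apply.
rewrite lee_wpmul2r ?eheat_ge0// lee_fin.
apply: ge0_ler_powR; rewrite ?nnegrE ?divr_ge0 ?(ltW h)//.
by rewrite ler_pdivrMr//; move: t0; lra.
Qed.

Lemma eheat_one_fin t (f : E -> R) : (0 < t <= 1)%R -> measurable_fun [set: E] f ->
  eheat 2 (absE f) o < +oo -> {ae mu, forall x, eheat t (absE f) x < +oo}.
Proof.
move=> t01 mf foo; have ma := measurable_absE mf.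
have a0 := absE_ge0 f.
apply: (@eheat_lty_ae _ _ 1%R (eheat t (absE f)) o ltr01).
- exact: measurable_eheat.
- by move=> y; exact: eheat_ge0.
apply: (le_lt_trans (eheat_one_le t01 ma _)); first exact: absE_ge0.
by rewrite lte_mul_pinfty// lee_fin powR_ge0.
Qed.

Lemma herr_weight_le t (f : E -> R) : (0 < t <= 1)%R -> measurable_fun [set: E] f ->
  eheat 1 (herr f t) o <= (2 * 2 `^ (n%:R / 2))%:E * eheat 2 (absE f) o.
Proof.
move=> t01 mf; have ma := measurable_absE mf; have a0 := absE_ge0 f.
have /andP[t0 t1] := t01.
apply: (@le_trans _ _ (eheat 1 (fun x => eheat t (absE f) x + absE f x) o)).
  apply: le_eheat => //.
  - exact: measurable_herr.
  - by apply: emeasurable_funD => //; exact: measurable_eheat.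
  - by move=> y; exact: herr_ge0.
  - by move=> y; exact: herr_le.
rewrite eheatD//; last 2 first.
- exact: measurable_eheat.
- by move=> y; exact: eheat_ge0.
have -> : (2 * 2 `^ (n%:R / 2) = 2 `^ (n%:R / 2) + (2 / 1) `^ (n%:R / 2) :> R)%R by rewrite divr1; ring.
rewrite EFinD ge0_muleDl ?lee_fin ?powR_ge0//; apply: leeD; first exact: eheat_one_le.
by apply: eheat_le_time => //; rewrite ler1n.
Qed.

Lemma herr_weightD t (f g : E -> R) : (0 < t <= 1)%R ->
  measurable_fun [set: E] f -> measurable_fun [set: E] g ->
  eheat 2 (absE f) o < +oo -> eheat 2 (absE g) o < +oo ->
  eheat 1 (herr (fun x => f x + g x)%R t) o <= eheat 1 (herr f t) o + eheat 1 (herr g t) o.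
Proof.
move=> t01 mf mg foo goo; rewrite -eheatD//; last 4 first.
- exact: measurable_herr.
- exact: measurable_herr.
- exact: herr_ge0.
- exact: herr_ge0.
apply: le_eheat_ae => //.
- by apply: measurable_herr; exact: measurable_funD.
- by apply: emeasurable_funD; exact: measurable_herr.
- exact: herr_ge0.
- by move=> y; rewrite adde_ge0 ?herr_ge0.
near=> y; rewrite /herr heatD//; last 2 first.
- by near: y; exact: eheat_one_fin.
- by near: y; exact: eheat_one_fin.
rewrite -EFinD lee_fin; set a := heat _ _ _; set b := heat _ _ _.
by rewrite (_ : _ - _ = (a - f y) + (b - g y))%R ?ler_normD//; ring.
Unshelve. all: end_near. Qed.

(* Strong continuity at 0 in L^1 for the Gaussian weight centred at [o]. *)
Definition heat_cont (f : E -> R) :=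
  [/\ measurable_fun [set: E] f, eheat 2 (absE f) o < +oo & tends0 (fun t => eheat 1 (herr f t) o)].

Lemma heat_contD f g : heat_cont f -> heat_cont g -> heat_cont (fun x => f x + g x)%R.
Proof.
move=> [mf foo cf] [mg goo cg]; split; first exact: measurable_funD.
  apply: (@le_lt_trans _ _ (eheat 2 (absE f) o + eheat 2 (absE g) o)); last by rewrite lte_add_pinfty.
  rewrite -eheatD; [|exact: measurable_absE..|exact: absE_ge0|exact: absE_ge0].
  apply: le_eheat.
  - by apply: measurable_absE; exact: measurable_funD.
  - by apply: emeasurable_funD; exact: measurable_absE.
  - exact: absE_ge0.
  - by move=> y; rewrite -EFinD lee_fin ler_normD.
apply: (tends0_le ltr01 _ (tends0D cf cg)) => t /andP[t0 t1]; apply: herr_weightD => //.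
by rewrite t0 ltW.
Qed.

Lemma heat_contZ c f : heat_cont f -> heat_cont (fun x => c * f x)%R.
Proof.
move=> [mf foo cf]; have aE : absE (fun x => c * f x)%R = (fun x => `|c|%:E * absE f x).
  by apply/funext => x; rewrite /absE normrM EFinM.
have mcf : measurable_fun [set: E] (fun x => c * f x)%R by exact: measurable_funM.
split => //.
  rewrite aE eheatZ//; [|exact: measurable_absE|exact: absE_ge0].
  by rewrite lte_mul_pinfty// eheat_ge0//; exact: absE_ge0.
apply: (tends0_le ltr01 _ (tends0Z (normr_ge0 c) cf)) => t /andP[t0 t1].
rewrite -eheatZ//; [|exact: measurable_herr|exact: herr_ge0].
apply: le_eheat_ae => //.
- exact: measurable_herr.
- by apply: measurable_funeM; exact: measurable_herr.
- exact: herr_ge0.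
- by move=> y; rewrite mule_ge0// herr_ge0.
near=> y; rewrite /herr heatZ//; last by near: y; apply: eheat_one_fin => //; rewrite t0 ltW.
by rewrite -EFinM -normrM mulrBr.
Unshelve. all: end_near. Qed.

Lemma heat_cont_sum (I : eqType) (r : seq I) (f : I -> E -> R) : (forall i, i \in r -> heat_cont (f i)) ->
  heat_cont (fun x => \sum_(i <- r) f i x)%R.
Proof.
elim: r => [|i r IH] H.
  rewrite [X in heat_cont X](_ : _ = cst 0%R); last by apply/funext => x; rewrite big_nil.
  split => //.
    rewrite (_ : absE _ = cst 0) ?eheat_cst//.
    by apply/funext => x; rewrite /absE normr0.
  move=> e e0; exists 1%R => // t _.
  have -> : herr (cst 0%R) t = cst 0 by apply/funext => x; rewrite /herr heat_cst subrr normr0.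
  by rewrite eheat_cst// lee_fin ltW.
rewrite [X in heat_cont X](_ : _ = (fun x => f i x + \sum_(j <- r) f j x)%R); last first.
  by apply/funext => x; rewrite big_cons.
apply: heat_contD; first by apply: H; rewrite mem_head.
by apply: IH => j jr; apply: H; rewrite inE jr orbT.
Qed.

(** [herr_weight_le] bounds the error of [f - g i] uniformly in [t <= 1], so the class is closed
    under limits in the weighted norm. *)
Lemma heat_cont_lim f (g : nat -> E -> R) : measurable_fun [set: E] f -> eheat 2 (absE f) o < +oo ->
  (forall i, heat_cont (g i)) ->
  eheat 2 (absE (fun x => f x - g i x)%R) o @[i --> \oo] --> 0 -> heat_cont f.
Proof.
move=> mf foo cg lim; split => //.
pose C := (2 * 2 `^ (n%:R / 2) : R)%R.
have C0 : (0 <= C)%R by rewrite mulr_ge0 ?powR_ge0.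
apply: (@tends0_lim _ _ (fun i t => eheat 1 (herr (g i) t) o)
   (fun i => C%:E * eheat 2 (absE (fun x => f x - g i x)%R) o) _ ltr01).
- by rewrite -[X in _ --> X](mule0 C%:E); apply: cvgeZl.
- by move=> i; have [] := cg i.
move=> i t /andP[t0 t1]; have t01 : (0 < t <= 1)%R by rewrite t0 ltW.
have [mg goo _] := cg i.
have mfg : measurable_fun [set: E] (fun x => f x - g i x)%R by exact: measurable_funB.
apply: le_trans (leeD2l _ (herr_weight_le t01 mfg)).
have -> : herr f t = herr (fun x => g i x + (f x - g i x))%R t.
  by congr herr; apply/funext => x; ring.
apply: herr_weightD => //.
apply: (@le_lt_trans _ _ (eheat 2 (absE f) o + eheat 2 (absE (g i)) o)); last by rewrite lte_add_pinfty.
rewrite -eheatD; [|exact: measurable_absE..|exact: absE_ge0|exact: absE_ge0].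
apply: le_eheat.
- exact: measurable_absE.
- by apply: emeasurable_funD; exact: measurable_absE.
- exact: absE_ge0.
- by move=> y; rewrite -EFinD lee_fin ler_normB.
Qed.

End heat_weight.

Import HBSimple.

(** * From half boxes to integrable functions *)

Section half_boxes.
Context {R : realType} {n : nat}.
Local Notation E := (Rspace R n).
Local Notation mu := (@lebesgue_space R n).
Local Open Scope ereal_scope.

(** Bounds in the extended reals: once [+oo] is allowed, the family contains the whole space, is
    closed under intersection, and generates the sigma-algebra from one coordinate at a time. *)
Definition half_box (c : 'I_n -> \bar R) : set E :=
  [set x | forall i, (tnth x i : R)%:E < c i].

Lemma measurable_half_box c : measurable (half_box c).
Proof.
rewrite (_ : half_box c = \bigcap_(i in [set: 'I_n])
    ((fun x : E => (tnth x i : R)%:E) @^-1` [set y | y < c i])); last first.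
  by apply/seteqP; split => x /= H i; [move=> _|]; exact: H.
apply: fin_bigcap_measurable => // i _; rewrite -[X in measurable X]setTI.
have mt : measurable_fun [set: E] (fun x : E => (tnth x i : R)%:E).
  by apply/measurable_EFinP; exact: measurable_tnth.
apply: mt => //; rewrite (_ : [set y | _] = `]-oo, c i[%classic); first exact: emeasurable_itv.
by apply/seteqP; split => y /=; rewrite in_itv.
Qed.

Lemma measurable_half_boxE : @measurable _ E = <<s range half_box >>.
Proof.
apply/seteqP; split; last first.
  apply: smallest_sub; first exact: sigma_algebra_measurable.
  by move=> _ [c _ <-]; exact: measurable_half_box.
apply: smallest_sub; first exact: smallest_sigma_algebra.
apply: (big_ind (fun S => S `<=` <<s range half_box >>)) => //.
  by move=> A B HA HB; rewrite subUset.
move=> i _; rewrite RGenInftyO.measurableE -g_sigma_preimageE.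
apply: smallest_sub; first exact: smallest_sigma_algebra.
move=> _ [_ [x ->] <-]; rewrite setTI; apply: sub_sigma_algebra.
exists (fun j => if j == i then x%:E else +oo) => //.
apply/seteqP; split => y /=; rewrite in_itv/=.
  by move=> /(_ i); rewrite eqxx lte_fin.
by move=> yx j; case: eqP => [->|_]; rewrite ?lte_fin ?ltry.
Qed.

Lemma setI_closed_half_box : setI_closed (range half_box).
Proof.
move=> _ _ [c _ <-] [d _ <-]; exists (fun i => Order.min (c i) (d i)) => //.
apply/seteqP; split => y /=.
  by move=> H; split => i; have := H i; rewrite lt_min => /andP[].
by move=> [H1 H2] i; rewrite lt_min H1 H2.
Qed.

Lemma half_box_boundary_null (c : 'I_n -> \bar R) :
  {ae mu, forall x : E, forall i, (tnth x i : R)%:E != c i}.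
Proof.
apply: filter_forall => i.
pose A (j : 'I_n) : set (measurableTypeR R) := if j == i then [set fine (c i)] else setT.
have mA j : measurable (A j) by rewrite /A; case: eqP => // _; exact: measurable_set1.
exists [set x | forall j, A j (tnth x j)]; split.
- rewrite (_ : [set x | _] = \bigcap_(i in [set: 'I_n])
      ((fun x : Rspace R n => tnth x i) @^-1` A i)); last first.
    by apply/seteqP; split => x /= H j; [move=> _|]; exact: H.
  apply: fin_bigcap_measurable => // j _; rewrite -[X in measurable X]setTI.
  exact: measurable_tnth.
- rewrite lebesgue_space_box// (bigD1 i)//= /A eqxx.
  by rewrite lebesgue_measure_set1 mul0e.
- move=> x /= /negP; rewrite negbK => /eqP xc j; rewrite /A; case: eqP => // ->.
  by rewrite /= -xc.
Qed.

Lemma half_box_local (c : 'I_n -> \bar R) (x : E) :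
  (forall i, (tnth x i : R)%:E != c i) ->
  exists2 d : R, (0 < d)%R & forall y : E, (enorm (subs x y) < d)%R ->
    half_box c y <-> half_box c x.
Proof.
move=> xc.
have H i : exists d : R, (0 < d)%R /\ forall r : R, (`|(tnth x i : R) - r| < d)%R ->
    (r%:E < c i) = ((tnth x i : R)%:E < c i).
  have := xc i; case: (c i) => [e| |] ne.
  - exists `|(tnth x i : R) - e|%R; split; first by rewrite normr_gt0 subr_eq0; move: ne; rewrite eqe.
    move=> r; rewrite !lte_fin; set u : R := tnth x i; rewrite ltr_norml.
    have [ue|eu|->] := ltgtP u e.
    + by rewrite ltr0_norm ?subr_lt0// => /andP[h1 h2]; apply/idP; lra.
    + by rewrite gtr0_norm ?subr_gt0// => /andP[h1 h2]; apply/negbTE; rewrite -leNgt; lra.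
    + by rewrite subrr normr0 oppr0 => /andP[h1 h2]; have := lt_trans h1 h2; rewrite ltxx.
  - by exists 1%R; split => // r _; rewrite !ltry.
  - by exists 1%R; split => // r _; rewrite !ltNge !leNye.
have [d Hd] := choice H.
exists (\big[Order.min/1%R]_i d i).
  by apply: lt_bigmin => // i _; have [] := Hd i.
move=> y yd; suff HE i : ((tnth y i : R)%:E < c i) = ((tnth x i : R)%:E < c i).
  by split => Hx i; have := Hx i; rewrite HE.
apply: (Hd i).2; apply: (@le_lt_trans _ _ (enorm (subs x y))).
  by have := le_tnth_enorm (subs x y) i; rewrite tnth_mktuple.
by apply: (lt_le_trans yd); exact: bigmin_le.
Qed.

Variable o : E.

(** Near [x] the function is constant and contributes nothing to the error; at distance at least [d]
    the Gaussian factor is at most [8 t / d^2] by [expRN_le_powR] with exponent 1. *)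
Lemma herr_local (f : E -> R) (x : E) (d t : R) : (0 < d)%R -> (0 < t)%R ->
  measurable_fun [set: E] f -> (forall y, 0 <= f y <= 1)%R ->
  (forall y : E, (enorm (subs x y) < d)%R -> f y = f x) ->
  herr f t x <= (2 `^ (n%:R / 2) * (8 / d ^+ 2) * t)%:E.
Proof.
move=> d0 t0 mf f01 fl.
have t20 : (0 < 2 * t)%R by rewrite mulr_gt0.
have fin (g : E -> R) : measurable_fun [set: E] g -> (forall y, `|g y| <= 1)%R ->
    eheat t (absE g) x < +oo.
  move=> mg g1; apply: (@le_lt_trans _ _ 1); last by rewrite ltry.
  rewrite -[leRHS](eheat_cst t x lee01); apply: le_eheat => //.
    exact: measurable_absE.
  exact: absE_ge0.
have f1 y : (`|f y| <= 1)%R by have /andP[h0 h1] := f01 y; rewrite ger0_norm.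
have -> : herr f t x = `|heat t (fun y => f y - f x)%R x|%:E.
  have := heatB mf (measurable_cst (f x)) (fin _ mf f1) (fin _ (measurable_cst (f x)) (fun=> f1 x)).
  by rewrite heat_cst /herr => ->.
apply: (le_trans (abs_heat_le _ _ _)); first exact: measurable_funB.
set C := (2 `^ _ * _ * _)%R.
have C0 : (0 <= C)%R by rewrite !mulr_ge0 ?powR_ge0 ?invr_ge0 ?sqr_ge0 ?ltW.
rewrite eheatE//; apply: (@le_trans _ _ (\int[mu]_y (C%:E * (hker (2 * t) x y)%:E))); last first.
  rewrite ge0_integralZl//; last 2 first.
  - exact: measurable_hkerl.
  - by move=> y _; rewrite lee_fin hker_ge0.
  by rewrite integral_hker// mule1.
apply: ge0_le_integral => //.
- by move=> y _; rewrite mule_ge0 ?lee_fin ?hker_ge0.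
- by apply: measurable_hkerg; apply: measurable_absE; exact: measurable_funB.
- by apply: measurable_funeM; exact: measurable_hkerl.
move=> y _; rewrite -!EFinM lee_fin.
have [yd|dy] := ltP (enorm (subs x y)) d.
  by rewrite fl// subrr normr0 mulr0 mulr_ge0// hker_ge0.
apply: (@le_trans _ _ (hker t x y)).
  rewrite ler_piMr ?hker_ge0//; have /andP[a0 a1] := f01 y; have /andP[b0 b1] := f01 x.
  by rewrite ler_norml; apply/andP; split; lra.
rewrite hker_gauss// ler_wpM2r ?hker_ge0// /C -mulrA ler_wpM2l ?powR_ge0//.
have X0 : (0 < enorm (subs x y) ^+ 2 / (8 * t))%R.
  by rewrite divr_gt0 ?exprn_gt0 ?mulr_gt0// (lt_le_trans d0).
apply: (le_trans (expRN_le_powR X0 ltr01)).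
have -> : (1 / (enorm (subs x y) ^+ 2 / (8 * t)) = 8 * t / enorm (subs x y) ^+ 2)%R.
  by rewrite div1r invf_div.
rewrite powRr1; last first.
  by apply: divr_ge0; [rewrite mulr_ge0// ltW|exact: sqr_ge0].
have -> : (8 / d ^+ 2 * t = 8 * t / d ^+ 2)%R by ring.
have e0 : (0 < enorm (subs x y))%R by exact: lt_le_trans dy.
apply: ler_wpM2l; first by rewrite mulr_ge0// ltW.
rewrite lef_pV2 ?posrE ?exprn_gt0//.
by apply: lerXn2r => //; rewrite nnegrE ltW.
Qed.

(** Off its null boundary the indicator is locally constant, so the error tends to 0 pointwise by
    [herr_local]; twice the Gaussian weight dominates. *)
Lemma heat_cont_half_box c : heat_cont o \1_(half_box c).
Proof.
have mf : measurable_fun [set: E] (\1_(half_box c) : E -> R).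
  by apply: measurable_indic; exact: measurable_half_box.
have f01 y : (0 <= (\1_(half_box c) : E -> R) y <= 1)%R.
  by rewrite indicE; case: (_ \in _); rewrite /= ?lexx ?ler01.
have f1 y : absE (\1_(half_box c)) y <= 1.
  by have /andP[h0 h1] := f01 y; rewrite /absE ger0_norm// lee_fin.
have ea1 t x : eheat t (absE (\1_(half_box c))) x <= 1.
  rewrite -[leRHS](eheat_cst t x lee01); apply: le_eheat => //; last exact: absE_ge0.
  exact: measurable_absE.
split => //; first by apply: (le_lt_trans (ea1 _ _)); rewrite ltry.
apply: tends0_of_seq => ts ts0; under eq_fun do rewrite eheatE//.
have ig : mu.-integrable setT (fun x => 2%:E * (hker 1 o x)%:E).
  apply: integrableZl => //; apply/integrableP; split; first exact: measurable_hkerl.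
  under eq_integral => y _ do rewrite /= ger0_norm ?hker_ge0//.
  by rewrite integral_hker// ltry.
have herr2 i x : herr \1_(half_box c) (ts i) x <= 2%:E.
  apply: (le_trans (herr_le _ _ mf)).
  by rewrite (_ : 2%:E = 1 + 1)//; exact: leeD.
have [|||//|_ _] := @dominated_convergence _ E R mu setT measurableT
  (fun i x => (hker 1 o x)%:E * herr \1_(half_box c) (ts i) x) (cst 0) _ _ _ _ ig.
- by move=> i; apply: measurable_hkerg; exact: measurable_herr.
- exact: measurable_cst.
- apply: filterS (half_box_boundary_null c) => x xc _.
  have [d d0 Hd] := half_box_local xc.
  have fl y : (enorm (subs x y) < d)%R -> \1_(half_box c) y = \1_(half_box c) x :> R.
    move=> /Hd H; rewrite !indicE; congr (_%:R); congr nat_of_bool.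
    by apply/idP/idP; rewrite !inE => /H.
  pose K := (hker 1 o x * (2 `^ (n%:R / 2) * (8 / d ^+ 2)))%R.
  have K0 : (0 <= K)%R by rewrite !mulr_ge0 ?hker_ge0 ?powR_ge0 ?invr_ge0 ?sqr_ge0.
  apply: seq0_intro => [i|e e0]; first by rewrite mule_ge0 ?herr_ge0// lee_fin hker_ge0.
  have e1 : (0 < e / (K + 1))%R by rewrite divr_gt0// ltr_wpDl.
  have [N _ HN] := near_infty_natSinv_lt (PosNum e1).
  exists N => i Ni; have /andP[t0 t1] := ts0 i.
  apply: (@le_trans _ _ ((hker 1 o x)%:E * (2 `^ (n%:R / 2) * (8 / d ^+ 2) * ts i)%:E)).
    by rewrite lee_wpmul2l ?lee_fin ?hker_ge0//; exact: herr_local.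
  rewrite -EFinM mulrA lee_fin -/K.
  have te : (ts i <= e / (K + 1))%R by apply: (le_trans t1); exact/ltW/(HN i Ni).
  apply: (@le_trans _ _ ((K + 1) * (e / (K + 1)))%R).
    by apply: ler_pM => //; [exact: ltW|rewrite lerDl].
  by rewrite mulrC divfK// gt_eqF// ltr_wpDl.
- apply: aeW => x i _; rewrite gee0_abs ?mule_ge0 ?herr_ge0 ?lee_fin ?hker_ge0//.
  rewrite mulrC ler_wpM2r ?hker_ge0//; exact: herr2 i x.
by rewrite integral0.
Qed.

(** The pi-lambda theorem takes the place of an approximation by continuous functions: complements
    follow from linearity, disjoint unions from dominated convergence of partial sums. *)
Lemma heat_cont_indic (A : set E) : measurable A -> heat_cont o \1_A.
Proof.
move=> mA.
have ea1 (B : set E) t x : measurable B -> eheat t (absE \1_B) x <= 1.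
  move=> mB; rewrite -[leRHS](eheat_cst t x lee01); apply: le_eheat => //.
  - by apply: measurable_absE; exact: measurable_indic.
  - exact: absE_ge0.
  - by move=> y; rewrite /absE indicE lee_fin; case: (_ \in _); rewrite ?normr1 ?normr0.
have sA : <<s range half_box >> A by rewrite -measurable_half_boxE.
have cT : heat_cont o (\1_[set: E]).
  rewrite (_ : [set: E] = half_box (fun=> +oo)); first exact: heat_cont_half_box.
  by apply/seteqP; split => x //= _ i; rewrite ltry.
apply: (@dynkin_induction _ _ (range half_box) (fun B => heat_cont o (\1_B))) sA.
- exact: measurable_half_boxE.
- exact: setI_closed_half_box.
- exact: cT.
- by move=> _ [c _ <-]; exact: heat_cont_half_box.
- move=> S mS cS; rewrite (_ : \1_(~` S) = (fun x => \1_[set: E] x + (-1) * \1_S x)%R).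
    by apply: heat_contD => //; exact: heat_contZ.
  apply/funext => x; rewrite !indicE in_setC in_setT/=.
  by case: (_ \in _); rewrite /= ?mulr1 ?mulr0 ?addr0 ?subrr.
move=> F mF tF cF.
have mU : measurable (\bigcup_k F k) by exact: bigcupT_measurable.
apply: (@heat_cont_lim _ _ _ _ (fun i x => \sum_(j <- iota 0 i) \1_(F j) x)%R).
- exact: measurable_indic.
- by apply: le_lt_trans (ea1 _ _ _ mU) _; rewrite ltry.
- by move=> i; apply: heat_cont_sum => j _; exact: cF.
have sumE i k x : F k x -> (\sum_(j <- iota 0 i) (\1_(F j) x : R) = (k < i)%N%:R)%R.
  move=> Fkx; have z j : j != k -> (\1_(F j) x = 0 :> R)%R.
    move=> jk; rewrite indicE memNset// => Fjx.
    by move/eqP: jk; apply; exact: (tF j k I I (ex_intro _ x (conj Fjx Fkx))).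
  have [ki|ik] := ltnP k i.
    rewrite (bigD1_seq k) ?mem_iota ?iota_uniq//= big1 ?addr0 ?indicE ?mem_set//.
  rewrite big_seq big1// => j; rewrite mem_iota add0n => /andP[_ ji]; apply: z.
  by rewrite neq_ltn (leq_trans ji ik).
have U1 k x : F k x -> (\1_(\bigcup_k F k) x = 1 :> R)%R.
  by move=> Fkx; rewrite indicE mem_set//; exists k.
have U0 x : ~ (\bigcup_k F k) x -> (\1_(\bigcup_k F k) x = 0 :> R)%R /\
    forall i, (\sum_(j <- iota 0 i) (\1_(F j) x : R) = 0)%R.
  move=> nU; split; first by rewrite indicE memNset.
  by move=> i; apply: big1 => j _; rewrite indicE memNset// => Fjx; apply: nU; exists j.
pose D (i : nat) := absE (fun x : E => (\1_(\bigcup_k F k) x - \sum_(j <- iota 0 i) \1_(F j) x)%R).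
have D1 i x : D i x <= 1.
  rewrite /D /absE lee_fin; have [[k _ Fkx]|nU] := pselect ((\bigcup_k F k) x).
    by rewrite (sumE _ _ _ Fkx) (U1 _ _ Fkx); case: ltnP => _; rewrite ?subrr ?subr0 ?normr0 ?normr1.
  by have [-> ->] := U0 x nU; rewrite subrr normr0.
have mD i : measurable_fun [set: E] (D i).
  apply: measurable_absE; apply: measurable_funB; first exact: measurable_indic.
  by apply: measurable_sum => j; exact: measurable_indic.
under eq_fun do rewrite eheatE//.
rewrite -[0](integral0 mu [set: E]).
apply: (@dominated_cvg _ _ _ _ _ measurableT _ _ (fun x => (hker 2 o x)%:E)) => //.
- by move=> i; apply: measurable_hkerg; exact: mD.
- move=> x _; have [[k _ Fkx]|nU] := pselect ((\bigcup_k F k) x).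
    apply: seq0_intro => [i|e e0]; first by rewrite mule_ge0 ?absE_ge0// lee_fin hker_ge0.
    exists k.+1 => i ki; rewrite /D /absE (sumE _ _ _ Fkx) (U1 _ _ Fkx) ki subrr normr0 mule0.
    by rewrite lee_fin ltW.
  apply: seq0_intro => [i|e e0]; first by rewrite mule_ge0 ?absE_ge0// lee_fin hker_ge0.
  exists 0%N => i _; rewrite /D /absE; have [-> ->] := U0 x nU.
  by rewrite subrr normr0 mule0 lee_fin ltW.
- apply/integrableP; split; first exact: measurable_hkerl.
  under eq_integral => y _ do rewrite /= ger0_norm ?hker_ge0//.
  by rewrite integral_hker// ltry.
- move=> i x _; rewrite gee0_abs ?mule_ge0 ?absE_ge0 ?lee_fin ?hker_ge0//.
  by rewrite -[leRHS]mulr1 ler_wpM2l ?hker_ge0//; exact: D1 i x.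
Qed.

Lemma heat_cont_integrable (f : E -> R) : mu.-integrable setT (EFin \o f) -> heat_cont o f.
Proof.
move=> fi; have mf : measurable_fun [set: E] f by apply/measurable_EFinP; exact: measurable_int fi.
have e2 (g : E -> R) : measurable_fun [set: E] g -> eheat 2 (absE g) o <= \int[mu]_x (absE g x).
  move=> mg; apply: (le_trans (eheat_le_integral _ _ _ _)) => //.
  - exact: measurable_absE.
  - exact: absE_ge0.
  rewrite -[leRHS]mul1e lee_wpmul2r ?integral_ge0// => [x _|]; first exact: absE_ge0.
  rewrite lee_fin powRN invf_le1 ?powR_gt0 ?mulr_gt0 ?pi_gt0//.
  rewrite -[leLHS](powR1x (n%:R / 2)); apply: ge0_ler_powR; rewrite ?nnegrE ?divr_ge0 ?mulr_ge0 ?pi_ge0//.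
  by have := @fourpi_ge1 R; lra.
have [g [gi _ gl]] := approximation_sfun_integrable measurableT fi.
apply: (@heat_cont_lim R n o f g) => //.
- by apply: le_lt_trans (e2 _ mf) _; have /integrableP[] := fi.
- move=> i; rewrite (_ : (g i : E -> R) = fun x => (\sum_(y <- finmap.enum_fset (fset_set (range (g i))))
      y * \1_(g i @^-1` [set y]) x)%R); last first.
    by apply/funext => x; rewrite fimfunE fsbig_finite//; exact: fimfunP.
  apply: heat_cont_sum => y _; apply: heat_contZ; apply: heat_cont_indic.
  exact: measurable_sfunP.
apply: (@squeeze_cvge _ _ _ _ (cst 0) _ _ _ _ _ gl); last exact: cvg_cst.
apply: nearW => i; rewrite /= eheat_ge0 ?e2//=; first exact: measurable_funB.
exact: absE_ge0.
Qed.

End half_boxes.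

(** * Strong continuity in Herz spaces by truncation *)

Section strong_continuity.
Context {R : realType} {n : nat}.
Hypothesis n0 : (0 < n)%N.
Local Notation E := (Rspace R n).
Local Notation mu := (@lebesgue_space R n).
Local Notation ann := (@dyadic_annulus R n).
Local Open Scope ereal_scope.

Lemma poweR_cvg0 (a : nat -> \bar R) (r : R) : (0 < r)%R -> (forall i, 0 <= a i) ->
  a i @[i --> \oo] --> 0 -> (a i `^ r) @[i --> \oo] --> 0.
Proof.
move=> r0 a0 al; apply: seq0_intro => [i|e e0]; first exact: poweR_ge0.
have [N HN] := seq0_le al (powR_gt0 r^-1 e0); exists N => i Ni.
apply: (@le_trans _ _ ((e `^ r^-1)%:E `^ r)).
  by apply: gt0_ler_poweR; rewrite ?in_itv/= ?andbT ?a0 ?leey ?lee_fin ?powR_ge0 ?HN// ltW.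
by rewrite poweR_EFin -powRrM mulVf ?gt_eqF// powRr1// ltW.
Qed.

Definition truncation_set (f : E -> R) (m : nat) : set E :=
  [set x | (`|f x| <= m%:R)%R /\ (2 `^ (- m%:R) <= enorm x < 2 `^ m%:R)%R].

(** Cut off both in height and to a dyadic shell, so that a function of one Herz space becomes
    integrable, bounded, and of finite norm for every weight. *)
Definition truncation (f : E -> R) (m : nat) : E -> R :=
  fun x => (f x * \1_(truncation_set f m) x)%R.

Lemma measurable_truncation f m : measurable_fun [set: E] f ->
  measurable_fun [set: E] (truncation f m).
Proof.
move=> mf; apply: measurable_funM => //; apply: measurable_indic.
rewrite (_ : truncation_set f m = ((fun x => `|f x|%R) @^-1` `]-oo, (m%:R : R)]) `&`
   (@enorm R n @^-1` `[(2 `^ (- m%:R))%R, (2 `^ m%:R)%R[)); last first.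
  by apply/seteqP; split => x /=; rewrite !in_itv.
apply: measurableI; rewrite -[X in measurable X]setTI.
  have : measurable_fun [set: E] (fun x => `|f x|%R) by exact: measurableT_comp.
  by apply => //; exact: measurable_itv.
by apply: measurable_enorm => //; exact: measurable_itv.
Qed.

Lemma truncation_le f m x : absE (truncation f m) x <= absE f x.
Proof.
by rewrite lee_fin /truncation indicE; case: (_ \in _); rewrite ?mulr1// mulr0 normr0.
Qed.

Lemma truncation_bound f m x : absE (truncation f m) x <= m%:R%:E.
Proof.
rewrite lee_fin /truncation indicE.
case: (boolP (_ \in _)) => [|_]; last by rewrite mulr0 normr0.
by rewrite inE mulr1 => -[].
Qed.

Lemma truncationB_le f m x : absE (fun x => f x - truncation f m x)%R x <= absE f x.
Proof.
rewrite lee_fin /truncation indicE; case: (_ \in _); rewrite ?mulr1 ?mulr0 ?subr0//.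
by rewrite subrr normr0.
Qed.

Lemma powR2_ltI (a b : R) : (2 `^ a < 2 `^ b -> a < b)%R.
Proof. by rewrite !ltNge; apply: contra; apply: ler_powR; rewrite ler1n. Qed.

Lemma truncation_annulus f m k x : ann k x -> (m%:Z < `|k|)%R -> truncation f m x = 0%R.
Proof.
move=> /dyadic_annulusP/andP[x1 x2] mk; rewrite /truncation indicE memNset ?mulr0//.
move=> [_ /andP[h1 h2]].
have H1 := powR2_ltI (le_lt_trans h1 x2); have H2 := powR2_ltI (le_lt_trans x1 h2).
have {}H1 : (- m%:Z < k)%R by rewrite -(ltr_int R) rmorphN.
have {}H2 : (k - 1 < m%:Z)%R by rewrite -(ltr_int R) rmorphB.
lia.
Qed.

Lemma truncation_id f m k x : ann k x -> (`|f x| <= m%:R)%R -> (`|k| < m%:Z)%R ->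
  truncation f m x = f x.
Proof.
move=> /dyadic_annulusP/andP[x1 x2] fm km; rewrite /truncation indicE mem_set ?mulr1//.
split => //; apply/andP; split.
  apply: le_trans x1; apply: ler_powR; first by rewrite ler1n.
  have : (- m%:Z <= k - 1)%R by lia.
  by rewrite -(ler_int R) rmorphN rmorphB.
apply: (lt_le_trans x2); apply: ler_powR; first by rewrite ler1n.
have : (k <= m%:Z)%R by lia.
by rewrite -(ler_int R).
Qed.

Lemma block0 p (g : E -> \bar R) k : (0 < p)%R -> (forall x, ann k x -> g x = 0) -> block p g k = 0.
Proof.
move=> p0 g0; rewrite /block integral0_eq ?poweR0r ?invr_eq0 ?gt_eqF// => x /g0 ->.
by rewrite poweR0r// gt_eqF.
Qed.

Variables (s q : R).
Hypotheses (q1 : (1 < q)%R) (sq0 : (0 < s + n%:R / q)%R) (sq1 : (s < n%:R * (1 - q^-1))%R).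
Let q0 : (0 < q)%R. Proof. exact: lt_trans q1. Qed.
Let q1' : (1 <= q)%R. Proof. exact: ltW. Qed.
Notation H := (hnorm s q).

(** Only annuli with |k| <= m are met, and there a change of weight costs at most
    [2^(m |alpha - s|)]. *)
Lemma hnorm_truncation_le (alpha : R) f m : measurable_fun [set: E] f ->
  hnorm alpha q (absE (truncation f m)) <= (2 `^ (m%:R * `|alpha - s|))%:E * H (absE f).
Proof.
move=> mf; rewrite /hnorm -esum_intZ ?powR_ge0//; last first.
  by move=> k; rewrite mule_ge0 ?block_ge0// lee_fin powR_ge0.
apply: le_esum => k _; have [km|mk] := leP `|k|%R m%:Z; last first.
  rewrite block0 ?mule0 ?mule_ge0 ?block_ge0 ?lee_fin ?powR_ge0// => x kx.
  by rewrite /absE (truncation_annulus f kx mk) normr0.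
rewrite muleA -EFinM; apply: lee_pmul; rewrite ?block_ge0 ?lee_fin ?powR_ge0//.
  rewrite -powRDp//; apply: ler_powR; first by rewrite ler1n.
  have -> : (k%:~R * alpha = k%:~R * (alpha - s) + k%:~R * s :> R)%R by ring.
  rewrite lerD2r; apply: (le_trans (ler_norm _)); rewrite normrM ler_wpM2r//.
  by rewrite -intr_norm -[m%:R]/(m%:Z%:~R) ler_int.
apply: le_block => //.
- by apply: measurable_absE; exact: measurable_truncation.
- exact: measurable_absE.
- exact: absE_ge0.
- exact: absE_ge0.
- by apply: aeW => x _; exact: truncation_le.
Qed.

Lemma integrable_truncation f m : measurable_fun [set: E] f -> H (absE f) < +oo ->
  mu.-integrable setT (EFin \o truncation f m).
Proof.
move=> mf foo; have mt := measurable_truncation m mf; have ma := measurable_absE mt.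
apply/integrableP; split; first exact/measurable_EFinP.
rewrite (_ : (fun x => `|(EFin \o truncation f m) x|) = absE (truncation f m))//.
rewrite integral_annuli//.
(* The weight at which the Herz norm controls the L^1 norm annulus by annulus, by Hölder's
   inequality. *)
pose alpha := (n%:R * (1 - q^-1) : R)%R.
apply: (@le_lt_trans _ _ ((2 `^ n%:R)%:E * hnorm alpha q (absE (truncation f m)))).
  rewrite /hnorm -esum_intZ ?powR_ge0//; last first.
    by move=> k; rewrite mule_ge0 ?block_ge0// lee_fin powR_ge0.
  apply: le_esum => k _; rewrite muleA -EFinM; exact: integral_block_le.
apply: lte_mul_pinfty; [by rewrite lee_fin powR_ge0|by []|].
apply: (le_lt_trans (hnorm_truncation_le _ _ mf)).
by rewrite lte_mul_pinfty ?lee_fin ?powR_ge0.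
Qed.

Lemma hnorm_truncation_cvg f : measurable_fun [set: E] f -> H (absE f) < +oo ->
  H (absE (fun x => f x - truncation f m x)%R) @[m --> \oo] --> 0.
Proof.
move=> mf foo; have ma := measurable_absE mf.
have md m : measurable_fun [set: E] (absE (fun x => f x - truncation f m x)%R).
  by apply: measurable_absE; apply: measurable_funB => //; exact: measurable_truncation.
apply: (@esum_cvg0 _ _ (fun k => (2 `^ (k%:~R * s))%:E * block q (absE f) k)) => //.
- by move=> m k; rewrite mule_ge0 ?block_ge0 ?lee_fin ?powR_ge0.
- move=> m k; rewrite lee_wpmul2l ?lee_fin ?powR_ge0//; apply: le_block => //.
  + exact: absE_ge0.
  + exact: absE_ge0.
  + by apply: aeW => x _; exact: truncationB_le.
move=> k; rewrite -[0](mule0 (2 `^ (k%:~R * s))%:E); apply: cvgeZl => //.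
apply: poweR_cvg0; rewrite ?invr_gt0//.
  by move=> m; apply: integral_ge0 => x _; exact: poweR_ge0.
rewrite -[0](integral0 mu (ann k)).
have mk := @measurable_dyadic_annulus R n k.
apply: (@dominated_cvg _ _ _ _ _ mk _ _ (fun x => absE f x `^ q)) => //.
- by move=> m; apply: measurable_funTS; exact: measurable_funpow.
- move=> x kx; apply: poweR_cvg0 => //; first by move=> m; exact: absE_ge0.
  apply: seq0_intro => [m|e e0]; first exact: absE_ge0.
  exists (maxn (Num.truncn `|f x|).+1 `|k|%N.+1) => m; rewrite geq_max => /andP[m1 m2].
  rewrite /absE (truncation_id kx) ?subrr ?normr0 ?lee_fin ?(ltW e0)//.
  by apply/ltW/(lt_le_trans (truncnS_gt _)); rewrite ler_nat.
- apply/integrableP; split; first by apply: measurable_funTS; exact: measurable_funpow.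
  under eq_integral do rewrite gee0_abs ?poweR_ge0//.
  have := block_le_hnorm s q (absE f) k.
  move=> /le_lt_trans; move=> /(_ +oo); rewrite lte_mul_pinfty ?lee_fin ?powR_ge0// => /(_ isT).
  by apply: lty_poweRy; rewrite invr_eq0 gt_eqF.
- move=> m x kx; rewrite gee0_abs ?poweR_ge0//; apply: gt0_ler_poweR; rewrite ?(ltW q0)//.
  + by rewrite in_itv/= leey absE_ge0.
  + by rewrite in_itv/= leey absE_ge0.
  + exact: truncationB_le.
Qed.

Lemma hnorm_herr_le (alpha : R) : (0 < alpha + n%:R / q)%R -> (alpha < n%:R * (1 - q^-1))%R ->
  exists2 D : R, (0 <= D)%R & forall f t, (0 < t)%R -> measurable_fun [set: E] f ->
    hnorm alpha q (herr f t) <= D%:E * hnorm alpha q (absE f).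
Proof.
move=> a0 a1; have [C C0 HC] := heat_herz n0 q1 (lexx q) a0 a1.
exists (4 * (C + 1))%R => [|f t t0 mf]; first by rewrite mulr_ge0// addr_ge0// ltW.
have ma := measurable_absE mf.
have me : measurable_fun [set: E] (eheat t (absE f)).
  by apply: measurable_eheat => //; exact: absE_ge0.
have e0 x : 0 <= eheat t (absE f) x by apply: eheat_ge0; exact: absE_ge0.
apply: (@le_trans _ _ (hnorm alpha q (fun x => eheat t (absE f) x + absE f x))).
  apply: le_hnorm => //.
  - exact: measurable_herr.
  - exact: emeasurable_funD.
  - exact: herr_ge0.
  - by move=> x; rewrite adde_ge0// absE_ge0.
  - by apply: aeW => x; exact: herr_le.
apply: (le_trans (hnormD _ q1' me ma e0 (absE_ge0 f))).
rewrite EFinM -muleA lee_wpmul2l// EFinD ge0_muleDl ?lee_fin ?(ltW C0)// mul1e leeD2r//.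
apply: (le_trans (HC _ _ t0 ma (absE_ge0 f))).
by rewrite subrr mulr0 powRr0 mulr1.
Qed.

Lemma eheat_fin_ae f t : (0 < t)%R -> measurable_fun [set: E] f -> H (absE f) < +oo ->
  {ae mu, forall x, eheat t (absE f) x < +oo}.
Proof.
move=> t0 mf foo; have [C C0 HC] := heat_herz n0 q1 (lexx q) sq0 sq1.
have ma := measurable_absE mf; have a0 := absE_ge0 f.
have me : measurable_fun [set: E] (eheat t (absE f)) by exact: measurable_eheat.
have e0 x : 0 <= eheat t (absE f) x by exact: eheat_ge0.
have : H (eheat t (absE f)) < +oo.
  apply: (le_lt_trans (HC _ _ t0 ma a0)).
  by rewrite lte_mul_pinfty// lee_fin mulr_ge0 ?powR_ge0 ?ltW.
move=> /(hnorm_lty_fin n0 q0 me e0); apply: filterS => x.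
by rewrite ge0_fin_numE.
Qed.

(** A truncation also has finite norms for the weights [s + eps] and [s - eps], and the error is
    bounded in both; this yields a majorant summable over the annuli. On a single annulus the error
    tends to 0 by weighted L^1 continuity and boundedness. *)
Lemma tends0_truncation f m : measurable_fun [set: E] f -> H (absE f) < +oo ->
  tends0 (fun t => H (herr (truncation f m) t)).
Proof.
move=> mf foo; set g := truncation f m.
have mg : measurable_fun [set: E] g by exact: measurable_truncation.
pose o : E := [tuple 0%R | _ < n].
have [_ _ cg] := heat_cont_integrable o (integrable_truncation m mf foo).
apply: tends0_of_seq => ts ts0.
have t0 i : (0 < ts i)%R by have /andP[] := ts0 i.
(* The conditions on the weight are strict, which leaves room on both sides of [s]. *)
pose eps := (Num.min (s + n%:R / q) (n%:R * (1 - q^-1) - s) / 2)%R.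
have eps0 : (0 < eps)%R by rewrite divr_gt0// lt_min sq0 subr_gt0.
have [eps1 eps2] : (eps < s + n%:R / q)%R /\ (eps < n%:R * (1 - q^-1) - s)%R.
  have h (x y : R) : (0 < x)%R -> (x <= y -> x / 2 < y)%R by move=> x0 xy; lra.
  have m0 : (0 < Num.min (s + n%:R / q) (n%:R * (1 - q^-1) - s))%R by rewrite lt_min sq0 subr_gt0.
  by split; apply: h => //; rewrite ge_min lexx ?orbT.
have [D1 D10 HD1] := @hnorm_herr_le (s + eps) ltac:(lra) ltac:(lra).
have [D2 D20 HD2] := @hnorm_herr_le (s - eps) ltac:(lra) ltac:(lra).
have Hg alpha : hnorm alpha q (absE g) < +oo.
  apply: (le_lt_trans (hnorm_truncation_le _ _ mf)).
  by rewrite lte_mul_pinfty ?lee_fin ?powR_ge0.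
pose B := (fine (D1%:E * hnorm (s + eps) q (absE g)) + fine (D2%:E * hnorm (s - eps) q (absE g)))%R.
have fin (D : R) (h : \bar R) : (0 <= D)%R -> 0 <= h -> h < +oo -> D%:E * h \is a fin_num.
  by move=> d0 h0 hoo; rewrite ge0_fin_numE; [exact: lte_mul_pinfty|exact: mule_ge0].
have fin1 : D1%:E * hnorm (s + eps) q (absE g) \is a fin_num.
  exact: fin (hnorm_ge0 _ _ _) (Hg _).
have fin2 : D2%:E * hnorm (s - eps) q (absE g) \is a fin_num.
  exact: fin (hnorm_ge0 _ _ _) (Hg _).
have B1 : D1%:E * hnorm (s + eps) q (absE g) <= B%:E.
  by rewrite /B EFinD !fineK// leeDl// mule_ge0 ?hnorm_ge0.
have B2 : D2%:E * hnorm (s - eps) q (absE g) <= B%:E.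
  by rewrite /B EFinD !fineK// leeDr// mule_ge0 ?hnorm_ge0.
have B0 : (0 <= B)%R by rewrite addr_ge0// fine_ge0// mule_ge0 ?hnorm_ge0.
apply: (@esum_cvg0 _ _ (fun k : int => B%:E * (2 `^ (- eps * `|k|%:~R))%:E)).
- by move=> i k; rewrite mule_ge0 ?block_ge0 ?lee_fin ?powR_ge0.
- move=> i k; have [k0|k0] := leP 0%R k.
    apply: (@le_trans _ _ ((2 `^ (k%:~R * s))%:E * ((2 `^ (- (k%:~R * (s + eps))))%:E * B%:E))).
      rewrite lee_wpmul2l ?lee_fin ?powR_ge0//; apply: (le_trans (block_le_hnorm (s + eps) _ _ _)).
      by rewrite lee_wpmul2l ?lee_fin ?powR_ge0//; apply: le_trans B1; exact: HD1.
    rewrite muleA -!EFinM lee_fin mulrC ler_wpM2l// -powRDp//.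
    apply: ler_powR; first by rewrite ler1n.
    by rewrite ger0_norm// le_eqVlt; apply/orP; left; apply/eqP; ring.
  apply: (@le_trans _ _ ((2 `^ (k%:~R * s))%:E * ((2 `^ (- (k%:~R * (s - eps))))%:E * B%:E))).
    rewrite lee_wpmul2l ?lee_fin ?powR_ge0//; apply: (le_trans (block_le_hnorm (s - eps) _ _ _)).
    by rewrite lee_wpmul2l ?lee_fin ?powR_ge0//; apply: le_trans B2; exact: HD2.
  rewrite muleA -!EFinM lee_fin mulrC ler_wpM2l// -powRDp//.
  apply: ler_powR; first by rewrite ler1n.
  by rewrite ltr0_norm// rmorphN le_eqVlt; apply/orP; left; apply/eqP; ring.
- rewrite esum_intZ//.
  have [C C0 HC] := @geometric_int_sum R eps eps0.
  by rewrite lte_mul_pinfty ?lee_fin// (le_lt_trans HC)// ltry.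
move=> k; rewrite -[0](mule0 (2 `^ (k%:~R * s))%:E); apply: cvgeZl => //.
apply: poweR_cvg0; rewrite ?invr_gt0//.
  by move=> i; apply: integral_ge0 => x _; exact: poweR_ge0.
(* [c] bounds the Gaussian weight at the origin from below on annulus [k]. As the error is at most
   [2 m], its [q]-th power is at most [(2 m)^(q-1)] times the error, and the weighted L^1 norm
   controls the block. *)
pose c := ((4 * pi * 1) `^ (- (n%:R / 2)) * expR (- ((2 `^ k%:~R) ^+ 2 / (4 * 1))) : R)%R.
have c0 : (0 < c)%R by rewrite mulr_gt0 ?expR_gt0 ?powR_gt0 ?mulr_gt0 ?pi_gt0.
have hc x : ann k x -> (c <= hker 1 o x)%R.
  move=> /dyadic_annulusP/andP[_ x2]; rewrite /hker /heat_kernel.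
  rewrite ler_wpM2l ?powR_ge0// ler_expR lerN2 ler_wpM2r ?invr_ge0 ?mulr_ge0//.
  rewrite enorm_sqrB; under eq_bigr do rewrite tnth_mktuple sub0r sqrrN.
  by rewrite -enorm_sqr lerXn2r ?nnegrE ?enorm_ge0 ?powR_ge0// ltW.
have hm i x : herr g (ts i) x <= (2 * m%:R)%:E.
  apply: (le_trans (herr_le _ _ mg)); rewrite mulr_natl mulr2n EFinD.
  apply: leeD; last exact: truncation_bound.
  rewrite -[leRHS](eheat_cst (ts i) x (_ : 0 <= m%:R%:E)) ?lee_fin//.
  apply: le_eheat => //; [exact: measurable_absE|exact: absE_ge0|].
  by move=> y; exact: truncation_bound.
pose K := ((2 * m%:R) `^ (q - 1) / c : R)%R.
have K0 : (0 <= K)%R by rewrite divr_ge0 ?powR_ge0 ?ltW.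
apply: (@squeeze_cvge _ _ _ _ (cst 0) _ (fun i => K%:E * eheat 1 (herr g (ts i)) o)).
- apply: nearW => i; apply/andP; split.
    by apply: integral_ge0 => x _; exact: poweR_ge0.
  rewrite eheatE// -ge0_integralZl//; last 2 first.
  - by apply: measurable_hkerg; exact: measurable_herr.
  - by move=> x _; rewrite mule_ge0 ?herr_ge0// lee_fin hker_ge0.
  have mI : measurable_fun [set: E] (fun x => K%:E * ((hker 1 o x)%:E * herr g (ts i) x)).
    by apply: measurable_funeM; apply: measurable_hkerg; exact: measurable_herr.
  have mk := @measurable_dyadic_annulus R n k.
  apply: (@le_trans _ _ (\int[mu]_(x in ann k) (K%:E * ((hker 1 o x)%:E * herr g (ts i) x)))); last first.
    apply: ge0_subset_integral => // x _; rewrite !mule_ge0 ?herr_ge0 ?lee_fin ?hker_ge0//.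
  apply: ge0_le_integral => //.
  - by move=> x _; exact: poweR_ge0.
  - by apply: measurable_funTS; apply: measurable_funpow; exact: measurable_herr.
  - exact: measurable_funTS.
  move=> x kx; rewrite /herr poweR_EFin -!EFinM lee_fin.
  have := hm i x; rewrite /herr lee_fin; set h := `|_|%R => hle.
  have h0 : (0 <= h)%R by exact: normr_ge0.
  have {}hle : (h `^ (q - 1) <= (2 * m%:R) `^ (q - 1))%R.
    have q10 : (0 <= q - 1)%R by rewrite subr_ge0.
    by apply: ge0_ler_powR => //; rewrite nnegrE mulr_ge0.
  rewrite -(mulr_powRB1 h0 q0); apply: (@le_trans _ _ (K * (c * h))%R); last first.
    by apply: ler_wpM2l => //; apply: ler_wpM2r => //; exact: hc.
  by rewrite /K mulrA divfK ?gt_eqF// mulrC ler_wpM2r.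
- exact: cvg_cst.
- rewrite -[X in _ --> X](mule0 K%:E); apply: cvgeZl => //.
  by apply: (tends0_seq _ cg) => // t; apply: eheat_ge0; exact: herr_ge0.
Qed.

(** Truncations are dense, and by [hnorm_herr_le] the error operator is bounded uniformly in
    time. *)
Theorem heat_strong_continuity f : measurable_fun [set: E] f -> H (absE f) < +oo ->
  tends0 (fun t => H (herr f t)).
Proof.
move=> mf foo; have [D D0 HD] := hnorm_herr_le sq0 sq1.
have mt m := measurable_truncation m mf.
have md m : measurable_fun [set: E] (fun x => f x - truncation f m x)%R by exact: measurable_funB.
apply: (@tends0_lim _ _ (fun m t => 4%:E * H (herr (truncation f m) t))
  (fun m => (4 * D)%:E * H (absE (fun x => f x - truncation f m x)%R)) 1) => //.
- rewrite -[X in _ --> X](mule0 (4 * D)%:E); apply: cvgeZl => //.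
  exact: hnorm_truncation_cvg.
- by move=> m; apply: tends0Z => //; exact: tends0_truncation.
move=> m t /andP[t0 _].
have moo : H (absE (truncation f m)) < +oo.
  apply: (le_lt_trans (hnorm_truncation_le _ _ mf)).
  by rewrite lte_mul_pinfty ?lee_fin ?powR_ge0.
have doo : H (absE (fun x => f x - truncation f m x)%R) < +oo.
  apply: le_lt_trans foo; apply: le_hnorm => //; [exact: measurable_absE..|exact: absE_ge0|exact: absE_ge0|].
  by apply: aeW => x; exact: truncationB_le.
rewrite EFinM -muleA; apply: (@le_trans _ _ (4%:E * (H (herr (truncation f m) t) +
    H (herr (fun x => f x - truncation f m x)%R t)))); last first.
  rewrite -ge0_muleDr ?hnorm_ge0 ?mule_ge0 ?hnorm_ge0// lee_wpmul2l// leeD2l//.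
  exact: HD.
apply: le_trans (hnormD _ q1' _ _ _ _); [|exact: measurable_herr..|exact: herr_ge0|exact: herr_ge0].
apply: le_hnorm => //.
- exact: measurable_herr.
- by apply: emeasurable_funD; exact: measurable_herr.
- exact: herr_ge0.
- by move=> x; rewrite adde_ge0 ?herr_ge0.
apply: filterS2 (eheat_fin_ae t0 (mt m) moo) (eheat_fin_ae t0 (md m) doo) => x fx gx.
rewrite /herr -EFinD lee_fin.
have := heatD (mt m) (md m) fx gx; rewrite (_ : (fun y => truncation f m y + _)%R = f); last first.
  by apply/funext => y; ring.
move=> ->; set a := heat _ _ _; set b := heat _ _ _.
by rewrite (_ : (a + b - f x) = (a - truncation f m x) + (b - (f x - truncation f m x)))%R ?ler_normD//; ring.
Qed.

End strong_continuity.

(** * Duhamel integrals *)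

Section nonlinear_estimates.
Context {R : realType}.

(** On [0, 1] a real power dominates the next integer power, and [1 - x^N] factors into [1 - x]
    times a sum of [N] terms at most 1; no derivative is involved. *)
Lemma one_sub_powR_le (x b : R) : 0 <= x <= 1 -> 0 <= b ->
  1 - x `^ b <= (Num.truncn b).+1%:R * (1 - x).
Proof.
move=> /andP[x0 x1] b0; set N := (Num.truncn b).+1.
apply: (@le_trans _ _ (1 - x ^+ N)).
  rewrite lerB//; move: x0; rewrite le_eqVlt => /predU1P[<-|x0].
    by rewrite expr0n/= powR_ge0.
  rewrite -(powR_mulrn _ (ltW x0)); apply: ger_powR; first by rewrite x0.
  exact/ltW/truncnS_gt.
rewrite -[X in X - _](expr1n _ N) subrXX mulrC ler_wpM2r ?subr_ge0//.
rewrite -[X in _ <= X%:R](card_ord N) -sumr_const; apply: ler_sum => i _.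
by rewrite expr1n mul1r exprn_ile1.
Qed.

Lemma powR_succ_sub_le (b r t : R) : 0 < b -> 0 <= t -> t <= r ->
  r `^ b * r - t `^ b * t <= (Num.truncn (b + 1)).+1%:R * r `^ b * (r - t).
Proof.
move=> b0 t0; rewrite le_eqVlt => /predU1P[->|tr]; first by rewrite !subrr mulr0.
have r0 : 0 < r by exact: le_lt_trans tr.
have E (y : R) : 0 <= y -> y `^ b * y = y `^ (b + 1).
  by move=> y0; have := mulr_powRB1 y0 (addr_gt0 b0 ltr01); rewrite addrK mulrC.
have h : 0 <= t / r <= 1 by rewrite divr_ge0 ?(ltW r0)//= ler_pdivrMr// mul1r ltW.
have := one_sub_powR_le h (ltW (addr_gt0 b0 ltr01)).
have -> : (t / r) `^ (b + 1) = (t `^ b * t) / (r `^ b * r).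
  have -> : (t / r) `^ (b + 1) = t `^ (b + 1) * r^-1 `^ (b + 1) by rewrite powRM// invr_ge0 ltW.
  rewrite (E _ t0) (E _ (ltW r0)); congr (_ * _).
  by rewrite -(powR_inv1 (ltW r0)) powRAC powR_inv1// powR_ge0.
set c := r `^ b; have c0 : 0 < c by exact: powR_gt0.
set L := _%:R => H.
have -> : c * r - t `^ b * t = (c * r) * (1 - t `^ b * t / (c * r)) by field; rewrite !gt_eqF.
have -> : L * c * (r - t) = (c * r) * (L * (1 - t / r)) by field; rewrite gt_eqF.
by apply: ler_wpM2l => //; rewrite mulr_ge0// ltW.
Qed.

Definition lip_const (b : R) : R := (Num.truncn (b + 1)).+1%:R.

Lemma lip_const_ge1 b : 1 <= lip_const b. Proof. by rewrite ler1n. Qed.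

(** By oddness only two cases matter. For equal signs [powR_succ_sub_le] applies; for opposite signs
    |r - t| is |r| + |t| and the inequality is elementary. *)
Lemma abs_powR_mul_lip (b r t : R) : 0 < b ->
  `| `|r| `^ b * r - `|t| `^ b * t| <=
  lip_const b * (`|r| `^ b + `|t| `^ b) * `|r - t|.
Proof.
move=> b0; have L1 := lip_const_ge1 b; have L0 : 0 <= lip_const b by exact: le_trans L1.
have pos (x y : R) : 0 <= x -> x <= y ->
    `| y `^ b * y - x `^ b * x| <= lip_const b * (y `^ b + x `^ b) * `|y - x|.
  move=> x0 xy; have y0 : 0 <= y by exact: le_trans xy.
  rewrite ger0_norm; last first.
    by rewrite subr_ge0; apply: ler_pM; rewrite ?powR_ge0//; apply: ge0_ler_powR; rewrite ?nnegrE// ltW.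
  rewrite [X in _ <= _ * X]ger0_norm ?subr_ge0//; apply: (le_trans (powR_succ_sub_le b0 x0 xy)).
  by rewrite ler_wpM2r ?subr_ge0// ler_wpM2l// lerDl powR_ge0.
have same (x y : R) : 0 <= x -> 0 <= y ->
    `| y `^ b * y - x `^ b * x| <= lip_const b * (y `^ b + x `^ b) * `|y - x|.
  move=> x0 y0; have [xy|/ltW yx] := leP x y; first exact: pos.
  by rewrite distrC [y `^ b + _]addrC [`|y - x|]distrC; exact: pos.
have opp (x y : R) : 0 <= x -> 0 <= y ->
    `| y `^ b * y + x `^ b * x| <= lip_const b * (y `^ b + x `^ b) * `|y + x|.
  move=> x0 y0; have h (z : R) := powR_ge0 z b.
  rewrite !ger0_norm ?addr_ge0 ?mulr_ge0//.
  apply: (@le_trans _ _ (1 * (y `^ b + x `^ b) * (y + x))); last first.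
    by rewrite ler_wpM2r ?addr_ge0// ler_wpM2r ?addr_ge0.
  rewrite mul1r mulrDl !mulrDr.
  have := mulr_ge0 (h y) x0; have := mulr_ge0 (h x) y0; lra.
have [r0|/ltW r0] := leP 0 r; have [t0|/ltW t0] := leP 0 t.
- by rewrite (ger0_norm r0) (ger0_norm t0); exact: same.
- rewrite (ger0_norm r0) (ler0_norm t0).
  by have := opp (- t) r; rewrite oppr_ge0 mulrN; exact.
- rewrite (ler0_norm r0) (ger0_norm t0).
  have := opp t (- r) t0; rewrite oppr_ge0 => /(_ r0).
  have -> : (- r) `^ b * - r + t `^ b * t = - ((- r) `^ b * r - t `^ b * t) by ring.
  have -> : - r + t = - (r - t) by ring.
  by rewrite !normrN.
- rewrite (ler0_norm r0) (ler0_norm t0).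
  have := same (- t) (- r); rewrite !oppr_ge0 !mulrN -!opprD !normrN => /(_ t0 r0).
  exact.
Qed.

End nonlinear_estimates.

Section eheat_param.
Context {R : realType} {n : nat}.
Local Notation E := (Rspace R n).
Local Notation mu := (@lebesgue_space R n).
Local Open Scope ereal_scope.

Lemma measurable_eheat_param d (T : measurableType d) (t : T -> R) (x : T -> E) (f : T -> E -> \bar R) :
  measurable_fun [set: T] t -> measurable_fun [set: T] x ->
  measurable_fun [set: T * E] (fun z => f z.1 z.2) ->
  measurable_fun [set: T] (fun z => eheat (t z) (f z) (x z)).
Proof.
move=> mt mx mf.
have -> : (fun z => eheat (t z) (f z) (x z)) = (fun z => if (0 < t z)%R
    then \int[mu]_y ((hker (t z) (x z) y)%:E * f z y) else f z (x z)) by [].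
apply: measurable_fun_if => //.
- exact: measurable_fun_ltr.
- apply: measurable_funTS.
  apply: (@measurable_int_param _ _ _ _ _ mu (fun z : T * E => (hker (t z.1) (x z.1) z.2)%:E * f z.1 z.2)).
  apply: emeasurable_funM => //; apply/measurable_EFinP.
  by apply: measurable_hker => //; exact: measurableT_comp.
- apply: measurable_funTS.
  apply: (measurableT_comp (f := fun z : T * E => f z.1 z.2) (g := fun z => (z, x z))) => //.
  exact: measurable_fun_pair.
Qed.

Lemma measurable_eheat2 (b : R) (g : E -> \bar R) : measurable_fun [set: E] g ->
  measurable_fun [set: R * E] (fun z => eheat (z.1 - b)%R g z.2).
Proof.
move=> mg; apply: (@measurable_eheat_param _ _ (fun z : R * E => z.1 - b)%R snd (fun _ => g)) => //.
- exact: measurable_funB.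
- exact: measurableT_comp.
Qed.

End eheat_param.

(** * Exponents, and the Duhamel integral of the free evolution *)

Section duhamel_bounds.
Context {R : realType} {n : nat}.
Local Notation E := (Rspace R n).
Local Notation mu := (@lebesgue_space R n).
Local Notation leb := (@lebesgue_measure R).
Local Open Scope ereal_scope.

(* What the proof uses of the exponents; [s] is the weight of the Herz spaces.
   The [eta] conditions make the potential [enorm ^ (- gamma) * f ^ beta]
   uniformly integrable against Gaussians, with singularity [theta] in time;
   [lambda_lt1] makes the resulting time kernel integrable. *)
Record herz_params (beta gamma q kappa s : R) : Prop := HerzParams {
  dim_gt0 : (0 < n)%N;
  beta_gt0 : (0 < beta)%R;
  gamma_gt0 : (0 < gamma)%R;
  q_gt1 : (1 < q)%R;
  q_lt_kappa : (q < kappa)%R;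
  beta_lt_kappa : (beta < kappa)%R;
  sq_gt0 : (0 < s + n%:R / q)%R;
  sq_lt : (s < n%:R * (1 - q^-1))%R;
  skappa_gt0 : (0 < s + n%:R / kappa)%R;
  eta_gt0 : (0 < gamma + s * beta)%R;
  eta_lt : (gamma + s * beta < n%:R * (1 - beta / kappa))%R;
  lambda_lt1 : (n%:R * beta / (2 * kappa) + (gamma + s * beta) / 2 +
     beta * (n%:R / 2 * (q^-1 - kappa^-1)) < 1)%R }.

Variables (beta gamma q kappa s : R).
Hypothesis hp : herz_params beta gamma q kappa s.

Definition theta : R := (n%:R * beta / (2 * kappa) + (gamma + s * beta) / 2)%R.
Definition sigma : R := (n%:R / 2 * (q^-1 - kappa^-1))%R.
(** Total time singularity of the Duhamel integrand: [theta] from the potential and [beta * sigma]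
    from smoothing its argument from index [q] to index [kappa]. *)
Definition lambda : R := (theta + beta * sigma)%R.

Lemma q_gt0 : (0 < q)%R. Proof. exact: lt_trans (q_gt1 hp). Qed.
Lemma kappa_gt0 : (0 < kappa)%R. Proof. exact: lt_trans q_gt0 (q_lt_kappa hp). Qed.
Lemma theta_ge0 : (0 <= theta)%R.
Proof.
have := kappa_gt0; have := beta_gt0 hp; have := eta_gt0 hp => e0 b0 k0.
by rewrite addr_ge0 ?divr_ge0 ?mulr_ge0 ?(ltW e0) ?(ltW b0) ?(ltW k0).
Qed.
Lemma sigma_ge0 : (0 <= sigma)%R.
Proof.
rewrite mulr_ge0 ?divr_ge0// subr_ge0 lef_pV2 ?posrE ?q_gt0 ?kappa_gt0//.
exact/ltW/(q_lt_kappa hp).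
Qed.
Lemma betasigma_ge0 : (0 <= beta * sigma)%R.
Proof. by rewrite mulr_ge0 ?sigma_ge0// ltW// (beta_gt0 hp). Qed.
Lemma lambda_ge0 : (0 <= lambda)%R. Proof. by rewrite addr_ge0 ?theta_ge0 ?betasigma_ge0. Qed.
Lemma one_sub_lambda : (0 < 1 - lambda)%R.
Proof. by rewrite subr_gt0; exact: lambda_lt1 hp. Qed.

Definition pot (g : E -> \bar R) (z : E) : \bar R := (enorm z `^ (- gamma))%:E * g z `^ beta.

Lemma pot_ge0 g z : 0 <= pot g z.
Proof. by rewrite mule_ge0 ?poweR_ge0// lee_fin powR_ge0. Qed.

Lemma measurable_enorm_powR c : measurable_fun [set: E] (fun z : E => (enorm z `^ c)%:E).
Proof.
by apply/measurable_EFinP; apply: (measurableT_comp (measurable_powR _)) => //; exact: measurable_enorm.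
Qed.

Lemma measurable_pot g : measurable_fun [set: E] g -> measurable_fun [set: E] (pot g).
Proof.
move=> mg; apply: emeasurable_funM; first exact: measurable_enorm_powR.
exact: measurable_funpow.
Qed.

Lemma potential_semigroup : exists2 C : R, (0 <= C)%R &
  forall (t1 t2 : R) (g h : E -> \bar R) x, (0 < t1)%R -> (0 < t2)%R ->
    measurable_fun [set: E] g -> measurable_fun [set: E] h ->
    (forall y, 0 <= g y) -> (forall y, 0 <= h y) ->
    eheat t2 (fun z => pot g z * eheat t1 h z) x <=
    (C * (t1 * t2 / (t1 + t2)) `^ (- theta))%:E * hnorm s kappa g `^ beta * eheat (t1 + t2) h x.
Proof.
have [C C0 HC] := herz_potential (dim_gt0 hp) (beta_gt0 hp) (beta_lt_kappa hp) (gamma_gt0 hp) (eta_gt0 hp) (eta_lt hp).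
exists C => // t1 t2 g h x t10 t20 mg mh g0 h0.
apply: eheat_potential_le => //.
- exact: measurable_pot.
- exact: pot_ge0.
by move=> m; apply: HC => //; rewrite divr_gt0 ?mulr_gt0 ?addr_gt0.
Qed.

(** The nonlinearity on a free evolution, flowed on to time [t], is again a multiple of the free
    evolution. This self-reproducing bound is what makes iteration possible at each point
    separately. *)
Lemma heat_integrand_bound : exists2 K : R, (0 <= K)%R &
  forall (b tau t N : R) (g : E -> \bar R) x, (b < tau < t)%R ->
    measurable_fun [set: E] g -> (forall y, 0 <= g y) -> (0 <= N)%R -> hnorm s q g <= N%:E ->
    eheat (t - tau) (fun z => pot (eheat (tau - b) g) z * eheat (tau - b) g z) x <=
    (K * N `^ beta * tker b t lambda tau)%:E * eheat (t - b) g x.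
Proof.
have [C C0 HC] := potential_semigroup.
have [D D0 HD] := heat_herz (dim_gt0 hp) (q_gt1 hp) (ltW (q_lt_kappa hp)) (skappa_gt0 hp) (sq_lt hp).
exists (C * 2 `^ theta * D `^ beta)%R; first by rewrite !mulr_ge0 ?powR_ge0.
move=> b tau t N g x /andP[btau taut] mg g0 N0 gN.
have t10 : (0 < tau - b)%R by rewrite subr_gt0.
have t20 : (0 < t - tau)%R by rewrite subr_gt0.
have mh := measurable_eheat (tau - b) mg g0.
have h0 y : 0 <= eheat (tau - b) g y by exact: eheat_ge0.
apply: (le_trans (HC _ _ _ _ x t10 t20 mh mg h0 g0)).
have -> : (tau - b + (t - tau) = t - b)%R by ring.
rewrite lee_wpmul2r ?eheat_ge0//.
have Hk : hnorm s kappa (eheat (tau - b) g) `^ beta <= (D `^ beta * (tau - b) `^ (- (beta * sigma)) * N `^ beta)%:E.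
  apply: (@le_trans _ _ ((D * (tau - b) `^ (- sigma) * N)%:E `^ beta)).
    have DN0 : (0 <= D * (tau - b) `^ (- sigma) * N)%R by rewrite !mulr_ge0 ?powR_ge0// ltW.
    apply: gt0_ler_poweR; rewrite ?in_itv/= ?leey ?andbT ?hnorm_ge0 ?lee_fin ?(ltW (beta_gt0 hp))//.
    apply: (le_trans (HD _ _ t10 mg g0)); rewrite [leRHS]EFinM.
    have -> : (- (n%:R / 2) * (q^-1 - kappa^-1) = - sigma)%R by rewrite mulNr.
    by apply: lee_wpmul2l => //; rewrite lee_fin mulr_ge0 ?powR_ge0// ltW.
  rewrite poweR_EFin lee_fin !powRM ?mulr_ge0 ?powR_ge0 ?(ltW D0)//.
  by rewrite -powRrM mulNr [(sigma * _)%R]mulrC.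
apply: (@le_trans _ _ ((C * ((tau - b) * (t - tau) / (t - b)) `^ (- theta))%:E *
   (D `^ beta * (tau - b) `^ (- (beta * sigma)) * N `^ beta)%:E)).
  by rewrite lee_wpmul2l// lee_fin mulr_ge0 ?powR_ge0.
rewrite -EFinM lee_fin.
have H1 := powRN_harmonic_le t10 t20 theta_ge0.
have E1 : (tau - b + (t - tau) = t - b)%R by ring.
rewrite E1 in H1.
have H2 := powRN_mul_le t10 t20 betasigma_ge0 theta_ge0.
have H3 : ((tau - b) `^ (- (beta * sigma)) * (tau - b) `^ (- theta) = (tau - b) `^ (- lambda))%R.
  by rewrite -powRDp// -opprD [(beta * sigma + _)%R]addrC.
rewrite (addrC (beta * sigma)%R) -/lambda in H2.
have P0 : (0 <= C * D `^ beta * N `^ beta)%R by rewrite !mulr_ge0 ?powR_ge0.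
rewrite /tker; move: H1 H2 H3.
set X := (_ `^ (- theta))%R; set A := ((tau - b) `^ (- theta))%R; set B := ((t - tau) `^ (- theta))%R.
set S := ((tau - b) `^ (- (beta * sigma)))%R; set L1 := ((tau - b) `^ (- lambda))%R.
set L2 := ((t - tau) `^ (- lambda))%R; set W := (2 `^ theta)%R => H1 H2 H3.
have S0 : (0 <= S)%R by exact: powR_ge0.
have W0 : (0 <= W)%R by exact: powR_ge0.
apply: (@le_trans _ _ (C * D `^ beta * N `^ beta * (S * (W * (A + B))))%R).
  have -> : (C * X * (D `^ beta * S * N `^ beta) = C * D `^ beta * N `^ beta * (S * X))%R by ring.
  by apply: ler_wpM2l => //; apply: ler_wpM2l.
have -> : (C * W * D `^ beta * N `^ beta * (2 * L1 + L2) = C * D `^ beta * N `^ beta * (W * (2 * L1 + L2)))%R by ring.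
apply: ler_wpM2l => //; rewrite mulrCA; apply: ler_wpM2l => //.
by rewrite mulrDr H3; lra.
Qed.

(** The interval is open so that [tau = t], where the flow degenerates to the identity, is never
    met. *)
Definition duh (c t : R) (f : R -> E -> \bar R) (x : E) : \bar R :=
  \int[leb]_(tau in `]c, t[) eheat (t - tau) (f tau) x.

Lemma measurable_duh_integrand (t : R) (f : R -> E -> \bar R) x :
  measurable_fun [set: R * E] (fun z => f z.1 z.2) ->
  measurable_fun [set: R] (fun tau => eheat (t - tau) (f tau) x).
Proof.
move=> mf; apply: (@measurable_eheat_param R n _ (measurableTypeR R) (fun tau => t - tau)%R (fun=> x) f) => //.
exact: measurable_funB.
Qed.

Lemma le_duh c t (f g : R -> E -> \bar R) x :
  measurable_fun [set: R * E] (fun z => f z.1 z.2) ->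
  measurable_fun [set: R * E] (fun z => g z.1 z.2) ->
  (forall tau y, 0 <= f tau y) -> (forall tau y, 0 <= g tau y) ->
  (forall tau, c < tau < t -> {ae mu, forall y, (f tau y <= g tau y)%E})%R ->
  duh c t f x <= duh c t g x.
Proof.
move=> mf mg f0 g0 fg; apply: ge0_le_integral => //.
- by move=> tau _; exact: eheat_ge0.
- by apply: measurable_funTS; exact: measurable_duh_integrand.
- by apply: measurable_funTS; exact: measurable_duh_integrand.
move=> tau; rewrite /= in_itv/= => /andP[ct tt]; apply: le_eheat_ae => //.
- by rewrite subr_gt0.
- exact: (measurableT_comp mf (measurable_pair1 tau)).
- exact: (measurableT_comp mg (measurable_pair1 tau)).
- by apply: fg; rewrite ct.
Qed.

(** Modulus of the nonlinearity on the free evolution of [g] from time [b], that is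
    [|z|^(-gamma) (P g)^(beta+1)]. *)
Definition dominant (b : R) (g : E -> \bar R) : R -> E -> \bar R :=
  fun tau z => pot (eheat (tau - b) g) z * eheat (tau - b) g z.

Lemma dominant_ge0 b g tau z : (forall y, 0 <= g y) -> 0 <= dominant b g tau z.
Proof. by move=> g0; rewrite mule_ge0 ?pot_ge0// eheat_ge0. Qed.

Lemma measurable_dominant b g : measurable_fun [set: E] g -> (forall y, 0 <= g y) ->
  measurable_fun [set: R * E] (fun z => dominant b g z.1 z.2).
Proof.
move=> mg g0; apply: emeasurable_funM; last exact: measurable_eheat2.
apply: emeasurable_funM.
  by apply: (measurableT_comp (measurable_enorm_powR _)).
by apply: measurable_funpow; exact: measurable_eheat2.
Qed.

(** Moving the left end of the kernel from [b] to [c] only enlarges it. The power of [t - c] is the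
    smallness behind the contraction, with [c = b], and behind continuity in time, with [c] close to
    [t]. *)
Lemma duhamel_bound : exists2 K : R, (0 <= K)%R &
  forall (b c t N : R) (g : E -> \bar R) x, (b <= c < t)%R ->
    measurable_fun [set: E] g -> (forall y, 0 <= g y) -> (0 <= N)%R -> hnorm s q g <= N%:E ->
    duh c t (dominant b g) x <= (K * N `^ beta * (t - c) `^ (1 - lambda))%:E * eheat (t - b) g x.
Proof.
have [K K0 HK] := heat_integrand_bound; have l0 := lambda_ge0; have l1 := one_sub_lambda.
exists (K * (3 / (1 - lambda)))%R; first by rewrite mulr_ge0// divr_ge0// ltW.
move=> b c t N g x /andP[bc ct] mg g0 N0 gN.
apply: (@le_trans _ _ (\int[leb]_(tau in `]c, t[)
   ((K * N `^ beta)%:E * eheat (t - b) g x * (tker c t lambda tau)%:E))).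
  have mt : measurable_fun (`]c, t[ : set R) (fun tau => (tker c t lambda tau)%:E).
    apply: measurable_funTS; apply/measurable_EFinP.
    exact: measurable_tker.
  apply: ge0_le_integral => //.
  - by move=> tau _; apply: eheat_ge0 => y; exact: dominant_ge0.
  - apply: measurable_funTS; apply: measurable_duh_integrand; exact: measurable_dominant.
  - exact: measurable_funeM.
  move=> tau; rewrite /= in_itv/= => /andP[ctau taut].
  have btau : (b < tau)%R by exact: le_lt_trans ctau.
  apply: (le_trans (HK b tau t N g x _ mg g0 N0 gN)); first by rewrite btau.
  rewrite EFinM -muleA [(tker _ _ _ _)%:E * _]muleC muleA.
  rewrite lee_wpmul2l ?mule_ge0 ?eheat_ge0 ?lee_fin ?mulr_ge0 ?powR_ge0//.
  rewrite /tker lerD2r ler_pM2l// !powRN lef_pV2 ?posrE ?powR_gt0 ?subr_gt0//.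
  by apply: ge0_ler_powR; rewrite ?nnegrE ?subr_ge0 ?(ltW btau) ?(ltW ctau)// lerB.
rewrite ge0_integralZl//; last 3 first.
- by apply: measurable_funTS; apply/measurable_EFinP; exact: measurable_tker.
- by move=> tau _; rewrite lee_fin tker_ge0.
- by rewrite mule_ge0 ?eheat_ge0 ?lee_fin ?mulr_ge0 ?powR_ge0.
rewrite muleAC.
have H : (\int[leb]_(tau in `]c, t[) (tker c t lambda tau)%:E <= (3 * (t - c) `^ (1 - lambda) / (1 - lambda))%:E)%E.
  by apply: integral_tker => //; rewrite -subr_gt0.
rewrite lee_wpmul2r ?eheat_ge0//.
apply: (@le_trans _ _ ((K * N `^ beta)%:E * (3 * (t - c) `^ (1 - lambda) / (1 - lambda))%:E)).
  by rewrite lee_wpmul2l// lee_fin mulr_ge0 ?powR_ge0.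
by rewrite -EFinM lee_fin le_eqVlt; apply/orP; left; apply/eqP; ring.
Qed.

End duhamel_bounds.

(** * Signed Duhamel integrals *)

Section duhamel.
Context {R : realType} {n : nat}.
Local Notation E := (Rspace R n).
Local Notation leb := (@lebesgue_measure R).
Local Open Scope ereal_scope.

Definition jointly_measurable (f : R -> E -> R) :=
  measurable_fun [set: R * E] (fun z => f z.1 z.2).

Lemma jointly_measurable_absE f : jointly_measurable f ->
  measurable_fun [set: R * E] (fun z => absE (f z.1) z.2).
Proof. by move=> mf; apply/measurable_EFinP; exact: measurableT_comp. Qed.

Lemma jointly_measurable_fix f t : jointly_measurable f -> measurable_fun [set: E] (f t).
Proof. by move=> mf; exact: (measurableT_comp mf (measurable_pair1 t)). Qed.

Lemma duhZ c t (k : R) (f : R -> E -> \bar R) x : (0 <= k)%R ->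
  measurable_fun [set: R * E] (fun z => f z.1 z.2) -> (forall tau y, 0 <= f tau y) ->
  duh c t (fun tau y => k%:E * f tau y) x = k%:E * duh c t f x.
Proof.
move=> k0 mf f0; rewrite /duh -ge0_integralZl//; last 2 first.
- by apply: measurable_funTS; exact: measurable_duh_integrand.
- by move=> tau _; exact: eheat_ge0.
apply: eq_integral => tau _; apply: eheatZ => //.
exact: (measurableT_comp mf (measurable_pair1 tau)).
Qed.

Lemma duh_ge0 c t (f : R -> E -> \bar R) x : (forall tau y, 0 <= f tau y) -> 0 <= duh c t f x.
Proof. by move=> f0; apply: integral_ge0 => tau _; exact: eheat_ge0. Qed.

Definition rduh (c t : R) (f : R -> E -> R) (x : E) : R :=
  (\int[leb]_(tau in `]c, t[) heat (t - tau) (f tau) x)%R.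

Lemma measurable_heat_integrand t (f : R -> E -> R) x : jointly_measurable f ->
  measurable_fun [set: R] (fun tau => heat (t - tau) (f tau) x).
Proof.
move=> mf; apply: (@measurable_heat_param R n _ (measurableTypeR R) (fun tau => t - tau)%R (fun=> x) f) => //.
exact: measurable_funB.
Qed.

Lemma measurable_rduh c f : jointly_measurable f -> jointly_measurable (fun t => rduh c t f).
Proof.
move=> mf; rewrite /jointly_measurable /rduh /Rintegral; apply: measurableT_comp => //.
under eq_fun do rewrite integral_mkcond.
(* The interval of integration varies with the parameter; encoded in the integrand, it leaves an
   integral over a fixed space. *)
pose k (w : (R * E) * R) : \bar R := if (c < w.2 < w.1.1)%R
  then (heat (w.1.1 - w.2) (f w.2) w.1.2)%:E else 0.
have -> : (fun z : R * E => \int[leb]_tau ((fun tau => (heat (z.1 - tau) (f tau) z.2)%:E) \_ `]c, z.1[) tau) =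
    (fun z : R * E => \int[leb]_tau k (z, tau)).
  apply/funext => z; apply: eq_integral => tau _.
  by rewrite patchE mem_setE/= in_itv.
apply: (@measurable_int_param R _ _ _ _ leb k).
apply: measurable_fun_if => //.
- by apply: measurable_and; apply: measurable_fun_ltr => //; exact: measurableT_comp.
- apply: measurable_funTS; apply/measurable_EFinP.
  apply: (@measurable_heat_param R n _ ((R * E) * R)%type (fun w => w.1.1 - w.2)%R (fun w => w.1.2) (fun w => f w.2)).
  + by apply: measurable_funB => //; exact: measurableT_comp.
  + exact: measurableT_comp.
  + apply: (measurableT_comp (f := fun z : R * E => f z.1 z.2)
      (g := fun w : ((R * E) * R) * E => (w.1.2, w.2))) => //.
    by apply: measurable_fun_pair => //; exact: measurableT_comp.
Qed.

Lemma integrable_rduh c t f x : jointly_measurable f ->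
  duh c t (fun tau => absE (f tau)) x < +oo ->
  leb.-integrable (`]c, t[ : set R) (fun tau => (heat (t - tau) (f tau) x)%:E).
Proof.
move=> mf foo; apply/integrableP; split.
  by apply: measurable_funTS; apply/measurable_EFinP; exact: measurable_heat_integrand.
apply: le_lt_trans foo; apply: ge0_le_integral => //.
- apply: measurable_funTS; apply/measurable_EFinP; apply: measurableT_comp => //.
  exact: measurable_heat_integrand.
- by apply: measurable_funTS; apply: measurable_duh_integrand; exact: jointly_measurable_absE.
- by move=> tau _; apply: abs_heat_le; exact: jointly_measurable_fix.
Qed.

Lemma abs_rduh_le c t f x : jointly_measurable f ->
  `|rduh c t f x|%:E <= duh c t (fun tau => absE (f tau)) x.
Proof.
move=> mf; have mh := measurable_heat_integrand t x mf.
apply: (le_trans (abs_fine_le _)); apply: (le_trans (le_abse_integral _ _ _)) => //.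
  by apply: measurable_funTS; apply/measurable_EFinP.
apply: ge0_le_integral => //.
- by apply: measurable_funTS; apply/measurable_EFinP; exact: measurableT_comp.
- by apply: measurable_funTS; apply: measurable_duh_integrand; exact: jointly_measurable_absE.
- by move=> tau _; apply: abs_heat_le; exact: jointly_measurable_fix.
Qed.

Lemma eheat_lty_time c t (f : R -> E -> \bar R) x :
  measurable_fun [set: R * E] (fun z => f z.1 z.2) -> (forall tau y, 0 <= f tau y) ->
  duh c t f x < +oo -> {ae leb, forall tau : measurableTypeR R, `]c, t[%classic tau -> eheat (t - tau) (f tau) x < +oo}.
Proof.
move=> mf f0 foo.
have ie : leb.-integrable (`]c, t[ : set R) (fun tau => eheat (t - tau) (f tau) x).
  apply/integrableP; split; first by apply: measurable_funTS; exact: measurable_duh_integrand.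
  by under eq_integral do rewrite gee0_abs ?eheat_ge0//.
have mi : measurable (`]c, t[%classic : set (measurableTypeR R)) by exact: measurable_itv.
have := integrable_ae mi ie; apply: filterS => tau /[apply].
by rewrite ge0_fin_numE// eheat_ge0.
Qed.

Lemma rduhB c t f g x : jointly_measurable f -> jointly_measurable g ->
  duh c t (fun tau => absE (f tau)) x < +oo -> duh c t (fun tau => absE (g tau)) x < +oo ->
  rduh c t (fun tau y => f tau y - g tau y)%R x = (rduh c t f x - rduh c t g x)%R.
Proof.
move=> mf mg foo goo; rewrite /rduh -RintegralB//; [|exact: integrable_rduh|exact: integrable_rduh].
congr fine; apply: ae_eq_integral => //.
- apply: measurable_funTS; apply/measurable_EFinP; apply: measurable_heat_integrand.
  exact: measurable_funB.
- apply: measurable_funTS; apply/measurable_EFinP.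
  by apply: measurable_funB; exact: measurable_heat_integrand.
have H1 := eheat_lty_time (jointly_measurable_absE mf) (fun tau => absE_ge0 (f tau)) foo.
have H2 := eheat_lty_time (jointly_measurable_absE mg) (fun tau => absE_ge0 (g tau)) goo.
apply: filterS2 H2 H1 => tau gt ft tt; rewrite heatB//; [exact: jointly_measurable_fix..|exact: ft|exact: gt].
Qed.

End duhamel.

(** * Pointwise Lipschitz bounds for the nonlinearity *)

Section nonlinearity_bounds.
Context {R : realType} {n : nat}.
Local Notation E := (Rspace R n).
Local Open Scope ereal_scope.
Variables (beta gamma : R).
Hypothesis beta0 : (0 < beta)%R.
Local Notation F := (@nonlinearity R n gamma beta).

Lemma jointly_measurable_nonlinearity u : jointly_measurable u ->
  jointly_measurable (fun t => F (u t)).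
Proof.
move=> mu_; apply: measurable_funM => //; apply: measurable_funM.
  have := @measurable_enorm_powR R n (- gamma) => /measurable_EFinP m.
  exact: (measurableT_comp m).
apply: (measurableT_comp (measurable_powR _)); exact: measurableT_comp.
Qed.

Lemma measurable_nonlinearity v : measurable_fun [set: E] v -> measurable_fun [set: E] (F v).
Proof.
move=> mv; apply: measurable_funM => //; apply: measurable_funM.
  by have := @measurable_enorm_powR R n (- gamma) => /measurable_EFinP.
by apply: (measurableT_comp (measurable_powR _)); exact: measurableT_comp.
Qed.

Lemma absE_nonlinearity v y : absE (F v) y = pot beta gamma (absE v) y * absE v y.
Proof.
rewrite /absE /nonlinearity /pot !normrM !(ger0_norm (powR_ge0 _ _)).
by rewrite poweR_EFin -!EFinM.
Qed.

Lemma le_pot (g h : E -> \bar R) y : 0 <= g y -> g y <= h y -> pot beta gamma g y <= pot beta gamma h y.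
Proof.
move=> g0 gh; rewrite /pot lee_wpmul2l ?lee_fin ?powR_ge0//.
apply: gt0_ler_poweR => //; rewrite ?in_itv/= ?leey ?andbT ?(le_trans g0 gh)//.
exact: ltW.
Qed.

Lemma potZ (k : R) (h : E -> \bar R) y : (0 <= k)%R -> 0 <= h y ->
  pot beta gamma (fun z => k%:E * h z) y = (k `^ beta)%:E * pot beta gamma h y.
Proof. by move=> k0 h0; rewrite /pot poweRM ?lee_fin// poweR_EFin muleCA. Qed.

Lemma nonlinearity_le v (d : E -> \bar R) (B : R) y : (0 <= B)%R -> 0 <= d y ->
  absE v y <= B%:E * d y ->
  absE (F v) y <= (B `^ beta * B)%:E * (pot beta gamma d y * d y).
Proof.
move=> B0 d0 vB; rewrite absE_nonlinearity EFinM muleACA -potZ//.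
by apply: lee_pmul; rewrite ?pot_ge0 ?absE_ge0//; apply: le_pot; rewrite ?absE_ge0.
Qed.

Lemma nonlinearityB_le v w y :
  absE (fun z => F v z - F w z)%R y <=
  (lip_const beta)%:E * ((pot beta gamma (absE v) y + pot beta gamma (absE w) y) *
     absE (fun z => v z - w z)%R y).
Proof.
have E (z : E -> R) : pot beta gamma (absE z) y = (enorm y `^ (- gamma) * `|z y| `^ beta)%:E.
  by rewrite /pot /absE poweR_EFin -EFinM.
rewrite !E /absE /nonlinearity -EFinD -!EFinM lee_fin.
have -> : (enorm y `^ (- gamma) * `|v y| `^ beta * v y - enorm y `^ (- gamma) * `|w y| `^ beta * w y =
  enorm y `^ (- gamma) * (`|v y| `^ beta * v y - `|w y| `^ beta * w y))%R by ring.
rewrite normrM (ger0_norm (powR_ge0 _ _)).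
have := abs_powR_mul_lip (v y) (w y) beta0; set c := (enorm y `^ _)%R => H.
have c0 : (0 <= c)%R by exact: powR_ge0.
apply: (le_trans (ler_wpM2l c0 H)); rewrite le_eqVlt; apply/orP; left; apply/eqP; ring.
Qed.

Lemma nonlinearityB_dominated v w (d : E -> \bar R) (B e : R) y : (0 <= B)%R -> (0 <= e)%R -> 0 <= d y ->
  absE v y <= B%:E * d y -> absE w y <= B%:E * d y ->
  absE (fun z => v z - w z)%R y <= e%:E * d y ->
  absE (fun z => F v z - F w z)%R y <=
    (lip_const beta * (2 * B `^ beta) * e)%:E * (pot beta gamma d y * d y).
Proof.
move=> B0 e0 d0 vB wB vw; apply: (le_trans (nonlinearityB_le v w y)).
have p0 (g : E -> \bar R) := pot_ge0 beta gamma g y.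
rewrite -mulrA EFinM -muleA lee_wpmul2l ?lee_fin//.
have hp (v' : E -> R) : absE v' y <= B%:E * d y ->
    pot beta gamma (absE v') y <= (B `^ beta)%:E * pot beta gamma d y.
  by move=> h; rewrite -potZ//; apply: le_pot; rewrite ?absE_ge0.
apply: (@le_trans _ _ (((2 * B `^ beta)%:E * pot beta gamma d y) * (e%:E * d y))).
  apply: lee_pmul; rewrite ?adde_ge0 ?absE_ge0//.
  rewrite mulr_natl mulr2n EFinD ge0_muleDl ?lee_fin ?powR_ge0//.
  by apply: leeD; exact: hp.
by rewrite EFinM muleACA.
Qed.

End nonlinearity_bounds.

(** * Picard iteration *)

Section geometric_increments.
Context {R : realType}.

(** Adding or subtracting the tail [e m] of the geometric bound makes the sequence monotone, which
    yields the limit and the error estimate together. *)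
Lemma geometric_increments_cvg (v : nat -> R) (d : R) : 0 <= d ->
  (forall m, `|v m.+1 - v m| <= 2^-1 ^+ m * d) ->
  exists2 l : R, v m @[m --> \oo] --> l & forall m, `|l - v m| <= 2 * 2^-1 ^+ m * d.
Proof.
move=> d0 H; pose e m := 2 * 2^-1 ^+ m * d : R.
have eS m : e m - e m.+1 = 2^-1 ^+ m * d by rewrite /e exprS; field.
have e0 m : 0 <= e m by rewrite !mulr_ge0// exprn_ge0.
have el : e m @[m --> \oo] --> (0 : R).
  rewrite (_ : e = geometric (2 * d) 2^-1); last by apply/funext => m; rewrite /e/= mulrAC.
  by apply: cvg_geometric; rewrite ger0_norm// invf_lt1// ltr1n.
pose w m := v m + e m; pose z m := v m - e m.
have ndz : nondecreasing_seq z.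
  apply/nondecreasing_seqP => m; rewrite /z; have := H m; have := eS m.
  by rewrite ler_norml => E /andP[h1 h2]; lra.
have niw : nonincreasing_seq w.
  apply/nonincreasing_seqP => m; rewrite /w; have := H m; have := eS m.
  by rewrite ler_norml => E /andP[h1 h2]; lra.
have cw : cvgn w.
  apply: nonincreasing_is_cvgn => //; exists (z 0%N) => _ [m _ <-].
  by apply: (le_trans (ndz 0%N m (leq0n m))); rewrite /z /w; have := e0 m; lra.
have vl : v m @[m --> \oo] --> limn w.
  rewrite -[limn w]subr0 (_ : v = fun m => w m - e m); last by apply/funext => m; rewrite /w addrK.
  exact: cvgB.
have zl : z m @[m --> \oo] --> limn w by rewrite -[limn w]subr0; exact: cvgB.
exists (limn w) => // m; rewrite -/(e m) ler_norml; apply/andP; split.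
  have := nondecreasing_cvgn_le ndz (cvgP _ zl) m.
  by rewrite (cvg_lim _ zl)// /z; lra.
have := nonincreasing_cvgn_ge niw cw m.
by rewrite {2}/w; lra.
Qed.

End geometric_increments.

(** * Picard iterates below the free evolution *)

Section picard.
Context {R : realType} {n : nat}.
Local Notation E := (Rspace R n).
Local Open Scope ereal_scope.
Variables (a beta gamma b : R) (u0 : E -> R).
Hypotheses (beta0 : (0 < beta)%R) (mu0 : measurable_fun [set: E] u0).
Local Notation F := (@nonlinearity R n gamma beta).
Local Notation g := (absE u0).
Local Notation D t := (eheat (t - b) g).

Fixpoint picard (m : nat) (t : R) (x : E) : R :=
  if m is k.+1 then (heat (t - b) u0 x + a * rduh b t (fun tau => F (picard k tau)) x)%R
  else heat (t - b) u0 x.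

Lemma jointly_measurable_heat : jointly_measurable (fun t => heat (t - b) u0).
Proof.
apply: (@measurable_heat_param R n _ (R * E)%type (fun z => z.1 - b)%R snd (fun=> u0)) => //.
- exact: measurable_funB.
- exact: measurableT_comp.
Qed.

Lemma jointly_measurable_picard m : jointly_measurable (picard m).
Proof.
elim: m => [|m IH]; first exact: jointly_measurable_heat.
apply: measurable_funD; first exact: jointly_measurable_heat.
apply: measurable_funM => //; apply: measurable_rduh.
exact: jointly_measurable_nonlinearity.
Qed.

Let mg : measurable_fun [set: E] g. Proof. exact: measurable_absE. Qed.
Let g0 : forall x, 0 <= g x. Proof. exact: absE_ge0. Qed.
Let D0 t x : 0 <= D t x. Proof. exact: eheat_ge0. Qed.

(** [k0] is the factor by which the Duhamel operator shrinks the free evolution up to time [T];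
    [small] then makes the nonlinear map a contraction of ratio 1/2 on functions bounded by
    [2 D]. *)
Variables (T k0 : R).
Hypotheses (k00 : (0 <= k0)%R)
  (small : (`|a| * (lip_const beta * (2 * 2 `^ beta)) * k0 <= 2^-1)%R)
  (dom : forall t x, (b <= t <= T)%R -> duh b t (dominant beta gamma b g) x <= k0%:E * D t x).

Let mdom : measurable_fun [set: R * E] (fun z => dominant beta gamma b g z.1 z.2).
Proof. exact: measurable_dominant. Qed.

Lemma dominated_duh_le f c t x : jointly_measurable f -> (0 <= c)%R -> (b <= t <= T)%R ->
  (forall tau y, (b < tau < t)%R -> absE (f tau) y <= c%:E * dominant beta gamma b g tau y) ->
  duh b t (fun tau => absE (f tau)) x <= (c * k0)%:E * D t x.
Proof.
move=> mf c0 tT H; apply: (@le_trans _ _ (duh b t (fun tau y => c%:E * dominant beta gamma b g tau y) x)).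
  apply: le_duh => //.
  - exact: jointly_measurable_absE.
  - exact: measurable_funeM.
  - by move=> tau y; exact: absE_ge0.
  - by move=> tau y; rewrite mule_ge0// dominant_ge0.
  - by move=> tau bt; apply: aeW => y; exact: H.
rewrite duhZ//; last by move=> tau y; exact: dominant_ge0.
by rewrite EFinM -muleA lee_wpmul2l//; exact: dom.
Qed.

Let L2 : (0 <= 2 `^ beta * 2 <= lip_const beta * (2 * 2 `^ beta))%R.
Proof.
have p0 : (0 <= 2 `^ beta * 2 :> R)%R by rewrite mulr_ge0 ?powR_ge0.
by rewrite p0/= [X in (_ <= _ * X)%R]mulrC ler_peMl// lip_const_ge1.
Qed.

Lemma abs_nonlinearity_dom v tau y : absE v y <= 2%:E * D tau y ->
  absE (F v) y <= (2 `^ beta * 2)%:E * dominant beta gamma b g tau y.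
Proof. by move=> H; apply: nonlinearity_le => //; exact: D0. Qed.

Lemma duhamel_term_le (u : R -> E -> R) t x : jointly_measurable u -> (b <= t <= T)%R ->
  (forall tau y, (b < tau < t)%R -> absE (u tau) y <= 2%:E * D tau y) ->
  duh b t (fun tau => absE (F (u tau))) x <= ((2 `^ beta * 2) * k0)%:E * D t x.
Proof.
move=> mu_ tT H; apply: dominated_duh_le => //.
- exact: jointly_measurable_nonlinearity.
- by move=> tau y bt; apply: abs_nonlinearity_dom; exact: H.
Qed.

Lemma duhamel_term_small (u : R -> E -> R) t x : jointly_measurable u -> (b <= t <= T)%R ->
  (forall tau y, (b < tau < t)%R -> absE (u tau) y <= 2%:E * D tau y) ->
  `|a * rduh b t (fun tau => F (u tau)) x|%:E <= D t x.
Proof.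
move=> mu_ tT H; rewrite normrM EFinM.
apply: (@le_trans _ _ (`|a|%:E * (((2 `^ beta * 2) * k0)%:E * D t x))).
  rewrite lee_wpmul2l//; apply: le_trans (duhamel_term_le x mu_ tT H).
  by apply: abs_rduh_le; exact: jointly_measurable_nonlinearity.
rewrite muleA -EFinM -[leRHS]mul1e lee_wpmul2r//= lee_fin mulrA.
have /andP[p0 p1] := L2; apply: (@le_trans _ _ (2^-1)%R); last by rewrite invf_le1 ?ler1n.
by apply: le_trans small; rewrite ler_wpM2r// ler_wpM2l.
Qed.

Lemma picard_le m t x : (b <= t <= T)%R -> absE (picard m t) x <= 2%:E * D t x.
Proof.
elim: m t x => [|m IH] t x tT.
  apply: (le_trans (abs_heat_le _ _ mu0)); rewrite -[leLHS]mul1e lee_wpmul2r//.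
  by rewrite lee_fin ler1n.
rewrite (_ : 2%:E = 1 + 1)// ge0_muleDl// !mul1e.
apply: (@le_trans _ _ (`|heat (t - b) u0 x|%:E + `|a * rduh b t (fun tau => F (picard m tau)) x|%:E)).
  by rewrite -EFinD lee_fin ler_normD.
apply: leeD; first exact: abs_heat_le.
apply: duhamel_term_small => //; first exact: jointly_measurable_picard.
have /andP[bt tT1] := tT.
by move=> tau y /andP[h1 h2]; apply: IH; rewrite (ltW h1) (le_trans (ltW h2)).
Qed.

(** A contraction with errors measured as multiples of the free evolution. Finiteness of [D t x]
    makes both Duhamel integrals converge absolutely at [x], so that their difference is the
    integral of the difference. *)
Lemma rduh_increment_le (u v : R -> E -> R) e t x : jointly_measurable u -> jointly_measurable v ->
  (0 <= e)%R -> (b <= t <= T)%R -> D t x < +oo ->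
  (forall tau y, (b < tau < t)%R -> absE (u tau) y <= 2%:E * D tau y) ->
  (forall tau y, (b < tau < t)%R -> absE (v tau) y <= 2%:E * D tau y) ->
  (forall tau y, (b < tau < t)%R -> absE (fun z => u tau z - v tau z)%R y <= e%:E * D tau y) ->
  `|a * rduh b t (fun tau => F (u tau)) x - a * rduh b t (fun tau => F (v tau)) x|%:E <=
  (2^-1 * e)%:E * D t x.
Proof.
move=> mu_ mv e0 tT Doo Hu Hv Huv; rewrite -mulrBr normrM EFinM.
have jF w : jointly_measurable w -> jointly_measurable (fun tau => F (w tau)).
  exact: jointly_measurable_nonlinearity.
have fin w : jointly_measurable w ->
    (forall tau y, (b < tau < t)%R -> absE (w tau) y <= 2%:E * D tau y) ->
    duh b t (fun tau => absE (F (w tau))) x < +oo.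
  move=> mw Hw; apply: (le_lt_trans (duhamel_term_le x mw tT Hw)).
  apply: lte_mul_pinfty => //; rewrite lee_fin mulr_ge0//; by have /andP[] := L2.
rewrite -rduhB//; [|exact: jF|exact: jF|exact: fin|exact: fin].
have C0 : (0 <= lip_const beta * (2 * 2 `^ beta) * e)%R.
  by rewrite !mulr_ge0 ?powR_ge0// (le_trans ler01)// lip_const_ge1.
apply: (@le_trans _ _ (`|a|%:E * ((lip_const beta * (2 * 2 `^ beta) * e * k0)%:E * D t x))).
  rewrite lee_wpmul2l//.
  have mFB : jointly_measurable (fun tau y => F (u tau) y - F (v tau) y)%R.
    by apply: measurable_funB; exact: jF.
  apply: (le_trans (abs_rduh_le _ _ _ mFB)); apply: dominated_duh_le => //.
  move=> tau y bt; apply: nonlinearityB_dominated => //; [exact: Hu|exact: Hv|exact: Huv].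
rewrite muleA -EFinM lee_wpmul2r// lee_fin.
have -> : (`|a| * (lip_const beta * (2 * 2 `^ beta) * e * k0) =
  `|a| * (lip_const beta * (2 * 2 `^ beta)) * k0 * e)%R by ring.
by rewrite ler_wpM2r.
Qed.

Lemma picardB_le m t x : (b <= t <= T)%R ->
  absE (fun z => picard m.+1 t z - picard m t z)%R x <= (2^-1 ^+ m)%:E * D t x.
Proof.
elim: m t x => [|m IH] t x tT.
  rewrite expr0 mul1e /absE /= addrAC subrr add0r.
  apply: duhamel_term_small => //; first exact: jointly_measurable_heat.
  have /andP[bt tT1] := tT.
  by move=> tau y /andP[h1 h2]; apply: (picard_le 0); rewrite (ltW h1) (le_trans (ltW h2)).
have [->|] := eqVneq (D t x) +oo.
  by rewrite mulry gtr0_sg ?exprn_gt0// mul1e leey.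
rewrite -ltey => Doo; have /andP[bt tT1] := tT.
have ok tau : (b < tau < t)%R -> (b <= tau <= T)%R.
  by move=> /andP[h1 h2]; rewrite (ltW h1) (le_trans (ltW h2)).
rewrite exprS /absE.
have -> : (picard m.+2 t x - picard m.+1 t x =
  a * rduh b t (fun tau => F (picard m.+1 tau)) x - a * rduh b t (fun tau => F (picard m tau)) x)%R.
  by rewrite /=; ring.
apply: rduh_increment_le => //; try exact: jointly_measurable_picard.
- by move=> tau y /ok; exact: picard_le.
- by move=> tau y /ok; exact: picard_le.
- by move=> tau y /ok; exact: IH.
Qed.

(** The limit superior is defined and jointly measurable everywhere, including where the free
    evolution is infinite and the iterates are not controlled. *)
Definition picard_lim (t : R) (x : E) : R := fine (limn_esup (fun m => (picard m t x)%:E)).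

Lemma jointly_measurable_picard_lim : jointly_measurable picard_lim.
Proof.
apply: measurableT_comp => //.
apply: (@measurable_fun_limn_esup _ _ R setT (fun m (z : R * E) => (picard m z.1 z.2)%:E)) => m.
by apply/measurable_EFinP; exact: jointly_measurable_picard.
Qed.

Lemma picard_lim_spec t x : (b <= t <= T)%R -> D t x < +oo ->
  picard m t x @[m --> \oo] --> picard_lim t x /\
  forall m, absE (fun z => picard_lim t z - picard m t z)%R x <= (2 * 2^-1 ^+ m)%:E * D t x.
Proof.
move=> tT Doo; have Dfin : D t x \is a fin_num by rewrite ge0_fin_numE.
have d0 : (0 <= fine (D t x))%R by rewrite fine_ge0.
have inc m : (`|picard m.+1 t x - picard m t x| <= 2^-1 ^+ m * fine (D t x))%R.
  by have := picardB_le m x tT; rewrite -(fineK Dfin) -EFinM lee_fin.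
have [l vl Hl] := geometric_increments_cvg d0 inc.
have lE : picard_lim t x = l.
  have cl : (picard m t x)%:E @[m --> \oo] --> l%:E.
    by apply: cvg_EFin; [exact: nearW|exact: vl].
  by rewrite /picard_lim is_cvg_limn_esupE ?(cvg_lim _ cl)//; apply/cvg_ex; exists l%:E.
by rewrite lE; split => // m; rewrite /absE lE -(fineK Dfin) -EFinM lee_fin.
Qed.

Lemma picard_limB_le m t x : (b <= t <= T)%R ->
  absE (fun z => picard_lim t z - picard m t z)%R x <= (2 * 2^-1 ^+ m)%:E * D t x.
Proof.
move=> tT; have [->|] := eqVneq (D t x) +oo.
  by rewrite mulry gtr0_sg ?mulr_gt0 ?exprn_gt0// mul1e leey.
by rewrite -ltey => Doo; have [_] := picard_lim_spec tT Doo; exact.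
Qed.

Lemma picard_lim_le t x : (b <= t <= T)%R -> absE (picard_lim t) x <= 2%:E * D t x.
Proof.
move=> tT; have [->|] := eqVneq (D t x) +oo.
  by rewrite mulry gtr0_sg// mul1e leey.
rewrite -ltey => Doo; have [cv _] := picard_lim_spec tT Doo.
have Dfin : D t x \is a fin_num by rewrite ge0_fin_numE.
rewrite -(fineK Dfin) -EFinM lee_fin.
have cn : `|picard m t x|%R @[m --> \oo] --> `|picard_lim t x|%R by exact: cvg_norm.
rewrite -(cvg_lim _ cn)//; apply: limr_le; first by apply/cvg_ex; eexists; exact: cn.
by apply: nearW => m; have := picard_le m x tT; rewrite -(fineK Dfin) -EFinM lee_fin.
Qed.

(** No limit is taken under the integral: the contraction estimate applied to the limit and an
    iterate, both bounded by [2 D], shows that the two sides differ by at most [4 * 2^-1 ^+ m * d]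
    for every [m]. *)
Lemma picard_lim_eq t x : (b <= t <= T)%R -> D t x < +oo ->
  picard_lim t x = (heat (t - b) u0 x + a * rduh b t (fun tau => F (picard_lim tau)) x)%R.
Proof.
move=> tT Doo; have Dfin : D t x \is a fin_num by rewrite ge0_fin_numE.
set rhs := (RHS); apply/eqP; rewrite -subr_eq0 -normr_le0; apply/ler_addgt0Pr => e e0.
rewrite add0r; set d := fine (D t x); have d0 : (0 <= d)%R by rewrite fine_ge0.
have /andP[bt tT1] := tT.
have ok tau : (b < tau < t)%R -> (b <= tau <= T)%R.
  by move=> /andP[h1 h2]; rewrite (ltW h1) (le_trans (ltW h2)).
have H m : (`|picard_lim t x - rhs| <= 4 * 2^-1 ^+ m * d)%R.
  have h1 := picard_limB_le m.+1 x tT.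
  have h2 : `|picard m.+1 t x - rhs|%:E <= (2^-1 * (2 * 2^-1 ^+ m))%:E * D t x.
    rewrite /rhs /= opprD addrACA subrr add0r distrC.
    apply: rduh_increment_le => //.
    - exact: jointly_measurable_picard_lim.
    - exact: jointly_measurable_picard.
    - by move=> tau y /ok; exact: picard_lim_le.
    - by move=> tau y /ok; exact: picard_le.
    - by move=> tau y /ok; exact: picard_limB_le.
  move: h1 h2; rewrite /absE -(fineK Dfin) -!EFinM !lee_fin -/d exprS => h1 h2.
  have := ler_distD (picard m.+1 t x) (picard_lim t x) rhs.
  have : (0 <= 2^-1 ^+ m * d)%R by rewrite mulr_ge0 ?exprn_ge0.
  move: h1 h2; rewrite (_ : 2 * (2^-1 * 2^-1 ^+ m) * d = 2^-1 ^+ m * d)%R; last by field.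
  rewrite (_ : 2^-1 * (2 * 2^-1 ^+ m) * d = 2^-1 ^+ m * d)%R; last by field.
  by rewrite -[(4 * _ * d)%R]mulrA; lra.
have gl : (geometric (4 * d) 2^-1 m)%R @[m --> \oo] --> (0%R : R).
  by apply: cvg_geometric; rewrite ger0_norm// invf_lt1// ltr1n.
have [N _ HN] := (cvgr0Pnorm_le _).1 gl e e0.
apply: (le_trans (H N)); have := HN N (leqnn N); rewrite /= ger0_norm; first by rewrite mulrAC.
by rewrite !mulr_ge0 ?exprn_ge0.
Qed.

End picard.

(** * Heat flow of a Duhamel integral *)

Section duhamel_shift.
Context {R : realType} {n : nat}.
Local Notation E := (Rspace R n).
Local Notation mu := (@lebesgue_space R n).
Local Notation leb := (@lebesgue_measure R).
Local Open Scope ereal_scope.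
Implicit Types f : R -> E -> R.

Lemma duh_subset b t0 t f x : (b <= t0 <= t)%R -> jointly_measurable f ->
  \int[leb]_(tau in `]b, t0[) eheat (t - tau) (absE (f tau)) x <= duh b t (fun tau => absE (f tau)) x.
Proof.
move=> /andP[bt0 t0t] mf; apply: ge0_subset_integral => //.
- by apply: measurable_funTS; apply: measurable_duh_integrand; exact: jointly_measurable_absE.
- by move=> tau _; apply: eheat_ge0; exact: absE_ge0.
- by move=> tau /=; rewrite !in_itv/= => /andP[-> /lt_le_trans ->].
Qed.

Lemma rduh_split b t0 t f x : (b <= t0 < t)%R -> jointly_measurable f ->
  duh b t (fun tau => absE (f tau)) x < +oo ->
  rduh b t f x = (\int[leb]_(tau in `]b, t0[) heat (t - tau) (f tau) x + rduh t0 t f x)%R.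
Proof.
move=> /andP[bt0 t0t] mf foo; have fi := integrable_rduh mf foo.
rewrite Rintegral_itv_bndo_bndc; last first.
  apply: integrableS fi => //; move=> tau /=; rewrite !in_itv/= => /andP[-> h].
  exact: lt_trans t0t.
have := @Rintegral_itvB R (fun tau => heat (t - tau) (f tau) x) (BRight b) (BLeft t) t0 fi.
rewrite !bnd_simp => /(_ bt0 t0t) E1.
by rewrite /rduh -E1 addrC subrK.
Qed.

(** By Tonelli and the semigroup law, the flow of a Duhamel integral up to [t0] is the part over
    []b, t0[] of the Duhamel integral at time [t]. *)
Lemma eheat_duh_le b t0 t f x : (b <= t0 < t)%R -> jointly_measurable f ->
  eheat (t - t0) (duh b t0 (fun tau => absE (f tau))) x <= duh b t (fun tau => absE (f tau)) x.
Proof.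
move=> /andP[bt0 t0t] mf; have ma := jointly_measurable_absE mf.
have tt0 : (0 < t - t0)%R by rewrite subr_gt0.
have t0t' : (b <= t0 <= t)%R by rewrite bt0 ltW.
apply: le_trans (duh_subset x t0t' mf).
rewrite eheatE// /duh.
pose k (w : E * R) : \bar R := if (b < w.2 < t0)%R
  then (hker (t - t0) x w.1)%:E * eheat (t0 - w.2) (absE (f w.2)) w.1 else 0.
have mk : measurable_fun [set: E * R] k.
  apply: measurable_fun_if => //.
  - by apply: measurable_and; exact: measurable_fun_ltr.
  - apply: measurable_funTS; apply: emeasurable_funM.
      by apply/measurable_EFinP; exact: measurable_hker.
    apply: (@measurable_eheat_param R n _ (E * R)%type (fun w => t0 - w.2)%R fst (fun w => absE (f w.2))) => //.
    + exact: measurable_funB.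
    + apply: (measurableT_comp (f := fun z : R * E => absE (f z.1) z.2)
        (g := fun w : (E * R) * E => (w.1.2, w.2))) => //.
      by apply: measurable_fun_pair => //; exact: measurableT_comp.
have k0 w : 0 <= k w.
  rewrite /k; case: ifP => // _; rewrite mule_ge0 ?lee_fin ?hker_ge0// eheat_ge0//.
  exact: absE_ge0.
have -> : \int[mu]_y ((hker (t - t0) x y)%:E * \int[leb]_(tau in `]b, t0[) eheat (t0 - tau) (absE (f tau)) y) =
    \int[mu]_y \int[leb]_tau k (y, tau).
  apply: eq_integral => y _; rewrite -ge0_integralZl//; last 3 first.
  - by apply: measurable_funTS; exact: measurable_duh_integrand.
  - by move=> tau _; apply: eheat_ge0; exact: absE_ge0.
  - by rewrite lee_fin hker_ge0.
  rewrite integral_mkcond; apply: eq_integral => tau _.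
  by rewrite patchE mem_setE/= in_itv.
rewrite (@fubini_tonelli _ _ _ _ R mu leb k mk k0) [leRHS]integral_mkcond.
apply: ge0_le_integral => //.
- by move=> tau _; exact: integral_ge0.
- have := @measurable_fun_fubini_tonelli_G _ _ _ _ R mu k mk k0; exact.
- apply/(measurable_restrictT _ _).1 => //.
  by apply: measurable_funTS; exact: measurable_duh_integrand.
move=> tau _; rewrite patchE mem_setE/= in_itv/= /k/=; case: ifPn => [/andP[h1 h2]|_]; last by rewrite integral0.
have t0tau : (0 < t0 - tau)%R by rewrite subr_gt0.
rewrite -eheatE// eheat_semigroup//.
- by have -> : (t0 - tau + (t - t0) = t - tau)%R by ring.
- by apply: measurable_absE; exact: jointly_measurable_fix.
- exact: absE_ge0.
Qed.

Lemma measurable_duh_fix b t0 f : jointly_measurable f ->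
  measurable_fun [set: E] (duh b t0 (fun tau => absE (f tau))).
Proof.
move=> mf; have ma := jointly_measurable_absE mf.
rewrite /duh; under eq_fun do rewrite integral_mkcond.
pose h (w : E * R) : \bar R := if (b < w.2 < t0)%R
  then eheat (t0 - w.2) (absE (f w.2)) w.1 else 0.
have -> : (fun y => \int[leb]_tau ((fun tau => eheat (t0 - tau) (absE (f tau)) y) \_ `]b, t0[) tau) =
    (fun y => \int[leb]_tau h (y, tau)).
  by apply/funext => y; apply: eq_integral => tau _; rewrite patchE mem_setE/= in_itv.
apply: (@measurable_int_param R _ _ _ _ leb h); apply: measurable_fun_if => //.
- by apply: measurable_and; exact: measurable_fun_ltr.
- apply: measurable_funTS.
  apply: (@measurable_eheat_param R n _ (E * R)%type (fun w => t0 - w.2)%R fst (fun w => absE (f w.2))) => //.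
  + exact: measurable_funB.
  + apply: (measurableT_comp (f := fun z : R * E => absE (f z.1) z.2)
      (g := fun w : (E * R) * E => (w.1.2, w.2))) => //.
    by apply: measurable_fun_pair => //; exact: measurableT_comp.
Qed.

(** Signed form of the same exchange. Absolute convergence at the single point [x] supplies both the
    integrability for Fubini and, through [eheat_lty_ae], convergence of the inner integrals almost
    everywhere. *)
Lemma heat_rduh b t0 t f x : (b <= t0 < t)%R -> jointly_measurable f ->
  duh b t (fun tau => absE (f tau)) x < +oo ->
  heat (t - t0) (rduh b t0 f) x = (\int[leb]_(tau in `]b, t0[) heat (t - tau) (f tau) x)%R.
Proof.
move=> bt0t mf foo; have ma := jointly_measurable_absE mf; have /andP[bt0 t0t] := bt0t.
have tt0 : (0 < t - t0)%R by rewrite subr_gt0.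
have t0t' : (b <= t0 <= t)%R by rewrite bt0 ltW.
pose k (w : E * R) : \bar R := if (b < w.2 < t0)%R
  then (hker (t - t0) x w.1 * heat (t0 - w.2) (f w.2) w.1)%:E else 0.
have mk : measurable_fun [set: E * R] k.
  apply: measurable_fun_if => //.
  - by apply: measurable_and; exact: measurable_fun_ltr.
  - apply: measurable_funTS; apply/measurable_EFinP; apply: measurable_funM.
      exact: measurable_hker.
    apply: (@measurable_heat_param R n _ (E * R)%type (fun w => t0 - w.2)%R fst (fun w => f w.2)) => //.
    + exact: measurable_funB.
    + apply: (measurableT_comp (f := fun z : R * E => f z.1 z.2)
        (g := fun w : (E * R) * E => (w.1.2, w.2))) => //.
      by apply: measurable_fun_pair => //; exact: measurableT_comp.
have eoo : eheat (t - t0) (duh b t0 (fun tau => absE (f tau))) x < +oo.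
  exact: le_lt_trans (eheat_duh_le _ _ _) foo.
have mduh : measurable_fun [set: E] (duh b t0 (fun tau => absE (f tau))) by exact: measurable_duh_fix.
have d0 y : 0 <= duh b t0 (fun tau => absE (f tau)) y by apply: duh_ge0 => tau z; exact: absE_ge0.
have aefin : {ae mu, forall y, duh b t0 (fun tau => absE (f tau)) y < +oo}.
  exact: eheat_lty_ae eoo.
have ik : (mu \x leb).-integrable setT k.
  apply/(integrable12ltyP mu leb) => //; apply: le_lt_trans eoo; rewrite eheatE//.
  apply: ge0_le_integral => //.
  - by move=> y _; exact: integral_ge0.
  - apply: (@measurable_int_param _ _ _ _ _ leb (fun z => `|k z|)).
    exact: measurableT_comp.
  - exact: measurable_hkerg.
  move=> y _; rewrite -ge0_integralZl//; last 3 first.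
  - by apply: measurable_funTS; exact: measurable_duh_integrand.
  - by move=> tau _; apply: eheat_ge0; exact: absE_ge0.
  - by rewrite lee_fin hker_ge0.
  rewrite [leRHS]integral_mkcond; apply: ge0_le_integral => //.
  - have := measurableT_comp mk (measurable_pair1 y); exact: measurableT_comp.
  - apply/(measurable_restrictT _ _).1 => //; apply: measurable_funTS.
    by apply: measurable_funeM; exact: measurable_duh_integrand.
  move=> tau _; rewrite patchE mem_setE/= in_itv/= /k/=; case: ifPn => _; last by rewrite abse0.
  rewrite /= normrM ger0_norm ?hker_ge0// EFinM lee_wpmul2l ?lee_fin ?hker_ge0//.
  by apply: abs_heat_le; exact: jointly_measurable_fix.
rewrite heatE// /Rintegral; congr fine.
transitivity (\int[mu]_y \int[leb]_tau k (y, tau)).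
  apply: ae_eq_integral => //.
  - apply/measurable_EFinP; apply: measurable_hkerf.
    exact: (jointly_measurable_fix t0 (measurable_rduh b mf)).
  - exact: (@measurable_int_param _ _ _ _ _ leb k).
  apply: filterS aefin => y yoo _; have iy := integrable_rduh mf yoo.
  rewrite EFinM /rduh /Rintegral fineK; last exact: integrable_fin_num.
  rewrite -integralZl// integral_mkcond; apply: eq_integral => tau _.
  by rewrite patchE mem_setE/= in_itv.
rewrite (Fubini ik) [RHS]integral_mkcond.
have foo2 := le_lt_trans (duh_subset x t0t' mf) foo.
apply: ae_eq_integral => //.
- have := @measurable_int_param _ _ (measurableTypeR R) _ E mu (fun w => k (w.2, w.1)).
  by apply; apply: (measurableT_comp mk); exact: measurable_fun_pair.
- apply/(measurable_restrictT _ _).1 => //; apply: measurable_funTS; apply/measurable_EFinP.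
  exact: measurable_heat_integrand.
have := eheat_lty_time ma (fun tau => absE_ge0 (f tau)) foo.
apply: filterS => tau ft _; rewrite patchE mem_setE/= in_itv/= /k/=.
case: ifPn => [/andP[h1 h2]|_]; last by rewrite integral0.
have t0tau : (0 < t0 - tau)%R by rewrite subr_gt0.
have mft := jointly_measurable_fix tau mf.
have ftt : eheat (t - tau) (absE (f tau)) x < +oo.
  by apply: ft; rewrite /= in_itv/= h1 (lt_trans h2).
have E1 : (t0 - tau + (t - t0) = t - tau)%R by ring.
rewrite -E1 in ftt *; rewrite -heat_semigroup// [in RHS]heatE// fineK//.
apply: integrable_fin_num => //; apply: integrable_heat => //; first exact: measurable_heat.
apply: le_lt_trans ftt.
rewrite -(eheat_semigroup x t0tau tt0 (measurable_absE mft) (absE_ge0 (f tau))).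
apply: le_eheat.
- by apply: measurable_absE; exact: measurable_heat.
- by apply: measurable_eheat; [exact: measurable_absE|exact: absE_ge0].
- exact: absE_ge0.
- by move=> y; exact: abs_heat_le.
Qed.

End duhamel_shift.

(** * Solutions dominated by the free evolution *)

Section strong_solutions.
Context {R : realType} {n : nat}.
Local Notation E := (Rspace R n).
Local Notation mu := (@lebesgue_space R n).
Local Notation leb := (@lebesgue_measure R).
Local Open Scope ereal_scope.

Lemma heat_ae_eq t (f g : E -> R) x : (0 < t)%R -> measurable_fun [set: E] f ->
  measurable_fun [set: E] g -> {ae mu, forall y, f y = g y} -> heat t f x = heat t g x.
Proof.
move=> t0 mf mg fg; rewrite !heatE//; congr fine; apply: ae_eq_integral => //.
- by apply/measurable_EFinP; exact: measurable_hkerf.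
- by apply/measurable_EFinP; exact: measurable_hkerf.
- by apply: filterS fg => y -> _.
Qed.

Lemma heat_semigroup0 (t1 t2 : R) (f : E -> R) x : (0 <= t1)%R -> (0 < t2)%R ->
  measurable_fun [set: E] f -> eheat (t1 + t2) (absE f) x < +oo ->
  heat t2 (heat t1 f) x = heat (t1 + t2) f x.
Proof.
rewrite le_eqVlt => /predU1P[<-|t10] t20 mf; last exact: heat_semigroup.
by rewrite add0r heat0.
Qed.

Lemma eheat_semigroup0 (t1 t2 : R) (g : E -> \bar R) x : (0 <= t1)%R -> (0 <= t2)%R ->
  measurable_fun [set: E] g -> (forall y, 0 <= g y) ->
  eheat t2 (eheat t1 g) x = eheat (t1 + t2) g x.
Proof.
rewrite le_eqVlt => /predU1P[<-|t10]; first by rewrite add0r eheat0.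
rewrite le_eqVlt => /predU1P[<-|t20]; first by rewrite addr0 eheat0.
exact: eheat_semigroup.
Qed.

Lemma rduh_empty c t (f : R -> E -> R) x : (t <= c)%R -> rduh c t f x = 0%R.
Proof.
by move=> tc; rewrite /rduh set_itv_ge ?Rintegral_set0// bnd_simp -leNgt.
Qed.

Lemma duh_empty c t (f : R -> E -> \bar R) x : (t <= c)%R -> duh c t f x = 0.
Proof.
by move=> tc; rewrite /duh set_itv_ge ?integral_set0// bnd_simp -leNgt.
Qed.

Lemma eq_rduh c t (f g : R -> E -> R) x : (forall tau, (c < tau < t)%R -> f tau = g tau) ->
  rduh c t f x = rduh c t g x.
Proof.
move=> fg; apply: eq_Rintegral => tau; rewrite inE/= in_itv/= => /fg.
by move=> ->.
Qed.

Variables (a beta gamma q kappa s : R).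
Hypothesis hp : herz_params (n := n) beta gamma q kappa s.
Local Notation F := (@nonlinearity R n gamma beta).
Local Notation H := (hnorm s q).
Local Notation lam := (lambda (n := n) beta gamma q kappa s).
Let n0 := dim_gt0 hp.
Let beta0 := beta_gt0 hp.

Definition dominated (b T : R) (u0 : E -> R) (u : R -> E -> R) :=
  exists2 B : R, (0 <= B)%R & forall t, (b <= t <= T)%R ->
    {ae mu, forall x, absE (u t) x <= B%:E * eheat (t - b) (absE u0) x}.

Definition satisfies (b : R) (u0 : E -> R) (u : R -> E -> R) (t : R) :=
  {ae mu, forall x, u t x = heat (t - b) u0 x + a * rduh b t (fun tau => F (u tau)) x}%R.

(* Domination by the free evolution is preserved by gluing at an intermediate
   time, which makes it a better class to work in than [wp_class]. *)
Definition strong_solution (b T : R) (u0 : E -> R) (u : R -> E -> R) :=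
  [/\ jointly_measurable u, dominated b T u0 u & forall t, (b <= t <= T)%R -> satisfies b u0 u t].

Lemma eheat_dominant_fin b t u0 : (b <= t)%R -> measurable_fun [set: E] u0 -> H (absE u0) < +oo ->
  {ae mu, forall x, eheat (t - b) (absE u0) x < +oo}.
Proof.
rewrite le_eqVlt => /predU1P[->|bt] m0 u0oo.
  by apply: aeW => x; rewrite subrr eheat0 ltry.
by apply: (eheat_fin_ae n0 (q_gt1 hp) (sq_gt0 hp) (sq_lt hp)) => //; rewrite subr_gt0.
Qed.

(** The initial time [b] is free so that solutions can be restarted, and the length of the interval
    depends on the norm bound [M] alone. *)
Lemma existence : exists2 T : R -> R, (forall M, 0 <= M -> 0 < T M)%R &
  forall (M b : R) u0, (0 <= M)%R -> measurable_fun [set: E] u0 -> H (absE u0) <= M%:E ->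
    exists u, strong_solution b (b + T M) u0 u.
Proof.
have [K K0 HK] := duhamel_bound hp; have l1 := one_sub_lambda hp.
pose A := (`|a| * (lip_const beta * (2 * 2 `^ beta)) * K)%R.
have lc0 : (0 <= lip_const beta)%R by rewrite (le_trans ler01)// lip_const_ge1.
have A0 : (0 <= A)%R by rewrite !mulr_ge0 ?powR_ge0.
(* Obtained by solving [A * M^beta * T^(1 - lam) <= 1/2] for [T]; the added ones keep [Q] positive
   when [a] or [M] is 0. *)
pose Q M := (2 * (1 + A) * (1 + M) `^ beta)%R.
have Q0 M : (0 <= M -> 0 < Q M)%R.
  by move=> M0; rewrite !mulr_gt0 ?powR_gt0 ?ltr_wpDr.
exists (fun M => (Q M)^-1 `^ (1 - lam)^-1)%R.
  by move=> M M0; rewrite powR_gt0// invr_gt0 Q0.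
move=> M b u0 M0 m0 u0M; set T := (_ `^ _)%R.
have T0 : (0 <= T)%R by exact: powR_ge0.
have TE : (T `^ (1 - lam) = (Q M)^-1)%R.
  by rewrite /T -powRrM mulVf ?gt_eqF// powRr1// invr_ge0 ltW// Q0.
pose k0 := (K * M `^ beta * T `^ (1 - lam))%R.
have k00 : (0 <= k0)%R by rewrite !mulr_ge0 ?powR_ge0.
have small : (`|a| * (lip_const beta * (2 * 2 `^ beta)) * k0 <= 2^-1)%R.
  have -> : (`|a| * (lip_const beta * (2 * 2 `^ beta)) * k0 =
     A * M `^ beta * T `^ (1 - lam))%R by rewrite /k0 /A; ring.
  rewrite TE ler_pdivrMr ?Q0// /Q !mulrA mulVf// mul1r.
  apply: ler_pM; rewrite ?powR_ge0//; first by rewrite lerDr.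
  by apply: ge0_ler_powR; rewrite ?nnegrE ?addr_ge0 ?(ltW beta0)// lerDr.
have ma := measurable_absE m0.
have dom t x : (b <= t <= b + T)%R -> duh b t (dominant beta gamma b (absE u0)) x <=
    k0%:E * eheat (t - b) (absE u0) x.
  move=> /andP[]; rewrite le_eqVlt => /predU1P[<-|bt] tT.
    rewrite duh_empty// mule_ge0// eheat_ge0//; exact: absE_ge0.
  have bbt : (b <= b < t)%R by rewrite lexx.
  apply: (le_trans (HK b b t M _ x bbt ma (absE_ge0 u0) M0 u0M)).
  rewrite lee_wpmul2r ?eheat_ge0//; first exact: absE_ge0.
  rewrite lee_fin ler_wpM2l ?mulr_ge0 ?powR_ge0//.
  apply: ge0_ler_powR; [exact: ltW|by rewrite nnegrE subr_ge0 ltW|by rewrite nnegrE|].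
  by rewrite lerBlDl.
have u0oo : H (absE u0) < +oo by rewrite (le_lt_trans u0M)// ltry.
exists (picard_lim a beta gamma b u0); split.
- exact: jointly_measurable_picard_lim.
- by exists 2%R => // t tT; apply: aeW => x; exact: (picard_lim_le beta0 m0 k00 small dom).
- move=> t tT; have /andP[bt _] := tT; apply: filterS (eheat_dominant_fin bt m0 u0oo) => x.
  exact: (picard_lim_eq beta0 m0 k00 small dom).
Qed.

Lemma duh_dominated_le b T u0 u : measurable_fun [set: E] u0 -> H (absE u0) < +oo ->
  jointly_measurable u -> dominated b T u0 u ->
  exists2 C : R, (0 <= C)%R & forall c t x, (b <= c <= t)%R -> (t <= T)%R ->
    duh c t (fun tau => absE (F (u tau))) x <= (C * (t - c) `^ (1 - lam))%:E * eheat (t - b) (absE u0) x.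
Proof.
move=> m0 u0oo ju [B B0 HB]; have [K K0 HK] := duhamel_bound hp.
have ma := measurable_absE m0; have a0 := absE_ge0 u0.
have Nfin : H (absE u0) \is a fin_num by rewrite ge0_fin_numE ?hnorm_ge0.
set N := fine (H (absE u0)).
have N0 : (0 <= N)%R by rewrite fine_ge0 ?hnorm_ge0.
have NE : H (absE u0) <= N%:E by rewrite fineK.
pose B' := (B `^ beta * B)%R; have B'0 : (0 <= B')%R by rewrite mulr_ge0 ?powR_ge0.
exists (B' * (K * N `^ beta))%R; first by rewrite !mulr_ge0 ?powR_ge0.
move=> c t x /andP[bc]; rewrite le_eqVlt => /predU1P[->|ct] tT.
  rewrite duh_empty// mule_ge0 ?eheat_ge0// lee_fin !mulr_ge0 ?powR_ge0//.
have md : measurable_fun [set: R * E] (fun z => dominant beta gamma b (absE u0) z.1 z.2).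
  exact: measurable_dominant.
apply: (@le_trans _ _ (duh c t (fun tau y => B'%:E * dominant beta gamma b (absE u0) tau y) x)).
  apply: le_duh => //.
  - exact: (jointly_measurable_absE (jointly_measurable_nonlinearity beta gamma ju)).
  - exact: measurable_funeM.
  - by move=> tau y; exact: absE_ge0.
  - by move=> tau y; rewrite mule_ge0// dominant_ge0.
  move=> tau /andP[ctau taut].
  have bT : (b <= tau <= T)%R by rewrite (le_trans bc (ltW ctau)) (le_trans (ltW taut)).
  apply: filterS (HB tau bT) => y Hy; apply: nonlinearity_le => //; exact: eheat_ge0.
rewrite duhZ//; last by move=> tau y; exact: dominant_ge0.
rewrite -(mulrA B') (EFinM B') -muleA; apply: lee_wpmul2l => //.
by apply: HK => //; rewrite bc.
Qed.

(** Flowing the equation at time [t0] for a duration [t - t0] gives the equation at time [t] with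
    its Duhamel integral stopped at [t0]. Restarting and gluing both rest on this identity. *)
Lemma heat_solution b T u0 u t0 t : measurable_fun [set: E] u0 -> H (absE u0) < +oo ->
  jointly_measurable u -> dominated b T u0 u -> satisfies b u0 u t0 ->
  (b <= t0 < t)%R -> (t <= T)%R ->
  {ae mu, forall x, duh b t (fun tau => absE (F (u tau))) x < +oo /\
    (heat (t - t0) (u t0) x =
    heat (t - b) u0 x + a * \int[leb]_(tau in `]b, t0[) heat (t - tau) (F (u tau)) x)%R}.
Proof.
move=> m0 u0oo ju du st0 bt0t tT; have /andP[bt0 t0t] := bt0t.
have bt : (b < t)%R by exact: le_lt_trans t0t.
have [C C0 HC] := duh_dominated_le m0 u0oo ju du.
have jF : jointly_measurable (fun tau => F (u tau)) by exact: jointly_measurable_nonlinearity.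
apply: filterS (eheat_dominant_fin (ltW bt) m0 u0oo) => x Dx.
have foo : duh b t (fun tau => absE (F (u tau))) x < +oo.
  apply: (le_lt_trans (HC b t x _ tT)); first by rewrite lexx ltW.
  by apply: lte_mul_pinfty => //; rewrite lee_fin mulr_ge0 ?powR_ge0.
split => //.
have tt0 : (0 < t - t0)%R by rewrite subr_gt0.
have t0b : (0 <= t0 - b)%R by rewrite subr_ge0.
have mh : measurable_fun [set: E] (heat (t0 - b) u0) by exact: measurable_heat.
have mr : measurable_fun [set: E] (rduh b t0 (fun tau => F (u tau))).
  exact: (jointly_measurable_fix t0 (measurable_rduh b jF)).
have mar : measurable_fun [set: E] (fun y => a * rduh b t0 (fun tau => F (u tau)) y)%R.
  exact: measurable_funM.
have E1 : (t0 - b + (t - t0) = t - b)%R by ring.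
have ma := measurable_absE m0.
rewrite (@heat_ae_eq _ _ (fun y => heat (t0 - b) u0 y + a * rduh b t0 (fun tau => F (u tau)) y)%R)//;
  [|exact: jointly_measurable_fix|exact: measurable_funD].
have rfin : eheat (t - t0) (absE (rduh b t0 (fun tau => F (u tau)))) x < +oo.
  apply: le_lt_trans foo; apply: le_trans (eheat_duh_le x bt0t jF).
  rewrite !eheatE//; apply: ge0_le_integral => //.
  - by move=> y _; rewrite mule_ge0 ?absE_ge0// lee_fin hker_ge0.
  - by apply: measurable_hkerg; exact: measurable_absE.
  - apply: measurable_hkerg; rewrite /duh.
    exact: measurable_duh_fix.
  - by move=> y _; rewrite lee_wpmul2l ?lee_fin ?hker_ge0//; exact: abs_rduh_le.
have hfin : eheat (t - t0) (absE (heat (t0 - b) u0)) x < +oo.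
  apply: le_lt_trans Dx; rewrite -E1 -(eheat_semigroup0 x t0b (ltW tt0) ma (absE_ge0 u0)).
  apply: le_eheat.
  - exact: measurable_absE.
  - by apply: measurable_eheat => //; exact: absE_ge0.
  - exact: absE_ge0.
  - by move=> y; exact: abs_heat_le.
have arfin : eheat (t - t0) (absE (fun y => a * rduh b t0 (fun tau => F (u tau)) y)%R) x < +oo.
  rewrite (_ : absE _ = fun y => `|a|%:E * absE (rduh b t0 (fun tau => F (u tau))) y); last first.
    by apply/funext => y; rewrite /absE normrM EFinM.
  rewrite eheatZ//; [|exact: measurable_absE|exact: absE_ge0].
  by apply: lte_mul_pinfty.
have Dx' := Dx; rewrite -E1 in Dx'.
by rewrite (heatD mh mar hfin arfin) (heatZ a mr rfin) (heat_rduh bt0t jF foo) (heat_semigroup0 t0b tt0 m0 Dx') E1.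
Qed.

Lemma solution_restart b T u0 u t0 t : measurable_fun [set: E] u0 -> H (absE u0) < +oo ->
  strong_solution b T u0 u -> (b <= t0 <= t)%R -> (t <= T)%R ->
  {ae mu, forall x, u t x = heat (t - t0) (u t0) x + a * rduh t0 t (fun tau => F (u tau)) x}%R.
Proof.
move=> m0 u0oo [ju du su] /andP[bt0]; rewrite le_eqVlt => /predU1P[->|t0t] tT.
  by apply: aeW => x; rewrite subrr heat0 rduh_empty// mulr0 addr0.
have bt0t : (b <= t0 < t)%R by rewrite bt0.
have t0T : (b <= t0 <= T)%R by rewrite bt0 (le_trans (ltW t0t)).
have tbT : (b <= t <= T)%R by rewrite tT (le_trans bt0 (ltW t0t)).
have jF : jointly_measurable (fun tau => F (u tau)) by exact: jointly_measurable_nonlinearity.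
apply: filterS2 (heat_solution m0 u0oo ju du (su _ t0T) bt0t tT) (su _ tbT) => x [foo ->] ->.
by rewrite (rduh_split bt0t jF foo) mulrDr addrA.
Qed.

(** Domination composes by the semigroup law, the constants being multiplied. It is established for
    the glued function first, because [heat_solution] needs it for absolute convergence. *)
Lemma strong_solution_glue b t1 T u0 u w : measurable_fun [set: E] u0 -> H (absE u0) < +oo ->
  (b < t1 <= T)%R -> strong_solution b t1 u0 u -> strong_solution t1 T (u t1) w ->
  strong_solution b T u0 (fun t => if (t <= t1)%R then u t else w t).
Proof.
move=> m0 u0oo /andP[bt1 t1T] [ju [Bu Bu0 du] su] [jw [Bw Bw0 dw] sw].
set z := fun t => if (t <= t1)%R then u t else w t.
have ma := measurable_absE m0; have a0 := absE_ge0 u0.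
have jz : jointly_measurable z.
  rewrite /jointly_measurable.
  have -> : (fun p : R * E => z p.1 p.2) = (fun p => if (p.1 <= t1)%R then u p.1 p.2 else w p.1 p.2).
    by apply/funext => p; rewrite /z; case: ifP.
  apply: measurable_fun_if => //; [exact: measurable_fun_ler|exact: measurable_funTS|exact: measurable_funTS].
have dz : dominated b T u0 z.
  exists (Bu + Bw * Bu)%R; first by rewrite addr_ge0// mulr_ge0.
  move=> t /andP[bt tT]; have Dt0 x : 0 <= eheat (t - b) (absE u0) x by exact: eheat_ge0.
  rewrite /z; case: (leP t t1) => tt1.
    have bt1' : (b <= t <= t1)%R by rewrite bt.
    apply: filterS (du _ bt1') => x /le_trans; apply.
    by rewrite lee_wpmul2r// lee_fin lerDl mulr_ge0.
  have t1t : (t1 <= t <= T)%R by rewrite ltW.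
  have bt1' : (b <= t1 <= t1)%R by rewrite lexx ltW.
  apply: filterS (dw _ t1t) => x /le_trans; apply.
  apply: (@le_trans _ _ (Bw%:E * (Bu%:E * eheat (t - b) (absE u0) x))); last first.
    by rewrite muleA -EFinM lee_wpmul2r// lee_fin lerDr.
  rewrite lee_wpmul2l//; have E1 : (t - b = t1 - b + (t - t1))%R by ring.
  have t1b0 : (0 <= t1 - b)%R by rewrite subr_ge0 ltW.
  have tt10 : (0 <= t - t1)%R by rewrite subr_ge0 ltW.
  rewrite E1 -(eheat_semigroup0 x t1b0 tt10 ma a0).
  have mD := measurable_eheat (t1 - b) ma a0.
  have hD y : 0 <= eheat (t1 - b) (absE u0) y by exact: eheat_ge0.
  rewrite -(@eheatZ R n (t - t1) _ Bu%:E x mD hD Bu0).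
  apply: le_eheat_ae => //.
  - by rewrite subr_gt0.
  - by apply: measurable_absE; exact: jointly_measurable_fix.
  - exact: measurable_funeM.
  - exact: absE_ge0.
  - by move=> y; rewrite mule_ge0// eheat_ge0.
  - exact: du.
have sz t : (b <= t <= t1)%R -> satisfies b u0 z t.
  move=> btt1; have /andP[bt tt1] := btt1; apply: filterS (su _ btt1) => x.
  rewrite {1}/z tt1 => ->; congr (_ + _ * _)%R; apply: eq_rduh => tau /andP[_ taut].
  by rewrite /z (le_trans (ltW taut) tt1).
split => // t /andP[bt tT]; have [tt1|t1t] := leP t t1; first by apply: sz; rewrite bt.
have bt1' : (b <= t1 <= t1)%R by rewrite lexx ltW.
have bt1t : (b <= t1 < t)%R by rewrite ltW.
have t1t' : (t1 <= t <= T)%R by rewrite ltW.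
have jF : jointly_measurable (fun tau => F (z tau)) by exact: jointly_measurable_nonlinearity.
(* At [t1] the glued function is [u t1], the datum of [w]: its flow supplies the Duhamel integral
   over []b, t1[], and the equation for [w] the rest. *)
apply: filterS2 (heat_solution m0 u0oo jz dz (sz _ bt1') bt1t tT) (sw _ t1t') => x [foo h1] h2.
rewrite {1}/z leNgt t1t/= h2; have zt1 : z t1 = u t1 by rewrite /z lexx.
rewrite -zt1 h1 (rduh_split bt1t jF foo) mulrDr addrA; congr (_ + _ * _)%R.
by apply: eq_rduh => tau /andP[h _]; rewrite /z leNgt h.
Qed.

End strong_solutions.

(** * Membership in the Herz space *)

Section herz_membership.
Context {R : realType} {n : nat}.
Hypothesis n0 : (0 < n)%N.
Local Notation E := (Rspace R n).
Local Notation mu := (@lebesgue_space R n).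
Local Notation ann := (@dyadic_annulus R n).

Lemma enorm_eq0 (x : E) : enorm x = 0 -> x = [tuple 0 | _ < n].
Proof.
move=> x0; apply: eq_from_tnth => i; rewrite tnth_mktuple.
by apply/eqP; rewrite -normr_le0 -x0 le_tnth_enorm.
Qed.

Let row_tuple (v : 'rV[R]_n) : E := [tuple v ord0 i | i < n].

Lemma continuous_enorm_row : continuous (fun v : 'rV[R]_n => enorm (row_tuple v)).
Proof.
move=> v; rewrite /enorm; apply: (@continuous_comp _ _ _
  (fun v : 'rV[R]_n => \sum_(i < n) (tnth (row_tuple v) i : R) ^+ 2) (@Num.sqrt R)); last first.
  exact: sqrt_continuous.
rewrite (_ : (fun v : 'rV[R]_n => _) = (fun v : 'rV[R]_n => \sum_(i < n) (v ord0 i * v ord0 i))); last first.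
  by apply/funext => w; apply: eq_bigr => i _; rewrite tnth_mktuple expr2.
suff H (r : seq 'I_n) : continuous (fun v : 'rV[R]_n => \sum_(i <- r) (v ord0 i * v ord0 i)) by exact: H.
elim: r => [|i r IH] w.
  have -> : (fun v : 'rV[R]_n => \sum_(i <- [::]) (v ord0 i * v ord0 i)) = cst 0.
    by apply/funext => z; rewrite big_nil.
  exact: cst_continuous.
have -> : (fun v : 'rV[R]_n => \sum_(j <- i :: r) (v ord0 j * v ord0 j)) =
    (fun v : 'rV[R]_n => v ord0 i * v ord0 i + \sum_(j <- r) (v ord0 j * v ord0 j)).
  by apply/funext => z; rewrite big_cons.
have ci : {for w, continuous (fun v : 'rV[R]_n => v ord0 i)} by exact: coord_continuous.
exact: (continuousD (continuousM ci ci) (IH w)).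
Qed.

(** The norm is continuous, so the image of [K] is compact in the line: it is bounded, and it stays
    away from 0 because its complement is open. *)
Lemma compact_space_shell (K : set E) : @compact_space R n K -> ~ K [tuple 0 | _ < n] ->
  exists N : nat, forall x, K x -> 2 `^ (- N%:R) <= enorm x < 2 `^ N%:R.
Proof.
move=> cK nK0; pose phi (v : 'rV[R]_n) := enorm (row_tuple v).
pose K' := [set v : 'rV[R]_n | K (row_tuple v)].
have {}cK : compact K' by [].
have cI : compact (phi @` K').
  by apply: continuous_compact => //; apply: continuous_subspaceT; exact: continuous_enorm_row.
have inI x : K x -> (phi @` K') (enorm x).
  move=> Kx; exists (\row_i (tnth x i : R)).
    have rx : row_tuple (\row_i (tnth x i : R)) = x.
      by apply: eq_from_tnth => i; rewrite tnth_mktuple mxE.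
    by rewrite /K'/= rx.
  rewrite /phi; congr enorm; apply: eq_from_tnth => i.
  by rewrite tnth_mktuple mxE.
have n0I : ~ (phi @` K') 0.
  by move=> [v Kv /enorm_eq0 v0]; apply: nK0; rewrite -v0.
have [M [_ HM]] := compact_bounded cI.
have {}HM x : K x -> enorm x <= `|M| + 1.
  have h : M < `|M| + 1 by rewrite (le_lt_trans (ler_norm M))// ltrDl.
  move=> Kx; have := HM (`|M| + 1) h _ (inI x Kx).
  by rewrite /= ger0_norm// enorm_ge0.
have [r r0 Hr] : exists2 r : R, 0 < r & forall x, K x -> r <= enorm x.
  have oC : open (~` (phi @` K')) by apply: closed_openC; exact: compact_closed.
  have /nbhs_ballP[r /= r0 Hr] : nbhs (0 : R) (~` (phi @` K')).
    exact: open_nbhs_nbhs.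
  exists r => // x Kx; rewrite leNgt; apply/negP => xr; apply: (Hr (enorm x)); last exact: inI.
  by rewrite /ball/= sub0r normrN ger0_norm ?enorm_ge0.
pose y := Num.max (`|M| + 1) r^-1; pose N := (Num.truncn y).+1.
have yN : y < 2 `^ N%:R.
  apply: (lt_trans (truncnS_gt y)); rewrite powR_mulrn// -natrX ltr_nat.
  exact: ltn_expl.
have N1 : `|M| + 1 < 2 `^ N%:R by apply: le_lt_trans yN; rewrite le_max lexx.
have N2 : 2 `^ (- N%:R) < r.
  rewrite powRN -[r]invrK ltf_pV2 ?posrE ?invr_gt0 ?powR_gt0//.
  by apply: le_lt_trans yN; rewrite le_max lexx orbT.
exists N => x Kx; rewrite (le_trans (ltW N2) (Hr x Kx))/=.
exact: le_lt_trans (HM x Kx) N1.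
Qed.

Local Open Scope ereal_scope.

(** Local integrability ranges over compact sets that are not known to be measurable for the product
    sigma-algebra. The integral, a supremum over simple functions below, is monotone all the
    same. *)
Lemma ge0_le_integral_nonmeasurable (f g : E -> \bar R) : (forall x, 0 <= f x) ->
  (forall x, f x <= g x) -> \int[mu]_x f x <= \int[mu]_x g x.
Proof.
move=> f0 fg; have g0 x : 0 <= g x by exact: le_trans (fg x).
rewrite !ge0_integralTE//; apply: ge_ereal_sup => _ [h hf <-].
by apply: ereal_sup_ubound; exists h => // x; exact: le_trans (fg x).
Qed.

Lemma herz_of_hnorm (s q : R) (f : E -> R) : (1 <= q)%R -> measurable_fun [set: E] f ->
  hnorm s q (absE f) < +oo -> herz s q%:E 1 f.
Proof.
move=> q1 mf foo; have q0 : (0 < q)%R by exact: lt_le_trans q1.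
split => //; last by rewrite herz_normE.
move=> K cK K0; have [N HN] := compact_space_shell cK K0.
pose B : set E := @enorm R n @^-1` `[(2 `^ (- N%:R))%R, (2 `^ N%:R)%R[.
have mB : measurable B.
  by rewrite -[X in measurable X]setTI; apply: measurable_enorm => //; exact: measurable_itv.
have ma := measurable_absE mf; have a0 := absE_ge0 f.
pose g : E -> \bar R := absE f \_ B.
have mg : measurable_fun [set: E] g by exact: measurable_restr.
have g0 x : 0 <= g x by exact: restr_ge0.
have Hfin : hnorm s q (absE f) \is a fin_num by rewrite ge0_fin_numE// hnorm_ge0.
rewrite /Lp_norm unlock; apply: poweR_lty.
apply: (@le_lt_trans _ _ (\int[mu]_x (g x `^ q))).
  apply: ge0_le_integral_nonmeasurable => x; first exact: poweR_ge0.
  apply: gt0_ler_poweR; rewrite ?in_itv/= ?leey ?andbT ?(ltW q0)//.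
  rewrite indicE; case: (boolP (x \in K)) => xK /=; last by rewrite mulr0 normr0.
  rewrite mulr1 /g patchE mem_set//; rewrite inE in xK.
  by rewrite /B/= in_itv/=; exact: HN.
rewrite integral_annuli//; last 2 first.
- exact: measurable_funpow.
- by move=> x; exact: poweR_ge0.
pose c := ((2 `^ (N%:R * `|s|) * fine (hnorm s q (absE f))) `^ q : R)%R.
(* The shell meets only annuli with |k| <= N, where [2^N 2^(-|k|)] is at least 1; a convergent
   series over all integers thus bounds the finite sum. *)
have [C C0 HC] := geometric_int_sum (ltr01 : (0 < 1 :> R)%R).
apply: (@le_lt_trans _ _ ((c * 2 `^ N%:R)%:E * \esum_(k in [set: int]) (2 `^ (- 1 * `|k|%:~R))%:E)); last first.
  apply: lte_mul_pinfty => //; first by rewrite lee_fin mulr_ge0 ?powR_ge0.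
  by rewrite (le_lt_trans HC)// ltry.
rewrite -esum_intZ ?mulr_ge0 ?powR_ge0//.
apply: le_esum => k _; have [kN|Nk] := leP `|k|%R N%:Z; last first.
  rewrite integral0_eq => [|x kx]; first by rewrite -EFinM lee_fin !mulr_ge0 ?powR_ge0.
  rewrite /g patchE memNset ?poweR0r ?gt_eqF// => xB.
  move: kx xB => /dyadic_annulusP/andP[x1 x2]; rewrite /B/= in_itv/= => /andP[h1 h2].
  have H1 := powR2_ltI (le_lt_trans h1 x2); have H2 := powR2_ltI (le_lt_trans x1 h2).
  have {}H1 : (- N%:Z < k)%R by rewrite -(ltr_int R) rmorphN.
  have {}H2 : (k - 1 < N%:Z)%R by rewrite -(ltr_int R) rmorphB.
  lia.
apply: (@le_trans _ _ (c%:E)); last first.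
  rewrite -EFinM lee_fin -mulrA ler_peMr ?powR_ge0// -powRDp//.
  rewrite -[leLHS](powRr0 2); apply: ler_powR; first by rewrite ler1n.
  by rewrite mulN1r subr_ge0 -[N%:R]/(N%:Z%:~R) ler_int.
have -> : \int[mu]_(x in ann k) (g x `^ q) = block q g k `^ q.
  rewrite /block -poweRrM mulVf ?gt_eqF// poweRe1//.
  by apply: integral_ge0 => x _; exact: poweR_ge0.
rewrite /c -poweR_EFin; apply: gt0_ler_poweR; rewrite ?in_itv/= ?leey ?andbT ?block_ge0 ?(ltW q0)//.
  by rewrite lee_fin mulr_ge0 ?powR_ge0 ?fine_ge0// hnorm_ge0.
apply: (@le_trans _ _ (block q (absE f) k)).
  apply: le_block => //; apply: aeW => x _; rewrite /g patchE.
  by case: (x \in B).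
apply: (le_trans (block_le_hnorm s _ _ _)).
rewrite EFinM fineK// lee_wpmul2r ?hnorm_ge0// lee_fin; apply: ler_powR; first by rewrite ler1n.
apply: (le_trans (ler_norm _)); rewrite normrN normrM ler_wpM2r//.
by rewrite -intr_norm -[N%:R]/(N%:Z%:~R) ler_int.
Qed.

End herz_membership.

(** * Herz norms of strong solutions *)

Section classes.
Context {R : realType} {n : nat}.
Local Notation E := (Rspace R n).
Local Open Scope ereal_scope.

Lemma cvg_ereal0 (T : Type) (G : set_system T) (FG : Filter G) (phi : T -> \bar R) :
  (forall x, 0 <= phi x) -> (forall e : R, (0 < e)%R -> \forall x \near G, phi x <= e%:E) ->
  phi x @[x --> G] --> 0.
Proof.
move=> p0 Hp; apply/fine_cvgP; split.
  apply: filterS (Hp 1%R ltr01) => x px.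
  by rewrite ge0_fin_numE// (le_lt_trans px)// ltry.
apply/cvgr0Pnorm_le => e e0; apply: filterS (Hp e e0) => x.
have := p0 x; rewrite /=; case: (phi x) => [r| |]//= r0 re.
by rewrite ger0_norm.
Qed.

Lemma abs_sub_perturb_le (A B r r' : R) (e g g' : \bar R) :
  `|A - B|%:E <= e -> `|r|%:E <= g -> `|r'|%:E <= g' -> `|(A + r') - (B + r)|%:E <= e + (g + g').
Proof.
move=> h1 h2 h3; apply: (@le_trans _ _ (`|A - B|%:E + (`|r|%:E + `|r'|%:E))).
  rewrite -!EFinD lee_fin (_ : A + r' - (B + r) = (A - B) + (r' - r))%R; last by ring.
  by apply: (le_trans (ler_normD _ _)); rewrite lerD2l [leRHS]addrC; exact: ler_normB.
by apply: leeD => //; exact: leeD.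
Qed.

Variables (a beta gamma q kappa s : R).
Hypothesis hp : herz_params (n := n) beta gamma q kappa s.
Local Notation F := (@nonlinearity R n gamma beta).
Local Notation H := (hnorm s q).
Local Notation Hk := (hnorm s kappa).
Local Notation lam := (lambda (n := n) beta gamma q kappa s).
Local Notation sig := (sigma (n := n) q kappa).
Local Notation strong := (strong_solution a beta gamma).
Let n0 := dim_gt0 hp.
Let q0 : (0 < q)%R := q_gt0 hp.
Let q1 : (1 <= q)%R := ltW (q_gt1 hp).

Lemma hnorm_eheat_le : exists2 C : R, (0 <= C)%R & forall t g, (0 <= t)%R ->
  measurable_fun [set: E] g -> (forall y, 0 <= g y) -> H (eheat t g) <= C%:E * H g.
Proof.
have [C C0 HC] := heat_herz n0 (q_gt1 hp) (lexx q) (sq_gt0 hp) (sq_lt hp).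
exists (C + 1)%R; first by rewrite addr_ge0// ltW.
move=> t g; rewrite le_eqVlt => /predU1P[<-|t0] mg g0.
  by rewrite eheat0 -[leLHS]mul1e lee_wpmul2r ?hnorm_ge0// lee_fin lerDr ltW.
apply: (le_trans (HC t g t0 mg g0)); rewrite subrr mulr0 powRr0 mulr1.
by rewrite lee_wpmul2r ?hnorm_ge0// lee_fin lerDl.
Qed.

Lemma dominated_hnorm_le b T u0 u : measurable_fun [set: E] u0 -> H (absE u0) < +oo ->
  jointly_measurable u -> dominated b T u0 u ->
  exists2 C : R, (0 <= C)%R & forall t, (b <= t <= T)%R -> H (absE (u t)) <= C%:E.
Proof.
move=> m0 u0oo ju [B B0 HB]; have [C C0 HC] := hnorm_eheat_le.
have ma := measurable_absE m0; have a0 := absE_ge0 u0.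
exists (B * C * fine (H (absE u0)))%R; first by rewrite !mulr_ge0// fine_ge0// hnorm_ge0.
move=> t btT; have /andP[bt tT] := btT; have bt0 : (0 <= t - b)%R by rewrite subr_ge0.
have mD := measurable_eheat (t - b) ma a0.
have D0 y : 0 <= eheat (t - b) (absE u0) y by exact: eheat_ge0.
apply: (@le_trans _ _ (H (fun x => B%:E * eheat (t - b) (absE u0) x))).
  apply: le_hnorm => //.
  - by apply: measurable_absE; exact: jointly_measurable_fix.
  - exact: measurable_funeM.
  - exact: absE_ge0.
  - by move=> y; rewrite mule_ge0.
  - exact: HB.
rewrite hnormZ// -mulrA 2!EFinM lee_wpmul2l// fineK ?ge0_fin_numE ?hnorm_ge0//.
exact: HC.
Qed.

Lemma dominated_kappa_le b T u0 u : measurable_fun [set: E] u0 -> H (absE u0) < +oo ->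
  jointly_measurable u -> dominated b T u0 u ->
  exists M : R, forall t, (b < t <= T)%R -> ((t - b) `^ sig)%:E * Hk (absE (u t)) <= M%:E.
Proof.
move=> m0 u0oo ju [B B0 HB].
have [C C0 HC] := heat_herz n0 (q_gt1 hp) (ltW (q_lt_kappa hp)) (skappa_gt0 hp) (sq_lt hp).
have ma := measurable_absE m0; have a0 := absE_ge0 u0.
exists (B * C * fine (H (absE u0)))%R => t /andP[bt tT].
have bt0 : (0 < t - b)%R by rewrite subr_gt0.
have btT : (b <= t <= T)%R by rewrite ltW.
have mD := measurable_eheat (t - b) ma a0.
have D0 y : 0 <= eheat (t - b) (absE u0) y by exact: eheat_ge0.
have k0 := kappa_gt0 hp.
apply: (@le_trans _ _ (((t - b) `^ sig)%:E * Hk (fun x => B%:E * eheat (t - b) (absE u0) x))).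
  rewrite lee_wpmul2l ?lee_fin ?powR_ge0//; apply: le_hnorm => //.
  - by apply: measurable_absE; exact: jointly_measurable_fix.
  - exact: measurable_funeM.
  - exact: absE_ge0.
  - by move=> y; rewrite mule_ge0.
  - exact: HB.
rewrite hnormZ// muleCA -mulrA EFinM lee_wpmul2l//.
apply: (@le_trans _ _ (((t - b) `^ sig)%:E * ((C * (t - b) `^ (- sig))%:E * H (absE u0)))).
  rewrite lee_wpmul2l ?lee_fin ?powR_ge0//; apply: (le_trans (HC _ _ bt0 ma a0)).
  by rewrite /sigma mulNr.
rewrite [X in _ <= X]EFinM fineK ?ge0_fin_numE ?hnorm_ge0// muleA lee_wpmul2r ?hnorm_ge0// -EFinM lee_fin.
by rewrite mulrCA -powRDp// subrr powRr0 mulr1.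
Qed.

(** Both values are restarted from [t0]: the free parts differ by the flow of (P_(t'-t) - 1) u(t0),
    and the Duhamel parts are short. With [t0] fixed before [t] and [t'] vary, strong continuity of
    the semigroup is used at the single function [u t0]. *)
Lemma strong_increment_le b T u0 u : measurable_fun [set: E] u0 -> H (absE u0) < +oo ->
  strong b T u0 u -> exists2 C : R, (0 <= C)%R & forall t0 t t', (b <= t0 <= t)%R -> (t < t' <= T)%R ->
    H (absE (fun x => u t' x - u t x)%R) <=
    C%:E * (H (herr (u t0) (t' - t)) + ((t - t0) `^ (1 - lam) + (t' - t0) `^ (1 - lam))%:E).
Proof.
move=> m0 u0oo su; have [ju du _] := su.
have [C1 C10 HC1] := duh_dominated_le hp m0 u0oo ju du.
have [C2 C20 HC2] := hnorm_eheat_le.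
have [Mu Mu0 HMu] := dominated_hnorm_le m0 u0oo ju du.
have ma := measurable_absE m0; have a0 := absE_ge0 u0.
set N := fine (H (absE u0)).
have NE : H (absE u0) = N%:E by rewrite fineK// ge0_fin_numE ?hnorm_ge0.
have N0 : (0 <= N)%R by rewrite fine_ge0 ?hnorm_ge0.
pose K := (`|a| * C1 * (C2 * N))%R.
have K0 : (0 <= K)%R by rewrite !mulr_ge0.
exists (4 * C2 + 16 * K)%R; first by rewrite addr_ge0 ?mulr_ge0.
move=> t0 t t' /andP[bt0 t0t] /andP[tt' t'T].
have jF : jointly_measurable (fun tau => F (u tau)) by exact: jointly_measurable_nonlinearity.
have mf : measurable_fun [set: E] (u t0) by exact: jointly_measurable_fix.
have maf := measurable_absE mf.
have t0T : (b <= t0 <= T)%R by rewrite bt0 (le_trans t0t) ?(le_trans (ltW tt')).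
have foo : H (absE (u t0)) < +oo by rewrite (le_lt_trans (HMu _ t0T)) ?ltry.
have tT : (t <= T)%R by exact: le_trans (ltW tt') t'T.
have t0t' : (t0 <= t')%R by exact: le_trans t0t (ltW tt').
have d0 : (0 < t' - t)%R by rewrite subr_gt0.
have e0 : (0 <= t - t0)%R by rewrite subr_ge0.
pose p w := ((w - t0) `^ (1 - lam))%R.
have p0 w : (0 <= p w)%R by exact: powR_ge0.
pose G w x : \bar R := (`|a| * C1 * p w)%:E * eheat (w - b) (absE u0) x.
have G0 w x : 0 <= G w x by rewrite mule_ge0 ?eheat_ge0// lee_fin !mulr_ge0.
have mG w : measurable_fun [set: E] (G w) by apply: measurable_funeM; exact: measurable_eheat.
have HG w : (b <= w)%R -> H (G w) <= (K * p w)%:E.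
  move=> bw; rewrite hnormZ ?mulr_ge0//; [|exact: measurable_eheat|by move=> y; exact: eheat_ge0].
  have wb0 : (0 <= w - b)%R by rewrite subr_ge0.
  apply: (@le_trans _ _ ((`|a| * C1 * p w)%:E * (C2%:E * N%:E))).
    rewrite lee_wpmul2l ?lee_fin ?mulr_ge0//; apply: (le_trans (HC2 _ _ wb0 ma a0)).
    by rewrite NE.
  by rewrite -!EFinM lee_fin /K le_eqVlt; apply/orP; left; apply/eqP; ring.
have duhG w x : (t0 <= w <= T)%R -> `|a * rduh t0 w (fun tau => F (u tau)) x|%:E <= G w x.
  move=> /andP[t0w wT]; rewrite normrM EFinM.
  apply: (@le_trans _ _ (`|a|%:E * ((C1 * p w)%:E * eheat (w - b) (absE u0) x))); last first.
    by rewrite muleA -EFinM mulrA.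
  rewrite lee_wpmul2l//; apply: (le_trans (abs_rduh_le _ _ _ jF)).
  by apply: HC1 => //; rewrite bt0.
have mherr : measurable_fun [set: E] (herr (u t0) (t' - t)) by exact: measurable_herr.
have me : measurable_fun [set: E] (eheat (t - t0) (herr (u t0) (t' - t))).
  by apply: measurable_eheat => //; exact: herr_ge0.
have he0 x : 0 <= eheat (t - t0) (herr (u t0) (t' - t)) x by apply: eheat_ge0; exact: herr_ge0.
have mGG : measurable_fun [set: E] (fun x => G t x + G t' x) by exact: emeasurable_funD.
apply: (@le_trans _ _ (H (fun x => eheat (t - t0) (herr (u t0) (t' - t)) x + (G t x + G t' x)))).
  apply: le_hnorm => //.
  - by apply: measurable_absE; apply: measurable_funB; exact: jointly_measurable_fix.
  - exact: emeasurable_funD.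
  - exact: absE_ge0.
  - by move=> x; rewrite !adde_ge0.
  have bt0t : (b <= t0 <= t)%R by rewrite bt0.
  have bt0t' : (b <= t0 <= t')%R by rewrite bt0.
  have fin1 := eheat_dominant_fin hp t0t' mf foo.
  have fin2 := eheat_dominant_fin hp t0t mf foo.
  apply: filterS2 (filterI fin1 fin2) (filterI (solution_restart hp m0 u0oo su bt0t tT)
     (solution_restart hp m0 u0oo su bt0t' t'T)) => x [f1 f2]; rewrite /absE => -[-> ->].
  have h1 : (t0 <= t <= T)%R by rewrite t0t.
  have h2 : (t0 <= t' <= T)%R by rewrite t0t'.
  have duh1 := duhG t x h1; have duh2 := duhG t' x h2.
  have E1 : (t' - t + (t - t0) = t' - t0)%R by ring.
  have hh : `|heat (t' - t0) (u t0) x - heat (t - t0) (u t0) x|%:E <=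
      eheat (t - t0) (herr (u t0) (t' - t)) x.
    move: e0 E1; rewrite le_eqVlt => /predU1P[e0|e0] E1.
      by rewrite -e0 eheat0 heat0 -E1 -e0 addr0.
    have f3 : eheat (t - t0) (absE (heat (t' - t) (u t0))) x < +oo.
      apply: le_lt_trans f1; rewrite -E1 -(eheat_semigroup x d0 e0 maf (absE_ge0 (u t0))).
      apply: le_eheat.
      - by apply: measurable_absE; exact: measurable_heat.
      - by apply: measurable_eheat => //; exact: absE_ge0.
      - exact: absE_ge0.
      - by move=> y; exact: abs_heat_le.
    have f1' := f1; rewrite -E1 in f1'.
    rewrite -E1 -(heat_semigroup d0 e0 mf f1') -(heatB (measurable_heat _ mf) mf f3 f2).
    apply: (le_trans (abs_heat_le _ _ _)) => //.
    by apply: measurable_funB => //; exact: measurable_heat.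
  exact: (abs_sub_perturb_le hh duh1 duh2).
apply: (le_trans (hnormD _ q1 me mGG he0 _)); first by move=> x; rewrite adde_ge0.
have h1 : H (eheat (t - t0) (herr (u t0) (t' - t))) <= C2%:E * H (herr (u t0) (t' - t)).
  by apply: HC2 => //; exact: herr_ge0.
have bt : (b <= t)%R by exact: le_trans t0t.
have h2 : H (fun x => G t x + G t' x) <= (4 * (K * (p t + p t')))%:E.
  apply: (le_trans (hnormD _ q1 (mG t) (mG t') (G0 t) (G0 t'))).
  rewrite EFinM lee_wpmul2l// mulrDr EFinD; apply: leeD; apply: HG => //.
  exact: le_trans (ltW tt').
have hh0 := hnorm_ge0 (R:=R) (n:=n) s q (herr (u t0) (t' - t)).
rewrite -/(p t) -/(p t') [leRHS]ge0_muleDr ?lee_fin ?addr_ge0//.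
apply: (@le_trans _ _ (4%:E * (C2%:E * H (herr (u t0) (t' - t)) + (4 * (K * (p t + p t')))%:E))).
  by rewrite lee_wpmul2l//; exact: leeD.
rewrite [leLHS]ge0_muleDr ?mule_ge0 ?lee_fin ?mulr_ge0 ?addr_ge0//; apply: leeD.
  by rewrite muleA -EFinM lee_wpmul2r// lee_fin lerDl mulr_ge0.
rewrite -!EFinM lee_fin; have : (0 <= C2 * (p t + p t'))%R by rewrite mulr_ge0 ?addr_ge0.
by rewrite !mulrDl -!mulrA; lra.
Qed.

End classes.

(** * From strong solutions to the well-posedness class *)

Section strong_to_mild.
Context {R : realType} {n : nat}.
Local Notation E := (Rspace R n).
Local Notation mu := (@lebesgue_space R n).
Local Notation leb := (@lebesgue_measure R).
Local Open Scope ereal_scope.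
Variables (a beta gamma q kappa s : R).
Hypothesis hp : herz_params (n := n) beta gamma q kappa s.
Local Notation F := (@nonlinearity R n gamma beta).
Local Notation H := (hnorm s q).
Local Notation lam := (lambda (n := n) beta gamma q kappa s).
Local Notation sig := (sigma (n := n) q kappa).
Local Notation strong := (strong_solution a beta gamma).
Let n0 := dim_gt0 hp.
Let q0 : (0 < q)%R := q_gt0 hp.
Let q1 : (1 <= q)%R := ltW (q_gt1 hp).

Lemma strong_continuous T u0 u : measurable_fun [set: E] u0 -> H (absE u0) < +oo ->
  strong 0 T u0 u -> continuous_herz s q%:E 1 `[0%R, T]%classic u.
Proof.
move=> m0 u0oo su; have [ju du _] := su.
have [Mu Mu0 HMu] := dominated_hnorm_le hp m0 u0oo ju du.
have Hfin t : (0 <= t <= T)%R -> H (absE (u t)) < +oo.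
  by move=> /HMu tM; rewrite (le_lt_trans tM)// ltry.
split => [t|t1].
  rewrite /= in_itv/= => tT.
  exact: (herz_of_hnorm n0 q1 (jointly_measurable_fix t ju) (Hfin t tT)).
move=> t1I; have /andP[t10 t1T] : (0 <= t1 <= T)%R by move: t1I; rewrite /= in_itv.
have [C C0 HC] := strong_increment_le hp m0 u0oo su.
have l1 := one_sub_lambda hp.
apply: cvg_ereal0 => [x|e e0]; first by rewrite herz_normE// hnorm_ge0.
pose e1 := (e / (2 * (C + 1)))%R; have e10 : (0 < e1)%R by rewrite divr_gt0 ?mulr_gt0 ?ltr_wpDl.
(* Half of the length on which [(t - t0)^(1 - lam)] reaches [e1 / 2], since times up to [2 * dl]
   after [t0] occur. *)
pose dl := ((e1 / 2) `^ (1 - lam)^-1 / 2)%R.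
have e20 : (0 < e1 / 2)%R by exact: divr_gt0.
have dl0 : (0 < dl)%R by apply: divr_gt0 => //; exact: powR_gt0.
have dlE : ((2 * dl) `^ (1 - lam) = e1 / 2)%R.
  by rewrite /dl mulrC divfK// -powRrM mulVf ?gt_eqF// powRr1// ltW.
(* Restarting at most [dl] before [t1] treats both sides of [t1] together: every admissible time
   within [dl] of [t1] lies after [t0], at distance at most [2 * dl]. *)
pose t0 := Num.max 0%R (t1 - dl)%R.
have t00 : (0 <= t0)%R by rewrite le_max lexx.
have t0t1 : (t0 <= t1)%R by rewrite ge_max t10 lerBlDr lerDl ltW.
have t1dl : (t1 - dl <= t0)%R by rewrite le_max lexx orbT.
have t0T : (0 <= t0 <= T)%R by rewrite t00 (le_trans t0t1).
have [d d0 Hd] := heat_strong_continuity n0 (q_gt1 hp) (sq_gt0 hp) (sq_lt hp)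
  (jointly_measurable_fix t0 ju) (Hfin _ t0T) e10.
apply/nbhs_ballP; exists (Num.min dl d); first by rewrite /= lt_min dl0 d0.
move=> t tt1d tI; change (herz_norm s q%:E 1 (u t \- u t1)%R <= e%:E).
have /andP[tdl td] : (`|t1 - t| < dl)%R && (`|t1 - t| < d)%R by rewrite -lt_min; exact: tt1d.
have /andP[t0' tT] : (0 <= t <= T)%R by move: tI; rewrite /= in_itv.
rewrite herz_normE//.
have key w w' : (t0 <= w)%R -> (w < w')%R -> (w' <= T)%R -> (w' - w < d)%R ->
    (w - t0 <= 2 * dl)%R -> (w' - t0 <= 2 * dl)%R ->
    H (absE (fun x => u w' x - u w x)%R) <= e%:E.
  move=> t0w ww' w'T wd w1 w2.
  have tw : (0 <= t0 <= w)%R by rewrite t00.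
  have twT : (w < w' <= T)%R by rewrite ww'.
  apply: (le_trans (HC t0 w w' tw twT)).
  have h1 : H (herr (u t0) (w' - w)) <= e1%:E by apply: Hd; rewrite subr_gt0 ww'.
  have pw y : (t0 <= y)%R -> (y - t0 <= 2 * dl)%R -> ((y - t0) `^ (1 - lam) <= e1 / 2)%R.
    move=> ty y2; rewrite -dlE; apply: ge0_ler_powR; rewrite ?(ltW l1) ?nnegrE ?subr_ge0//.
    by rewrite mulr_ge0// ltW.
  have h2 := pw w t0w w1; have h3 := pw w' (le_trans t0w (ltW ww')) w2.
  apply: (@le_trans _ _ (C%:E * (e1%:E + (e1 / 2 + e1 / 2)%:E))).
    by rewrite lee_wpmul2l//; apply: leeD => //; rewrite lee_fin lerD.
  rewrite -EFinD -EFinM lee_fin -splitr.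
  have -> : (e = (C + 1) * (e1 + e1))%R by rewrite /e1; field; rewrite gt_eqF// ltr_wpDl.
  by rewrite ler_wpM2r ?addr_ge0 ?(ltW e10)// lerDl.
have [tt1|t1t|->] := ltgtP t t1.
- rewrite (_ : (fun x => _) = absE (fun x => u t1 x - u t x)%R); last first.
    by apply/funext => x; rewrite /absE /= distrC.
  have h : (t1 - t < dl)%R by rewrite -(ger0_norm (_ : 0 <= t1 - t)%R)// subr_ge0 ltW.
  apply: key => //.
  + by rewrite /t0 ge_max t0'/= lerBlDr -lerBlDl ltW.
  + by rewrite -(ger0_norm (_ : 0 <= t1 - t)%R)// subr_ge0 ltW.
  + lra.
  + lra.
- have h : (t - t1 < dl)%R by rewrite -(ger0_norm (_ : 0 <= t - t1)%R) 1?distrC// subr_ge0 ltW.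
  apply: key => //.
  + by rewrite -(ger0_norm (_ : 0 <= t - t1)%R) 1?distrC// subr_ge0 ltW.
  + lra.
  + lra.
rewrite (_ : (fun x => _) = (fun=> 0)); last by apply/funext => x; rewrite /= subrr normr0.
rewrite /hnorm; under eq_esum => k _ do rewrite block0// mule0.
by rewrite esum1// lee_fin ltW.
Qed.

Lemma strong_wp_class T u0 u : measurable_fun [set: E] u0 -> H (absE u0) < +oo ->
  strong 0 T u0 u -> wp_class s q kappa T u.
Proof.
move=> m0 u0oo su; split; first exact: strong_continuous su.
have [ju du _] := su; have [M HM] := dominated_kappa_le hp m0 u0oo ju du.
exists M => t t0T; have := HM t t0T; rewrite subr0 herz_normE//; last exact: kappa_gt0 hp.
suff -> : sig = (n%:R / (2 * q) - n%:R / (2 * kappa))%R by [].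
rewrite /sigma; field; rewrite !gt_eqF//; exact: kappa_gt0 hp.
Qed.

(** [mild_solution] integrates over a closed interval. Removing the endpoints does not change the
    integral and discards [tau = t], where [heat_kernel] at time 0 and [eheat] disagree. *)
Lemma abs_duhamel_closed u t x : jointly_measurable u ->
  \int[leb]_(tau in `[0%R, t]) \int[mu]_y
        `|heat_kernel (t - tau) (subs x y) * F (u tau) y|%R%:E =
  duh 0 t (fun tau => absE (F (u tau))) x.
Proof.
move=> ju; have jF := jointly_measurable_nonlinearity beta gamma ju.
rewrite (@integral_itv_bndoo R 0%R t _ true false); last first.
  apply: measurable_funTS.
  apply: (@measurable_int_param R _ _ _ _ mu (fun w : R * E => `|heat_kernel (t - w.1) (subs x w.2) * F (u w.1) w.2|%R%:E)).
  apply/measurable_EFinP; apply: measurableT_comp => //; apply: measurable_funM => //.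
  apply: (@measurable_hker R n _ (R * E)%type (fun w => t - w.1)%R (fun=> x) snd) => //.
  exact: measurable_funB.
apply: eq_integral => tau; rewrite inE/= in_itv/= => /andP[_ taut].
rewrite eheatE ?subr_gt0//; apply: eq_integral => y _.
by rewrite -abs_hkerf.
Qed.

Lemma rduh_closed u t x : jointly_measurable u ->
  (\int[leb]_(tau in `[0, t]) heat (t - tau) (F (u tau)) x)%R = rduh 0 t (fun tau => F (u tau)) x.
Proof.
move=> ju; have jF := jointly_measurable_nonlinearity beta gamma ju.
rewrite /rduh /Rintegral (@integral_itv_bndoo R 0%R t _ true false)//.
by apply: measurable_funTS; apply/measurable_EFinP; exact: (measurable_heat_integrand t x jF).
Qed.

Lemma strong_mild T u0 u : measurable_fun [set: E] u0 -> H (absE u0) < +oo ->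
  strong 0 T u0 u -> mild_solution a gamma beta `[0%R, T]%classic u0 u.
Proof.
move=> m0 u0oo [ju du su] t; rewrite /= in_itv/= => /andP[t0 tT].
have [C C0 HC] := duh_dominated_le hp m0 u0oo ju du.
have t0T : (0 <= t <= T)%R by rewrite t0.
apply: filterS2 (eheat_dominant_fin hp t0 m0 u0oo) (su t t0T) => x Dx; rewrite subr0 => ux.
rewrite abs_duhamel_closed// rduh_closed//; split => //.
apply: (le_lt_trans (HC 0%R t x _ tT)); first by rewrite lexx.
by apply: lte_mul_pinfty => //; rewrite lee_fin mulr_ge0 ?powR_ge0.
Qed.

End strong_to_mild.

(** * Uniqueness *)

Section joint_version.
Context {R : realType} {n : nat}.
Hypothesis n0 : (0 < n)%N.
Local Notation E := (Rspace R n).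
Local Notation mu := (@lebesgue_space R n).
Local Notation ann := (@dyadic_annulus R n).
Local Open Scope ereal_scope.
Variables (s q : R).
Hypothesis q1 : (1 < q)%R.
Let q0 : (0 < q)%R. Proof. exact: lt_trans q1. Qed.
Let q1' : (1 <= q)%R. Proof. exact: ltW. Qed.
Local Notation H := (hnorm s q).

Lemma nneseries_cvg0 (f : nat -> \bar R) : (forall m, 0 <= f m) -> \sum_(m <oo) f m < +oo ->
  f m @[m --> \oo] --> 0.
Proof.
move=> f0 foo; have tl : (\sum_(N <= k <oo) f k) @[N --> \oo] --> 0.
  by apply: (@nneseries_tail_cvg R f predT).
apply: (@squeeze_cvge _ _ _ _ (cst 0) _ _ _ _ _ tl); last exact: cvg_cst.
apply: nearW => N; rewrite /= f0/=.
have := @nneseries_lim_ge R f predT N N.+1 (fun k _ _ => f0 k).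
by rewrite big_nat1.
Qed.

(** On each annulus the L^1 norms are summable, so the series of absolute values is finite almost
    everywhere and its terms tend to 0; countably many annuli cover almost all of space. *)
Lemma hnorm_geometric_cvg (g : nat -> E -> R) : (forall m, measurable_fun [set: E] (g m)) ->
  (forall m, H (absE (g m)) <= (2^-1 ^+ m)%:E) ->
  {ae mu, forall x, g m x @[m --> \oo] --> 0%R}.
Proof.
move=> mg Hg; have ma m := measurable_absE (mg m).
have onann k : {ae mu, forall x, ann k x -> absE (g m) x @[m --> \oo] --> 0}.
  have mk := @measurable_dyadic_annulus R n k.
  pose c := (2 `^ n%:R * 2 `^ (k%:~R * (n%:R * (1 - q^-1))) * 2 `^ (- (k%:~R * s)) : R)%R.
  have c0 : (0 <= c)%R by rewrite !mulr_ge0 ?powR_ge0.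
  have le m : \int[mu]_(x in ann k) absE (g m) x <= (c * 2^-1 ^+ m)%:E.
    apply: (le_trans (integral_block_le k q1 (ma m) (absE_ge0 (g m)))).
    apply: (@le_trans _ _ ((2 `^ n%:R * 2 `^ (k%:~R * (n%:R * (1 - q^-1))))%:E *
        ((2 `^ (- (k%:~R * s)))%:E * (2^-1 ^+ m)%:E))); last by rewrite -!EFinM lee_fin mulrA.
    rewrite lee_wpmul2l ?lee_fin ?mulr_ge0 ?powR_ge0//.
    apply: (le_trans (block_le_hnorm s _ _ _)).
    by rewrite lee_wpmul2l ?lee_fin ?powR_ge0//; exact: Hg.
  have fin : \int[mu]_(x in ann k) (\sum_(m <oo) absE (g m) x) < +oo.
    rewrite integral_nneseries//; last 2 first.
    - by move=> m; exact: measurable_funTS.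
    - by move=> m x _; exact: absE_ge0.
    apply: (@le_lt_trans _ _ (\sum_(m <oo) (c * 2^-1 ^+ m)%:E)).
      by apply: lee_nneseries => // m *; first [exact: le | (apply: integral_ge0 => x _; exact: absE_ge0)].
    have cg : (series (geometric c 2^-1) m)%:E @[m --> \oo] --> (c / (1 - 2^-1))%:E.
      apply: cvg_EFin; first exact: nearW.
      by apply: cvg_geometric_series; rewrite ger0_norm// invf_lt1// ltr1n.
    have -> : \sum_(m <oo) (c * 2^-1 ^+ m)%:E = (c / (1 - 2^-1))%:E.
      apply/cvg_lim => //; apply: cvg_trans cg; apply: near_eq_cvg; apply: nearW => m.
      by rewrite /series/= -sumEFin.
    exact: ltry.
  have ik : mu.-integrable (ann k) (fun x => \sum_(m <oo) absE (g m) x).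
    apply/integrableP; split.
      apply: measurable_funTS; apply: ge0_emeasurable_sum => // m x _ _; exact: absE_ge0.
    have S0 x : 0 <= \sum_(m <oo) absE (g m) x by apply: nneseries_ge0 => m _ _; exact: absE_ge0.
    under eq_integral do rewrite gee0_abs//.
    exact: fin.
  have := integrable_ae mk ik; apply: filterS => x /[apply] xf.
  apply: nneseries_cvg0; first by move=> m; exact: absE_ge0.
  by rewrite ltey_eq xf.
have allk : {ae mu, forall x, forall j : nat, ann (int_of_nat j) x -> absE (g m) x @[m --> \oo] --> 0}.
  by apply: ae_foralln => j; exact: onann.
apply: filterS2 (ae_annulus n0) allk => x [k xk] Hx.
have [_ _ surj] := int_of_nat_bij; have [j _ jk] := surj k I.
have := Hx j; rewrite jk => /(_ xk) lim.
apply/cvgr0Pnorm_le => e e0; have [N HN] := seq0_le lim e0.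
by exists N => // i Ni; have := HN i Ni; rewrite lee_fin.
Qed.

Lemma jointly_measurable_step (kappa : R -> nat) (V : nat -> E -> R) :
  (forall k, measurable [set t | kappa t = k]) -> (forall k, measurable_fun [set: E] (V k)) ->
  jointly_measurable (fun t => V (kappa t)).
Proof.
move=> mk mV _ B mB; rewrite setTI.
rewrite (_ : _ @^-1` B = \bigcup_k ([set t | kappa t = k] `*` (V k @^-1` B))); last first.
  apply/seteqP; split => [[t x] /= h|[t x] [k _ /= [<-]]//].
  by exists (kappa t).
apply: bigcupT_measurable => k; apply: measurableX; first exact: mk.
by rewrite -[X in measurable X]setTI; apply: mV.
Qed.

Lemma measurable_mesh (d : R) k : measurable [set t : R | Num.truncn (Num.max 0 (t / d))%R = k].
Proof.
have lt j : measurable [set t : R | (Num.truncn (Num.max 0 (t / d))%R < j)%N].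
  have mf : measurable_fun [set: R] (fun t : R => Num.max 0%R (t / d)%R).
    by apply: measurable_maxr => //; exact: measurable_funM.
  rewrite (_ : [set t | _] = (fun t : R => Num.max 0%R (t / d)%R) @^-1` `]-oo, j%:R[); last first.
    apply/seteqP; split => t; rewrite /= in_itv/= truncn_lt_nat// le_max lexx//.
  by rewrite -[X in measurable X]setTI; apply: mf => //; exact: measurable_itv.
rewrite (_ : [set t | _] = [set t : R | (Num.truncn (Num.max 0 (t / d))%R < k.+1)%N] `\`
    [set t : R | (Num.truncn (Num.max 0 (t / d))%R < k)%N]).
  exact: measurableD.
apply/seteqP; split => t /=; first by move=> ->; rewrite ltnn ltnSn.
by move=> [h1 /negP]; rewrite -leqNgt => h2; apply/eqP; rewrite eqn_leq h2 andbT -ltnS.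
Qed.

(** Heine's theorem for the compact interval, phrased through near-coverings because the norm is
    available only as an extended-valued function. *)
Lemma herz_uniform_continuity (T : R) (v : R -> E -> R) : continuous_herz s q%:E 1 `[0%R, T]%classic v ->
  forall e : R, (0 < e)%R -> exists2 d : R, (0 < d)%R & forall t t', (0 <= t <= T)%R -> (0 <= t' <= T)%R ->
    (`|t - t'| < d)%R -> H (absE (fun x => v t x - v t' x)%R) <= e%:E.
Proof.
move=> [hv cv] e e0; have mv t : (0 <= t <= T)%R -> measurable_fun [set: E] (v t).
  by move=> tT; have [] := hv t; rewrite /= ?in_itv.
have mB t t' : (0 <= t <= T)%R -> (0 <= t' <= T)%R -> measurable_fun [set: E] (absE (fun x => v t x - v t' x)%R).
  by move=> h h'; apply: measurable_absE; apply: measurable_funB; exact: mv.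
(* 8 is the constant 4 of [hnormD] times the two increments through the centre [t]. *)
have e8 : (0 < e / 8)%R by rewrite divr_gt0.
have loc t : (0 <= t <= T)%R -> exists2 r : R, (0 < r)%R & forall t', (0 <= t' <= T)%R -> (`|t - t'| < r)%R ->
    H (absE (fun x => v t' x - v t x)%R) <= (e / 8)%:E.
  move=> tT; have tI : `[0%R, T]%classic t by rewrite /= in_itv.
  have := cv t tI [set y | y < (e / 8)%:E] (@nbhs_open_ereal_lt _ 0%R (fun=> (e / 8)%R) e8).
  move=> /nbhs_ballP[r r0 Hr]; exists r => // t' t'T tt'.
  have t'I : `[0%R, T]%classic t' by rewrite /= in_itv.
  by have /ltW := Hr t' tt' t'I; rewrite herz_normE.
have cov : forall t, `[0%R, T]%classic t -> \forall t1 \near t & d \near 0%R^'+,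
   forall t', (0 <= t1 <= T)%R -> (0 <= t' <= T)%R -> (`|t1 - t'| < d)%R ->
    H (absE (fun x => v t1 x - v t' x)%R) <= e%:E.
  move=> t; rewrite /= in_itv/= => tT; have [r r0 Hr] := loc t tT.
  have r2 : (0 < r / 2)%R by rewrite divr_gt0.
  exists (ball t (r / 2)%R, [set d : R | (d < r / 2)%R]).
    split => /=; first exact: nbhsx_ballx.
    exact: nbhs_right_lt.
  move=> [t1 d] /= [t1r dr] t' t1T t'T t1t'.
  have tt1 : (`|t - t1| < r)%R by apply: (lt_trans t1r); rewrite ltr_pdivrMr// ltr_pMr// ltr1n.
  have tt' : (`|t - t'| < r)%R.
    apply: (le_lt_trans (ler_distD t1 _ _)); rewrite [r]splitr ltrD//.
    exact: lt_trans t1t' dr.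
  apply: (@le_trans _ _ (H (fun x => absE (fun x => v t1 x - v t x)%R x + absE (fun x => v t' x - v t x)%R x))).
    apply: le_hnorm => //.
    - exact: mB.
    - by apply: emeasurable_funD; exact: mB.
    - exact: absE_ge0.
    - by move=> x; rewrite adde_ge0 ?absE_ge0.
    apply: aeW => x; rewrite -EFinD lee_fin.
    rewrite (_ : v t1 x - v t' x = (v t1 x - v t x) - (v t' x - v t x))%R; last by ring.
    exact: ler_normB.
  apply: (le_trans (hnormD _ q1' (mB _ _ t1T tT) (mB _ _ t'T tT) (absE_ge0 _) (absE_ge0 _))).
  apply: (@le_trans _ _ (4%:E * ((e / 8)%:E + (e / 8)%:E))).
    by rewrite lee_wpmul2l//; apply: leeD; exact: Hr.
  by rewrite -EFinD -EFinM lee_fin le_eqVlt; apply/orP; left; apply/eqP; field.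
have nd := (compact_near_coveringP _).1 (@segment_compact R 0%R T) R (0%R^'+)
  (fun d t => forall t', (0 <= t <= T)%R -> (0 <= t' <= T)%R -> (`|t - t'| < d)%R ->
    H (absE (fun x => v t x - v t' x)%R) <= e%:E) _ cov.
have [d [d0 Hd]] : exists d : R, (0 < d)%R /\ forall t, `[0%R, T]%classic t ->
    forall t', (0 <= t <= T)%R -> (0 <= t' <= T)%R -> (`|t - t'| < d)%R ->
    H (absE (fun x => v t x - v t' x)%R) <= e%:E.
  apply: (@filter_ex _ (0%R^'+)); near=> d; split; first by near: d; exact: nbhs_right_gt.
  by move=> t tT; move: t tT; near: d; exact: nd.
by exists d => // t t' tT t'T; apply: Hd => //; rewrite /= in_itv.
Unshelve. all: end_near. Qed.

(* A continuous curve in the Herz space has no reason to be measurable jointly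
   in time and space, as Fubini's theorem requires in the uniqueness proof. *)
Lemma joint_version (T : R) (v : R -> E -> R) : continuous_herz s q%:E 1 `[0%R, T]%classic v ->
  exists2 w : R -> E -> R, jointly_measurable w &
    forall t, (0 <= t <= T)%R -> {ae mu, forall x, w t x = v t x}.
Proof.
move=> cv; have [hv _] := cv.
have mv t : (0 <= t <= T)%R -> measurable_fun [set: E] (v t).
  by move=> tT; have [] := hv t; rewrite /= ?in_itv.
have unif m : exists d : R, (0 < d)%R /\ forall t t', (0 <= t <= T)%R -> (0 <= t' <= T)%R ->
    (`|t - t'| < d)%R -> H (absE (fun x => v t x - v t' x)%R) <= (2^-1 ^+ m)%:E.
  have e0 : (0 < 2^-1 ^+ m :> R)%R by rewrite exprn_gt0.
  by have [d d0 Hd] := herz_uniform_continuity cv e0; exists d.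
have [d Hd] := choice unif.
pose mesh m t := Num.truncn (Num.max 0 (t / d m))%R.
(* Samples at left mesh points, constant in time on each cell; samples that would fall beyond [T],
   where [v] is not controlled, are set to 0. *)
pose V m k : E -> R := if (d m * k%:R <= T)%R then v (d m * k%:R)%R else cst 0%R.
pose wm m t : E -> R := V m (mesh m t).
have mV m k : measurable_fun [set: E] (V m k).
  rewrite /V; case: ifP => // dT; apply: mv; rewrite dT andbT mulr_ge0// ltW//.
  by have [] := Hd m.
have jwm m : jointly_measurable (wm m).
  by apply: jointly_measurable_step => // k; exact: measurable_mesh.
pose w t x := fine (limn_esup (fun m => (wm m t x)%:E)).
exists w.
  apply: measurableT_comp => //.
  apply: (@measurable_fun_limn_esup _ _ R setT (fun m (z : R * E) => (wm m z.1 z.2)%:E)) => m.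
  by apply/measurable_EFinP; exact: jwm.
move=> t tT; have /andP[t0 tT'] := tT.
have mwm m : measurable_fun [set: E] (fun x => wm m t x - v t x)%R.
  by apply: measurable_funB; [exact: mV|exact: mv].
have Hwm m : H (absE (fun x => wm m t x - v t x)%R) <= (2^-1 ^+ m)%:E.
  have [dm0 Hdm] := Hd m.
  have td0 : (0 <= t / d m)%R by rewrite divr_ge0// ltW.
  have kE : mesh m t = Num.truncn (t / d m)%R by rewrite /mesh max_r.
  have h1 : (d m * (mesh m t)%:R <= t)%R.
    by rewrite kE mulrC -ler_pdivlMr// truncn_le.
  have h2 : (t - d m * (mesh m t)%:R < d m)%R.
    rewrite kE ltrBlDl -[X in (_ + X)%R]mulr1 -mulrDr mulrC -ltr_pdivrMr//.
    by rewrite natr1 truncnS_gt.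
  rewrite /wm /V (le_trans h1 tT'); apply: Hdm => //.
    by rewrite (le_trans h1 tT') andbT mulr_ge0// ltW.
  by rewrite distrC ger0_norm// subr_ge0.
apply: filterS (hnorm_geometric_cvg mwm Hwm) => x lim.
have lv : wm m t x @[m --> \oo] --> v t x.
  have lc : (wm m t x - v t x + v t x)%R @[m --> \oo] --> (0 + v t x)%R.
    by apply: cvgD; [exact: lim|exact: cvg_cst].
  by move: lc; rewrite add0r; under eq_fun do rewrite subrK.
have cl : (wm m t x)%:E @[m --> \oo] --> (v t x)%:E.
  by apply: cvg_EFin; [exact: nearW|exact: lv].
by rewrite /w is_cvg_limn_esupE ?(cvg_lim _ cl)//; apply/cvg_ex; exists (v t x)%:E.
Qed.

End joint_version.

(** * A Gronwall lemma for a kernel singular at both ends *)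

Section gronwall.
Context {R : realType}.
Local Notation leb := (@lebesgue_measure R).
Local Open Scope ereal_scope.
Variables (A : R -> \bar R) (T K l : R).
Hypotheses (l0 : (0 <= l)%R) (l1 : (l < 1)%R) (K0 : (0 <= K)%R)
  (mA : measurable_fun [set: R] A) (A0 : forall t, 0 <= A t)
  (AT : \int[leb]_(t in `]0%R, T[) A t < +oo)
  (AK : forall t, (0 < t < T)%R ->
     A t <= K%:E * \int[leb]_(tau in `]0%R, t[) ((tker tau T l t)%:E * A tau)).
Let I (c : R) := \int[leb]_(t in `]0%R, c[) A t.
Let l10 : (0 < 1 - l)%R. Proof. by rewrite subr_gt0. Qed.

Let I_ge0 c : 0 <= I c. Proof. exact: integral_ge0. Qed.

Let I_le b c : (b <= c)%R -> I b <= I c.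
Proof.
move=> bc; apply: ge0_subset_integral => //; first exact: measurable_funTS.
by move=> t /=; rewrite !in_itv/= => /andP[-> /lt_le_trans ->].
Qed.

(** Integrating the hypothesis in [t] and exchanging the integrals replaces the doubly singular
    kernel by its integral over []tau, c[], which is bounded and small when [c - tau] is. *)
Let kernel_bound c : (0 < c <= T)%R ->
  I c <= K%:E * \int[leb]_(tau in `]0%R, c[) ((3 * (c - tau) `^ (1 - l) / (1 - l))%:E * A tau).
Proof.
move=> /andP[c0 cT].
pose k (w : R * R) : \bar R := if (0 < w.2 < w.1)%R && (w.1 < c)%R then (tker w.2 T l w.1)%:E * A w.2 else 0.
have mk : measurable_fun [set: R * R] k.
  apply: measurable_fun_if => //.
  - apply: measurable_and; first by apply: measurable_and; exact: measurable_fun_ltr.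
    exact: measurable_fun_ltr.
  - apply: measurable_funTS; apply: emeasurable_funM; last exact: measurableT_comp.
    by apply/measurable_EFinP; exact: (@measurable_tker R _ (R * R)%type snd (cst T) fst).
have k0 w : 0 <= k w by rewrite /k; case: ifP => // _; rewrite mule_ge0// lee_fin tker_ge0.
apply: (@le_trans _ _ (K%:E * \int[leb]_t \int[leb]_tau k (t, tau))).
  rewrite /I integral_mkcond -ge0_integralZl//; last 2 first.
  - exact: (@measurable_fun_fubini_tonelli_F _ _ _ _ R leb k mk k0).
  - by move=> t _; exact: integral_ge0.
  apply: ge0_le_integral => //.
  - by move=> t _; rewrite patchE; case: ifP.
  - by apply/(measurable_restrictT _ _).1 => //; exact: measurable_funTS.
  - apply: measurable_funeM; exact: (@measurable_fun_fubini_tonelli_F _ _ _ _ R leb k mk k0).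
  move=> t _; rewrite patchE mem_setE/= in_itv/=; case: ifPn => [/andP[t0 tc]|_]; last first.
    by rewrite mule_ge0//; exact: integral_ge0.
  have tT : (0 < t < T)%R by rewrite t0 (lt_le_trans tc).
  apply: (le_trans (AK tT)); rewrite lee_wpmul2l// integral_mkcond.
  rewrite le_eqVlt; apply/orP; left; apply/eqP; apply: eq_integral => tau _.
  by rewrite patchE mem_setE/= in_itv/= /k/= tc andbT.
rewrite lee_wpmul2l// (@fubini_tonelli _ _ _ _ R leb leb k mk k0) [leRHS]integral_mkcond.
have mW : measurable_fun [set: R] (fun tau => (3 * (c - tau) `^ (1 - l) / (1 - l))%:E * A tau).
  apply: emeasurable_funM => //; apply/measurable_EFinP.
  apply: measurable_funM => //; apply: measurable_funM => //.
  by apply: (measurableT_comp (measurable_powR _)) => //; exact: measurable_funB.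
apply: ge0_le_integral => //.
- by move=> tau _; exact: integral_ge0.
- exact: (@measurable_fun_fubini_tonelli_G _ _ _ _ R leb k mk k0).
- by apply/(measurable_restrictT _ _).1 => //; exact: measurable_funTS.
move=> tau _; rewrite patchE mem_setE/= in_itv/=; case: ifPn => [/andP[tau0 tauc]|ntau]; last first.
  rewrite integral0_eq// => t _; rewrite /k/=; case: ifPn => // /andP[/andP[h1 h2] h3].
  by move: ntau; rewrite h1 (lt_trans h2 h3).
(* Replacing the right endpoint [T] by the smaller [c] only increases the kernel, and makes
   [integral_tker] applicable. *)
apply: (@le_trans _ _ (\int[leb]_(t in `]tau, c[) ((tker tau c l t)%:E * A tau))).
  rewrite [leRHS]integral_mkcond; apply: ge0_le_integral => //.
  - have := measurableT_comp mk (measurable_pair2 tau); exact.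
  - apply/(measurable_restrictT _ _).1 => //; apply: measurable_funTS.
    by apply: emeasurable_funM => //; apply/measurable_EFinP; exact: measurable_tker.
  move=> t _; rewrite patchE mem_setE/= in_itv/= /k/= tau0/=; case: ifPn => // /andP[taut tc].
  rewrite lee_wpmul2r// lee_fin /tker lerD2l !powRN lef_pV2 ?posrE ?powR_gt0 ?subr_gt0//.
    by apply: ge0_ler_powR; rewrite ?nnegrE ?subr_ge0 ?(ltW tc) ?lerD2r// ?(le_trans (ltW tc) cT).
  exact: lt_le_trans tc cT.
have mt : measurable_fun (`]tau, c[ : set R) (fun t => (tker tau c l t)%:E).
  by apply: measurable_funTS; apply/measurable_EFinP; exact: measurable_tker.
under eq_integral => t _ do rewrite muleC.
rewrite ge0_integralZl//; last by move=> t _; rewrite lee_fin tker_ge0.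
rewrite muleC lee_wpmul2r//; exact: integral_tker.
Qed.

(** Chosen so that [K * 3 * d^(1 - l) / (1 - l) <= 1/2], the contraction needed on a window of
    length [d]; [K + 1] avoids a division by 0. *)
Let d : R := ((1 - l) / (6 * (K + 1))) `^ (1 - l)^-1.
Let d0 : (0 < d)%R.
Proof. by rewrite powR_gt0// divr_gt0// mulr_gt0// ltr_wpDl. Qed.

(** As [I b] vanishes, [kernel_bound] reduces to [I c <= I c / 2], and finiteness of [I c] forces it
    to be 0. *)
Let step b c : (0 <= b)%R -> (b < c <= T)%R -> (c - b <= d)%R -> I b = 0 -> I c = 0.
Proof.
move=> b0 /andP[bc cT] cb Ib; have c0 : (0 < c)%R by exact: le_lt_trans bc.
have IcT : I c <= I T by exact: I_le.
have Icfin : I c \is a fin_num by rewrite ge0_fin_numE//; exact: le_lt_trans IcT AT.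
have c0T : (0 < c <= T)%R by rewrite c0.
pose W := (K * (3 * c `^ (1 - l) / (1 - l)))%R.
have W0 : (0 <= W)%R by rewrite mulr_ge0// divr_ge0 ?mulr_ge0 ?powR_ge0// ltW.
have mAb : measurable_fun [set: R] (A \_ `]0%R, b[).
  by apply/(measurable_restrictT _ _).1 => //; exact: measurable_funTS.
have Ab0 t : 0 <= (A \_ `]0%R, b[) t by rewrite patchE; case: ifP.
have le : I c <= W%:E * I b + (2^-1)%:E * I c.
  apply: (le_trans (kernel_bound c0T)).
  have mW : measurable_fun [set: R] (fun tau => (3 * (c - tau) `^ (1 - l) / (1 - l))%:E * A tau).
    apply: emeasurable_funM => //; apply/measurable_EFinP.
    apply: measurable_funM => //; apply: measurable_funM => //.
    by apply: (measurableT_comp (measurable_powR _)) => //; exact: measurable_funB.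
  have W1 tau : 0 <= (3 * (c - tau) `^ (1 - l) / (1 - l))%:E * A tau.
    by rewrite mule_ge0// lee_fin divr_ge0 ?mulr_ge0 ?powR_ge0// ltW.
  rewrite -ge0_integralZl//; last exact: measurable_funTS.
  apply: (@le_trans _ _ (\int[leb]_(tau in `]0%R, c[) (W%:E * (A \_ `]0%R, b[) tau + (2^-1)%:E * A tau))).
    apply: ge0_le_integral => //.
    - by move=> tau _; rewrite mule_ge0.
    - by apply: measurable_funTS; exact: measurable_funeM.
    - by apply: measurable_funTS; apply: emeasurable_funD; exact: measurable_funeM.
    move=> tau; rewrite /= in_itv/= => /andP[tau0 tauc]; rewrite muleA -EFinM patchE mem_setE/= in_itv/= tau0/=.
    have [taub|btau] := ltP tau b.
      rewrite -[leLHS]adde0; apply: leeD; last by rewrite mule_ge0.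
      rewrite lee_wpmul2r// lee_fin /W ler_wpM2l// ler_wpM2r ?invr_ge0 ?(ltW l10)//.
      rewrite ler_wpM2l//; apply: ge0_ler_powR; rewrite ?(ltW l10) ?nnegrE ?subr_ge0 ?(ltW c0) ?(ltW tauc)//.
      by rewrite lerBlDr lerDl ltW.
    rewrite mule0 add0e lee_wpmul2r// lee_fin.
    have : ((c - tau) `^ (1 - l) <= d `^ (1 - l))%R.
      apply: ge0_ler_powR; rewrite ?(ltW l10) ?nnegrE ?subr_ge0 ?(ltW tauc) ?(ltW d0)//.
      by apply: le_trans cb; rewrite lerB.
    rewrite /d -powRrM mulVf ?gt_eqF// powRr1; last by rewrite ltW// divr_gt0// mulr_gt0// ltr_wpDl.
    have K1 : (0 < K + 1)%R by rewrite ltr_wpDl.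
    set p := ((c - tau) `^ _)%R => hp; have p0 : (0 <= p)%R by exact: powR_ge0.
    have -> : (K * (3 * p / (1 - l)) = K * 3 * p / (1 - l))%R by field; rewrite gt_eqF.
    rewrite ler_pdivrMr//; apply: (@le_trans _ _ ((K + 1) * 3 * ((1 - l) / (6 * (K + 1))))%R).
      by apply: ler_pM => //; rewrite ?mulr_ge0// ler_wpM2r// lerDl.
    by rewrite le_eqVlt; apply/orP; left; apply/eqP; field; rewrite gt_eqF.
  rewrite ge0_integralD//; last 4 first.
  - by move=> tau _; rewrite mule_ge0.
  - by apply: measurable_funTS; exact: measurable_funeM.
  - by move=> tau _; rewrite mule_ge0.
  - by apply: measurable_funTS; exact: measurable_funeM.
  rewrite !ge0_integralZl//; try exact: measurable_funTS.
  apply: leeD => //; rewrite lee_wpmul2l// /I [leRHS]integral_mkcond.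
  by apply: ge0_subset_integral.
move: le; rewrite Ib mule0 add0e -(fineK Icfin) -EFinM lee_fin => le.
have : (0 <= fine (I c))%R by rewrite fine_ge0.
by move: le => /[swap] h0 le; congr EFin; lra.
Qed.

Lemma gronwall_singular : \int[leb]_(t in `]0%R, T[) A t = 0.
Proof.
have I0 c : (c <= 0)%R -> I c = 0.
  by move=> c0; rewrite /I set_itv_ge ?integral_set0// bnd_simp -leNgt.
have H m : I (Num.min (m%:R * d) T)%R = 0.
  elim: m => [|m IH]; first by apply: I0; rewrite mul0r ge_min lexx.
  have [T0|T0] := leP T 0%R; first by apply: I0; rewrite ge_min T0 orbT.
  have dm : (m.+1%:R * d = m%:R * d + d)%R by rewrite -natr1; ring.
  have [Tm|mT] := leP T (m%:R * d)%R.
    rewrite min_r; last by rewrite dm (le_trans Tm)// lerDl ltW.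
    by move: IH; rewrite min_r.
  move: IH; rewrite (min_l (ltW mT)) => IH.
  apply: (step _ _ _ IH).
  - by rewrite mulr_ge0// ltW.
  - by rewrite lt_min mT dm ltrDl d0/= ge_min lexx orbT.
  - by rewrite lerBlDl dm ge_min lexx.
have := H (Num.truncn (T / d)).+1; rewrite min_r//.
by rewrite -ler_pdivrMr// ltW// truncnS_gt.
Qed.

End gronwall.

(** * Uniqueness at almost every point *)

Section uniqueness.
Context {R : realType} {n : nat}.
Local Notation E := (Rspace R n).
Local Notation mu := (@lebesgue_space R n).
Local Notation leb := (@lebesgue_measure R).
Local Open Scope ereal_scope.

Lemma eheat_mul_duh_le r c t (V : E -> \bar R) (f : R -> E -> R) x : (0 < r)%R ->
  measurable_fun [set: E] V -> (forall y, 0 <= V y) -> jointly_measurable f ->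
  eheat r (fun y => V y * duh c t (fun tau => absE (f tau)) y) x <=
  \int[leb]_(tau in `]c, t[) eheat r (fun y => V y * eheat (t - tau) (absE (f tau)) y) x.
Proof.
move=> r0 mV V0 mf; have ma := jointly_measurable_absE mf.
have e0 tau y : 0 <= eheat (t - tau) (absE (f tau)) y by apply: eheat_ge0; exact: absE_ge0.
have me : measurable_fun [set: R * E] (fun w => eheat (t - w.1) (absE (f w.1)) w.2).
  apply: (@measurable_eheat_param R n _ (R * E)%type (fun w => t - w.1)%R snd (fun w => absE (f w.1))) => //.
  - exact: measurable_funB.
  - apply: (measurableT_comp (f := fun z : R * E => absE (f z.1) z.2)
      (g := fun w : (R * E) * E => (w.1.1, w.2))) => //.
    by apply: measurable_fun_pair => //; exact: measurableT_comp.
have mh tau : measurable_fun [set: E] (fun y => V y * eheat (t - tau) (absE (f tau)) y).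
  by apply: emeasurable_funM => //; exact: (measurableT_comp me (measurable_pair1 tau)).
pose k (w : E * R) : \bar R := if (c < w.2 < t)%R
  then (hker r x w.1)%:E * (V w.1 * eheat (t - w.2) (absE (f w.2)) w.1) else 0.
have mVe : measurable_fun [set: E * R] (fun w => V w.1 * eheat (t - w.2) (absE (f w.2)) w.1).
  apply: emeasurable_funM; first exact: measurableT_comp.
  apply: (measurableT_comp me (g := fun w : E * R => (w.2, w.1))).
  exact: measurable_fun_pair.
have mk : measurable_fun [set: E * R] k.
  apply: measurable_fun_if => //.
  - by apply: measurable_and; exact: measurable_fun_ltr.
  - apply: measurable_funTS; apply: emeasurable_funM => //.
    by apply/measurable_EFinP; exact: measurable_hker.
have k0 w : 0 <= k w.
  by rewrite /k; case: ifP => // _; rewrite !mule_ge0 ?lee_fin ?hker_ge0.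
rewrite eheatE// /duh.
have -> : \int[mu]_y ((hker r x y)%:E * (V y * \int[leb]_(tau in `]c, t[) eheat (t - tau) (absE (f tau)) y)) =
    \int[mu]_y \int[leb]_tau k (y, tau).
  apply: eq_integral => y _; rewrite muleA -ge0_integralZl//; last 2 first.
  - by apply: measurable_funTS; exact: measurable_duh_integrand.
  - by rewrite mule_ge0// lee_fin hker_ge0.
  rewrite integral_mkcond; apply: eq_integral => tau _.
  by rewrite patchE mem_setE/= in_itv/= /k/= muleA.
rewrite (@fubini_tonelli _ _ _ _ R mu leb k mk k0) [leRHS]integral_mkcond.
rewrite le_eqVlt; apply/orP; left; apply/eqP; apply: eq_integral => tau _.
rewrite patchE mem_setE/= in_itv/= /k/=; case: ifPn => _; last by rewrite integral0.
by rewrite eheatE.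
Qed.

Lemma duhB_le c t (f g : R -> E -> R) x : jointly_measurable f -> jointly_measurable g ->
  duh c t (fun tau => absE (fun y => f tau y - g tau y)%R) x <=
  duh c t (fun tau => absE (f tau)) x + duh c t (fun tau => absE (g tau)) x.
Proof.
move=> mf mg; have maf := jointly_measurable_absE mf; have mag := jointly_measurable_absE mg.
have mB : jointly_measurable (fun tau y => f tau y - g tau y)%R by exact: measurable_funB.
have e0 (h : R -> E -> R) tau y : 0 <= eheat (t - tau) (absE (h tau)) y.
  by apply: eheat_ge0; exact: absE_ge0.
have mi (h : R -> E -> R) : jointly_measurable h ->
    measurable_fun (`]c, t[ : set R) (fun tau => eheat (t - tau) (absE (h tau)) x).
  move=> mh; apply: measurable_funTS; apply: measurable_duh_integrand.
  exact: jointly_measurable_absE.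
rewrite /duh -ge0_integralD//; [|exact: mi|exact: mi].
apply: ge0_le_integral => //.
- by move=> tau _; exact: (e0 (fun tau y => f tau y - g tau y)%R).
- exact: (mi (fun tau y => f tau y - g tau y)%R).
- by apply: emeasurable_funD; exact: mi.
move=> tau _.
have mft := measurable_absE (jointly_measurable_fix tau mf).
have mgt := measurable_absE (jointly_measurable_fix tau mg).
rewrite -(@eheatD R n (t - tau) _ _ x mft mgt (absE_ge0 _) (absE_ge0 _)).
apply: le_eheat.
- by apply: measurable_absE; exact: (jointly_measurable_fix tau mB).
- exact: emeasurable_funD.
- exact: absE_ge0.
- by move=> y; rewrite -EFinD lee_fin ler_normB.
Qed.

Variables (a beta gamma q kappa s : R).
Hypothesis hp : herz_params (n := n) beta gamma q kappa s.
Local Notation F := (@nonlinearity R n gamma beta).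
Local Notation Hk := (hnorm s kappa).
Local Notation lam := (lambda (n := n) beta gamma q kappa s).
Local Notation sig := (sigma (n := n) q kappa).
Local Notation th := (theta (n := n) beta gamma kappa s).
Let beta0 := beta_gt0 hp.

Definition mild_at u0 (w : R -> E -> R) t :=
  {ae mu, forall x, duh 0 t (fun tau => absE (F (w tau))) x < +oo /\
     (w t x = heat t u0 x + a * rduh 0 t (fun tau => F (w tau)) x)%R}.

(** Here the potential comes from a given solution, known only through its K_kappa norm of order
    [t^(-sigma)]. Since [t - tau <= t], that singularity at 0 can be moved to [tau], which gives a
    kernel with ends [tau] and [T]. *)
Lemma perturbed_kernel_bound (M T : R) : (0 <= M)%R -> exists2 K : R, (0 <= K)%R &
  forall (w : E -> R) (h : E -> \bar R) tau t x, (0 <= tau < t)%R -> (t < T)%R ->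
    measurable_fun [set: E] w -> measurable_fun [set: E] h -> (forall y, 0 <= h y) ->
    (t `^ sig)%:E * Hk (absE w) <= M%:E ->
    eheat (T - t) (fun y => pot beta gamma (absE w) y * eheat (t - tau) h y) x <=
    (K * tker tau T lam t)%:E * eheat (T - tau) h x.
Proof.
move=> M0; have [C C0 HC] := potential_semigroup hp.
exists (C * 2 `^ th * M `^ beta)%R; first by rewrite !mulr_ge0 ?powR_ge0.
move=> w h tau t x /andP[tau0 taut] tT mw mh h0 wM.
have t0 : (0 < t)%R by exact: le_lt_trans taut.
have t10 : (0 < t - tau)%R by rewrite subr_gt0.
have t20 : (0 < T - t)%R by rewrite subr_gt0.
apply: (le_trans (HC _ _ _ _ x t10 t20 (measurable_absE mw) mh (absE_ge0 w) h0)).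
have E1 : (t - tau + (T - t) = T - tau)%R by ring.
rewrite E1 lee_wpmul2r ?eheat_ge0//.
have k0 := kappa_gt0 hp.
have Hw : Hk (absE w) <= (M * t `^ (- sig))%:E.
  rewrite -[leLHS]mul1e -[X in X%:E * _](powRr0 t) -(subrr sig) powRDp// mulrC EFinM -muleA.
  by rewrite [leRHS]EFinM muleC lee_wpmul2r// lee_fin powR_ge0.
have Hwb : Hk (absE w) `^ beta <= (M `^ beta * t `^ (- (beta * sig)))%:E.
  apply: (@le_trans _ _ ((M * t `^ (- sig))%:E `^ beta)).
    apply: gt0_ler_poweR; rewrite ?in_itv/= ?leey ?andbT ?hnorm_ge0 ?lee_fin ?mulr_ge0 ?powR_ge0//.
    exact: ltW.
  by rewrite poweR_EFin lee_fin powRM ?powR_ge0// -powRrM mulNr [(sig * _)%R]mulrC.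
apply: (@le_trans _ _ ((C * ((t - tau) * (T - t) / (T - tau)) `^ (- th))%:E *
   (M `^ beta * t `^ (- (beta * sig)))%:E)).
  by rewrite lee_wpmul2l// lee_fin mulr_ge0 ?powR_ge0.
rewrite -EFinM lee_fin.
have th0 := theta_ge0 hp; have bs0 := betasigma_ge0 hp.
have H1 := powRN_harmonic_le t10 t20 th0; rewrite E1 in H1.
have H2 := powRN_mul_le t10 t20 bs0 th0.
have H3 : ((t - tau) `^ (- (beta * sig)) * (t - tau) `^ (- th) = (t - tau) `^ (- lam))%R.
  by rewrite -powRDp// -opprD [(beta * sig + _)%R]addrC.
have H4 : (t `^ (- (beta * sig)) <= (t - tau) `^ (- (beta * sig)))%R.
  rewrite !powRN lef_pV2 ?posrE ?powR_gt0//.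
  by apply: ge0_ler_powR; rewrite ?nnegrE ?(ltW t10) ?(ltW t0)// lerBlDr lerDl.
rewrite (addrC (beta * sig)%R) -/lam in H2.
have P0 : (0 <= C * M `^ beta)%R by rewrite !mulr_ge0 ?powR_ge0.
rewrite /tker; move: H1 H2 H3 H4.
set X := (_ `^ (- th))%R; set A := ((t - tau) `^ (- th))%R; set B := ((T - t) `^ (- th))%R.
set S0 := (t `^ _)%R; set S := ((t - tau) `^ (- (beta * sig)))%R; set L1 := ((t - tau) `^ (- lam))%R.
set L2 := ((T - t) `^ (- lam))%R; set W := (2 `^ th)%R => H1 H2 H3 H4.
have S00 : (0 <= S0)%R by exact: powR_ge0.
have S1 : (0 <= S)%R by exact: powR_ge0.
have W0 : (0 <= W)%R by exact: powR_ge0.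
have X0 : (0 <= X)%R by exact: powR_ge0.
apply: (@le_trans _ _ (C * M `^ beta * (S * (W * (A + B))))%R).
  have -> : (C * X * (M `^ beta * S0) = C * M `^ beta * (S0 * X))%R by ring.
  by apply: ler_wpM2l => //; apply: ler_pM.
have -> : (C * W * M `^ beta * (2 * L1 + L2) = C * M `^ beta * (W * (2 * L1 + L2)))%R by ring.
apply: ler_wpM2l => //; rewrite mulrCA; apply: ler_wpM2l => //.
by rewrite mulrDr H3; lra.
Qed.

(** The difference of the nonlinear terms is bounded by a potential times the Duhamel integral of
    itself. Carried to the point (T, x) and freed from the potential, this becomes an inequality for
    a scalar function of time, integrable because both Duhamel integrals converge absolutely at
    [x]. *)
Lemma mild_unique T u0 (w1 w2 : R -> E -> R) (M : R) : (0 < T)%R ->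
  jointly_measurable w1 -> jointly_measurable w2 ->
  (forall t, (0 <= t <= T)%R -> mild_at u0 w1 t) -> (forall t, (0 <= t <= T)%R -> mild_at u0 w2 t) ->
  (forall t, (0 < t <= T)%R -> (t `^ sig)%:E * Hk (absE (w1 t)) <= M%:E) ->
  (forall t, (0 < t <= T)%R -> (t `^ sig)%:E * Hk (absE (w2 t)) <= M%:E) ->
  {ae mu, forall x, w1 T x = w2 T x}.
Proof.
move=> T0 j1 j2 m1 m2 b1 b2.
have M0 : (0 <= M)%R.
  have := b1 T; rewrite T0 lexx => /(_ isT); apply: contraTT; rewrite -!ltNge => M0.
  by apply: (@lt_le_trans _ _ 0); rewrite ?lte_fin// mule_ge0 ?hnorm_ge0// lee_fin powR_ge0.
pose dF tau y : R := (F (w1 tau) y - F (w2 tau) y)%R.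
have jF1 : jointly_measurable (fun tau => F (w1 tau)) by exact: jointly_measurable_nonlinearity.
have jF2 : jointly_measurable (fun tau => F (w2 tau)) by exact: jointly_measurable_nonlinearity.
have jd : jointly_measurable dF by exact: measurable_funB.
have diff t : (0 <= t <= T)%R -> {ae mu, forall y,
    absE (fun z => w1 t z - w2 t z)%R y <= `|a|%:E * duh 0 t (fun tau => absE (dF tau)) y}.
  move=> tT; apply: filterS2 (m1 t tT) (m2 t tT) => y [f1 e1] [f2 e2].
  rewrite /absE e1 e2 opprD addrACA subrr add0r -mulrBr -(rduhB jF1 jF2 f1 f2).
  by rewrite normrM EFinM lee_wpmul2l//; exact: abs_rduh_le.
have [K K0 HK] := perturbed_kernel_bound T M0.
have L0 : (0 <= lip_const beta)%R by rewrite (le_trans ler01)// lip_const_ge1.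
have TT : (0 <= T <= T)%R by rewrite lexx ltW.
apply: filterS2 (filterI (m1 T TT) (m2 T TT)) (diff T TT) => x [[f1 _] [f2 _]] dx.
(* The difference of the nonlinear terms at time [tau], seen from the fixed final point (T, x); by
   [dx] its time integral controls the difference of the solutions there. *)
pose A tau := eheat (T - tau) (absE (dF tau)) x.
have A0 tau : 0 <= A tau by apply: eheat_ge0; exact: absE_ge0.
have AI : duh 0 T (fun tau => absE (dF tau)) x = 0.
  (* The factor 2 in [2 * K] accounts for the two potentials, one for each solution, in
     [nonlinearityB_le]. *)
  apply: (@gronwall_singular R A T (lip_const beta * `|a| * (2 * K)) lam (lambda_ge0 hp)) => //.
  - by rewrite -subr_gt0; exact: one_sub_lambda hp.
  - by rewrite !mulr_ge0.
  - by apply: measurable_duh_integrand; exact: jointly_measurable_absE.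
  - apply: (@le_lt_trans _ _ (duh 0 T (fun tau => absE (dF tau)) x)) => //.
    by apply: (le_lt_trans (duhB_le _ _ _ jF1 jF2)); rewrite lte_add_pinfty.
  move=> t /andP[t0 tT]; have t0T : (0 <= t <= T)%R by rewrite !ltW.
  have t0T' : (0 < t <= T)%R by rewrite t0 ltW.
  pose V y := pot beta gamma (absE (w1 t)) y + pot beta gamma (absE (w2 t)) y.
  have mp (w : R -> E -> R) : jointly_measurable w -> measurable_fun [set: E] (pot beta gamma (absE (w t))).
    by move=> jw; apply: measurable_pot; apply: measurable_absE; exact: jointly_measurable_fix.
  have mV : measurable_fun [set: E] V by apply: emeasurable_funD; exact: mp.
  have V0 y : 0 <= V y by rewrite adde_ge0 ?pot_ge0.
  have Tt0 : (0 < T - t)%R by rewrite subr_gt0.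
  have md : measurable_fun [set: E] (duh 0 t (fun tau => absE (dF tau))) by exact: measurable_duh_fix.
  have d0 y : 0 <= duh 0 t (fun tau => absE (dF tau)) y by apply: duh_ge0 => *; exact: absE_ge0.
  have c0 : (0 <= lip_const beta * `|a|)%R by rewrite mulr_ge0.
  have mVd : measurable_fun [set: E] (fun y => V y * duh 0 t (fun tau => absE (dF tau)) y).
    exact: emeasurable_funM.
  have Vd0 y : 0 <= V y * duh 0 t (fun tau => absE (dF tau)) y by rewrite mule_ge0.
  apply: (@le_trans _ _ ((lip_const beta * `|a|)%:E *
      eheat (T - t) (fun y => V y * duh 0 t (fun tau => absE (dF tau)) y) x)).
    rewrite -(@eheatZ R n (T - t) _ (lip_const beta * `|a|)%:E x mVd Vd0)//.
    apply: le_eheat_ae => //.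
    - by apply: measurable_absE; exact: jointly_measurable_fix.
    - exact: measurable_funeM.
    - exact: absE_ge0.
    - by move=> y; rewrite mule_ge0.
    apply: filterS (diff t t0T) => y dy; apply: (le_trans (nonlinearityB_le gamma beta0 _ _ _)).
    rewrite EFinM -muleA lee_wpmul2l ?lee_fin// muleCA.
    by rewrite lee_wpmul2l//; exact: V0.
  rewrite (EFinM (lip_const beta * `|a|) (2 * K)) -muleA; apply: lee_wpmul2l; first by rewrite lee_fin.
  apply: (le_trans (eheat_mul_duh_le _ _ _ Tt0 mV V0 jd)).
  have mtA : measurable_fun (`]0%R, t[ : set R) (fun tau => (tker tau T lam t)%:E * A tau).
    apply: measurable_funTS; apply: emeasurable_funM.
      by apply/measurable_EFinP; exact: measurable_tker.
    by apply: measurable_duh_integrand; exact: jointly_measurable_absE.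
  rewrite -ge0_integralZl//; last 2 first.
  - by move=> tau _; rewrite mule_ge0// lee_fin tker_ge0.
  - by rewrite lee_fin mulr_ge0.
  have msum tau : measurable_fun [set: E] (fun y => V y * eheat (t - tau) (absE (dF tau)) y).
    apply: emeasurable_funM => //; apply: measurable_eheat; last exact: absE_ge0.
    by apply: measurable_absE; exact: jointly_measurable_fix.
  apply: ge0_le_integral => //.
  - by move=> tau _; apply: eheat_ge0 => y; rewrite mule_ge0// eheat_ge0//; exact: absE_ge0.
  - apply: measurable_funTS.
    apply: (@measurable_eheat_param R n _ (measurableTypeR R) (cst (T - t)%R) (cst x)
      (fun tau y => V y * eheat (t - tau) (absE (dF tau)) y)) => //.
    apply: emeasurable_funM; first exact: measurableT_comp.
    apply: (@measurable_eheat_param R n _ (R * E)%type (fun w => t - w.1)%R snd (fun w => absE (dF w.1))) => //.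
    + exact: measurable_funB.
    + apply: (measurableT_comp (f := fun z : R * E => absE (dF z.1) z.2)
        (g := fun w : (R * E) * E => (w.1.1, w.2))); first exact: jointly_measurable_absE.
      by apply: measurable_fun_pair => //; exact: measurableT_comp.
  - exact: measurable_funeM.
  move=> tau; rewrite /= in_itv/= => /andP[tau0 taut].
  have madt : measurable_fun [set: E] (absE (dF tau)).
    by apply: measurable_absE; exact: jointly_measurable_fix.
  have met : measurable_fun [set: E] (eheat (t - tau) (absE (dF tau))).
    by apply: measurable_eheat => //; exact: absE_ge0.
  have et0 y : 0 <= eheat (t - tau) (absE (dF tau)) y by apply: eheat_ge0; exact: absE_ge0.
  have -> : (fun y => V y * eheat (t - tau) (absE (dF tau)) y) =
      (fun y => pot beta gamma (absE (w1 t)) y * eheat (t - tau) (absE (dF tau)) y +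
                pot beta gamma (absE (w2 t)) y * eheat (t - tau) (absE (dF tau)) y).
    by apply/funext => y; rewrite ge0_muleDl ?pot_ge0.
  have mpe (w : R -> E -> R) : jointly_measurable w -> measurable_fun [set: E]
      (fun y => pot beta gamma (absE (w t)) y * eheat (t - tau) (absE (dF tau)) y).
    by move=> jw; apply: emeasurable_funM => //; exact: mp.
  have pe0 (w : R -> E -> R) y : 0 <= pot beta gamma (absE (w t)) y * eheat (t - tau) (absE (dF tau)) y.
    by rewrite mule_ge0 ?pot_ge0.
  rewrite (@eheatD R n (T - t) _ _ x (mpe w1 j1) (mpe w2 j2) (pe0 w1) (pe0 w2)).
  have tt : (0 <= tau < t)%R by rewrite ltW.
  have h1 := HK _ _ _ _ x tt tT (jointly_measurable_fix t j1) madt (absE_ge0 (dF tau)) (b1 t t0T').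
  have h2 := HK _ _ _ _ x tt tT (jointly_measurable_fix t j2) madt (absE_ge0 (dF tau)) (b2 t t0T').
  apply: (le_trans (leeD h1 h2)); rewrite -ge0_muleDl ?lee_fin ?mulr_ge0 ?tker_ge0//.
  by rewrite muleA -EFinD -EFinM -/(A tau) le_eqVlt; apply/orP; left; apply/eqP; congr (_%:E * _); ring.
apply/eqP; rewrite -subr_eq0 -normr_le0 -lee_fin.
by apply: (le_trans dx); rewrite AI mule0.
Qed.

End uniqueness.

(** * Change of representative at each time *)

Section modifications.
Context {R : realType} {n : nat}.
Local Notation E := (Rspace R n).
Local Notation mu := (@lebesgue_space R n).
Local Notation leb := (@lebesgue_measure R).
Local Open Scope ereal_scope.
Variables (a beta gamma q kappa s : R).
Hypothesis hp : herz_params (n := n) beta gamma q kappa s.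
Local Notation F := (@nonlinearity R n gamma beta).
Let n0 := dim_gt0 hp.
Let q0 : (0 < q)%R := q_gt0 hp.
Let q1 : (1 <= q)%R := ltW (q_gt1 hp).
Let k0 : (0 < kappa)%R := kappa_gt0 hp.

Variables (T : R) (v w : R -> E -> R).
Hypotheses (mv : forall t, (0 <= t <= T)%R -> measurable_fun [set: E] (v t))
  (mw : forall t, (0 <= t <= T)%R -> measurable_fun [set: E] (w t))
  (vw : forall t, (0 <= t <= T)%R -> {ae mu, forall x, v t x = w t x}).

Lemma hnorm_modification p t : (0 < p)%R -> (0 <= t <= T)%R ->
  hnorm s p (absE (v t)) = hnorm s p (absE (w t)).
Proof.
move=> p0 tT; apply: eq_hnorm => //.
- by apply: measurable_absE; exact: mv.
- by apply: measurable_absE; exact: mw.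
- exact: absE_ge0.
- exact: absE_ge0.
- by apply: filterS (vw tT) => x; rewrite /absE => ->.
Qed.

Lemma wp_class_modification : wp_class s q kappa T v -> wp_class s q kappa T w.
Proof.
move=> [[hv cv] [M HM]]; split; last first.
  exists M => t t0T; have := HM t t0T.
  have tT : (0 <= t <= T)%R by have /andP[/ltW -> ->] := t0T.
  by rewrite (herz_normE s (v t) k0) (herz_normE s (w t) k0) (hnorm_modification k0 tT).
have inI t : (0 <= t <= T)%R = (t \in `[0%R, T]) by rewrite in_itv.
split => t tI; have tT : (0 <= t <= T)%R by rewrite inI.
  apply: (herz_of_hnorm n0 q1 (mw tT)); rewrite -(hnorm_modification q0 tT).
  by have [_ _] := hv t tI; rewrite herz_normE.
apply: cvg_trans (cv t tI); apply: near_eq_cvg.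
rewrite near_withinE; near=> t'; move=> t'I.
have t'T : (0 <= t' <= T)%R by rewrite inI.
rewrite (herz_normE s (v t' \- v t)%R q0) (herz_normE s (w t' \- w t)%R q0).
apply: (eq_hnorm s q0).
- by apply: measurable_absE; apply: measurable_funB; exact: mv.
- by apply: measurable_absE; apply: measurable_funB; exact: mw.
- by move=> x; rewrite lee_fin.
- by move=> x; rewrite lee_fin.
- by apply: filterS2 (vw tT) (vw t'T) => x; rewrite /= => -> ->.
Unshelve. all: end_near. Qed.

Lemma mild_modification u0 : mild_solution a gamma beta `[0%R, T]%classic u0 v ->
  mild_solution a gamma beta `[0%R, T]%classic u0 w.
Proof.
move=> mild t tI; have /andP[t0 tT] : (0 <= t <= T)%R by move: tI; rewrite /= in_itv.
have t0T : (0 <= t <= T)%R by rewrite t0.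
apply: filterS2 (mild t tI) (vw t0T) => x [foo ve] vwx.
have tauT tau : tau \in `[0%R, t]%classic -> (0 <= tau <= T)%R.
  by rewrite inE /= in_itv/= => /andP[-> /le_trans ->].
split.
  have -> : \int[leb]_(tau in `[0%R, t]) \int[mu]_y
        `|heat_kernel (t - tau) (subs x y) * F (w tau) y|%R%:E =
      \int[leb]_(tau in `[0%R, t]) \int[mu]_y
        `|heat_kernel (t - tau) (subs x y) * F (v tau) y|%R%:E; last exact: foo.
  apply: eq_integral => tau /tauT tT'; apply: ae_eq_integral => //.
  - apply/measurable_EFinP; apply: measurableT_comp => //; apply: measurable_funM.
      by apply: (@measurable_hker R n _ _ (cst (t - tau)%R) (cst x) id).
    by apply: measurable_nonlinearity; exact: mw.
  - apply/measurable_EFinP; apply: measurableT_comp => //; apply: measurable_funM.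
      by apply: (@measurable_hker R n _ _ (cst (t - tau)%R) (cst x) id).
    by apply: measurable_nonlinearity; exact: mv.
  - by apply: filterS (vw tT') => y vy _; rewrite /nonlinearity vy.
rewrite -vwx ve; congr (_ + _ * _)%R; apply: eq_Rintegral => tau tt.
have tT' := tauT tau tt; have /andP[_ taut] : (0 <= tau <= t)%R by move: tt; rewrite inE /= in_itv.
(* At [tau = t] the flow is the identity, so equality almost everywhere does not help and equality
   at the point [x] itself is used. *)
move: taut; rewrite le_eqVlt => /predU1P[->|taut].
  by rewrite subrr !heat0 /nonlinearity vwx.
apply: heat_ae_eq.
- by rewrite subr_gt0.
- by apply: measurable_nonlinearity; exact: mv.
- by apply: measurable_nonlinearity; exact: mw.
- by apply: filterS (vw tT') => y vy; rewrite /nonlinearity vy.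
Qed.

End modifications.

(** * Uniqueness in the well-posedness class *)

Section wp_uniqueness.
Context {R : realType} {n : nat}.
Local Notation E := (Rspace R n).
Local Notation mu := (@lebesgue_space R n).
Local Open Scope ereal_scope.
Variables (a beta gamma q kappa s : R).
Hypothesis hp : herz_params (n := n) beta gamma q kappa s.
Local Notation Hk := (hnorm s kappa).
Local Notation sig := (sigma (n := n) q kappa).
Let n0 := dim_gt0 hp.
Let k0 : (0 < kappa)%R := kappa_gt0 hp.

Lemma wp_mild_joint T u0 (v : R -> E -> R) : wp_class s q kappa T v ->
  mild_solution a gamma beta `[0%R, T]%classic u0 v ->
  exists w : R -> E -> R, [/\ jointly_measurable w,
    forall t, (0 <= t <= T)%R -> {ae mu, forall x, v t x = w t x},
    forall t, (0 <= t <= T)%R -> mild_at a beta gamma u0 w t &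
    exists M : R, forall t, (0 < t <= T)%R -> (t `^ sig)%:E * Hk (absE (w t)) <= M%:E].
Proof.
move=> wv mild; have [cv _] := wv; have [hv _] := cv.
have [w jw wv_eq] := joint_version n0 (q_gt1 hp) cv.
have mv t : (0 <= t <= T)%R -> measurable_fun [set: E] (v t).
  by move=> tT; have [] := hv t; rewrite /= ?in_itv.
have mw t : (0 <= t <= T)%R -> measurable_fun [set: E] (w t).
  by move=> _; exact: jointly_measurable_fix.
have vw t : (0 <= t <= T)%R -> {ae mu, forall x, v t x = w t x}.
  by move=> tT; apply: filterS (wv_eq t tT) => x ->.
exists w; split => //.
  move=> t tT; have tI : `[0%R, T]%classic t by rewrite /= in_itv.
  apply: filterS (mild_modification mv mw vw mild tI) => x.
  by rewrite abs_duhamel_closed// rduh_closed.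
have [_ [M HM]] := wp_class_modification hp mv mw vw wv.
exists M => t t0T; have := HM t t0T; rewrite herz_normE//.
suff -> : sig = (n%:R / (2 * q) - n%:R / (2 * kappa))%R by [].
by rewrite /sigma; field; rewrite !gt_eqF//; exact: q_gt0 hp.
Qed.

Lemma wp_mild_unique T u0 (v1 v2 : R -> E -> R) :
  wp_class s q kappa T v1 -> mild_solution a gamma beta `[0%R, T]%classic u0 v1 ->
  wp_class s q kappa T v2 -> mild_solution a gamma beta `[0%R, T]%classic u0 v2 ->
  forall t, (0 <= t <= T)%R -> {ae mu, forall x, v1 t x = v2 t x}.
Proof.
move=> wv1 mild1 wv2 mild2 t tT; have /andP[t0 tT'] := tT.
have [w1 [j1 e1 m1 [M1 b1]]] := wp_mild_joint wv1 mild1.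
have [w2 [j2 e2 m2 [M2 b2]]] := wp_mild_joint wv2 mild2.
suff H12 : {ae mu, forall x, w1 t x = w2 t x}.
  by apply: filterS2 (filterI (e1 t tT) (e2 t tT)) H12 => x [-> ->].
(* [mild_unique] asks for a positive final time; at time 0 the Duhamel integrals are empty and both
   solutions equal the datum. *)
move: t0; rewrite le_eqVlt => /predU1P[t0|t0].
  subst t; apply: filterS2 (m1 _ tT) (m2 _ tT) => x [_ ->] [_ ->].
  by rewrite !rduh_empty.
have sub tau : (0 <= tau <= t)%R -> (0 <= tau <= T)%R by move=> /andP[-> /le_trans ->].
have sub' tau : (0 < tau <= t)%R -> (0 < tau <= T)%R by move=> /andP[-> /le_trans ->].
apply: (@mild_unique R n a beta gamma q kappa s hp t u0 w1 w2 (Num.max M1 M2)) => //.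
- by move=> tau /sub; exact: m1.
- by move=> tau /sub; exact: m2.
- by move=> tau /sub' h; apply: (le_trans (b1 _ h)); rewrite lee_fin le_max lexx.
- by move=> tau /sub' h; apply: (le_trans (b2 _ h)); rewrite lee_fin le_max lexx orbT.
Qed.

End wp_uniqueness.

(** * Maximal solutions *)

Section parameters.
Context {R : realType}.

(** With x = (n - gamma) / (n (beta + 1)), the weight is n x - n / kappa and gamma = n - n x (beta +
    1), so each condition becomes linear in [kappa^-1]. Then [u1], [l1], [u2] and [l2] give
    [sq_gt0], [sq_lt], [eta_gt0] and [lambda_lt1], while [skappa_gt0] and [eta_lt] reduce to n x >
    0. *)
Lemma herz_params_of_exponents (n : nat) (q beta gamma kappa : R) (hn : (1 <= n)%N)
  (hq : 1 < q) (hbeta : 0 < beta) (hgamma : 0 < gamma)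
  (hgamma_lt : gamma <
    Num.min (Num.min 2 n%:R) (n%:R - (n%:R - 2) * (beta + 1)))
  (hkappa : q < kappa)
  (hkappa_lower :
    Num.max
      (Num.max
        ((n%:R - gamma) / (n%:R * (beta + 1)) + q^-1 - 1)
        ((n%:R - gamma) / (n%:R * (beta + 1)) + q^-1
           + (gamma - 2) / (n%:R * beta)))
      (Num.max
        (q * (beta + 1))^-1
        (q^-1 - 2 / (n%:R * (beta + 1))))
    < kappa^-1)
  (hkappa_upper : kappa^-1 <
    Num.min
      ((n%:R - gamma) / (n%:R * (beta + 1)) + q^-1)
      (beta^-1 - (n%:R - gamma) / (n%:R * beta * (beta + 1)))) :
  herz_params (n := n) beta gamma q kappa
    ((n%:R - gamma) / (beta + 1) - n%:R / kappa).
Proof.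
have N0 : 0 < n%:R :> R by rewrite ltr0n.
move: hgamma_lt; rewrite !lt_min => /andP[/andP[_ gN] _].
move: hkappa_lower; rewrite !gt_max => /andP[/andP[l1 l2] _].
move: hkappa_upper; rewrite lt_min => /andP[u1 u2].
have q0 : 0 < q by exact: lt_trans hq.
have k0 : 0 < kappa by exact: lt_trans hkappa.
have b0 : 0 < beta + 1 by rewrite addr_gt0.
have nz : n%:R != 0 :> R by rewrite gt_eqF.
have bz : beta != 0 by rewrite gt_eqF.
have b1z : beta + 1 != 0 by rewrite gt_eqF.
pose N : R := n%:R; pose x := (N - gamma) / (N * (beta + 1)).
have x0 : 0 < x by rewrite divr_gt0 ?mulr_gt0// subr_gt0.
have Ngam : N - gamma = N * x * (beta + 1).
  by rewrite /x /N; field; rewrite nz b1z.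
have ki0 : 0 < kappa^-1 by rewrite invr_gt0.
have s1 : (N - gamma) / (beta + 1) = N * x by rewrite /x /N; field; rewrite nz b1z.
rewrite -/N s1; rewrite -/N -/x in l1 l2 u1.
have u2' : N * beta * kappa^-1 < N - N * x.
  rewrite -(ltr_pM2l (mulr_gt0 N0 hbeta)) in u2; apply: (lt_le_trans u2).
  by rewrite /x /N le_eqVlt; apply/orP; left; apply/eqP; field; rewrite nz bz b1z.
have l2' : N * beta * (x + q^-1) + (gamma - 2) < N * beta * kappa^-1.
  rewrite -(ltr_pM2l (mulr_gt0 N0 hbeta)) in l2; apply: le_lt_trans l2.
  by rewrite [leRHS]mulrDr [_ * (_ / _)]mulrCA divff ?mulr1// mulf_neq0.
have Nk : 0 < N * kappa^-1 by rewrite mulr_gt0.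
split => //.
- rewrite -(ltf_pV2 k0 hbeta); apply: (lt_trans u2).
  by rewrite ltrBlDr ltrDl divr_gt0 ?mulr_gt0// subr_gt0.
- have : N * kappa^-1 < N * (x + q^-1) by rewrite ltr_pM2l.
  by rewrite -/N; lra.
- have : N * (x + q^-1 - 1) < N * kappa^-1 by rewrite ltr_pM2l.
  by rewrite -/N; lra.
- by rewrite -/N subrK mulr_gt0.
- by rewrite -/N; nra.
- rewrite -/N -subr_gt0; have -> : N * (1 - beta / kappa) -
    (gamma + (N * x - N / kappa) * beta) = N * x by lra.
  by rewrite mulr_gt0.
- by rewrite -/N; lra.
Qed.

End parameters.

(** * Lifespan, maximal extension and blow-up *)

Section maximal_solution.
Context {R : realType} {n : nat}.
Local Notation E := (Rspace R n).
Local Notation mu := (@lebesgue_space R n).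
Local Open Scope ereal_scope.
Variables (a beta gamma q kappa s : R).
Hypothesis hp : herz_params (n := n) beta gamma q kappa s.
Local Notation H := (hnorm s q).
Local Notation strong := (strong_solution a beta gamma).
Let q0 : (0 < q)%R := q_gt0 hp.
Let q1 : (1 <= q)%R := ltW (q_gt1 hp).

Lemma strong_restrict b T1 T2 u0 (u : R -> E -> R) : (T1 <= T2)%R ->
  strong b T2 u0 u -> strong b T1 u0 u.
Proof.
move=> T12; have sub t : (b <= t <= T1)%R -> (b <= t <= T2)%R.
  by move=> /andP[-> /le_trans ->].
move=> [ju [B B0 hB] su]; split => //.
  by exists B => // t /sub; exact: hB.
by move=> t /sub; exact: su.
Qed.

Variable u0 : E -> R.
Hypotheses (m0 : measurable_fun [set: E] u0) (u0oo : H (absE u0) < +oo).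

Lemma strong_unique T1 T2 u1 u2 t : strong 0 T1 u0 u1 -> strong 0 T2 u0 u2 ->
  (0 <= t <= T1)%R -> (t <= T2)%R -> {ae mu, forall x, u1 t x = u2 t x}.
Proof.
move=> h1 h2 /andP[t0 tT1] tT2.
have {}h1 := strong_restrict tT1 h1; have {}h2 := strong_restrict tT2 h2.
apply: (wp_mild_unique hp (strong_wp_class hp m0 u0oo h1) (strong_mild hp m0 u0oo h1)
  (strong_wp_class hp m0 u0oo h2) (strong_mild hp m0 u0oo h2)).
by rewrite t0 lexx.
Qed.

(** Strong solutions agree almost everywhere at each time, so one representative per time serves
    them all. The choice gives no joint measurability; the required properties are transferred from
    strong solutions by the modification lemmas. *)
Lemma common_extension : exists U : R -> E -> R,
  (forall t, measurable_fun [set: E] (U t)) /\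
  (forall T u, strong 0 T u0 u -> forall t, (0 <= t <= T)%R ->
     {ae mu, forall x, u t x = U t x}).
Proof.
have /choice[U hU] : forall t, exists f : E -> R, measurable_fun [set: E] f /\
    forall T u, strong 0 T u0 u -> (0 <= t <= T)%R -> {ae mu, forall x, u t x = f x}.
  move=> t; have [[T [u [su tT]]]|no] :=
      pselect (exists T u, strong 0 T u0 u /\ (0 <= t <= T)%R); last first.
    exists (cst 0%R); split; first exact: measurable_cst.
    by move=> T u su tT; exfalso; apply: no; exists T, u.
  exists (u t); split; first by have [ju _ _] := su; exact: jointly_measurable_fix.
  by move=> T' u' su' tT'; have /andP[_ ?] := tT; exact: (strong_unique su' su).
exists U; split; first by move=> t; have [] := hU t.
by move=> T u su t tT; have [_ h] := hU t; exact: h su tT.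
Qed.

Definition lifespan : \bar R :=
  ereal_sup [set T%:E | T in [set T | exists u, strong 0 T u0 u]].

Lemma lt_lifespan T : T%:E < lifespan -> exists u, strong 0 T u0 u.
Proof.
move=> /ereal_sup_gt[_ [T' [u su] <-]]; rewrite lte_fin => /ltW TT'.
by exists u; exact: strong_restrict su.
Qed.

Lemma le_lifespan T u : strong 0 T u0 u -> T%:E <= lifespan.
Proof. by move=> su; apply: ereal_sup_ubound; exists T => //; exists u. Qed.

Variables (Te : R -> R).
Hypotheses (Te0 : forall M, (0 <= M)%R -> (0 < Te M)%R)
  (hTe : forall M b v0, (0 <= M)%R -> measurable_fun [set: E] v0 ->
    H (absE v0) <= M%:E -> exists u, strong b (b + Te M) v0 u).
Variable U : R -> E -> R.
Hypotheses (mU : forall t, measurable_fun [set: E] (U t))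
  (hU : forall T u, strong 0 T u0 u -> forall t, (0 <= t <= T)%R ->
     {ae mu, forall x, u t x = U t x}).

Lemma extension_wp_mild T : T%:E < lifespan -> wp_class s q kappa T U /\
  mild_solution a gamma beta `[0%R, T]%classic u0 U.
Proof.
move=> /lt_lifespan[u su]; have uU := hU su.
have mu' t : (0 <= t <= T)%R -> measurable_fun [set: E] (u t).
  by move=> _; have [ju _ _] := su; exact: jointly_measurable_fix.
have mU' t : (0 <= t <= T)%R -> measurable_fun [set: E] (U t) by move=> _.
split.
- apply: (wp_class_modification hp mu' mU' uU).
  exact: (strong_wp_class hp m0 u0oo su).
- apply: (mild_modification mu' mU' uU).
  exact: (strong_mild hp m0 u0oo su).
Qed.

(** A norm bound at one time before the lifespan pushes it at least [Te M] further, by gluing a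
    restarted solution. Blow-up and maximality are both read off from this. *)
Lemma lifespan_restart t M : (0 < t)%R -> t%:E < lifespan -> (0 <= M)%R ->
  H (absE (U t)) <= M%:E -> (t + Te M)%:E <= lifespan.
Proof.
move=> t0 /lt_lifespan[u su] M0 HM.
have mut : measurable_fun [set: E] (u t).
  by have [ju _ _] := su; exact: jointly_measurable_fix.
have Hut : H (absE (u t)) <= M%:E.
  suff -> : H (absE (u t)) = H (absE (U t)) by exact: HM.
  apply: (eq_hnorm s q0).
  - exact: measurable_absE.
  - exact: measurable_absE.
  - exact: absE_ge0.
  - exact: absE_ge0.
  - have tt : (0 <= t <= t)%R by rewrite ltW/=.
    by apply: filterS (hU su tt) => x; rewrite /absE => ->.
have [w sw] := hTe t M0 mut Hut.
have tt : (0 < t <= t + Te M)%R by rewrite t0 lerDl ltW// Te0.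
exact: (le_lifespan (strong_solution_glue hp m0 u0oo tt su sw)).
Qed.

(** At each time closer to [T1] than [Te M] the norm must exceed [M], or a restart would outlive
    [T1]; as this concerns every such time, the norm has a limit rather than being merely
    unbounded. *)
Lemma lifespan_blowup (T1 : R) : (0 < T1)%R -> lifespan = T1%:E ->
  herz_norm s q%:E 1 (U t) @[t --> at_left T1] --> +oo.
Proof.
move=> T10 lT1; apply/cvgeyPge => A.
pose M := Num.max 0%R A; have M0 : (0 <= M)%R by rewrite le_max lexx.
near=> t; have t0 : (0 < t)%R by near: t; exact: nbhs_left_gt.
have tT : (t < T1)%R by near: t; exact: nbhs_left_lt.
have tM : (T1 - Te M < t)%R.
  by near: t; apply: nbhs_left_gt; rewrite ltrBlDr ltrDl Te0.
rewrite (herz_normE s (U t) q0) leNgt; apply/negP => HA.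
have HM : H (absE (U t)) <= M%:E.
  by apply: (le_trans (ltW HA)); rewrite lee_fin le_max lexx orbT.
have tl : t%:E < lifespan by rewrite lT1 lte_fin.
have := lifespan_restart t0 tl M0 HM; rewrite lT1 lee_fin leNgt => /negP; apply.
by rewrite -ltrBlDr.
Unshelve. all: end_near. Qed.

(** Continuity of [V] at [T1] keeps the norm bounded just before [T1], and a restart from there
    would pass the lifespan. *)
Lemma no_closed_extension (T1 T : R) (V : R -> E -> R) : (0 < T1)%R ->
  lifespan = T1%:E -> (T1 <= T)%R -> wp_class s q kappa T V ->
  ~ (forall t, (0 <= t)%R -> t%:E < lifespan -> {ae mu, forall x, V t x = U t x}).
Proof.
move=> T10 lT1 T1T [[hV cV] _] VU.
have T1I : `[0%R, T]%classic T1 by rewrite /= in_itv/= ltW.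
have mV t : (0 <= t <= T)%R -> measurable_fun [set: E] (V t).
  by move=> tT; have [] := hV t; rewrite /= ?in_itv.
have T1T' : (0 <= T1 <= T)%R by rewrite ltW.
have [_ _] := hV T1 T1I; rewrite (herz_normE s (V T1) q0) => VT1.
have VT1f : H (absE (V T1)) \is a fin_num by rewrite ge0_fin_numE ?hnorm_ge0.
(* 4 is the constant of [hnormD], and 1 bounds the norm of [V t - V T1] for [t] near [T1]. *)
pose M := (4 * (1 + fine (H (absE (V T1)))))%R.
have M0 : (0 <= M)%R by rewrite mulr_ge0// addr_ge0// fine_ge0// hnorm_ge0.
have near1 : \forall t \near at_left T1,
    herz_norm s q%:E 1 (V t \- V T1)%R < 1.
  have : \forall y \near (0 : \bar R), y < 1.
    by apply: open_nbhs_nbhs; split; [exact: open_ereal_lt_ereal|exact: lte01].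
  move=> /(cV T1 T1I); rewrite /= !near_simpl near_withinE => h.
  have {}h : \forall t \near at_left T1, `[0%R, T]%classic t ->
      herz_norm s q%:E 1 (V t \- V T1)%R < 1.
    by rewrite near_withinE; apply: filterS h => t ht _; exact: ht.
  near=> t; have t0 : (0 < t)%R by near: t; exact: nbhs_left_gt.
  have tT : (t < T1)%R by near: t; exact: nbhs_left_lt.
  have : `[0%R, T]%classic t by rewrite /= in_itv/= !ltW// (lt_le_trans tT).
  by near: t; exact: h.
have [t [t0 tT tM Vt]] : exists t, [/\ (0 < t)%R, (t < T1)%R, (T1 - Te M < t)%R &
    herz_norm s q%:E 1 (V t \- V T1)%R < 1].
  apply: (@filter_ex _ (at_left T1)); near=> t; split.
  - by near: t; exact: nbhs_left_gt.
  - by near: t; exact: nbhs_left_lt.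
  - by near: t; apply: nbhs_left_gt; rewrite ltrBlDr ltrDl Te0.
  - by near: t; exact: near1.
have t0T : (0 <= t <= T)%R by rewrite ltW//= ltW// (lt_le_trans tT).
have tl : t%:E < lifespan by rewrite lT1 lte_fin.
have HM : H (absE (U t)) <= M%:E.
  have -> : H (absE (U t)) = H (absE (V t)).
    apply: (eq_hnorm s q0).
    - exact: measurable_absE.
    - by apply: measurable_absE; exact: mV.
    - exact: absE_ge0.
    - exact: absE_ge0.
    - by apply: filterS (VU t (ltW t0) tl) => x; rewrite /absE => ->.
  move: Vt; rewrite (herz_normE s (V t \- V T1)%R q0) => Vt.
  have mVB : measurable_fun [set: E] (absE (V t \- V T1)%R).
    by apply: measurable_absE; apply: measurable_funB; exact: mV.
  have mV1 : measurable_fun [set: E] (absE (V T1)) by apply: measurable_absE; exact: mV.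
  apply: (@le_trans _ _ (H (fun x => absE (V t \- V T1)%R x + absE (V T1) x))).
    apply: (le_hnorm s q0).
    - by apply: measurable_absE; exact: mV.
    - exact: emeasurable_funD.
    - exact: absE_ge0.
    - by move=> x; rewrite adde_ge0// absE_ge0.
    - apply: nearW => x; rewrite /absE -EFinD lee_fin /=.
      by apply: le_trans (ler_normD _ _); rewrite subrK.
  apply: (le_trans (hnormD s q1 mVB mV1 (absE_ge0 _) (absE_ge0 _))).
  have -> : M%:E = 4%:E * (1 + H (absE (V T1))).
    by rewrite -[in RHS](fineK VT1f) -EFinD -EFinM.
  apply: lee_wpmul2l => //.
  by apply: leeD => //; exact: ltW.
have := lifespan_restart t0 tl M0 HM; rewrite lT1 lee_fin leNgt => /negP; apply.
by rewrite -ltrBlDr.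
Unshelve. all: end_near. Qed.

End maximal_solution.

Theorem theorem3p20 (R : realType) (a : R) (n : nat) (q r beta gamma kappa : R)
  (hn : (1 <= n)%N) (hq : 1 < q) (hr : 1 <= r) (hbeta : 0 < beta)
  (hgamma : 0 < gamma)
  (hgamma_lt : gamma <
    Num.min (Num.min 2 n%:R) (n%:R - (n%:R - 2) * (beta + 1)))
  (hkappa : q < kappa)
  (hkappa_lower :
    Num.max
      (Num.max
        ((n%:R - gamma) / (n%:R * (beta + 1)) + q^-1 - 1)
        ((n%:R - gamma) / (n%:R * (beta + 1)) + q^-1
           + (gamma - 2) / (n%:R * beta)))
      (Num.max
        (q * (beta + 1))^-1
        (q^-1 - 2 / (n%:R * (beta + 1))))
    < kappa^-1)
  (hkappa_upper : kappa^-1 <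
    Num.min
      ((n%:R - gamma) / (n%:R * (beta + 1)) + q^-1)
      (beta^-1 - (n%:R - gamma) / (n%:R * beta * (beta + 1)))) :
  let s := (n%:R - gamma) / (beta + 1) - n%:R / kappa in
  exists2 T : R -> R, (forall M, 0 <= M -> 0 < T M) &
  forall u0 : Rspace R n -> R, herz s q%:E 1%E u0 ->
  let T0 := T (fine (herz_norm s q%:E 1%E u0)) in
  exists u : R -> Rspace R n -> R,
    [/\ wp_class s q kappa T0 u,
        mild_solution a gamma beta `[0, T0] u0 u,
        (forall v : R -> Rspace R n -> R,
           wp_class s q kappa T0 v -> mild_solution a gamma beta `[0, T0] u0 v ->
           forall t, t \in `[0, T0] -> v t = u t %[ae lebesgue_space n]) &
        exists (Tmax : \bar R) (U : R -> Rspace R n -> R),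
        [/\ (T0%:E < Tmax)%E,
            (forall t, t \in `[0, T0] -> U t = u t %[ae lebesgue_space n]),
            (forall T', 0 < T' -> (T'%:E < Tmax)%E ->
               wp_class s q kappa T' U /\
               mild_solution a gamma beta `[0, T'] u0 U),
            (* no solution on a closed interval containing [0, Tmax) extends U *)
            (forall (T' : R) (V : R -> Rspace R n -> R), (Tmax <= T'%:E)%E ->
               wp_class s q kappa T' V ->
               mild_solution a gamma beta `[0, T'] u0 V ->
               ~ (forall t, 0 <= t -> (t%:E < Tmax)%E ->
                    V t = U t %[ae lebesgue_space n])) &
            Tmax = +oo%E \/
            exists2 T1 : R, Tmax = T1%:E &
              herz_norm s q%:E 1%E (U t) @[t --> at_left T1] --> +oo%E]].
Proof.
have hp := herz_params_of_exponents hn hq hbeta hgamma hgamma_lt hkappa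
  hkappa_lower hkappa_upper.
move=> s; rewrite -/s in hp.
have q0 := q_gt0 hp.
have [Te Te0 hTe] := existence a hp.
(* Half of the available time, so that the first interval ends strictly before the lifespan. *)
exists (fun M => Te M / 2) => [M M0|u0 hu0]; first by rewrite divr_gt0// Te0.
have [m0 _] := hu0; rewrite (herz_normE s u0 q0) => u0oo.
pose N := fine (hnorm s q (absE u0)).
have N0 : 0 <= N by rewrite fine_ge0// hnorm_ge0.
have Ne : (hnorm s q (absE u0) <= N%:E)%E.
  by rewrite fineK// ge0_fin_numE// hnorm_ge0.
move=> T0; have {T0}-> : T0 = Te N / 2 by [].
have TeN0 := Te0 N N0.
have T00 : 0 < Te N / 2 by rewrite divr_gt0.
have [u] := hTe N 0 u0 N0 m0 Ne; rewrite add0r => sTe.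
have TT : Te N / 2 <= Te N by lra.
have su := strong_restrict TT sTe.
have tI (T t : R) : t \in `[0, T] -> 0 <= t <= T by rewrite in_itv.
have wu := strong_wp_class hp m0 u0oo su.
have mildu := strong_mild hp m0 u0oo su.
exists u; split => //.
  move=> v wv mildv t /tI tT.
  by apply: filterS (wp_mild_unique hp wv mildv wu mildu tT) => x ->.
have [U [mU hU]] := common_extension a hp m0 u0oo.
pose L := lifespan a beta gamma u0.
have TL : ((Te N / 2)%:E < L)%E.
  by apply: lt_le_trans (le_lifespan sTe); rewrite lte_fin; lra.
exists L, U; split => //.
- by move=> t /tI tT; apply: filterS (hU _ _ su t tT) => x ->.
- by move=> T' _ TL'; exact: (extension_wp_mild hp m0 u0oo mU hU TL').
- move=> T' V LT' wV _ VU'.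
  have VU t : 0 <= t -> (t%:E < L)%E -> \forall x \ae lebesgue_space n, V t x = U t x.
    by move=> t0 tL; apply: filterS (VU' t t0 tL) => x; exact.
  have Lf : L \is a fin_num.
    by rewrite fin_real// (lt_trans _ TL) ?ltNyr// (le_lt_trans LT') ?ltry.
  have L1 : L = (fine L)%:E by rewrite fineK.
  apply: (no_closed_extension hp m0 u0oo Te0 hTe mU hU _ L1 _ wV VU).
  + by rewrite -lte_fin -L1; apply: lt_trans TL; rewrite lte_fin.
  + by rewrite -lee_fin -L1.
- have [Ly|Ly] := eqVneq L +oo%E; [by left|right].
  have L1 : L = (fine L)%:E.
    by rewrite fineK// fin_real// (lt_trans _ TL) ?ltNyr//= ltey.
  exists (fine L) => //; apply: (lifespan_blowup hp m0 u0oo Te0 hTe mU hU) => //.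
  by rewrite -lte_fin -L1; apply: lt_trans TL; rewrite lte_fin.
Qed.
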